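(* Let $R$ be a (commutative) smooth $\mathbb{Z}$-algebra, and let $\mathfrak{a}$ be an ideal of $R$ generated by elements $\boldsymbol{f}=f_1,\dots,f_t$. Let $k$ be a nonnegative integer. Then: (1) If a prime integer is a nonzerodivisor on the Koszul cohomology module $H^k(\boldsymbol{f};R)$, then it is a nonzerodivisor on the local cohomology module $H^k_{\mathfrak{a}}(R)$. (2) All but finitely many prime integers are nonzerodivisors on $H^k_{\mathfrak{a}}(R)$. (3) The set of associated primes of the $R$-module $H^k_{\mathfrak{a}}(R)$ is finite.
   Context: A commutative algebra $R$ over a commutative ring $A$ is called smooth over $A$ if $R$ is a finitely presented and flat $A$-algebra such that for each prime ideal $\mathfrak{p}$ of $A$, the fiber $R_{\mathfrak{p}}/\mathfrak{p}R_{\mathfrak{p}}$ is geometrically regular over the field $A_{\mathfrak{p}}/\mathfrak{p}A_{\mathfrak{p}}$. For $f\in R$, $K^\bullet(f;R)$ is the complex $0\to R\xrightarrow{\,f\,}R\to 0$ in cohomological degrees $0$ and $1$; for $\boldsymbol{f}=f_1,\dots,f_t$, the Koszul complex is $K^\bullet(\boldsymbol{f};R)=K^\bullet(f_1;R)\otimes_R\cdots\otimes_R K^\bullet(f_t;R)$, and $H^k(\boldsymbol{f};R)$ is its $k$-th cohomology module. $H^k_{\mathfrak{a}}(R)$ denotes the $k$-th local cohomology module of $R$ with support in $\mathfrak{a}$. An element is a nonzerodivisor on a module $M$ if multiplication by it is an injective map $M\to M$ (in particular every element is a nonzerodivisor on the zero module). *)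

(* Defs.v *)
From HB Require Import structures.
From mathcomp Require Import all_boot all_order all_algebra.
From mathcomp Require Import generic_quotient ring_quotient.
From mathcomp Require Import boolp classical_sets cardinality.
From mathcomp Require Import mpoly ring.

Set Implicit Arguments.
Unset Strict Implicit.
Unset Printing Implicit Defensive.

Import GRing.Theory.
Local Open Scope ring_scope.
Local Open Scope quotient_scope.
Local Open Scope classical_set_scope.

(* Rings are of type comPzRingType, so that the zero ring is allowed. *)

Section Submodules.
Variables (R : comPzRingType) (M : lmodType R).
Implicit Types S N : set M.

Definition submodule N : Prop :=
  N 0 /\ forall (r : R) x y, N x -> N y -> N (r *: x + y).

Definition span S : set M :=
  [set x | forall N, submodule N -> S `<=` N -> N x].

Lemma span_submodule S : submodule (span S).
Proof.
split=> [N [] //|r x y Sx Sy N Nmod SN].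
by apply: Nmod.2; [apply: Sx | apply: Sy].
Qed.

Lemma sub_span S : S `<=` span S.
Proof. by move=> x Sx N _; apply. Qed.

Definition span_pred S : {pred M} := fun x => `[< span S x >].

Lemma span_predP S x : reflect (span S x) (x \in span_pred S).
Proof. exact: asboolP. Qed.

Lemma span_pred_closed S : subsemimod_closed (span_pred S).
Proof.
have [S0 SD] := span_submodule S.
split; first split.
- exact/span_predP.
- by move=> x y /span_predP Sx /span_predP Sy; apply/span_predP;
     rewrite -[x]scale1r; apply: SD.
- by move=> r x /span_predP Sx; apply/span_predP;
     rewrite -[_ *: _]addr0; apply: SD.
Qed.

HB.instance Definition _ S :=
  GRing.isSubmodClosed.Build R M (span_pred S) (span_pred_closed S).

(* The submodule of M generated by S; it is S itself if S is a submodule. *)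
Definition submod S := {x : M | x \in span_pred S}.
HB.instance Definition _ S := SubChoice.copy (submod S) {x : M | x \in span_pred S}.
HB.instance Definition _ S := [SubChoice_isSubLmodule of submod S by <:].

(* The quotient of M by the submodule generated by S. *)
Definition quotmod S := Quotient.quot (span_pred S).
HB.instance Definition _ S := GRing.Zmodule.on (quotmod S).

Definition qmod S (x : M) : quotmod S := \pi_(Quotient.quot (span_pred S)) x.

Lemma qmodP S x y : qmod S x = qmod S y <-> span S (x - y).
Proof.
split=> [/eqP|xy]; last apply/eqP; rewrite -Quotient.idealrBE.
  by move/span_predP.
exact/span_predP.
Qed.

Lemma qmodD S x y : qmod S (x + y) = qmod S x + qmod S y.
Proof. by rewrite /qmod !piE. Qed.

Lemma qmodK S (u : quotmod S) : qmod S (repr u) = u.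
Proof. exact: reprK. Qed.

Definition qscale S (r : R) (u : quotmod S) : quotmod S :=
  qmod S (r *: repr u).

Lemma qscaleE S r x : qscale r (qmod S x) = qmod S (r *: x).
Proof.
apply/qmodP; rewrite -scalerBr -[_ *: _]addr0.
by apply: (span_submodule S).2 (span_submodule S).1; apply/qmodP/qmodK.
Qed.

Fact qscaleA S a b (u : quotmod S) : qscale a (qscale b u) = qscale (a * b) u.
Proof. by rewrite -[u]qmodK !qscaleE scalerA. Qed.
Fact qscale1 S : left_id 1 (@qscale S).
Proof. by move=> u; rewrite -[u]qmodK qscaleE scale1r. Qed.
Fact qscaleDr S : right_distributive (@qscale S) +%R.
Proof.
by move=> a u v; rewrite -[u]qmodK -[v]qmodK -qmodD !qscaleE scalerDr qmodD.
Qed.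
Fact qscaleDl S (u : quotmod S) : {morph (@qscale S)^~ u : a b / a + b}.
Proof. by move=> a b; rewrite -[u]qmodK !qscaleE scalerDl qmodD. Qed.

HB.instance Definition _ S := GRing.Zmodule_isLmodule.Build R (quotmod S)
  (@qscaleA S) (@qscale1 S) (@qscaleDr S) (@qscaleDl S).

End Submodules.

Section Ideals.
Variable R : comPzRingType.
Implicit Types (I P S : set R).

Definition ideal I : Prop := @submodule R R^o I.

Definition ideal_gen S : set R := @span R R^o S.

Definition prime_ideal P : Prop :=
  [/\ ideal P, ~ P 1 & forall x y, P (x * y) -> P x \/ P y].

Definition maximal_ideal I : Prop :=
  [/\ ideal I, ~ I 1 & forall J, ideal J -> I `<=` J -> ~ J 1 -> J = I].

Fixpoint ideal_pow I (n : nat) : set R :=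
  if n is n'.+1 then
    ideal_gen [set z | exists x y, [/\ I x, ideal_pow I n' y & z = x * y]]
  else setT.

Definition noetherian : Prop :=
  forall I, ideal I -> exists s : seq R, I = ideal_gen [set` s].

(* R modulo the ideal generated by S. *)
Definition quotring S := @quotmod R R^o S.
HB.instance Definition _ S := GRing.Zmodule.on (quotring S).

Definition qring S (x : R) : quotring S := @qmod R R^o S x.

Definition qmul S (u v : quotring S) : quotring S :=
  qring S ((repr u : R) * (repr v : R)).

Lemma qmulE S x y : qmul (qring S x) (qring S y) = qring S (x * y).
Proof.
have [S0 SD] := @span_submodule R R^o S.
apply/qmodP; set x' : R := repr _; set y' : R := repr _.
have xx' : ideal_gen S (x' - x) by apply/(@qmodP R R^o)/qmodK.
have yy' : ideal_gen S (y' - y) by apply/(@qmodP R R^o)/qmodK.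
have -> : x' * y' - x * y = y' *: (x' - x : R^o) + (x *: (y' - y : R^o) + 0).
  rewrite addr0 !scalerBr /GRing.scale /= (mulrC y' x') (mulrC y' x).
  by rewrite addrA subrK.
exact: SD xx' (SD _ _ _ yy' S0).
Qed.

Lemma qringK S (u : quotring S) : qring S (repr u) = u.
Proof. exact: qmodK. Qed.

Fact qmulA S : associative (@qmul S).
Proof.
by move=> u v w; rewrite -[u]qringK -[v]qringK -[w]qringK !qmulE mulrA.
Qed.
Fact qmulC S : commutative (@qmul S).
Proof. by move=> u v; rewrite -[u]qringK -[v]qringK !qmulE mulrC. Qed.
Fact qmul1 S : left_id (qring S 1) (@qmul S).
Proof. by move=> u; rewrite -[u]qringK qmulE mul1r. Qed.
Fact qmulDl S : left_distributive (@qmul S) +%R.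
Proof.
move=> u v w; rewrite -[u]qringK -[v]qringK -[w]qringK.
by rewrite -[qring S _ + qring S _]qmodD !qmulE -[RHS]qmodD -mulrDl.
Qed.

HB.instance Definition _ S := GRing.Zmodule_isComPzRing.Build (quotring S)
  (@qmulA S) (@qmulC S) (@qmul1 S) (@qmulDl S).

Fact qring_zmod_morphism S : zmod_morphism (qring S).
Proof.
move=> x y; apply/eqP; rewrite eq_sym subr_eq; apply/eqP.
by rewrite -[RHS]qmodD subrK.
Qed.
Fact qring_monoid_morphism S : monoid_morphism (qring S).
Proof. by split=> // x y; rewrite -qmulE. Qed.

HB.instance Definition _ S :=
  GRing.isZmodMorphism.Build R (quotring S) (qring S) (@qring_zmod_morphism S).
HB.instance Definition _ S :=
  GRing.isMonoidMorphism.Build R (quotring S) (qring S)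
    (@qring_monoid_morphism S).

End Ideals.

Section Localization.
Variables (R : comPzRingType) (W : set R).

Definition submonoid (V : set R) : Prop :=
  V 1 /\ forall x y, V x -> V y -> V (x * y).

Definition submonoid_gen : set R :=
  [set x | forall V, submonoid V -> W `<=` V -> V x].

Lemma submonoid_genP : submonoid submonoid_gen.
Proof.
split=> [V [] //|x y Wx Wy V Vmon WV].
by apply: Vmon.2; [apply: Wx | apply: Wy].
Qed.

Definition denom := {x : R | `[< submonoid_gen x >]}.
HB.instance Definition _ := Choice.on denom.

Definition den1 : denom := exist _ 1 (asboolT submonoid_genP.1).
Definition denM (s t : denom) : denom :=
  exist _ (val s * val t)
    (asboolT (submonoid_genP.2 _ _ (asboolW (valP s)) (asboolW (valP t)))).

Definition loc_rel (x y : R * denom) : bool :=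
  `[< exists u : denom, val u * (x.1 * val y.2 - y.1 * val x.2) = 0 >].

Fact loc_rel_equiv : equiv_class_of loc_rel.
Proof.
split.
- by move=> x; apply/asboolP; exists den1; rewrite subrr mulr0.
- have sym x y : loc_rel x y -> loc_rel y x.
    move=> /asboolP[u Hu]; apply/asboolP; exists u.
    by apply/eqP; rewrite -oppr_eq0 -mulrN opprB; apply/eqP.
  by move=> x y; apply/idP/idP; apply: sym.
- move=> [b t] [a s] [c r] /asboolP[u /= Hu] /asboolP[v /= Hv].
  apply/asboolP; exists (denM u (denM v t)) => /=.
  move: (val s) (val t) (val r) (val u) (val v) Hu Hv => S T Q U V Hu Hv.
  have -> : U * (V * T) * (a * Q - c * S) =
            V * Q * (U * (a * T - b * S)) + U * S * (V * (b * Q - c * T)).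
    by ring.
  by rewrite Hu Hv !mulr0 addr0.
Qed.

Canonical loc_rel_equivRel := EquivRelPack loc_rel_equiv.
Canonical loc_rel_encModRel := defaultEncModRel loc_rel.

(* The localization W^-1 R; denominators are products of elements of W. *)
Definition localization := {eq_quot loc_rel}.
HB.instance Definition _ := Choice.on localization.

Definition frac (a : R) (s : denom) : localization :=
  \pi_({eq_quot loc_rel}) (a, s).

Lemma fracP a s b t : frac a s = frac b t <->
  exists u : denom, val u * (a * val t - b * val s) = 0.
Proof.
split=> [/eqmodP /asboolP //|H]; apply/eqmodP; exact/asboolP.
Qed.

Lemma frac_ind (P : localization -> Prop) :
  (forall a s, P (frac a s)) -> forall x, P x.
Proof. by move=> H x; rewrite -[x]reprK; case: (repr x) => a s; apply: H. Qed.

Definition loc_add (x y : localization) : localization :=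
  let: (a, s) := repr x in let: (b, t) := repr y in
  frac (a * val t + b * val s) (denM s t).
Definition loc_opp (x : localization) : localization :=
  let: (a, s) := repr x in frac (- a) s.
Definition loc_mul (x y : localization) : localization :=
  let: (a, s) := repr x in let: (b, t) := repr y in
  frac (a * b) (denM s t).

Lemma repr_frac a s : exists b t (u : denom),
  repr (frac a s) = (b, t) /\ val u * (b * val s - a * val t) = 0.
Proof.
case E: (repr (frac a s)) => [b t].
have /fracP[u Hu] : frac b t = frac a s by rewrite /frac -E reprK.
by exists b, t, u.
Qed.

Lemma loc_addE a s b t :
  loc_add (frac a s) (frac b t) = frac (a * val t + b * val s) (denM s t).
Proof.
rewrite /loc_add; have [a' [s' [u [-> Hu]]]] := repr_frac a s.
have [b' [t' [v [-> Hv]]]] := repr_frac b t.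
apply/fracP; exists (denM u v); move: Hu Hv => /=.
move: (sval s) (sval t) (sval s') (sval t') (sval u) (sval v).
move=> S T S' T' U V Hu Hv.
transitivity (V * T * T' * (U * (a' * S - a * S')) +
              U * S * S' * (V * (b' * T - b * T'))); first by ring.
by rewrite Hu Hv !mulr0 addr0.
Qed.

Lemma loc_oppE a s : loc_opp (frac a s) = frac (- a) s.
Proof.
rewrite /loc_opp; have [a' [s' [u [-> Hu]]]] := repr_frac a s.
apply/fracP; exists u; move: Hu => /=.
move: (sval s) (sval s') (sval u) => S S' U Hu.
by transitivity (- (U * (a' * S - a * S'))); [ring | rewrite Hu oppr0].
Qed.

Lemma loc_mulE a s b t :
  loc_mul (frac a s) (frac b t) = frac (a * b) (denM s t).
Proof.
rewrite /loc_mul; have [a' [s' [u [-> Hu]]]] := repr_frac a s.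
have [b' [t' [v [-> Hv]]]] := repr_frac b t.
apply/fracP; exists (denM u v); move: Hu Hv => /=.
move: (sval s) (sval t) (sval s') (sval t') (sval u) (sval v).
move=> S T S' T' U V Hu Hv.
transitivity (V * b' * T * (U * (a' * S - a * S')) +
              U * a * S' * (V * (b' * T - b * T'))); first by ring.
by rewrite Hu Hv !mulr0 addr0.
Qed.

Lemma frac_eq a s b t : a * val t = b * val s -> frac a s = frac b t.
Proof. by move=> E; apply/fracP; exists den1; rewrite E subrr mulr0. Qed.

Fact loc_addA : associative loc_add.
Proof.
elim/frac_ind=> a s; elim/frac_ind=> b t; elim/frac_ind=> c r.
by rewrite !loc_addE; apply: frac_eq => /=; ring.
Qed.
Fact loc_addC : commutative loc_add.
Proof.
elim/frac_ind=> a s; elim/frac_ind=> b t.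
by rewrite !loc_addE; apply: frac_eq => /=; ring.
Qed.
Fact loc_add0 : left_id (frac 0 den1) loc_add.
Proof. by elim/frac_ind=> a s; rewrite loc_addE; apply: frac_eq => /=; ring. Qed.
Fact loc_addN : left_inverse (frac 0 den1) loc_opp loc_add.
Proof.
by elim/frac_ind=> a s; rewrite loc_oppE loc_addE; apply: frac_eq => /=; ring.
Qed.
Fact loc_mulA : associative loc_mul.
Proof.
elim/frac_ind=> a s; elim/frac_ind=> b t; elim/frac_ind=> c r.
by rewrite !loc_mulE; apply: frac_eq => /=; ring.
Qed.
Fact loc_mulC : commutative loc_mul.
Proof.
elim/frac_ind=> a s; elim/frac_ind=> b t.
by rewrite !loc_mulE; apply: frac_eq => /=; ring.
Qed.
Fact loc_mul1 : left_id (frac 1 den1) loc_mul.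
Proof. by elim/frac_ind=> a s; rewrite loc_mulE; apply: frac_eq => /=; ring. Qed.
Fact loc_mulDl : left_distributive loc_mul loc_add.
Proof.
elim/frac_ind=> a s; elim/frac_ind=> b t; elim/frac_ind=> c r.
by rewrite !(loc_addE, loc_mulE); apply: frac_eq => /=; ring.
Qed.

HB.instance Definition _ :=
  GRing.isZmodule.Build localization loc_addA loc_addC loc_add0 loc_addN.
HB.instance Definition _ := GRing.Zmodule_isComPzRing.Build localization
  loc_mulA loc_mulC loc_mul1 loc_mulDl.

Definition to_loc (a : R) : localization := frac a den1.

Fact to_loc_zmod_morphism : zmod_morphism to_loc.
Proof.
move=> a b; rewrite -[- to_loc b]/(loc_opp _) loc_oppE.
rewrite -[RHS]/(loc_add _ _) loc_addE.
by apply: frac_eq => /=; ring.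
Qed.
Fact to_loc_monoid_morphism : monoid_morphism to_loc.
Proof.
split=> // a b; rewrite -[RHS]/(loc_mul _ _) loc_mulE.
by apply: frac_eq => /=; ring.
Qed.
HB.instance Definition _ :=
  GRing.isZmodMorphism.Build R localization to_loc to_loc_zmod_morphism.
HB.instance Definition _ :=
  GRing.isMonoidMorphism.Build R localization to_loc to_loc_monoid_morphism.

End Localization.

(* The map W^-1 A -> phi(W)^-1 R induced by phi. *)
Section LocalizationMap.
Variables (A R : comPzRingType) (phi : {rmorphism A -> R}) (W : set A).

Lemma submonoid_gen_map s : submonoid_gen W s -> submonoid_gen (phi @` W) (phi s).
Proof.
move=> /(_ (phi @^-1` submonoid_gen (phi @` W))); apply; last first.
  by move=> w Ww V _; apply; exists w.
have [W1 WM] := submonoid_genP (phi @` W).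
by split=> [|x y]; rewrite /= ?rmorph1 ?rmorphM //; apply: WM.
Qed.

Definition denom_map (s : denom W) : denom (phi @` W) :=
  exist _ (phi (val s)) (asboolT (submonoid_gen_map (asboolW (valP s)))).

Definition loc_map (x : localization W) : localization (phi @` W) :=
  let: (a, s) := repr x in frac (phi a) (denom_map s).

Lemma loc_mapE a s : loc_map (frac a s) = frac (phi a) (denom_map s).
Proof.
rewrite /loc_map; have [b [t [u [-> Hu]]]] := repr_frac a s.
apply/fracP; exists (denom_map u) => /=.
by rewrite -!rmorphM -rmorphB -rmorphM Hu rmorph0.
Qed.

Fact loc_map_zmod_morphism : zmod_morphism loc_map.
Proof.
elim/frac_ind=> a s; elim/frac_ind=> b t.
rewrite -[- frac b t]/(loc_opp _) loc_oppE -[X in loc_map X]/(loc_add _ _).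
rewrite loc_addE !loc_mapE -[- frac _ _]/(loc_opp _) loc_oppE.
rewrite -[RHS]/(loc_add _ _) loc_addE.
by apply: frac_eq => /=; rewrite !(rmorphD, rmorphM, rmorphN); ring.
Qed.
Fact loc_map_monoid_morphism : monoid_morphism loc_map.
Proof.
split; first by rewrite -[1]/(frac 1 _) loc_mapE;
  apply: frac_eq => /=; rewrite !rmorph1.
elim/frac_ind=> a s; elim/frac_ind=> b t.
rewrite -[X in loc_map X]/(loc_mul _ _) loc_mulE !loc_mapE.
rewrite -[RHS]/(loc_mul _ _) loc_mulE.
by apply: frac_eq => /=; rewrite !rmorphM.
Qed.
HB.instance Definition _ := GRing.isZmodMorphism.Build _ _ loc_map
  loc_map_zmod_morphism.
HB.instance Definition _ := GRing.isMonoidMorphism.Build _ _ loc_map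
  loc_map_monoid_morphism.
End LocalizationMap.

(* The map A/(S) -> R/(phi(S)) induced by phi. *)
Section QuotientMap.
Variables (A R : comPzRingType) (phi : {rmorphism A -> R}) (S : set A).

Definition quotring_map (x : quotring S) : quotring (phi @` S) :=
  qring (phi @` S) (phi (repr x)).

Lemma quotring_mapE a : quotring_map (qring S a) = qring (phi @` S) (phi a).
Proof.
apply/(@qmodP R R^o); rewrite -rmorphB.
have : ideal_gen S ((repr (qring S a) : A) - a).
  by apply/(@qmodP A A^o)/qmodK.
move: (_ - _) => d /(_ (phi @^-1` ideal_gen (phi @` S))); apply => [|x Sx].
  have [S0 SD] := @span_submodule R R^o (phi @` S).
  split=> [|r x y Sx Sy]; rewrite /preimage /= ?(rmorph0 phi) //.
  by rewrite (rmorphD phi) (rmorphM phi); apply: SD.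
by apply: sub_span; exists x.
Qed.

Fact quotring_map_zmod_morphism : zmod_morphism quotring_map.
Proof.
move=> x y; rewrite -[x]qringK -[y]qringK -rmorphB !quotring_mapE.
by rewrite -rmorphB -rmorphB.
Qed.
Fact quotring_map_monoid_morphism : monoid_morphism quotring_map.
Proof.
split; first by rewrite -[1]/(qring S 1) quotring_mapE !rmorph1.
move=> x y; rewrite -[x]qringK -[y]qringK -rmorphM !quotring_mapE.
by rewrite -rmorphM -rmorphM.
Qed.
HB.instance Definition _ := GRing.isZmodMorphism.Build _ _ quotring_map
  quotring_map_zmod_morphism.
HB.instance Definition _ := GRing.isMonoidMorphism.Build _ _ quotring_map
  quotring_map_monoid_morphism.
End QuotientMap.

Section Tensor.
Variables (A : comPzRingType) (M N : lmodType A).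

Definition balanced (T : zmodType) (b : M -> N -> T) : Prop :=
  [/\ forall x x' y, b (x + x') y = b x y + b x' y,
      forall x y y', b x (y + y') = b x y + b x y'
    & forall (a : A) x y, b (a *: x) y = b x (a *: y)].

Definition tens_eval (T : zmodType) (b : M -> N -> T) (s : seq (M * N)) : T :=
  \sum_(z <- s) b z.1 z.2.

(* Formal sums s and t define the same element of the tensor product iff all *)
(* balanced maps agree on them (universal property of M (x)_A N).            *)
Definition tens_rel (s t : seq (M * N)) : bool :=
  `[< forall (T : zmodType) (b : M -> N -> T),
        balanced b -> tens_eval b s = tens_eval b t >].

Fact tens_rel_equiv : equiv_class_of tens_rel.
Proof.
split=> [s|s t|t s r]; first exact/asboolP.
  by apply/asboolP/asboolP => H T b Hb; rewrite H.
by move=> /asboolP H1 /asboolP H2; apply/asboolP => T b Hb; rewrite H1 ?H2.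
Qed.

Canonical tens_rel_equivRel := EquivRelPack tens_rel_equiv.
Canonical tens_rel_encModRel := defaultEncModRel tens_rel.

Definition tensor := {eq_quot tens_rel}.
HB.instance Definition _ := Choice.on tensor.

Definition tens (s : seq (M * N)) : tensor := \pi_({eq_quot tens_rel}) s.

Definition tmul (x : M) (y : N) : tensor := tens [:: (x, y)].

Lemma tensP s t : tens s = tens t <->
  forall (T : zmodType) (b : M -> N -> T),
    balanced b -> tens_eval b s = tens_eval b t.
Proof. by split=> [/eqmodP /asboolP //|H]; apply/eqmodP; apply/asboolP. Qed.

Lemma tensK x : tens (repr x) = x.
Proof. exact: reprK. Qed.

Lemma tens_eval_repr s (T : zmodType) (b : M -> N -> T) :
  balanced b -> tens_eval b (repr (tens s)) = tens_eval b s.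
Proof. by move: T b; apply/tensP/tensK. Qed.

Lemma tens_eval_cat (T : zmodType) (b : M -> N -> T) s t :
  tens_eval b (s ++ t) = tens_eval b s + tens_eval b t.
Proof. exact: big_cat. Qed.

Definition tens_add (x y : tensor) : tensor := tens (repr x ++ repr y).
Definition tens_opp (x : tensor) : tensor :=
  tens [seq (- z.1, z.2) | z <- repr x].

Lemma balanced_eval_opp (T : zmodType) (b : M -> N -> T) s : balanced b ->
  tens_eval b [seq (- z.1, z.2) | z <- s] = - tens_eval b s.
Proof.
case=> bD _ _; rewrite /tens_eval big_map -sumrN; apply: eq_bigr => z _ /=.
apply/eqP; rewrite -addr_eq0 -bD addNr.
by rewrite -(inj_eq (addrI (b 0 z.2))) -bD !addr0.
Qed.

Fact tens_addA : associative tens_add.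
Proof.
move=> x y z; apply/tensP => T b Hb.
by rewrite !tens_eval_cat !tens_eval_repr // !tens_eval_cat addrA.
Qed.
Fact tens_addC : commutative tens_add.
Proof.
by move=> x y; apply/tensP => T b Hb; rewrite !tens_eval_cat addrC.
Qed.
Fact tens_add0 : left_id (tens [::]) tens_add.
Proof.
move=> x; rewrite -[RHS]tensK; apply/tensP => T b Hb.
by rewrite tens_eval_cat tens_eval_repr // /tens_eval big_nil add0r.
Qed.
Fact tens_addN : left_inverse (tens [::]) tens_opp tens_add.
Proof.
move=> x; apply/tensP => T b Hb; rewrite tens_eval_cat tens_eval_repr //.
by rewrite balanced_eval_opp // addNr /tens_eval big_nil.
Qed.

HB.instance Definition _ :=
  GRing.isZmodule.Build tensor tens_addA tens_addC tens_add0 tens_addN.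

End Tensor.

(* The map M (x) N -> M' (x) N induced by u. *)
Definition tensor_map (A : comPzRingType) (M M' N : lmodType A)
    (u : {linear M -> M'}) (x : tensor M N) : tensor M' N :=
  tens [seq (u z.1, z.2) | z <- repr x].

(* An A-algebra R, given by phi, seen as an A-module. *)
Definition restr (A R : comPzRingType) (phi : {rmorphism A -> R}) : Type := R.

Section Restriction.
Variables (A R : comPzRingType) (phi : {rmorphism A -> R}).

HB.instance Definition _ := GRing.Zmodule.on (restr phi).

Definition restr_scale (a : A) (x : restr phi) : restr phi := phi a * (x : R).

Fact restr_scaleA a b x :
  restr_scale a (restr_scale b x) = restr_scale (a * b) x.
Proof. by rewrite /restr_scale mulrA -rmorphM. Qed.
Fact restr_scale1 : left_id 1 restr_scale.
Proof. by move=> x; rewrite /restr_scale rmorph1 mul1r. Qed.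
Fact restr_scaleDr : right_distributive restr_scale +%R.
Proof. by move=> a x y; rewrite /restr_scale mulrDr. Qed.
Fact restr_scaleDl x : {morph restr_scale^~ x : a b / a + b}.
Proof. by move=> a b; rewrite /restr_scale rmorphD mulrDl. Qed.

HB.instance Definition _ := GRing.Zmodule_isLmodule.Build A (restr phi)
  restr_scaleA restr_scale1 restr_scaleDr restr_scaleDl.

End Restriction.

Section TensorRing.
Variables (A B C : comPzRingType).
Variables (phi : {rmorphism A -> B}) (psi : {rmorphism A -> C}).

Definition tensor_ring := tensor (restr phi) (restr psi).
HB.instance Definition _ := GRing.Zmodule.on tensor_ring.

Definition pair_mul (z w : restr phi * restr psi) : restr phi * restr psi :=
  ((z.1 : B) * (w.1 : B), (z.2 : C) * (w.2 : C)).

Definition tens_mul (x y : tensor_ring) : tensor_ring :=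
  tens [seq pair_mul z w | z <- repr x, w <- repr y].
Definition tens_one : tensor_ring :=
  tmul ((1 : B) : restr phi) ((1 : C) : restr psi).

Let tmuls (s t : seq (restr phi * restr psi)) :=
  [seq pair_mul z w | z <- s, w <- t].

Let mulb (T : zmodType) (b : restr phi -> restr psi -> T) t
    (x : restr phi) (y : restr psi) : T :=
  \sum_(z <- t) b ((x : B) * (z.1 : B)) ((y : C) * (z.2 : C)).

Lemma tens_eval_mul (T : zmodType) (b : restr phi -> restr psi -> T) s t :
  tens_eval b (tmuls s t) = tens_eval (mulb b t) s.
Proof. by rewrite /tens_eval big_allpairs_dep. Qed.

Lemma tens_eval_mulC (T : zmodType) (b : restr phi -> restr psi -> T) s t :
  tens_eval b (tmuls s t) = tens_eval b (tmuls t s).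
Proof.
rewrite !tens_eval_mul /tens_eval exchange_big /=.
apply: eq_bigr => w _; apply: eq_bigr => z _.
by congr (b _ _); apply: mulrC.
Qed.

Lemma balanced_mul (T : zmodType) (b : restr phi -> restr psi -> T) t : balanced b -> balanced (mulb b t).
Proof.
case=> bDl bDr bZ; split=> [x x' y|x y y'|a x y]; rewrite /mulb.
- by rewrite -big_split; apply: eq_bigr => z _ /=; rewrite -bDl -mulrDl.
- by rewrite -big_split; apply: eq_bigr => z _ /=; rewrite -bDr -mulrDl.
- apply: eq_bigr => z _; rewrite /GRing.scale /= /restr_scale -!mulrA.
  exact: (bZ a).
Qed.

Lemma tens_eval_mul_repr (T : zmodType) (b : restr phi -> restr psi -> T) s t :
  balanced b ->
  tens_eval b (tmuls (repr (tens s)) (repr (tens t))) = tens_eval b (tmuls s t).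
Proof.
move=> Hb; rewrite tens_eval_mul (tens_eval_repr _ (balanced_mul _ Hb)).
rewrite -tens_eval_mul tens_eval_mulC tens_eval_mul.
rewrite (tens_eval_repr _ (balanced_mul _ Hb)) -tens_eval_mul.
exact: tens_eval_mulC.
Qed.

Lemma tens_mulE s t : tens_mul (tens s) (tens t) = tens (tmuls s t).
Proof. by apply/tensP => T b Hb; apply: tens_eval_mul_repr. Qed.

Fact tens_mulA : associative tens_mul.
Proof.
move=> x y z; rewrite -[x]tensK -[y]tensK -[z]tensK !tens_mulE.
apply/tensP => T b Hb; rewrite !tens_eval_mul /tens_eval /mulb.
apply: eq_bigr => u _; rewrite big_allpairs_dep; apply: eq_bigr => v _ /=.
by apply: eq_bigr => w _; rewrite !mulrA.
Qed.
Fact tens_mulC : commutative tens_mul.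
Proof.
move=> x y; rewrite -[x]tensK -[y]tensK !tens_mulE.
by apply/tensP => T b Hb; apply: tens_eval_mulC.
Qed.
Fact tens_mul1 : left_id tens_one tens_mul.
Proof.
move=> x; rewrite -[x]tensK /tens_one /tmul tens_mulE.
apply/tensP => T b Hb; rewrite tens_eval_mul /tens_eval big_seq1.
by apply: eq_bigr => z _ /=; rewrite !mul1r.
Qed.
Fact tens_mulDl : left_distributive tens_mul +%R.
Proof.
move=> x y z; rewrite -[x]tensK -[y]tensK -[z]tensK.
rewrite -[X in tens_mul X _]/(tens_add _ _) -[RHS]/(tens_add _ _) !tens_mulE.
apply/tensP => T b Hb; rewrite tens_eval_mul !tens_eval_cat.
rewrite !(tens_eval_repr _ (balanced_mul _ Hb)) !(tens_eval_repr _ Hb).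
by rewrite !tens_eval_mul.
Qed.

HB.instance Definition _ := GRing.Zmodule_isComPzRing.Build tensor_ring
  tens_mulA tens_mulC tens_mul1 tens_mulDl.

End TensorRing.

Definition prime_chain (R : comPzRingType) (n : nat) (P : nat -> set R) : Prop :=
  (forall i, (i <= n)%N -> prime_ideal (P i)) /\
  (forall i, (i < n)%N -> P i `<=` P i.+1 /\ P i <> P i.+1).

Definition krull_dim (R : comPzRingType) (d : nat) : Prop :=
  (exists P : nat -> set R, prime_chain d P) /\
  ~ (exists P : nat -> set R, prime_chain d.+1 P).

Definition min_generators (R : comPzRingType) (I : set R) (d : nat) : Prop :=
  (exists s : seq R, size s = d /\ I = ideal_gen [set` s]) /\
  (forall s : seq R, I = ideal_gen [set` s] -> (d <= size s)%N).

Definition regular_local_ring (R : comPzRingType) : Prop :=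
  noetherian R /\
  exists m : set R, maximal_ideal m /\ (forall m', maximal_ideal m' -> m' = m) /\
    exists d, krull_dim R d /\ min_generators m d.

Definition regular_ring (R : comPzRingType) : Prop :=
  noetherian R /\
  forall q : set R, prime_ideal q -> regular_local_ring (localization (~` q)).

(* K is meant to be a field; L ranges over its finite field extensions. *)
Definition geometrically_regular (K F : comPzRingType)
    (iota : {rmorphism K -> F}) : Prop :=
  forall (L : fieldType) (j : {rmorphism K -> L}),
    (exists s : seq L, @span K (restr j) [set` s] = setT) ->
    regular_ring (tensor_ring iota j).

Section Fiber.
Variables (A R : comPzRingType) (phi : {rmorphism A -> R}) (p : set A).

(* A_p / p A_p *)
Definition residue_field : comPzRingType :=
  quotring (@to_loc A (~` p) @` p).

(* R_p / p R_p, where R_p is the localization of R at phi(A \ p). *)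
Definition fiber : comPzRingType :=
  quotring (@loc_map A R phi (~` p) @` (@to_loc A (~` p) @` p)).

(* Induced by the localization A_p -> R_p of phi. *)
Definition fiber_map : {rmorphism residue_field -> fiber} :=
  @quotring_map (localization (~` p)) (localization (phi @` ~` p))
    (@loc_map A R phi (~` p)) (@to_loc A (~` p) @` p).
End Fiber.

Definition finitely_presented (A : comNzRingType) (R : comPzRingType)
    (phi : {rmorphism A -> R}) : Prop :=
  exists (n : nat) (pi : {rmorphism {mpoly A[n]} -> R}),
    [/\ forall a : A, pi (a%:MP) = phi a,
        forall r : R, exists f, pi f = r
      & exists s : seq {mpoly A[n]}, [set f | pi f = 0] = ideal_gen [set` s]].

Definition flat (A R : comPzRingType) (phi : {rmorphism A -> R}) : Prop :=
  forall (M M' : lmodType A) (u : {linear M -> M'}),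
    injective u -> injective (@tensor_map A M M' (restr phi) u).

Definition smooth (A : comNzRingType) (R : comPzRingType)
    (phi : {rmorphism A -> R}) : Prop :=
  [/\ finitely_presented phi, flat phi
    & forall p : set A, prime_ideal p ->
        geometrically_regular (fiber_map phi p)].

Definition smooth_Z (R : comPzRingType) : Prop :=
  smooth (@intmul R 1 : {rmorphism int -> R}).

Section Complexes.
Variable R : comPzRingType.

Record complex := Complex {
  cobj :> nat -> lmodType R;
  cdiff : forall n, {linear cobj n -> cobj n.+1};
  cdiffK : forall n x, cdiff n.+1 (cdiff n x) = 0
}.

Definition cocycles (C : complex) (k : nat) : set (C k) :=
  [set x | cdiff C k x = 0].

Definition coboundaries (C : complex) (k : nat) : set (C k) :=
  match k with
  | 0 => [set 0]
  | n.+1 => range (cdiff C n)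
  end.


End Complexes.

Arguments cocycles {R} C k.
Arguments coboundaries {R} C k.

Definition cohomology (R : comPzRingType) (C : complex R) (k : nat) :
    lmodType R :=
  quotmod [set z : submod (cocycles C k) | coboundaries C k (val z)].

Section Koszul.
Variable R : comPzRingType.

(* R concentrated in degree 0: the unit of the tensor product. *)
Definition unit_obj (n : nat) : lmodType R := if n is 0 then R^o else 'rV[R]_0.
Definition unit_diff (n : nat) : {linear unit_obj n -> unit_obj n.+1} := \0.
Fact unit_diffK n x : unit_diff n.+1 (unit_diff n x) = 0.
Proof. by []. Qed.
Definition unit_complex : complex R := Complex unit_diffK.

(* K(f) (x) D, where K(f) has basis 1 in degree 0 and e in degree 1 with     *)
(* d 1 = f e: the pair (x, y) stands for 1 (x) x + e (x) y, and              *)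
(* d (e (x) y) = - e (x) d y by the sign rule.                               *)
Section Step.
Variables (f : R) (D : complex R).

Definition kos_obj (n : nat) : lmodType R :=
  if n is m.+1 then (D m.+1 * D m)%type : lmodType R else D 0.

Definition kos_fun (n : nat) : kos_obj n -> kos_obj n.+1 :=
  match n with
  | 0 => fun x => (cdiff D 0 x, f *: x)
  | m.+1 => fun z => (cdiff D m.+1 z.1, f *: z.1 - cdiff D m z.2)
  end.

Fact kos_fun_linear n : linear (@kos_fun n).
Proof.
case: n => [|n] a x y /=; congr pair.
- by rewrite linearP.
- transitivity (a *: (f *: x) + f *: y) => //.
  by rewrite scalerDr !scalerA mulrC.
- by rewrite linearP.
- transitivity (a *: (f *: x.1 - cdiff D n x.2) + (f *: y.1 - cdiff D n y.2)).
    by rewrite (scalerDr f) linearP scalerBr !scalerA (mulrC f) opprD addrACA.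
  by [].
Qed.

HB.instance Definition _ n := GRing.isLinear.Build R (kos_obj n) (kos_obj n.+1)
  _ (@kos_fun n) (@kos_fun_linear n).

Definition kos_diff n : {linear kos_obj n -> kos_obj n.+1} := @kos_fun n.

Fact kos_diffK n x : kos_diff n.+1 (kos_diff n x) = 0.
Proof.
case: n x => [|n] x; congr pair => /=; rewrite ?cdiffK //.
  by rewrite linearZ subrr.
by rewrite linearB linearZ /= cdiffK subr0 subrr.
Qed.

Definition koszul_step : complex R := Complex kos_diffK.
End Step.

Definition koszul (fs : seq R) : complex R := foldr koszul_step unit_complex fs.

End Koszul.

Section LocalCohomology.
Variable R : comPzRingType.

Definition injective_module (E : lmodType R) : Prop :=
  forall (M N : lmodType R) (i : {linear M -> N}) (g : {linear M -> E}),
    injective i -> exists h : {linear N -> E}, forall x, h (i x) = g x.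

Record injective_resolution (M : lmodType R) := InjectiveResolution {
  res_complex :> complex R;
  res_aug : {linear M -> res_complex 0};
  res_injective : forall n, injective_module (res_complex n);
  res_aug_inj : injective res_aug;
  res_exact0 : cocycles res_complex 0 = range res_aug;
  res_exactS : forall n,
    cocycles res_complex n.+1 = coboundaries res_complex n.+1
}.

Variable a : set R.

Definition torsion (M : lmodType R) : set M :=
  [set x | exists n, forall r, ideal_pow a n r -> r *: x = 0].

Definition Gamma (M : lmodType R) : lmodType R := submod (@torsion M).

Section GammaMap.
Variables (M N : lmodType R) (u : {linear M -> N}).

Lemma Gamma_map_subproof (x : Gamma M) : u (val x) \in span_pred (@torsion N).
Proof.
apply/span_predP => V [V0 VD] TV.
have /span_predP /(_ (u @^-1` V)) := valP x; apply.
  by split=> [|r y z Vy Vz]; rewrite /preimage /= ?linear0 // linearP; apply: VD.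
move=> y [n Hn]; apply: TV; exists n => r /Hn ry0.
by rewrite -linearZ ry0 linear0.
Qed.

Definition Gamma_fun (x : Gamma M) : Gamma N :=
  exist _ (u (val x)) (Gamma_map_subproof x).

Fact Gamma_fun_linear : linear Gamma_fun.
Proof. by move=> r x y; apply: val_inj; rewrite /= linearP. Qed.

HB.instance Definition _ :=
  GRing.isLinear.Build R (Gamma M) (Gamma N) _ Gamma_fun Gamma_fun_linear.

Definition Gamma_map : {linear Gamma M -> Gamma N} := Gamma_fun.
End GammaMap.

Fact Gamma_diffK (C : complex R) n x :
  Gamma_map (cdiff C n.+1) (Gamma_map (cdiff C n) x) = 0.
Proof. by apply: val_inj; rewrite /= cdiffK. Qed.

Definition Gamma_complex (C : complex R) : complex R :=
  Complex (@Gamma_diffK C).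

(* H^k_a(M) as the right derived functor of Gamma_a, computed with the       *)
(* injective resolution I of M.                                              *)
Definition local_cohomology (M : lmodType R) (I : injective_resolution M)
    (k : nat) : lmodType R :=
  cohomology (Gamma_complex I) k.

End LocalCohomology.

Definition nonzerodivisor (R : comPzRingType) (M : lmodType R) (r : R) : Prop :=
  injective (fun x : M => r *: x).

Definition associated_primes (R : comPzRingType) (M : lmodType R) :
    set (set R) :=
  [set P | prime_ideal P /\ exists x : M, P = [set r | r *: x = 0]].

(* Main.v *)
(* A class of [H^k_a(R)] is represented by a Koszul cocycle on powers [f^m] ("of level [m]"),     *)
(* considered up to raising the level. Locally [R] has etale coordinates [x_1, ..., x_n] over an  *)
(* open subset of affine space (Jacobian criterion), hence Taylor expansions in each [x_i], and   *)
(* modulo a prime number [p] the [x_i] form a [p]-basis of a reduced ring.                        *)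
(*                                                                                                *)
(* (1) A class killed by [p] comes, through the connecting map, from a class modulo [p], and it   *)
(* vanishes when the latter lifts. The expansions give operators on integral cochains which, by   *)
(* means of the Frobenius, show that a class of level [m] lifts if its [p]-th roots with respect  *)
(* to the [p]-basis do; these have level about [m / p] and, since degrees also get divided by     *)
(* [p], end up in a finite set. Everything is thus controlled by the classes of level one, whose  *)
(* lifting is the hypothesis on Koszul cohomology. (2) follows, since the torsion of the Koszul   *)
(* cohomology of a noetherian ring is bounded.                                                    *)
(*                                                                                                *)
(* (3) An associated prime containing [p] is determined by iterated roots lying in a finite set,  *)
(* for each of the finitely many [p] with torsion. For those that contain no [p], the derivations *)
(* act on local cohomology, and from a class whose annihilator is such a prime one gets           *)
(* [(k + 1)^n] independent elements of degree [O(k)], jointly independent for distinct primes;    *)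
(* as the elements of degree at most [d] have rank [O(d^n)], the number of primes is bounded.     *)

Require Import Defs.
From HB Require Import structures.
From mathcomp Require Import all_boot all_order all_algebra.
From mathcomp Require Import generic_quotient ring_quotient.
From mathcomp Require Import finmap boolp classical_sets functions cardinality.
From mathcomp Require Import mpoly ring zify.

Set Implicit Arguments.
Unset Strict Implicit.
Unset Printing Implicit Defensive.

Import GRing.Theory.
Local Open Scope ring_scope.
Local Open Scope classical_set_scope.


(** * Ideals and primes of noetherian rings *)

(** By [local_cohomology_repr], a class of [H^k_a(R)] is given by a Koszul cocycle on the powers
    [f_i ^ m], and a multiple of the class vanishes exactly when the same multiple of the cocycle
    becomes a coboundary for larger [m]. This rests on [inj_acyclic]: in the limit over [m], Koszul
    cohomology of an injective module vanishes in positive degrees. Vanishing and annihilators can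
    then be studied on the finitely many localizations of [good_cover].

    Each localization has coordinates [x_1, ..., x_n] by [local_structure]. At a closed point of
    characteristic [l], regularity of [R / l] makes the length of a chain of primes match a number
    of generators ([chain_length_le_generators]), and flatness removes [l]-torsion; the result is
    the Jacobian criterion. It yields Taylor homomorphisms in each [x_i] ([chart_hs]), a [p]-basis
    modulo every prime number [p] ([chart_pform]), reducedness modulo [p] ([smooth_reduced]), and
    algebraic dependence over the integers of any [n + 1] elements ([chart_dependent]).

    First assertion. A class killed by [p] comes from a class modulo [p] under the connecting map,
    and vanishes when the latter lifts ([evc_InIm]). Write a cochain modulo [p] as
    [v = sum_g x^g v_g ^ p]. Differential operators obtained from the Taylor maps separate the
    summands ([extract]), so [v ^ (p ^ e)] lifts if and only if all [v_g ^ (p ^ (e + 1))] do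
    ([St_root]). Passing to the roots [v_g] divides the level [m] by [p], rounded up, and the degree
    by [p] up to a constant ([rt_gauge]): iterated roots end in a finite set of cochains of level
    one. Inside it, those that are [k]-fold roots of level-one cocycles form sets decreasing with
    [k], hence eventually constant, and [all_lift] reduces liftability at every level to level one.
    There it follows from the hypothesis on Koszul cohomology ([nzd_criterion]).

    Second assertion. Koszul cohomology has no [p]-torsion for large [p], by the ascending chain
    condition ([bounded_torsion]).

    Third assertion. An associated prime that contains a prime number [p] is the annihilator of a
    class modulo [p] relative to liftable classes. Through [p ^ k]-th powers it is a finite
    intersection of ideals attached to elements of a fixed finite set, hence equal to one of them
    ([prime_annihilators]), and only finitely many [p] occur. If [P] contains no positive integer,
    derivations act on the limit of the cochains. From a class [z] with annihilator [P], monomials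
    in some coordinates times derivatives of [z] in the others are linearly independent over the
    integers, by an argument with symbols ([indep_one]), and jointly so for distinct primes
    ([joint_independent]). For [N] primes this gives [N (k + 1) ^ n] elements of degree [O(k)],
    while the elements of degree at most [d] have rational rank [O(d ^ n)] ([growth]); so [N] is
    bounded ([few_annihilators]). *)

Section IdealBasics.
Variable R : comPzRingType.
Implicit Types (I J P Q : set R) (x y r : R).

Lemma idealP I : ideal I <->
  [/\ I 0, forall x y, I x -> I y -> I (x + y) & forall r x, I x -> I (r * x)].
Proof.
split=> [[I0 ID]|[I0 ID IM]]; split=> //.
- by move=> x y Ix Iy; rewrite -[x]mul1r; apply: ID.
- by move=> r x Ix; rewrite -[_ * _]addr0; apply: ID.
- by move=> r x y Ix Iy; apply: ID => //; apply: IM.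
Qed.

Lemma ideal0 I : ideal I -> I 0. Proof. by case/idealP. Qed.
Lemma idealD I x y : ideal I -> I x -> I y -> I (x + y).
Proof. by case/idealP=> _ H _; apply: H. Qed.
Lemma idealMl I r x : ideal I -> I x -> I (r * x).
Proof. by case/idealP=> _ _; apply. Qed.
Lemma idealMr I r x : ideal I -> I x -> I (x * r).
Proof. by rewrite mulrC; apply: idealMl. Qed.
Lemma idealN I x : ideal I -> I x -> I (- x).
Proof. by move=> HI Ix; rewrite -mulN1r; apply: idealMl. Qed.
Lemma idealB I x y : ideal I -> I x -> I y -> I (x - y).
Proof. by move=> HI Ix Iy; apply: idealD => //; apply: idealN. Qed.
Lemma ideal_sum I (T : Type) (s : seq T) (p : pred T) (F : T -> R) :
  ideal I -> (forall i, p i -> I (F i)) -> I (\sum_(i <- s | p i) F i).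
Proof.
move=> HI HF; elim/big_ind: _ => //; first exact: ideal0.
by move=> x y; apply: idealD.
Qed.
Lemma idealBr I x y : ideal I -> I (x - y) -> I y -> I x.
Proof. by move=> HI Ixy Iy; rewrite -[x](subrK y); apply: idealD. Qed.
Lemma ideal1 I x : ideal I -> I 1 -> I x.
Proof. by move=> HI I1; rewrite -[x]mulr1; apply: idealMl. Qed.

Lemma ideal_gen_ideal (S : set R) : ideal (ideal_gen S).
Proof. exact: span_submodule. Qed.

Lemma sub_ideal_gen (S : set R) : S `<=` ideal_gen S.
Proof. by move=> x Sx I _; apply. Qed.

Lemma ideal_gen_min (S : set R) I : ideal I -> S `<=` I -> ideal_gen S `<=` I.
Proof. by move=> HI SI x; apply. Qed.

Lemma ideal_gen_seqP (s : seq R) x : ideal_gen [set` s] x <->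
  exists c : nat -> R, x = \sum_(i < size s) c i * s`_i.
Proof.
split=> [|[c ->]]; last first.
  apply: (@ideal_sum (ideal_gen [set` s])) => [|i _]; first exact: ideal_gen_ideal.
  apply: (@idealMl (ideal_gen [set` s])); first exact: ideal_gen_ideal.
  by apply: sub_ideal_gen; rewrite /= mem_nth.
apply: (@ideal_gen_min _ [set x | exists c : nat -> R,
   x = \sum_(i < size s) c i * s`_i]).
  apply/idealP; split.
  - by exists (fun=> 0); rewrite big1 // => i _; rewrite mul0r.
  - move=> _ _ [c ->] [d ->]; exists (fun i => c i + d i).
    by rewrite -big_split; apply: eq_bigr => i _; rewrite mulrDl.
  - move=> r _ [c ->]; exists (fun i => r * c i).
    by rewrite mulr_sumr; apply: eq_bigr => i _; rewrite mulrA.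
move=> y /= ys; exists (fun i => (i == index y s)%:R).
have iys : (index y s < size s)%N by rewrite index_mem.
rewrite (bigD1 (Ordinal iys)) //= eqxx mul1r nth_index // big1 ?addr0 // => i.
by rewrite -val_eqE /= => /negPf ->; rewrite mul0r.
Qed.

Definition iext I x : set R := [set y | exists a i, I i /\ y = a * x + i].

Fixpoint iexts I (s : seq R) : set R :=
  if s is x :: s' then iexts (iext I x) s' else I.

Lemma iext_ideal I x : ideal I -> ideal (iext I x).
Proof.
move=> HI; apply/idealP; split.
- by exists 0, 0; split; [apply: ideal0 | rewrite mul0r addr0].
- move=> _ _ [a [i [Ii ->]]] [b [j [Ij ->]]]; exists (a + b), (i + j).
  by split; [apply: idealD | rewrite mulrDl addrACA].
- move=> r _ [a [i [Ii ->]]]; exists (r * a), (r * i).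
  by split; [apply: idealMl | rewrite mulrDr mulrA].
Qed.

Lemma sub_iext I x : I `<=` iext I x.
Proof. by move=> y Iy; exists 0, y; rewrite mul0r add0r. Qed.

Lemma iext_mem I x : ideal I -> iext I x x.
Proof. by move=> HI; exists 1, 0; rewrite mul1r addr0; split=> //; apply: ideal0. Qed.

Lemma iext_min I J x : ideal J -> I `<=` J -> J x -> iext I x `<=` J.
Proof.
move=> HJ IJ Jx _ [a [i [Ii ->]]].
by apply: idealD; [|apply: idealMl|apply: IJ].
Qed.

Lemma iexts_ideal I s : ideal I -> ideal (iexts I s).
Proof. by elim: s I => //= x s IH I HI; apply/IH/iext_ideal. Qed.

Lemma sub_iexts I s : I `<=` iexts I s.
Proof.
by elim: s I => [|x s IH] I y //= Iy; apply/IH/sub_iext.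
Qed.

Lemma iexts_mem I s x : ideal I -> x \in s -> iexts I s x.
Proof.
elim: s I => //= y s IH I HI; rewrite inE => /orP[/eqP ->|xs].
  by apply: sub_iexts; apply: iext_mem.
by apply: IH => //; apply: iext_ideal.
Qed.

Lemma iexts_min I J s : ideal J -> I `<=` J -> (forall x, x \in s -> J x) ->
  iexts I s `<=` J.
Proof.
move=> HJ; elim: s I => [|x s IH] I IJ Js //=; apply: IH.
  by apply: iext_min => //; apply: Js; rewrite mem_head.
by move=> y ys; apply: Js; rewrite inE ys orbT.
Qed.

Section Prime.
Variables (Q : set R) (HQ : prime_ideal Q).

Lemma prime_idl : ideal Q. Proof. by case: HQ. Qed.
Lemma prime_n1 : ~ Q 1. Proof. by case: HQ. Qed.
Lemma primeM x y : ~ Q x -> ~ Q y -> ~ Q (x * y).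
Proof. by case: HQ => _ _ H nx ny /H[]. Qed.
Lemma primeX x n : ~ Q x -> ~ Q (x ^+ n).
Proof.
move=> nx; elim: n => [|n IH]; first by rewrite expr0; apply: prime_n1.
by rewrite exprS; apply: primeM.
Qed.
Lemma prime_expr x n : Q (x ^+ n) -> Q x.
Proof. by move=> H; apply: contrapT => /primeX; apply; apply: H. Qed.

(* Containment of [I] in [I'] after localizing at the prime [Q]. *)
Definition leQ I I' := forall x, I x -> exists s, ~ Q s /\ I' (s * x).

(** The ideal [I + Q s], built by recursion on [s] so that the elements of [s] can be eliminated one
    at a time. *)
Fixpoint qext I (s : seq R) : set R :=
  if s is n :: s' then [set y | exists c z, [/\ Q c, qext I s' z & y = c * n + z]]
  else I.

Lemma qext_ideal I s : ideal I -> ideal (qext I s).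
Proof.
move=> HI; elim: s => //= n s IH; apply/idealP; split.
- exists 0, 0; split; [exact: ideal0 prime_idl|exact: ideal0|].
  by rewrite mul0r addr0.
- move=> _ _ [a [i [Qa Ii ->]]] [b [j [Qb Ij ->]]]; exists (a + b), (i + j).
  split; [exact: idealD prime_idl _ _|exact: idealD|].
  by rewrite mulrDl addrACA.
- move=> r _ [a [i [Qa Ii ->]]]; exists (r * a), (r * i).
  by split; [apply: idealMl prime_idl _|apply: idealMl|rewrite mulrDr mulrA].
Qed.

Lemma qext_sub I s x : ideal I -> I x -> qext I s x.
Proof.
move=> HI Ix; elim: s => //= n s IH; exists 0, x; split=> //.
  exact: ideal0 prime_idl.
by rewrite mul0r add0r.
Qed.

Lemma qext_mem I s c n : ideal I -> n \in s -> Q c -> qext I s (c * n).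
Proof.
move=> HI; elim: s => //= m s IH; rewrite inE => /orP[/eqP ->|/IH H] Qc.
  exists c, 0; split=> //; last by rewrite addr0.
  exact: (ideal0 (qext_ideal _ HI)).
exists 0, (c * n); split; [exact: ideal0 prime_idl|exact: H|].
by rewrite mul0r add0r.
Qed.

Lemma qext_loc I s x : ideal I ->
  (forall n, n \in s -> exists s, ~ Q s /\ I (s * n)) ->
  qext I s x -> exists r, ~ Q r /\ I (r * x).
Proof.
move=> HI; elim: s x => [|n s IH] x Hs /=.
  by move=> Ix; exists 1; rewrite mul1r; split=> //; apply: prime_n1.
move=> [c [z [Qc Iz ->]]].
have [|r [nr Irz]] := IH z _ Iz.
  by move=> m ms; apply: Hs; rewrite inE ms orbT.
have [r' [nr' Irn]] := Hs n (mem_head _ _).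
exists (r * r'); split; first exact: primeM.
rewrite mulrDr; apply: idealD => //.
  have -> : r * r' * (c * n) = r * c * (r' * n) by ring.
  exact: idealMl.
by rewrite (mulrC r) -mulrA; apply: idealMl.
Qed.

(** Nakayama's lemma by elimination: in a relation [r0 n0 = c0 n0 + z0] with [c0] in [Q], the factor
    [r0 - c0] is outside [Q], so that locally at [Q] the element [n0] is expressed by the remaining
    ones. *)
Lemma nakayama_seq I s : ideal I ->
  (forall n, n \in s -> exists r, ~ Q r /\ qext I s (r * n)) ->
  forall n, n \in s -> exists r, ~ Q r /\ I (r * n).
Proof.
move=> HI; elim: s => //= n0 s IH Hs.
have [r0 [nr0 [c0 [z0 [Qc0 Iz0 E0]]]]] := Hs n0 (mem_head _ _).
pose r := r0 - c0.
have nr : ~ Q r by move=> /(idealD prime_idl Qc0); rewrite addrC subrK.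
have Er : r * n0 = z0 by rewrite mulrBl E0 addrAC subrr add0r.
have IHs : forall n, n \in s -> exists r, ~ Q r /\ I (r * n).
  apply: IH => n ns; have /= := Hs n; rewrite inE ns orbT.
  move=> /(_ isT)[rn [nrn [c [z [Qc Iz E]]]]].
  exists (r * rn); split; first exact: primeM.
  rewrite -mulrA E mulrDr mulrCA Er.
  by apply: idealD (qext_ideal s HI) _ _; apply: idealMl (qext_ideal s HI) _.
move=> n; rewrite inE => /orP[/eqP->|]; last exact: IHs.
rewrite -Er in Iz0; have [r' [nr' Ir']] := qext_loc HI IHs Iz0.
by exists (r' * r); split; [apply: primeM | rewrite -mulrA].
Qed.

End Prime.
End IdealBasics.

Section Noetherian.
Variables (R : comPzRingType) (noeR : noetherian R).
Implicit Types (I J P Q M : set R).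

Lemma noeth_acc (C : nat -> set R) :
  (forall n, ideal (C n)) -> (forall n, C n `<=` C n.+1) ->
  exists N, forall n, (N <= n)%N -> C n = C N.
Proof.
move=> HC CS.
have Cm m n : (m <= n)%N -> C m `<=` C n.
  by move=> /subnK <-; elim: (n - m)%N => // k IH; apply: subset_trans IH (CS _).
pose U : set R := [set x | exists n, C n x].
have HU : ideal U.
  apply/idealP; split; first by exists 0%N; apply: ideal0.
  - move=> x y [m mx] [n ny]; exists (maxn m n).
    by apply: idealD => //; [apply: Cm mx|apply: Cm ny]; rewrite ?leq_maxl ?leq_maxr.
  - by move=> r x [n nx]; exists n; apply: idealMl.
have [s Us] := noeR HU.
have [N HN] : exists N, forall x, x \in s -> C N x.
  have : forall x, x \in s -> U x by move=> x xs; rewrite Us; apply: sub_ideal_gen.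
  elim: s {Us} => [|y s IH] Hs; first by exists 0%N.
  have [|N HN] := IH; first by move=> x xs; apply: Hs; rewrite inE xs orbT.
  have [M HM] := Hs y (mem_head _ _); exists (maxn N M) => x.
  rewrite inE => /orP[/eqP ->|/HN]; last by apply: Cm; rewrite leq_maxl.
  by apply: Cm HM; rewrite leq_maxr.
exists N => n Nn; apply/seteqP; split; last exact: Cm.
move=> x Cx; have : U x by exists n.
by rewrite Us; apply: ideal_gen_min.
Qed.

Lemma noeth_max (F : set R -> Prop) I0 : F I0 -> (forall I, F I -> ideal I) ->
  exists2 M, F M & forall J, F J -> M `<=` J -> J = M.
Proof.
move=> F0 Fid; apply: contrapT => noM.
have next (I : {I | F I}) : {J : {J | F J} | sval I `<=` sval J /\ sval J <> sval I}.
  apply: cid; apply: contrapT => H; apply: noM; exists (sval I); first exact: svalP.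
  move=> J FJ IJ; apply: contrapT => JI; apply: H.
  by exists (exist _ J FJ).
pose C n := iter n (fun X => sval (next X)) (exist _ I0 F0).
have [N HN] := @noeth_acc (fun n => sval (C n)) (fun n => Fid _ (svalP _))
  (fun n => (svalP (next (C n))).1).
by have := (svalP (next (C N))).2; apply; apply: (HN N.+1).
Qed.

(** Among the ideals over [I] that avoid [W], a maximal one is prime: adjoining either of two
    outside elements meets [W], and the product of the two meeting points would lie in the ideal if
    [x * y] did. *)
Lemma prime_avoiding I (W : set R) : ideal I -> W 1 ->
  (forall x y, W x -> W y -> W (x * y)) -> (forall x, I x -> ~ W x) ->
  exists P : set R, [/\ prime_ideal P, I `<=` P & forall x, P x -> ~ W x].
Proof.
move=> HI W1 WM IW.
have [|J []//|P [HP IP PW] Pmax] :=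
  @noeth_max (fun J => [/\ ideal J, I `<=` J & forall x, J x -> ~ W x]) I.
  by split.
exists P; split=> //; split=> //; first by move=> /PW.
move=> x y Pxy; apply: contrapT => /not_orP[nx ny].
have meet z : ~ P z -> exists a i, P i /\ W (a * z + i).
  move=> nz; apply: contrapT => H; apply: nz.
  have <- : iext P z = P; last exact: iext_mem.
  apply: Pmax; last exact: sub_iext; split; first exact: iext_ideal.
    exact: subset_trans IP (@sub_iext _ _ _).
  by move=> _ [a [i [Pi ->]]] Wz; apply: H; exists a, i.
have [a [i [Pi Wa]]] := meet x nx; have [b [j [Pj Wb]]] := meet y ny.
apply: PW (WM _ _ Wa Wb).
have -> : (a * x + i) * (b * y + j) =
  a * b * (x * y) + (i * (b * y + j) + a * x * j) by ring.
apply: (idealD HP); first exact: (idealMl _ HP Pxy).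
by apply: (idealD HP); [apply: (idealMr _ HP)|apply: (idealMl _ HP)].
Qed.

Lemma maximal_over I : ideal I -> ~ I 1 -> exists2 M : set R, maximal_ideal M & I `<=` M.
Proof.
move=> HI nI.
have [|J []//|M [HM IM nM] Mmax] :=
  @noeth_max (fun J => [/\ ideal J, I `<=` J & ~ J 1]) I; first by split.
exists M => //; split=> // J HJ MJ nJ; apply: Mmax => //; split=> //.
exact: subset_trans MJ.
Qed.

Lemma maximal_inv M x : maximal_ideal M -> ~ M x -> exists y, M (y * x - 1).
Proof.
move=> [HM nM Mmax] nx.
have [a [i [Mi E]]] : iext M x 1.
  apply: contrapT => H; apply: nx; rewrite -(Mmax (iext M x)) //.
  - exact: iext_mem. - exact: iext_ideal. - exact: sub_iext.
by exists a; rewrite E opprD addrA subrr sub0r; apply: idealN.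
Qed.

Lemma maximal_prime M : maximal_ideal M -> prime_ideal M.
Proof.
move=> MM; have [HM nM _] := MM; split=> // x y Mxy.
apply: contrapT => /not_orP[/(maximal_inv MM)[a Ma] ny]; apply: ny.
have -> : y = a * (x * y) - (a * x - 1) * y by ring.
by apply: idealB => //; [apply: idealMl|apply: idealMr].
Qed.

(** Quantifying over all ideals [K] that contain [I] and [Q N] spares the construction of [I + Q N];
    in the proof [K] is [qext] of a finite set of generators of [N]. *)
Lemma nakayama Q (N : set R) I : prime_ideal Q -> ideal I -> ideal N ->
  (forall x, N x -> exists r, ~ Q r /\ forall K, ideal K -> I `<=` K ->
     (forall q n, Q q -> N n -> K (q * n)) -> K (r * x)) ->
  leQ Q N I.
Proof.
move=> HQ HI HN H; have [s Es] := noeR HN.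
have sN n : n \in s -> N n by move=> ns; rewrite Es; apply: sub_ideal_gen.
have Hs : forall n, n \in s -> exists r, ~ Q r /\ I (r * n).
  apply: (nakayama_seq HQ HI) => n /sN/H[r [nr Hr]]; exists r; split=> //.
  apply: Hr; first exact: qext_ideal.
    by move=> x Ix; apply: qext_sub.
  move=> q {r nr} m Qq; rewrite {1}Es => /ideal_gen_seqP[c ->].
  rewrite mulr_sumr; apply: ideal_sum; first exact: qext_ideal.
  move=> i _; rewrite mulrA; apply: (qext_mem HQ HI); first exact: mem_nth.
  exact: (idealMr _ (prime_idl HQ)).
have : forall x, qext Q I s x -> exists r, ~ Q r /\ I (r * x).
  by move=> x; apply: qext_loc.
move=> Hq x; rewrite Es => /ideal_gen_seqP[c ->].
have [r [nr Hr]] : exists r, ~ Q r /\ forall n, n \in s -> I (r * n).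
  elim: s Hs {Es sN Hq c x} => [|n s IH] Hs; first by exists 1; split=> //; apply: prime_n1 HQ.
  have [|r [nr Hr]] := IH; first by move=> m ms; apply: Hs; rewrite inE ms orbT.
  have [r' [nr' Hr']] := Hs n (mem_head _ _).
  exists (r * r'); split=> [|m]; first exact: (primeM HQ).
  rewrite inE => /orP[/eqP ->|/Hr].
    by rewrite -mulrA; apply: (idealMl _ HI).
  by move=> Irm; rewrite (mulrC r) -mulrA; apply: (idealMl _ HI).
exists r; split=> //; rewrite mulr_sumr; apply: ideal_sum => // i _.
by rewrite mulrCA; apply: (idealMl _ HI); apply/Hr/mem_nth.
Qed.

End Noetherian.

(** * Krull's principal ideal theorem, and chains of primes against numbers of generators *)

Section PrimeIdealTheorem.
Variables (R : comPzRingType) (noeR : noetherian R).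
Implicit Types (I J P Q M : set R).

(** The contraction to [R] of the ideal generated by [I] in the localization at [Q]. *)
Definition sat Q I : set R := [set x | exists s, ~ Q s /\ I (s * x)].

Lemma sat_ideal Q I : prime_ideal Q -> ideal I -> ideal (sat Q I).
Proof.
move=> HQ HI; apply/idealP; split.
- by exists 1; rewrite mulr0; split; [apply: prime_n1 HQ|apply: ideal0].
- move=> x y [s [ns Is]] [r [nr Ir]]; exists (s * r); split; first exact: (primeM HQ).
  have -> : s * r * (x + y) = r * (s * x) + s * (r * y) by ring.
  by apply: (idealD HI); apply: (idealMl _ HI).
- move=> r x [s [ns Is]]; exists s; split=> //.
  by rewrite mulrCA; apply: (idealMl _ HI).
Qed.

Lemma sub_sat Q I : prime_ideal Q -> I `<=` sat Q I.
Proof. by move=> HQ x Ix; exists 1; rewrite mul1r; split=> //; apply: prime_n1 HQ. Qed.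

Lemma sat_sat Q I s x : prime_ideal Q -> ~ Q s -> sat Q I (s * x) -> sat Q I x.
Proof.
move=> HQ ns [r [nr Ir]]; exists (r * s); rewrite -mulrA; split=> //.
exact: (primeM HQ).
Qed.

Lemma sat_mono Q I J : I `<=` J -> sat Q I `<=` sat Q J.
Proof. by move=> IJ x [s [ns /IJ Is]]; exists s. Qed.

Lemma sat_min Q I J : (forall s x, ~ Q s -> J (s * x) -> J x) -> I `<=` J ->
  sat Q I `<=` J.
Proof. by move=> HJ IJ x [s [ns /IJ Is]]; apply: HJ Is. Qed.

(** The quotient by [I] of the localization at [Q] is Artinian: its ideals correspond to the
    [Q]-saturated ideals of [R] over [I]. *)
Definition dcc_above Q I := forall C : nat -> set R,
  (forall n, ideal (C n)) -> (forall n s x, ~ Q s -> C n (s * x) -> C n x) ->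
  (forall n, I `<=` C n) -> (forall n, C n.+1 `<=` C n) ->
  exists N, forall n, (N <= n)%N -> C n = C N.

Lemma desc_le (C : nat -> set R) m n : (forall n, C n.+1 `<=` C n) ->
  (m <= n)%N -> C n `<=` C m.
Proof. by move=> HC /subnK <-; elim: (n - m)%N => // k IH; apply: subset_trans (HC _) IH. Qed.

(** A Noetherian local ring whose maximal ideal is nil is Artinian. Noetherian induction: over a
    maximal saturated counterexample [M], a socle element [r] gives a larger [M'] for which the
    chain condition holds. A chain over [M] either contains [r] throughout, or eventually meets [M']
    in [M] only and is then determined by its sums with [M']. *)
Lemma quotient_dcc Q I : prime_ideal Q -> ideal I ->
  (forall r, Q r -> exists s k, ~ Q s /\ I (s * r ^+ k)) -> dcc_above Q I.
Proof.
move=> HQ HI HQI.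
have sat_dcc J : prime_ideal Q -> dcc_above Q (sat Q J) -> dcc_above Q J.
  move=> _ H C Cid Csat JC CS; apply: H => // n.
  by apply: sat_min (JC n) => s x; apply: Csat.
apply: sat_dcc => //; apply: contrapT => ndcc.
have [|J []//|M [HM Msat IM nM] Mmax] := @noeth_max _ noeR
  (fun J => [/\ ideal J, forall s x, ~ Q s -> J (s * x) -> J x, sat Q I `<=` J & ~ dcc_above Q J])
  (sat Q I).
  by split=> //; [apply: sat_ideal | move=> s x; apply: sat_sat].
have nM1 : ~ M 1.
  move=> M1; apply: nM => C Cid _ MC _; exists 0%N => n _.
  by apply/seteqP; split=> x _; apply: ideal1 => //; apply: MC.
(* The socle element: an annihilator modulo [M] that is maximal among those of elements outside [M]
   contains [Q]. *)
have [r nr Qr] : exists2 r, ~ M r & forall q, Q q -> M (q * r).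
  have [|J [r [_ ->]]|K [r [nr ->]] Kmax] := @noeth_max _ noeR
    (fun J => exists r, ~ M r /\ J = [set a | M (a * r)]) [set a | M (a * 1)].
  - by exists 1.
  - apply/idealP; split=> [|x y|a x] /=; rewrite ?mul0r ?mulrDl -?mulrA.
    + exact: ideal0. + exact: idealD. + exact: idealMl.
  exists r => // q Qq; have [s [k [ns Isq]]] := HQI q Qq.
  have Mq : M (q ^+ k * r).
    apply: (Msat s) => //; rewrite mulrA; apply: (idealMr _ HM).
    by apply: IM; apply: sub_sat.
  elim: k Mq {Isq} => [|k IH]; first by rewrite expr0 mul1r.
  rewrite exprS -mulrA => Mq; have [//|nqr] := pselect (M (q * r)).
  have KE : [set a | M (a * (q * r))] = [set a | M (a * r)].
    apply: Kmax; first by exists (q * r).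
    by move=> a Ma /=; rewrite mulrCA; apply: (idealMl _ HM).
  apply: IH; have : [set a | M (a * (q * r))] (q ^+ k) by rewrite /= mulrCA.
  by rewrite KE.
pose M' := sat Q (iext M r).
have HM' : ideal M' by apply: sat_ideal => //; apply: iext_ideal.
have M'sat s x : ~ Q s -> M' (s * x) -> M' x by apply: sat_sat.
have MM' : M `<=` M' by move=> y My; apply: sub_sat => //; apply: sub_iext.
have M'r : M' r by apply: sub_sat => //; apply: iext_mem.
have dM' : dcc_above Q M'.
  apply: contrapT => nd; apply: nr; rewrite -(Mmax M') //.
  by split=> // y /IM/MM'.
apply: nM => C Cid Csat MC CS.
have [Cr|/existsNP[N nCr]] := pselect (forall n, C n r).
  apply: dM' => // n; apply: sat_min; first by move=> s x; apply: Csat.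
  exact: iext_min.
(* Otherwise a multiple of [r] by an element outside [Q], hence [r] itself, would lie in [C n]. *)
have EM n x : (N <= n)%N -> C n x -> M' x -> M x.
  move=> Nn Cx [s [ns [a [m [Mm E]]]]]; apply: (Msat s) => //.
  have [Qa|nQa] := pselect (Q a); first by rewrite E; apply: idealD => //; apply: Qr.
  case: nCr; apply: (desc_le CS Nn); apply: (Csat n a) => //.
  apply: (idealBr (Cid n)) (MC n _ (idealN HM Mm)); rewrite opprK -E.
  exact: idealMl.
pose D n : set R := sat Q [set y | exists c m, [/\ C n c, M' m & y = c + m]].
have [||||K HK] := dM' D.
- move=> n; apply: sat_ideal => //; apply/idealP; split.
  + by exists 0, 0; split; rewrite ?addr0 //; apply: ideal0.
  + move=> _ _ [c [m [Cc Mm ->]]] [d [l [Cd Ml ->]]]; exists (c + d), (m + l).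
    by split; [apply: idealD|apply: idealD|rewrite addrACA].
  + move=> a _ [c [m [Cc Mm ->]]]; exists (a * c), (a * m).
    by split; [apply: idealMl|apply: idealMl|rewrite mulrDr].
- by move=> n s x; apply: sat_sat.
- move=> n x Mx; apply: sub_sat => //; exists 0, x; rewrite add0r; split=> //.
  exact: ideal0.
- move=> n; apply: sat_mono => _ [c [m [Cc Mm ->]]]; exists c, m; split=> //.
  exact: CS.
exists (maxn N K) => n Hn; apply/seteqP; split; first exact: desc_le.
have Nn : (N <= n)%N by apply: leq_trans Hn; apply: leq_maxl.
have Kn : (K <= n)%N by apply: leq_trans Hn; apply: leq_maxr.
move=> x Cx.
have : D (maxn N K) x.
  apply: sub_sat => //; exists x, 0; rewrite addr0; split=> //; exact: ideal0.
rewrite (HK _ (leq_maxr _ _)) -(HK n Kn) => -[s [ns [c [m [Cc Mm E]]]]].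
apply: (Csat n s) => //; rewrite E; apply: (idealD (Cid n)) => //; apply: MC.
apply: (EM (maxn N K)) => //; first exact: leq_maxl.
have -> : m = s * x - c by rewrite E addrAC subrr add0r.
apply: (idealB (Cid _)); first exact: idealMl.
exact: (desc_le CS Hn).
Qed.

Lemma ideal_pow_ideal I n : ideal (ideal_pow I n).
Proof.
case: n => [|n]; last exact: ideal_gen_ideal.
by apply/idealP; split.
Qed.

Lemma ideal_powX I x n : ideal I -> I x -> ideal_pow I n (x ^+ n).
Proof.
move=> HI Ix; elim: n => //= n IH; apply: sub_ideal_gen.
by exists x, (x ^+ n); rewrite exprS.
Qed.

(* Krull's principal ideal theorem, in the form needed to move an element down a chain of primes. *)
Lemma prime_between (P0 P1 P2 : set R) x :
  prime_ideal P0 -> prime_ideal P1 -> prime_ideal P2 ->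
  P0 `<=` P1 -> P0 <> P1 -> P1 `<=` P2 -> P1 <> P2 -> P2 x -> ~ P0 x ->
  exists P, [/\ prime_ideal P, P0 `<=` P, P0 <> P, P `<=` P2 & P <> P2 /\ P x].
Proof.
move=> H0 H1 H2 P01 N01 P12 N12 P2x nP0x.
apply: contrapT => nP.
have nP1x : ~ P1 x by move=> P1x; apply: nP; exists P1.
have I0 := prime_idl H0; have I1 := prime_idl H1; have I2 := prime_idl H2.
(* Without the required prime, [P2] is minimal over [P0 + (x)]. *)
have dcc : dcc_above P2 (iext P0 x).
  apply: quotient_dcc => //; first exact: iext_ideal.
  move=> r P2r; apply: contrapT => nr.
  have [||||P [HP IP PW]] := @prime_avoiding _ noeR (iext P0 x)
    [set w | exists s k, ~ P2 s /\ w = s * r ^+ k].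
  - exact: iext_ideal.
  - by exists 1, 0%N; rewrite mul1r expr0; split=> //; apply: prime_n1 H2.
  - move=> _ _ [s [k [ns ->]]] [t [l [nt ->]]]; exists (s * t), (k + l)%N.
    by rewrite exprD mulrACA; split=> //; apply: (primeM H2).
  - by move=> w Iw [s [k [ns E]]]; apply: nr; exists s, k; rewrite -E.
  have Px : P x by apply: IP; apply: iext_mem.
  apply: nP; exists P; split=> //.
  - by apply: subset_trans IP; apply: sub_iext.
  - by move=> E; apply: nP0x; rewrite E.
  - move=> p Pp; apply: contrapT => np; apply: (PW p Pp).
    by exists p, 0%N; rewrite expr0 mulr1.
  - split=> // E; apply: (PW r); first by rewrite E.
    by exists 1, 1%N; rewrite expr1 mul1r; split=> //; apply: prime_n1 H2.
pose A n : set R := [set y | exists a b, [/\ ideal_pow P1 n a, P0 b & y = a + b]].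
have HA n : ideal (A n).
  have Hp := ideal_pow_ideal P1 n; apply/idealP; split.
  - by exists 0, 0; split; rewrite ?addr0 //; apply: ideal0.
  - move=> _ _ [c [m [Cc Mm ->]]] [d [l [Cd Ml ->]]]; exists (c + d), (m + l).
    by split; [apply: idealD|apply: idealD|rewrite addrACA].
  - move=> a _ [c [m [Cc Mm ->]]]; exists (a * c), (a * m).
    by split; [apply: idealMl|apply: idealMl|rewrite mulrDr].
(* The symbolic powers of [P1] modulo [P0]. Their sums with [(x)] stabilize; as [x] is outside [P1],
   Nakayama's lemma at [P2] makes the symbolic powers themselves stabilize, and Nakayama's lemma at
   [P1] then puts a power of [P1] into [P0] locally. *)
pose S n := sat P1 (A n).
have HS n : ideal (S n) by apply: sat_ideal.
have SS n : S n.+1 `<=` S n.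
  apply: sat_mono => _ [a [b [Pa P0b ->]]]; exists a, b; split=> //.
  move: a Pa; apply: ideal_gen_min; first exact: ideal_pow_ideal.
  by move=> _ [u [v [_ Pv ->]]]; apply: idealMl => //; apply: ideal_pow_ideal.
have [|||n|N HN] := dcc (fun n => sat P2 (iext (S n) x)).
- by move=> n; apply: sat_ideal => //; apply: iext_ideal.
- by move=> n s y; apply: sat_sat.
- move=> n _ [a [y [P0y ->]]]; apply: sub_sat => //; exists a, y; split=> //.
  apply: sub_sat => //; exists 0, y; rewrite add0r; split=> //.
  exact: (ideal0 (ideal_pow_ideal _ _)).
- apply: sat_mono => _ [a [i [Si ->]]]; exists a, i; split=> //; exact: SS.
have SN : S N `<=` S N.+1.
  have : leQ P2 (S N) (S N.+1).
    apply: (nakayama noeR) => // r Sr.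
    have : sat P2 (iext (S N) x) r by apply: sub_sat => //; apply: sub_iext.
    rewrite -(HN N.+1) // => -[s [ns [a [i [Si E]]]]]; exists s; split=> //.
    move=> K HK SK K2; rewrite E; apply: (idealD HK); last exact: SK.
    rewrite mulrC; apply: K2 => //; apply: (sat_sat (s := x)) => //.
    rewrite mulrC; apply: (idealBr (HS N)) (idealN (HS N) (SS _ _ Si)).
    by rewrite opprK -E; apply: (idealMl _ (HS N)).
  move=> H y /H[s [ns Ss]]; apply: (sat_sat (s := s)) => //.
  by move=> /P12.
have : leQ P1 (ideal_pow P1 N) P0.
  apply: (nakayama noeR) => //; first exact: ideal_pow_ideal.
  move=> r Pr; have : S N r.
    apply: sub_sat => //; exists r, 0; rewrite addr0; split=> //; exact: ideal0.
  move=> /SN[s [ns [a [b [Pa P0b E]]]]]; exists s; split=> // K HK PK KP.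
  rewrite E; apply: (idealD HK); last exact: PK.
  move: a Pa {E}; apply: ideal_gen_min => // _ [u [v [Pu Pv ->]]].
  exact: KP.
move=> H; apply: N01; apply/seteqP; split=> // y P1y.
have [s [ns]] := H _ (ideal_powX N I1 P1y).
have [_ _ HP] := H0; move=> /HP[/P01 //|]; exact: (prime_expr H0).
Qed.

Lemma prime_chain_sub r (P : nat -> set R) i j : prime_chain r P ->
  (i <= j <= r)%N -> P i `<=` P j.
Proof.
move=> [_ HP] /andP[]; elim: j => [|j IH]; first by rewrite leqn0 => /eqP -> _.
rewrite leq_eqVlt => /orP[/eqP -> _ //|ij jr].
by apply: (subset_trans (IH ij (ltnW jr))); case: (HP j jr).
Qed.

(** The top prime contains [t]; repeated use of [prime_between] moves [t] down to the first prime
    above the bottom one, while both ends stay fixed. *)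
Lemma prime_chain_move r (P : nat -> set R) t :
  prime_chain r.+1 P -> P r.+1 t ->
  exists P' : nat -> set R, [/\ prime_chain r.+1 P', P' 0 = P 0, P' r.+1 = P r.+1 & P' 1 t].
Proof.
elim: r P => [|r IH] P HP Pt; first by exists P.
have [Hp Hs] := HP.
have [P' [HP' P0' N0' P2' [N2' P't]]] : exists P' : set R, [/\ prime_ideal P',
    P r `<=` P', P r <> P', P' `<=` P r.+2 & P' <> P r.+2 /\ P' t].
  have [s1 n1] := Hs r (ltnW (ltnSn _)); have [s2 n2] := Hs r.+1 (ltnSn _).
  have [Prt|nPrt] := pselect (P r t).
    exists (P r.+1); split=> //; [exact: Hp|split=> //; exact: s1].
  by apply: (@prime_between _ (P r.+1)) => //; apply: Hp; lia.
pose P1 i := if (i <= r)%N then P i else P'.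
have [||P2 [[HP2 Hs2] P20 P2r P2t]] := IH P1.
- split=> [i|i] ir; rewrite /P1; first by case: ifP => // ir'; apply: Hp; lia.
  have /orP[/eqP->|ir'] : (i == r) || (i < r)%N by rewrite -leq_eqVlt -ltnS.
    by rewrite leqnn ltnn.
  by rewrite (ltnW ir') ir'; apply: Hs; lia.
- by rewrite /P1 ltnn.
exists (fun i => if (i <= r.+1)%N then P2 i else P r.+2); split=> //.
- split=> [i|i] ir.
    by case: ifP => // ir'; [apply: HP2 | apply: Hp].
  have /orP[/eqP->|ir'] : (i == r.+1) || (i < r.+1)%N by rewrite -leq_eqVlt -ltnS.
    by rewrite leqnn ltnn P2r /P1 ltnn.
  by rewrite (ltnW ir') ir'; apply: Hs2.
- by rewrite ltnn.
Qed.

(* The equality case contains the fact that a regular local ring is a domain. *)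
Lemma chain_length_le_generators Q (ts : seq R) I0 r (P : nat -> set R) :
  prime_ideal Q -> ideal I0 -> (forall t, t \in ts -> Q t) ->
  leQ Q Q (iexts I0 ts) -> prime_chain r P -> I0 `<=` P 0 -> P r `<=` Q ->
  (size ts <= r)%N -> r = size ts /\ leQ Q (P 0) I0.
Proof.
move=> HQ; elim: ts I0 r P => [|t ts IH] I0 r P HI0 tsQ HQt HP IP PQ.
  move=> _; have P0Q : P 0 `<=` Q.
    by move=> x P0x; apply: PQ; apply: (prime_chain_sub HP _ P0x); rewrite leqnn.
  case: r HP PQ => [|r] HP PQ; last first.
    case: (HP) => Hp Hs; have [s1] := Hs 0%N isT; case; apply/seteqP; split=> //.
    move=> x P1x; have [|s [ns]] := HQt x.
      by apply: PQ; apply: (prime_chain_sub HP _ P1x); rewrite /= leqnn.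
    by move=> /= I0s; have [_ _ /(_ _ _ (IP _ I0s))[/P0Q//|]] := Hp 0%N isT.
  by split=> // x /P0Q /HQt.
case: r HP PQ => // r HP PQ; rewrite ltnS -/(size ts) => tsr.
have [Hp Hs] := HP.
(* The top of the chain is replaced by [Q], which contains [t], before [t] is moved down. *)
pose P1 i := if (i <= r)%N then P i else Q.
have HP1 : prime_chain r.+1 P1.
  split=> [i|i] ir; rewrite /P1; first by case: ifP => // ir'; apply: Hp; lia.
  have /orP[/eqP->|ir'] : (i == r) || (i < r)%N by rewrite -leq_eqVlt -ltnS.
    2: by rewrite (ltnW ir') ir'; apply: Hs; lia.
  rewrite leqnn ltnn; have [s1 n1] := Hs r (ltnSn _).
  split; first exact: subset_trans PQ.
  by move=> E; apply: n1; apply/seteqP; split=> //; rewrite E.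
have Qt : Q t by apply: tsQ; rewrite mem_head.
have tsQ' t' : t' \in ts -> Q t' by move=> t's; apply: tsQ; rewrite inE t's orbT.
have [|P' [HP' P'0 P'r P't]] := prime_chain_move HP1 (t := t).
  by rewrite /P1 ltnn.
have HI1 : ideal (iext I0 t) by apply: iext_ideal.
have P'Q : P' r.+1 `<=` Q by rewrite P'r /P1 ltnn.
have P'0E : P' 0%N = P 0%N by rewrite P'0.
(* If [t] were in [P 0], the whole chain would lie over [I0 + (t)] and be too long for the remaining
   generators. Otherwise the induction hypothesis above [P 0] gives [P 0] inside [I0 + (t)], hence
   inside [I0 + t P 0] as [P 0] is prime, and Nakayama's lemma applies. *)
have [P0t|nP0t] := pselect (P 0%N t).
  have [|||E _] := IH (iext I0 t) r.+1 P' HI1 tsQ' HQt HP'.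
  - rewrite P'0E; apply: iext_min => //; exact: (prime_idl (Hp 0%N isT)).
  - exact: P'Q.
  - exact: leqW.
  by move: tsr; rewrite -E ltnn.
have [s01 _] := HP'.2 0%N isT.
have [||||rE H1] := IH (iext I0 t) r (fun i => P' i.+1) HI1 tsQ' HQt.
- split=> i ir; [exact: HP'.1|exact: HP'.2].
- apply: iext_min => //; first exact: (prime_idl (HP'.1 1%N isT)).
  by apply: subset_trans s01; rewrite P'0E.
- exact: P'Q.
- exact: tsr.
split; first by rewrite {1}rE.
apply: (nakayama noeR) => //; first exact: (prime_idl (Hp 0%N isT)).
move=> x P0x; have [|s [ns [a [i [Ii E]]]]] := H1 x.
  by apply: s01; rewrite P'0E.
exists s; split=> // K HK IK KP; rewrite E.
apply: (idealD HK); last exact: IK.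
rewrite mulrC; apply: KP => //.
have Pid := prime_idl (Hp 0%N isT).
have [_ _ HP0] := Hp 0%N isT.
have : P 0%N (a * t).
  apply: (idealBr Pid) (idealN Pid (IP _ Ii)); rewrite opprK -E.
  exact: idealMl.
by move=> /HP0[].
Qed.

End PrimeIdealTheorem.

(** * Hilbert's basis theorem *)

Section Hilbert.

Lemma noetherian_surj (A R : comPzRingType) (phi : {rmorphism A -> R}) :
  (forall r, exists a, phi a = r) -> noetherian A -> noetherian R.
Proof.
move=> phiS noeA I HI; have HJ : ideal (phi @^-1` I).
  apply/idealP; split=> [|x y|r x]; rewrite /preimage /= ?rmorph0 ?rmorphD ?rmorphM.
  - exact: ideal0. - exact: idealD. - exact: idealMl.
have [s Es] := noeA _ HJ; exists (map phi s); apply/seteqP; split.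
  move=> x; have [a <-] := phiS x => Ia.
  have : (phi @^-1` I) a by [].
  rewrite Es => /ideal_gen_seqP[c ->]; rewrite rmorph_sum.
  apply: ideal_sum; first exact: ideal_gen_ideal.
  move=> i _; rewrite rmorphM; apply: (idealMl _ (ideal_gen_ideal _)).
  by apply: sub_ideal_gen; rewrite /= map_f // mem_nth.
apply: ideal_gen_min => // _ /mapP[a sa ->].
by have : (phi @^-1` I) a by rewrite Es; apply: sub_ideal_gen.
Qed.

Lemma nat_min (P : nat -> Prop) : (exists n, P n) ->
  exists n, P n /\ forall m, P m -> (n <= m)%N.
Proof.
move=> [n0 Pn0]; have ex : exists n, `[< P n >] by exists n0; apply/asboolP.
case: (ex_minnP ex) => n /asboolP Pn nmin; exists n; split=> // m Pm.
by apply: nmin; apply/asboolP.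
Qed.

Lemma noetherian_int : noetherian int.
Proof.
move=> I HI; have [H|H] := pselect (exists n : nat, (0 < n)%N /\ I n%:Z).
  have [m [[m0 Im] mmin]] := nat_min H.
  exists [:: m%:Z]; apply/seteqP; split; last first.
    by apply: ideal_gen_min => // x; rewrite /= inE => /eqP ->.
  move=> x Ix; rewrite (divz_eq x m%:Z).
  have Ir : I (x %% m%:Z)%Z.
    have -> : (x %% m%:Z)%Z = x - (x %/ m%:Z)%Z * m%:Z by rewrite {2}(divz_eq x m%:Z); ring.
    by apply: (idealB HI) => //; apply: (idealMl _ HI).
  have -> : (x %% m%:Z)%Z = 0.
    have r0 : (0 <= (x %% m%:Z)%Z)%R by apply: modz_ge0; rewrite eqz_nat -lt0n.
    have rm : ((x %% m%:Z)%Z < m%:Z)%R by apply: ltz_pmod; rewrite ltz_nat.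
    case: (x %% m%:Z)%Z r0 rm Ir => // k _; rewrite ltz_nat => km Ik.
    case: k km Ik => // k km Ik; have := mmin k.+1 (conj isT Ik).
    by rewrite leqNgt km.
  rewrite addr0; apply: (idealMl _ (ideal_gen_ideal _)).
  by apply: sub_ideal_gen; rewrite /= mem_head.
exists [::]; apply/seteqP; split=> [x Ix|]; last by apply: ideal_gen_min.
suff -> : x = 0 by apply: (ideal0 (ideal_gen_ideal _)).
case: x Ix => [[//|n]|n] In; exfalso; apply: H; exists n.+1; split=> //.
by rewrite -[n.+1%:Z]opprK -NegzE; apply: (idealN HI).
Qed.

(** Hilbert's argument: were [I] not finitely generated, one could forever add an element of least
    degree outside the ideal generated so far. The ideals of leading coefficients stabilize, and
    then the leading term of the next element can be cancelled by the previous ones, against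
    minimality. *)
Lemma noetherian_poly (A : comNzRingType) : noetherian A -> noetherian {poly A}.
Proof.
move=> noeA I HI; apply: contrapT => nfg.
have next (s : seq {poly A}) : exists p, I p /\ ((forall x, x \in s -> I x) ->
    ~ ideal_gen [set` s] p /\
    forall q, I q -> ~ ideal_gen [set` s] q -> (size p <= size q)%N).
  have [sI|nsI] := pselect (forall x, x \in s -> I x); last first.
    by exists 0; split=> //; apply: ideal0.
  have ex : exists n p, [/\ I p, ~ ideal_gen [set` s] p & size p = n].
    apply: contrapT => H; apply: nfg; exists s; apply/seteqP; split.
      by move=> p Ip; apply: contrapT => np; apply: H; exists (size p), p.
    exact: ideal_gen_min.
  have [n [[p [Ip np pn]] nmin]] := nat_min ex.
  exists p; split=> // _; split=> // q Iq nq; rewrite pn; apply: nmin.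
  by exists q.
have [f Hf] := choice next.
pose S := fix S n := if n is n'.+1 then rcons (S n') (f (S n')) else [::].
have SI n x : x \in S n -> I x.
  elim: n => //= n IH; rewrite mem_rcons inE => /orP[/eqP ->|//].
  by case: (Hf (S n)).
have Smono m n x : (m <= n)%N -> x \in S m -> x \in S n.
  move=> /subnK <-; elim: (n - m)%N => //= k IH /IH.
  by rewrite mem_rcons inE orbC => ->.
have [||N HN] := noeth_acc noeA (C := fun n => ideal_gen [set` map lead_coef (S n)]).
- by move=> n; apply: ideal_gen_ideal.
- move=> n; apply: ideal_gen_min; first exact: ideal_gen_ideal.
  move=> _ /mapP[p ps ->]; apply: sub_ideal_gen; apply: map_f.
  exact: (Smono n).
set p := f (S N).
have [Ip /(_ (SI N))[np pmin]] := Hf (S N).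
have : ideal_gen [set` map lead_coef (S N)] (lead_coef p).
  rewrite -(HN N.+1) //; apply: sub_ideal_gen; apply: map_f => /=.
  by rewrite mem_rcons mem_head.
move=> /ideal_gen_seqP[c]; rewrite size_map => Ec.
pose G i : {poly A} := (S N)`_i.
have sz (i : 'I_(size (S N))) : (size (G i) <= size p)%N.
  have [k kN Ek] : exists2 k, (k <= N)%N & G i = f (S k).
    have : G i \in S N by apply: mem_nth.
    elim: (N) (G i) => //= n IH y; rewrite mem_rcons inE => /orP[/eqP->|].
      by exists n.
    by move=> /IH[k kn ->]; exists k => //; apply: leqW.
  have [_ /(_ (SI k))[_ kmin]] := Hf (S k).
  rewrite Ek; apply: kmin => // pk; apply: np.
  apply: ideal_gen_min pk; first exact: ideal_gen_ideal.
  by move=> y /= ys; apply: sub_ideal_gen; apply: (Smono k).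
pose q := p - \sum_(i < size (S N)) (c i)%:P * 'X^(size p - size (G i)) * G i.
have gS : ideal_gen [set` S N] (p - q).
  rewrite opprB addrCA subrr addr0; apply: ideal_sum; first exact: ideal_gen_ideal.
  move=> i _; apply: (idealMl _ (ideal_gen_ideal _)); apply: sub_ideal_gen.
  exact: mem_nth.
have p0 : p != 0.
  by apply/eqP => p0; apply: np; rewrite -/p p0; apply: (ideal0 (ideal_gen_ideal _)).
have : (size q < size p)%N.
  have sp : (0 < size p)%N by rewrite size_poly_gt0.
  rewrite -(prednK sp) ltnS; apply/leq_sizeP => j.
  rewrite leq_eqVlt => /orP[/eqP <-|].
    rewrite coefB -/(lead_coef p) Ec coef_sum; apply/eqP; rewrite subr_eq0; apply/eqP.
    apply: eq_bigr => i _; rewrite (nth_map 0) // -mulrA coefCM coefXnM.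
    have := sz i; rewrite -/(G i); set g := G i => szg.
    have [g0|g0] := eqVneq g 0; first by rewrite g0 lead_coef0 !coef0 if_same.
    have sg : (0 < size g)%N by rewrite size_poly_gt0.
    case: ltnP => [|_]; first by lia.
    by congr (_ * _); rewrite /lead_coef; congr (_`_ _); lia.
  rewrite prednK // => pj; rewrite coefB coef_sum nth_default // sub0r big1 ?oppr0 //.
  move=> i _; rewrite -mulrA coefCM coefXnM; case: ltnP => // _; first by rewrite mulr0.
  rewrite nth_default ?mulr0 //; apply: leq_trans (leq_sub2r _ pj).
  by rewrite subKn // sz.
rewrite ltnNge => /negP; apply; apply: pmin.
  rewrite -[q](subKr p); apply: (idealB HI) => //; rewrite /=.
  by apply: ideal_gen_min gS => // x; apply: SI.
move=> gq; apply: np; rewrite -/p -[p](subrK q).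
by apply: (idealD (ideal_gen_ideal _)).
Qed.

Fixpoint iter_poly (k : idomainType) (r : nat) : idomainType :=
  if r is r'.+1 then ({poly (iter_poly k r')} : idomainType) else k.

Lemma noetherian_iter_poly (k : idomainType) r : noetherian k -> noetherian (iter_poly k r).
Proof. by move=> nk; elim: r => //= r IH; apply: noetherian_poly. Qed.

Definition subring_set (R : comPzRingType) (D : set R) :=
  [/\ D 1, forall x y, D x -> D y -> D (x - y) & forall x y, D x -> D y -> D (x * y)].

Definition generates (R : comPzRingType) (ys : seq R) :=
  forall D : set R, subring_set D -> (forall y, y \in ys -> D y) -> forall x, D x.

Lemma generates_surj (B : comNzRingType) (ys : seq B) : generates ys ->
  exists r (phi : {rmorphism iter_poly int r -> B}), forall b, exists a, phi a = b.
Proof.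
move=> gen; suff [r [phi Hphi]] : exists r (phi : {rmorphism iter_poly int r -> B}),
    forall y, y \in ys -> exists a, phi a = y.
  exists r, phi; apply: gen => //; split.
  - by exists 1; rewrite rmorph1.
  - by move=> _ _ [a <-] [b <-]; exists (a - b); rewrite rmorphB.
  - by move=> _ _ [a <-] [b <-]; exists (a * b); rewrite rmorphM.
elim: ys {gen} => [|y ys [r [phi IH]]].
  by exists 0%N, (@intmul B 1 : {rmorphism int -> B}).
have cy : commr_rmorph phi y by move=> a; apply: mulrC.
exists r.+1, (horner_morph cy : {rmorphism {poly (iter_poly int r)} -> B}) => z.
rewrite inE => /orP[/eqP ->|/IH[a <-]].
  by exists 'X; rewrite /= horner_morphX.
by exists a%:P; rewrite /= horner_morphC.
Qed.

Lemma generates_noetherian (B : comNzRingType) (ys : seq B) :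
  generates ys -> noetherian B.
Proof.
move=> /generates_surj[r [phi Hphi]]; apply: noetherian_surj Hphi _.
exact/noetherian_iter_poly/noetherian_int.
Qed.

End Hilbert.

(** * Fields and finitely generated rings *)

Section Frobenius.
Variables (A : comPzRingType) (p : nat) (pp : prime p) (p0 : p%:R = 0 :> A).

Lemma frobenius_add (x y : A) : (x + y) ^+ p = x ^+ p + y ^+ p.
Proof.
have p_gt0 := prime_gt0 pp; rewrite exprDn -(prednK p_gt0).
rewrite big_ord_recl big_ord_recr /= subn0 bin0 mulr1n expr0 mulr1.
rewrite subnn binn mulr1n expr0 mul1r big1 ?add0r // => i _.
have /dvdnP[q ->] : (p %| 'C(p.-1.+1, bump 0 i))%N.
  by rewrite (prednK p_gt0) prime_dvd_bin //= /bump /=; have := ltn_ord i; lia.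
by rewrite -mulr_natr natrM p0 !mulr0.
Qed.

Lemma frobeniusX_add n (x y : A) :
  (x + y) ^+ (p ^ n) = x ^+ (p ^ n) + y ^+ (p ^ n).
Proof. by elim: n => [|n IH]; rewrite ?expr1 // expnS mulnC !exprM IH frobenius_add. Qed.

Lemma frobeniusX_opp n (x : A) : (- x) ^+ (p ^ n) = - x ^+ (p ^ n).
Proof.
apply/eqP; rewrite -addr_eq0 -frobeniusX_add addNr expr0n.
by rewrite expn_eq0 eqn0Ngt prime_gt0.
Qed.

End Frobenius.

Section Fields.

(** A bridge between the rings of the statement, where [1 = 0] is allowed, and the nonzero rings
    over which polynomials and matrices are taken. *)
Lemma comNzRing_of (A : comPzRingType) : (1 : A) <> 0 ->
  exists (B : comNzRingType) (f : {rmorphism A -> B}) (g : {rmorphism B -> A}),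
    cancel f g /\ cancel g f.
Proof.
move=> /eqP h; pose B : comNzRingType :=
  HB.pack (GRing.ComPzRing.sort A) (GRing.PzSemiRing_isNonZero.Build A h).
pose fAB (x : A) : B := x; pose fBA (x : B) : A := x.
have zAB : zmod_morphism fAB by []. have mAB : monoid_morphism fAB by [].
have zBA : zmod_morphism fBA by []. have mBA : monoid_morphism fBA by [].
pose f : {rmorphism A -> B} := HB.pack fAB
  (GRing.isZmodMorphism.Build A B fAB zAB) (GRing.isMonoidMorphism.Build A B fAB mAB).
pose g : {rmorphism B -> A} := HB.pack fBA
  (GRing.isZmodMorphism.Build B A fBA zBA) (GRing.isMonoidMorphism.Build B A fBA mBA).
by exists B, f, g.
Qed.

Lemma field_of (A : comPzRingType) : (1 : A) <> 0 ->
  (forall x : A, x <> 0 -> exists y, y * x = 1) ->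
  exists (L : fieldType) (f : {rmorphism A -> L}), bijective f.
Proof.
move=> h1 hinv; have [B [f [g [fg gf]]]] := comNzRing_of h1.
have ex (x : B) : exists y, (x != 0 -> y * x = 1) /\ (x == 0 -> y = 0).
  have [->|x0] := eqVneq x 0; first by exists 0; split=> // /eqP[].
  have [|y Hy] := hinv (g x).
    by move=> gx0; move/eqP: x0; apply; rewrite -[x]gf gx0 rmorph0.
  by exists (f y); split=> // _; rewrite -[x]gf -rmorphM Hy rmorph1.
have [inv Hinv] := choice ex.
have invP (x : B) : x != 0 -> inv x * x = 1 by case: (Hinv x).
have inv0 : inv 0 = 0 by case: (Hinv 0) => _; apply.
pose L : fieldType := HB.pack (GRing.ComNzRing.sort B)
  (GRing.ComNzRing_isField.Build B invP inv0).
pose fL (x : A) : L := f x.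
have zL : zmod_morphism fL by move=> x y; apply: (rmorphB f).
have mL : monoid_morphism fL.
  by split=> [|x y]; [apply: (rmorph1 f)|apply: (rmorphM f)].
pose h : {rmorphism A -> L} := HB.pack fL
  (GRing.isZmodMorphism.Build A L fL zL) (GRing.isMonoidMorphism.Build A L fL mL).
by exists L, h; exists (fun x : L => g (x : B)).
Qed.

Lemma qring_eq0 (A : comPzRingType) (I : set A) x : ideal I -> qring I x = 0 <-> I x.
Proof.
move=> HI; have -> : 0 = qring I 0 by rewrite rmorph0.
split=> [/(@qmodP A A^o)|Ix].
  by rewrite subr0 => H; apply: H.
by apply/(@qmodP A A^o); rewrite subr0; apply: sub_ideal_gen.
Qed.

(** The fraction field of [B / P], presented by the kernel [P] and by the existence of
    denominators. *)
Lemma residue_field_of (B : comPzRingType) (P : set B) : prime_ideal P ->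
  exists (L : fieldType) (k : {rmorphism B -> L}),
    (forall x, k x = 0 <-> P x) /\
    (forall l, exists a b, k b != 0 /\ l * k b = k a).
Proof.
move=> HP; have PI := prime_idl HP.
pose A := quotring P; pose W : set A := [set x | x <> 0].
have Wn0 (s : denom W) : val s <> 0.
  have : submonoid W.
    split; first by move/(qring_eq0 _ PI); apply: prime_n1 HP.
    move=> x y; rewrite -[x]qringK -[y]qringK => nx ny.
    rewrite /W /= -rmorphM => /(qring_eq0 _ PI).
    by case: HP => _ _ H /H[] /(qring_eq0 _ PI).
  move: (asboolW (valP s)) => /(_ W) H /H; apply.
  by [].
have mem a : a <> 0 -> submonoid_gen W a by move=> na V _ WV; apply: WV.
have mulA0 (x y : A) : x * y = 0 -> x = 0 \/ y = 0.
  rewrite -[x]qringK -[y]qringK -rmorphM => /(qring_eq0 _ PI).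
  by case: HP => _ _ H /H[] Pr; [left|right]; apply/(qring_eq0 _ PI).
have [||L [f [g fg gf]]] := @field_of (localization W).
- move=> /fracP[u] /=; rewrite !mul1r mul0r subr0 !mulr1 => u0.
  exact: (Wn0 u u0).
- elim/frac_ind=> a s as0.
  have na : a <> 0.
    move=> a0; apply: as0; rewrite a0; apply: frac_eq => /=.
    by rewrite !mul0r.
  exists (Defs.frac (val s) (exist _ a (asboolT (mem a na)) : denom W)).
  rewrite -[LHS]/(loc_mul _ _) loc_mulE; apply: frac_eq => /=.
  by rewrite mul1r mulr1 mulrC.
exists L, (f \o @to_loc A W \o qring P : {rmorphism B -> L}).
have k0 x : f (to_loc W (qring P x)) = 0 <-> P x.
  rewrite -(qring_eq0 x PI); split=> [|->]; last by rewrite !rmorph0.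
  rewrite -(rmorph0 f) => /(can_inj fg)/fracP[u] /=.
  rewrite mul0r subr0 mulr1 => /mulA0[] // /(Wn0 u) //.
split=> [x|l]; first exact: k0.
rewrite -[l]gf; move: (g l) => {l}; elim/frac_ind=> a s.
exists (repr a), (repr (val s)); rewrite /= !qringK; split.
  apply/eqP => fs0; apply: (Wn0 s); rewrite -[val s]qringK.
  by apply/(qring_eq0 _ PI)/k0; rewrite qringK.
rewrite -rmorphM; congr (f _); rewrite -[LHS]/(loc_mul _ _) loc_mulE.
by apply: frac_eq => /=; rewrite !mulr1.
Qed.

End Fields.

(** * Integral and transcendental elements: Zariski's lemma *)

Section Algebraic.
Implicit Types (L : fieldType) (k : idomainType).

(** Multiply the integral equation of [b = c / w] by [w] to its degree: [w] then divides a power of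
    [c]. This is what prevents a suitable [w] from being invertible. *)
Lemma integral_dvd L k (phi : {rmorphism k -> L}) (w c : k) (b : L) :
  injective phi -> integralOver phi b -> phi w * b = phi c ->
  exists d g, c ^+ d = w * g.
Proof.
move=> inj [q qm qb] E; have q0 : (0 < size q)%N by rewrite size_poly_gt0 monic_neq0.
pose d := (size q).-1; have sq : size q = d.+1 by rewrite prednK.
exists d, (- \sum_(i < d) q`_i * w ^+ (d.-1 - i) * c ^+ i).
apply: (inj _ _); rewrite rmorphM rmorphN rmorph_sum mulrN mulr_sumr.
apply/eqP; rewrite -addr_eq0; apply/eqP.
move: qb; rewrite /root horner_coef size_map_inj_poly ?rmorph0 //.
rewrite sq big_ord_recr /= => /eqP/(congr1 ( *%R (phi w ^+ d))).
rewrite mulr0 mulrDr mulr_sumr !coef_map /= => H; apply: etrans H.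
rewrite addrC; congr (_ + _).
  apply: eq_bigr => i _; rewrite coef_map /= !rmorphM !rmorphXn /= -E exprMn.
  have -> : phi w ^+ d = phi w * phi w ^+ (d.-1 - i) * phi w ^+ i.
    by rewrite -exprS -exprD; congr (_ ^+ _); have := ltn_ord i; lia.
  ring.
have -> : q`_d = 1 by move/monicP: qm; rewrite lead_coefE sq.
  by rewrite rmorph1 mul1r -exprMn E rmorphXn.
Qed.

Definition gen_over L (k : nzRingType) (phi : {rmorphism k -> L}) (ys : seq L) (b : L) :=
  forall D : set L, subring_set D -> (forall c, D (phi c)) ->
    (forall y, y \in ys -> D y) -> D b.

Definition algebraic_elt L (k : nzRingType) (phi : {rmorphism k -> L}) (y : L) :=
  exists p : {poly k}, p != 0 /\ (map_poly phi p).[y] = 0.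

Lemma algebraic_integral L k (phi : {rmorphism k -> L}) y : injective phi ->
  algebraic_elt phi y -> exists a, a != 0 /\ integralOver phi (phi a * y).
Proof.
move=> inj [p [p0 py]]; have sp : (0 < size p)%N by rewrite size_poly_gt0.
pose d := (size p).-1; have Esp : size p = d.+1 by rewrite prednK.
pose a := lead_coef p; have a0 : a != 0 by rewrite lead_coef_eq0.
exists a; split=> //; have [d0|d_gt0] := posnP d.
  move: py; rewrite horner_coef size_map_inj_poly ?rmorph0 // Esp d0 big_ord1.
  rewrite coef_map expr0 mulr1 /= => p00; exfalso; move/eqP: a0; apply.
  by rewrite /a lead_coefE -/d d0; apply: inj; rewrite p00 rmorph0.
pose q := 'X^d + \poly_(i < d) (p`_i * a ^+ (d.-1 - i)).
exists q.
  rewrite monicE lead_coefDl ?lead_coefXn // size_polyXn ltnS.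
  exact: size_poly.
rewrite /root rmorphD /= map_polyXn hornerD hornerXn.
have -> : map_poly phi (\poly_(i < d) (p`_i * a ^+ (d.-1 - i))) =
   \poly_(i < d) (phi (p`_i * a ^+ (d.-1 - i))).
  by apply/polyP => i; rewrite coef_map !coef_poly; case: ifP => // _; apply: rmorph0.
rewrite horner_poly; move: py.
rewrite horner_coef size_map_inj_poly ?rmorph0 // Esp big_ord_recr /=.
move=> /(congr1 ( *%R (phi a ^+ d.-1))); rewrite mulr0 mulrDr mulr_sumr addrC => H.
apply/eqP; apply: etrans H; congr (_ + _).
  rewrite coef_map /=; have -> : p`_d = a by rewrite /a lead_coefE.
  by rewrite exprMn -{1}(prednK d_gt0) exprSr mulrA.
apply: eq_bigr => i _; rewrite coef_map rmorphM rmorphXn exprMn /=.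
have -> : phi a ^+ d.-1 = phi a ^+ (d.-1 - i) * phi a ^+ i.
  by rewrite -exprD; congr (_ ^+ _); have := ltn_ord i; lia.
ring.
Qed.

Lemma algebraic_integral_seq L k (phi : {rmorphism k -> L}) (ys : seq L) : injective phi ->
  (forall y, y \in ys -> algebraic_elt phi y) ->
  exists a, a != 0 /\ forall y, y \in ys -> integralOver phi (phi a * y).
Proof.
move=> inj; elim: ys => [|y ys IH] H; first by exists 1; rewrite oner_neq0.
have [|a [a0 Ha]] := IH; first by move=> z zs; apply: H; rewrite inE zs orbT.
have [b [b0 Hb]] := algebraic_integral inj (H y (mem_head _ _)).
exists (a * b); split=> [|z]; first by rewrite mulf_neq0.
rewrite inE rmorphM => /orP[/eqP ->|/Ha Hz].
  by rewrite -mulrA; apply: integral_mul => //; apply: integral_id.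
by rewrite (mulrC (phi a)) -mulrA; apply: integral_mul => //; apply: integral_id.
Qed.

Lemma gen_over_integral L k (phi : {rmorphism k -> L}) (ys : seq L) a :
  (forall y, y \in ys -> integralOver phi (phi a * y)) ->
  forall b, gen_over phi ys b -> exists N, integralOver phi (phi a ^+ N * b).
Proof.
move=> H b /(_ [set b | exists N, integralOver phi (phi a ^+ N * b)]); apply.
- have up N M c : integralOver phi (phi a ^+ N * c) ->
      integralOver phi (phi a ^+ (M + N) * c).
    move=> Hc; rewrite exprD -mulrA -rmorphXn; apply: integral_mul => //.
    exact: integral_id.
  split; first by exists 0%N; rewrite mulr1 expr0; apply: integral1.
  + move=> x y [N HN] [M HM]; exists (M + N)%N; rewrite mulrBr.
    by apply: integral_sub; [apply: up|rewrite addnC; apply: up].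
  + move=> x y [N HN] [M HM]; exists (N + M)%N; rewrite exprD mulrACA.
    exact: integral_mul.
- by move=> c; exists 0%N; rewrite expr0 mul1r; apply: integral_id.
- by move=> y /H Hy; exists 1%N; rewrite expr1.
Qed.

End Algebraic.

Section Transcendental.
Implicit Types (L : fieldType) (k : idomainType).

Definition hom_ext (k B : comNzRingType) (phi : {rmorphism k -> B}) (u : B) :
    {rmorphism {poly k} -> B} :=
  horner_morph ((fun a => mulrC _ _) : commr_rmorph phi u).

Lemma hom_extE (k B : comNzRingType) (phi : {rmorphism k -> B}) u p :
  hom_ext phi u p = (map_poly phi p).[u].
Proof. by []. Qed.

Lemma hom_extC (k B : comNzRingType) (phi : {rmorphism k -> B}) u c :
  hom_ext phi u c%:P = phi c.
Proof. exact: horner_morphC. Qed.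

Lemma hom_extX (k B : comNzRingType) (phi : {rmorphism k -> B}) u :
  hom_ext phi u 'X = u.
Proof. exact: horner_morphX. Qed.

Lemma rmorph_inj0 (A B : pzRingType) (phi : {rmorphism A -> B}) :
  (forall a, phi a = 0 -> a = 0) -> injective phi.
Proof.
move=> H x y E; apply/eqP; rewrite -subr_eq0; apply/eqP/H.
by rewrite rmorphB E subrr.
Qed.

Lemma gen_over_sub L (k k' : nzRingType) (phi : {rmorphism k -> L})
    (phi' : {rmorphism k' -> L}) (ys zs : seq L) b :
  (forall c, gen_over phi' zs (phi c)) -> (forall y, y \in ys -> gen_over phi' zs y) ->
  gen_over phi ys b -> gen_over phi' zs b.
Proof.
move=> Hc Hy Hb D HD Dc Dz; apply: Hb => // [c|y ys']; first exact: Hc.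
exact: Hy.
Qed.

Lemma gen_over_subring L (k : nzRingType) (phi : {rmorphism k -> L}) ys :
  subring_set (gen_over phi ys).
Proof.
split.
- by move=> D [D1 _ _] _ _.
- move=> x y Hx Hy D HD Dc Dy; have [_ DB _] := HD.
  by apply: DB; [apply: Hx|apply: Hy].
- move=> x y Hx Hy D HD Dc Dy; have [_ _ DM] := HD.
  by apply: DM; [apply: Hx|apply: Hy].
Qed.

Lemma subring_setD (R : comPzRingType) (D : set R) x y :
  subring_set D -> D x -> D y -> D (x + y).
Proof.
move=> [D1 DB _] Dx Dy; have D0 : D 0 by rewrite -(subrr 1); apply: (DB _ _ D1 D1).
by rewrite -[y]opprK -[- y]sub0r; apply: (DB _ _ Dx (DB _ _ D0 Dy)).
Qed.

Lemma subring_set_hom_ext (k B : comNzRingType) (phi : {rmorphism k -> B}) u (D : set B) p :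
  subring_set D -> (forall c, D (phi c)) -> D u -> D (hom_ext phi u p).
Proof.
move=> HD Dc Du; elim/poly_ind: p => [|p c IH].
  by rewrite rmorph0 -(rmorph0 phi); apply: Dc.
rewrite rmorphD rmorphM /= hom_extC hom_extX; apply: subring_setD => //.
by case: HD => _ _; apply.
Qed.

(* The witness is [1 + a * u] with [a] a common denominator of the elements *)
(* that are algebraic over [k(u)].                                           *)
Lemma transcendental_nonunit L k (phi : {rmorphism k -> L}) (u : L) (ys zs : seq L) :
  injective phi -> injective (hom_ext phi u) ->
  (forall y, y \in ys -> algebraic_elt (hom_ext phi u) y) ->
  exists w, [/\ w != 0, gen_over phi (u :: ys ++ zs) w &
    forall b s, gen_over phi (u :: ys ++ zs) b -> w * b = phi s -> s = 0].
Proof.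
elim: zs k phi ys => [|z zs IH] k phi ys inj tr Hys; last first.
  have [Hz|nz] := pselect (algebraic_elt (hom_ext phi u) z).
    have E : u :: ys ++ z :: zs =i u :: (z :: ys) ++ zs.
      by move=> y; rewrite !(inE, mem_cat); do !case: (_ == _) => //=; case: (_ \in _).
    have [|w [w0 gw Hw]] := IH k phi (z :: ys) inj tr.
      by move=> y; rewrite inE => /orP[/eqP ->|/Hys].
    exists w; split=> //.
      by move=> D HD Dc Dy; apply: gw => // y yin; apply: Dy; rewrite E.
    move=> b s Hb; apply: Hw => D HD Dc Dy; apply: Hb => // y.
    by rewrite E; apply: Dy.
  (* A generator [z] that is transcendental over [k[u]] is moved into the base: [k] becomes [k[z]],
     and [u] stays transcendental over it by exchanging the two variables. *)
  have injz : injective (hom_ext phi z).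
    apply: rmorph_inj0 => p pz; apply/eqP/negP => /negP p0; apply: nz.
    exists (map_poly polyC p); split.
      by rewrite map_poly_eq0_id0 // polyC_eq0 lead_coef_eq0.
    rewrite -map_poly_comp /=; apply: etrans pz; rewrite hom_extE.
    congr (_.[_]); apply: eq_map_poly => c /=; exact: hom_extC.
  pose phi' := hom_ext phi z.
  have injuz : injective (hom_ext phi' u).
    apply: rmorph_inj0 => p pu; apply/eqP/negP => /negP p0; apply: nz.
    exists (swapXY p); split; first by rewrite swapXY_eq0.
    have E (x y : L) (q : {poly {poly k}}) : (map_poly (hom_ext phi x) q).[y] =
        (map_poly (map_poly phi) q).[y, x].
      rewrite -horner2_swapXY horner_swapXY -map_poly_comp.
      by congr (_.[_]); apply: eq_map_poly.
    by rewrite E -swapXY_map horner2_swapXY -E; apply: pu.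
  have [|w [w0 gw Hw]] := IH _ phi' ys injz injuz.
    move=> y /Hys[p [p0 py]]; exists (map_poly (map_poly polyC) p); split.
      by rewrite map_poly_eq0_id0 // map_poly_eq0_id0 ?polyC_eq0 ?lead_coef_eq0 ?lead_coef_eq0.
    rewrite -map_poly_comp /=; apply: etrans py.
    congr (_.[_]); apply: eq_map_poly => c /=.
    rewrite !hom_extE -map_poly_comp; congr (_.[_]); apply: eq_map_poly => d /=.
    exact: hom_extC.
  have zin : z \in u :: ys ++ z :: zs by rewrite !(inE, mem_cat) eqxx !orbT.
  have sub y : y \in u :: ys ++ zs -> y \in u :: ys ++ z :: zs.
    by rewrite !(inE, mem_cat) => /orP[->//|/orP[]->]; rewrite ?orbT.
  exists w; split=> //.
    apply: gen_over_sub gw => [c|y yin]; last by move=> D _ _; apply; apply: sub.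
    by move=> D HD Dc Dy; apply: subring_set_hom_ext => //; apply: Dy.
  move=> b s Hb E; apply/eqP; rewrite -polyC_eq0; apply/eqP.
  apply: (Hw b); last by rewrite /phi' hom_extC.
  apply: gen_over_sub Hb => [c D _ Dc _|y].
    by rewrite -(hom_extC phi z); apply: Dc.
  rewrite !(inE, mem_cat) => yin D HD Dc Dy.
  have [->|yz] := eqVneq y z; first by rewrite -(hom_extX phi z); apply: Dc.
  apply: Dy; rewrite !(inE, mem_cat).
  by move: yin; rewrite (negPf yz).
have [a [a0 Ha]] := algebraic_integral_seq tr Hys.
(* If [w b = s] with [s] a constant, then [w] divides a power of [a ^ N s]. Modulo [w] the product
   [a 'X] is [-1], so [w] divides a power of [s], and comparing degrees gives [s = 0]. *)
pose w : {poly k} := 1 + a * 'X; pose phi' := hom_ext phi u.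
have sw : (1 < size w)%N.
  have sX : size (a * 'X) = (size a).+1 by rewrite size_mulX.
  rewrite /w addrC size_polyDl; rewrite sX ?size_poly1 ltnS ?size_poly_gt0 //.
have w0 : w != 0 by rewrite -size_poly_gt0 (ltn_trans _ sw).
exists (phi' w); split.
- by rewrite -(rmorph0 phi'); apply: contra_neq w0 => /tr.
- by move=> D HD Dc Dy; apply: subring_set_hom_ext => //; apply: Dy; rewrite mem_head.
move=> b s Hb E; rewrite cats0 in Hb.
have [N HN] : exists N, integralOver phi' (phi' a ^+ N * b).
  apply: (gen_over_integral (ys := ys)) => //.
  apply: gen_over_sub Hb => [c D _ Dc _|y].
    by rewrite -(hom_extC phi u); apply: Dc.
  rewrite inE => /orP[/eqP ->|yin] D _ Dc Dy; last exact: Dy.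
  by rewrite -(hom_extX phi u); apply: Dc.
have [|d [g Eg]] := integral_dvd (c := a ^+ N * s%:P) (w := w) tr HN.
  by rewrite mulrCA E rmorphM rmorphXn /= hom_extC.
pose I : set {poly k} := [set x | exists g, x = w * g].
have HI : ideal I.
  apply/idealP; split; first by exists 0; rewrite mulr0.
  - by move=> _ _ [x ->] [y ->]; exists (x + y); rewrite mulrDr.
  - by move=> r _ [x ->]; exists (r * x); rewrite mulrCA.
have : I ((a * 'X) ^+ (N * d) * s%:P ^+ d).
  have -> : (a * 'X) ^+ (N * d) * s%:P ^+ d = 'X ^+ (N * d) * (a ^+ N * s%:P) ^+ d.
    by rewrite [(a ^+ N * _) ^+ d]exprMn -exprM exprMn; ring.
  by apply: (idealMl _ HI); exists g.
have aXw : a * 'X = w - 1 by rewrite /w addrC addKr.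
rewrite aXw => H.
have : I ((-1) ^+ (N * d) * s%:P ^+ d).
  have -> : (-1) ^+ (N * d) * s%:P ^+ d = (w - 1) ^+ (N * d) * s%:P ^+ d -
     ((w - 1) ^+ (N * d) - (-1) ^+ (N * d)) * s%:P ^+ d by ring.
  apply: (idealB HI) => //; apply: (idealMr _ HI).
  by rewrite subrXX opprK subrK; eexists.
move=> /(idealMl ((-1) ^+ (N * d)) HI); rewrite mulrA -exprMn mulrNN mulr1 expr1n mul1r.
move=> [h Eh]; have [h0|h0] := eqVneq h 0.
  apply/eqP; move: Eh; rewrite h0 mulr0 -rmorphXn /= => /eqP.
  by rewrite polyC_eq0 expf_eq0 => /andP[].
have := congr1 (fun p : {poly k} => size p) Eh.
rewrite size_mul // -rmorphXn /= => E'; exfalso.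
have := size_polyC_leq1 (s ^+ d); rewrite E'.
have : (0 < size h)%N by rewrite size_poly_gt0.
by move: sw; case: (size w) => [//|[//|m]] _; case: (size h) => // n _; rewrite addnS.
Qed.

(** Zariski's lemma: a transcendental element would give, by [transcendental_nonunit], a nonzero [w]
    without inverse in a field. *)
Lemma fg_field_algebraic L k (phi : {rmorphism k -> L}) gs : injective phi ->
  (forall x, gen_over phi gs x) -> forall g : L, algebraic_elt phi g.
Proof.
move=> inj gen g; apply: contrapT => ng.
have tr : injective (hom_ext phi g).
  apply: rmorph_inj0 => p pg; apply/eqP/negP => /negP p0; apply: ng.
  by exists p.
have [//|w [w0 _ Hw]] := @transcendental_nonunit L k phi g [::] gs inj tr.
have H10 : (1 : k) = 0.
  apply: (Hw w^-1); last by rewrite divff // rmorph1.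
  move=> D HD Dc Dy; apply: gen => // y ys; apply: Dy; rewrite inE.
  by rewrite ys orbT.
by move/eqP: H10; rewrite oner_eq0.
Qed.

End Transcendental.

Section ResidueFields.
Variables (B : comNzRingType) (gs : seq B) (gens : generates gs).

Lemma gen_over_rmorph (L : fieldType) (k : nzRingType) (phi : {rmorphism k -> L})
  (h : {rmorphism B -> L}) b : gen_over phi (map h gs) (h b).
Proof.
move: b; apply: gens; last by move=> y ys D _ _ Dy; apply: Dy; apply: map_f.
have [G1 GB GM] := gen_over_subring phi (map h gs).
split=> [|x y|x y]; rewrite ?rmorph1 ?rmorphB ?rmorphM //; [exact: GB|exact: GM].
Qed.

(** Enlarging [P] by the element of [transcendental_nonunit] keeps the nonzero elements of [k]
    outside, so some larger prime avoids them. Each algebraically independent element thus adds a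
    step to a chain of primes. *)
Lemma prime_above (P : set B) (k : idomainType) (phi : {rmorphism k -> B}) u :
  prime_ideal P -> (forall p, P (hom_ext phi u p) -> p = 0) ->
  exists P', [/\ prime_ideal P', P `<=` P', P <> P' & forall c, P' (phi c) -> c = 0].
Proof.
move=> HP tr; have [L [h [h0 hfrac]]] := residue_field_of HP.
pose psi : {rmorphism k -> L} := h \o phi.
have E p : hom_ext psi (h u) p = h (hom_ext phi u p).
  by rewrite !hom_extE -horner_map -map_poly_comp.
have tr' : injective (hom_ext psi (h u)).
  by apply: rmorph_inj0 => p; rewrite E => /h0/tr.
have inj : injective psi.
  apply: rmorph_inj0 => c; rewrite /= => /h0 Pc.
  have /eqP : c%:P = 0 by apply: tr; rewrite hom_extC.
  by rewrite polyC_eq0 => /eqP.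
have [//|w [w0 gw Hw]] := @transcendental_nonunit L k psi (h u) [::] (map h gs) inj tr'.
have [b Eb] : exists b, w = h b.
  apply: (gw [set w | exists b, w = h b]).
  - split; first by exists 1; rewrite rmorph1.
    + by move=> _ _ [x ->] [y ->]; exists (x - y); rewrite rmorphB.
    + by move=> _ _ [x ->] [y ->]; exists (x * y); rewrite rmorphM.
  - by move=> c; exists (phi c).
  - move=> y; rewrite inE => /orP[/eqP ->|/mapP[x _ ->]]; [by exists u|by exists x].
have HI := iext_ideal b (prime_idl HP).
have [|||P' [HP' IP' PW]] := prime_avoiding (generates_noetherian gens) HI
  (W := [set x | exists c, c != 0 /\ x = phi c]).
- by exists 1; rewrite oner_neq0 rmorph1.
- move=> _ _ [c [c0 ->]] [d [d0 ->]]; exists (c * d).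
  by rewrite mulf_neq0 // rmorphM.
- move=> x [a [i [Pi ->]]] [c [c0 E']]; move/eqP: c0; apply.
  apply: (Hw (h a)).
    have Hg := @gen_over_rmorph L k psi h a.
    move=> D HD Dc Dy; apply: Hg => // y ys.
    by apply: Dy; rewrite inE ys orbT.
  rewrite /psi /= -E' rmorphD rmorphM Eb mulrC.
  by have -> : h i = 0 by [apply/h0]; rewrite addr0.
exists P'; split=> //.
- by apply: (subset_trans _ IP'); apply: sub_iext.
- move=> EP; move/eqP: w0; apply; rewrite Eb; apply/h0; rewrite EP.
  by apply: IP'; apply: iext_mem; apply: prime_idl HP.
- move=> c Pc; apply/eqP/negP => /negP c0; apply: (PW _ Pc).
  by exists c.
Qed.

Lemma pigeonhole (T : finType) (f : nat -> T) : exists i j, (i < j)%N /\ f i = f j.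
Proof.
apply: contrapT => H.
have inj : injective (fun i : 'I_(#|T|).+1 => f i).
  move=> i j Eij; apply/val_inj/eqP; rewrite eqn_leq.
  apply/andP; split; rewrite leqNgt; apply/negP => lt; apply: H.
    by exists j, i.
  by exists i, j.
by have := leq_card _ inj; rewrite card_ord ltnn.
Qed.

Lemma Fp_rmorphism (L : comPzRingType) l : prime l -> l%:R = 0 :> L ->
  exists phi : {rmorphism 'F_l -> L}, forall n, phi n%:R = n%:R.
Proof.
move=> pl l0; pose f (x : 'F_l) : L := (x : nat)%:R.
have fn n : f n%:R = n%:R.
  rewrite /f val_Fp_nat // {2}(divn_eq n l) natrD natrM l0 mulr0 add0r //.
have fx (x : 'F_l) : x = (x : nat)%:R by rewrite natr_Zp.
have fD x y : f (x + y) = f x + f y by rewrite (fx x) (fx y) -natrD !fn natrD.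
have fB : zmod_morphism f.
  by move=> x y; apply/eqP; rewrite eq_sym subr_eq -fD subrK.
have fM : monoid_morphism f.
  split; first by rewrite -[1]/(1%:R) fn.
  by move=> x y; rewrite (fx x) (fx y) -natrM !fn natrM.
pose F : {rmorphism 'F_l -> L} := HB.pack f (GRing.isZmodMorphism.Build _ _ f fB)
  (GRing.isMonoidMorphism.Build _ _ f fM).
by exists F.
Qed.

(** Two of the remainders of ['X^(l ^ i)] modulo an equation of [g] coincide, as there are finitely
    many; injectivity of Frobenius on [L] cancels the common power. *)
Lemma algebraic_Fp (L : fieldType) l (phi : {rmorphism 'F_l -> L}) g : prime l ->
  l%:R = 0 :> L -> algebraic_elt phi g -> exists c, (0 < c)%N /\ g ^+ (l ^ c) = g.
Proof.
move=> pl l0 [p [p0 pg]].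
pose f i := [ffun j : 'I_(size p) => ('X^(l ^ i) %% p)`_j].
have [i [j [ij Eij]]] := pigeonhole f.
have Em : 'X^(l ^ i) %% p = 'X^(l ^ j) %% p.
  apply/polyP => n; have [np|np] := ltnP n (size p).
    by have := congr1 (fun F : {ffun _ -> _} => F (Ordinal np)) Eij; rewrite !ffunE.
  by rewrite !nth_default //; apply: leq_trans np; apply/ltnW; rewrite ltn_modp.
have Eg n : g ^+ n = (map_poly phi ('X^n %% p)).[g].
  rewrite -[LHS]/(_) -hornerXn -(map_polyXn phi) [in LHS](divp_eq 'X^n p).
  by rewrite rmorphD rmorphM hornerD hornerM /= pg mulr0 add0r.
have : g ^+ (l ^ i) = g ^+ (l ^ j) by rewrite !Eg Em.
rewrite -(subnK (ltnW ij)) addnC expnD mulnC exprM => E.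
exists (j - i)%N; split; first by rewrite subn_gt0.
apply/eqP; rewrite -subr_eq0; have : (g ^+ (l ^ (j - i)) - g) ^+ (l ^ i) == 0.
  by rewrite frobeniusX_add // frobeniusX_opp // E subrr.
by rewrite expf_eq0 => /andP[].
Qed.

(** The Nullstellensatz over the integers: residue fields at closed points are finite. In
    characteristic zero, Zariski's lemma would make the field integral over some [Z[1/a]], where a
    prime number larger than [|a|] has no integral inverse. *)
Lemma maximal_residue (M : set B) : maximal_ideal M ->
  exists l e, [/\ prime l, (0 < e)%N, M l%:R & forall x, M (x ^+ (l ^ e) - x)].
Proof.
move=> MM; have HM := maximal_prime MM; have MI := prime_idl HM.
have [L [h [h0 hfrac]]] := residue_field_of HM.
have hsurj y : exists x, y = h x.
  have [a [b [b0 E]]] := hfrac y.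
  have [|c Mc] := maximal_inv MM (x := b).
    by move=> /h0 hb; rewrite hb eqxx in b0.
  exists (a * c); apply: (mulIf b0); rewrite E rmorphM -mulrA -rmorphM.
  have /h0/eqP := Mc; rewrite rmorphB rmorph1 subr_eq0 => /eqP ->.
  by rewrite mulr1.
have gen (k : nzRingType) (phi : {rmorphism k -> L}) x : gen_over phi (map h gs) x.
  by have [b ->] := hsurj x; apply: gen_over_rmorph.
have [n [n0 Mn]] : exists n : nat, (0 < n)%N /\ M n%:R.
  apply: contrapT => nM.
  have inj : injective (h \o (@intmul B 1 : {rmorphism int -> B})).
    apply: rmorph_inj0 => z /= /h0 Mz; apply/eqP/negP => /negP z0; apply: nM.
    exists `|z|%N; split; first by rewrite absz_gt0.
    case: z Mz {z0} => n; rewrite ?NegzE ?absz_nat //= => Mz.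
    by rewrite -[_%:R]opprK; apply: (idealN MI); rewrite mulrNz in Mz.
  set phi := (h \o _) in inj.
  have [|a [a0 Ha]] := algebraic_integral_seq (phi := phi) (ys := map h gs) inj.
    by move=> y _; apply: (fg_field_algebraic (gs := map h gs)) => // x; apply: gen.
  have [l la pl] := prime.prime_above `|a|%N.
  have l0 : phi l%:Z != 0.
    rewrite -(rmorph0 phi) (inj_eq inj) eqz_nat -lt0n; exact: prime_gt0.
  have [N HN] := gen_over_integral Ha (gen _ phi (phi l%:Z)^-1).
  have [|d [g Eg]] := integral_dvd (w := l%:Z) (c := a ^+ N) inj HN.
    by rewrite mulrCA divff // mulr1 rmorphXn.
  have : (l %| `|a ^+ N ^+ d|)%N by rewrite Eg abszM dvdn_mulr.
  rewrite -exprM abszX Euclid_dvdX // => /andP[/dvdn_leq]; rewrite absz_gt0 => /(_ a0).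
  by rewrite leqNgt la.
have [l [pl Ml]] : exists l, prime l /\ M l%:R.
  have [m [[m0 Mm] mmin]] := nat_min (ex_intro (fun n => (0 < n)%N /\ M n%:R) n (conj n0 Mn)).
  have m1 : (1 < m)%N.
    case: m m0 Mm {mmin} => [//|[|//]] _ /prime_n1; exact.
  exists (pdiv m); split; first exact: pdiv_prime.
  have [_ _ HP] := HM; move: Mm; rewrite -{1}(divnK (pdiv_dvd m)) natrM.
  case/HP => // Mq; have := mmin (m %/ pdiv m)%N.
  have q0 : (0 < m %/ pdiv m)%N by rewrite divn_gt0 ?pdiv_gt0 // pdiv_leq.
  move=> /(_ (conj q0 Mq)); rewrite leqNgt ltn_Pdiv //.
  by rewrite prime_gt1 ?pdiv_prime.
have l0 : l%:R = 0 :> L by rewrite -(rmorph_nat h); apply/h0.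
have [phi _] := Fp_rmorphism pl l0; have inj := fmorph_inj phi.
have alg g : algebraic_elt phi g.
  by apply: (fg_field_algebraic (gs := map h gs)) => // x; apply: gen.
have pw (g : L) c m : g ^+ (l ^ c) = g -> g ^+ (l ^ (c * m)) = g.
  move=> E; elim: m => [|m IH]; first by rewrite muln0 expr1.
  by rewrite mulnS expnD exprM E.
have [e [e0 He]] : exists e, (0 < e)%N /\ forall g, g \in gs -> h g ^+ (l ^ e) = h g.
  elim: (gs) => [|g s [e [e0 IH]]]; first by exists 1%N.
  have [c [c0 Hc]] := algebraic_Fp pl l0 (alg (h g)).
  exists (c * e)%N; split; first by rewrite muln_gt0 c0.
  move=> x; rewrite inE => /orP[/eqP ->|/IH]; first exact: pw.
  by rewrite mulnC; apply: pw.
exists l, e; split=> // x; apply/h0; rewrite rmorphB rmorphXn.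
apply/eqP; rewrite subr_eq0; apply/eqP; move: x.
apply: gens => //; split.
- by rewrite rmorph1 expr1n.
- by move=> x y Hx Hy; rewrite rmorphB frobeniusX_add // frobeniusX_opp // Hx Hy.
- by move=> x y Hx Hy; rewrite rmorphM exprMn Hx Hy.
Qed.

End ResidueFields.

(** * Local structure of smooth algebras *)

Section UniversalProperties.

Lemma rmorphism_of (A C : comPzRingType) (f : A -> C) :
  zmod_morphism f -> monoid_morphism f -> exists h : {rmorphism A -> C}, h =1 f.
Proof.
move=> fB fM; pose F : {rmorphism A -> C} := HB.pack f
  (GRing.isZmodMorphism.Build _ _ f fB) (GRing.isMonoidMorphism.Build _ _ f fM).
by exists F.
Qed.

Lemma multiples_ideal (A : comPzRingType) (c : A) : ideal [set x | exists y, x = c * y].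
Proof.
apply/idealP; split; first by exists 0; rewrite mulr0.
  by move=> _ _ [u ->] [v ->]; exists (u + v); rewrite mulrDr.
by move=> r _ [u ->]; exists (r * u); rewrite mulrCA.
Qed.

Lemma ideal_gen1 (A : comPzRingType) (c x : A) :
  ideal_gen [set c] x -> exists y, x = c * y.
Proof.
apply: (ideal_gen_min (multiples_ideal c)) => _ ->.
by exists 1; rewrite mulr1.
Qed.

Lemma frac_lift (A : comPzRingType) (W : set A) (a : A) (s : denom W) :
  @Defs.frac A W a s * to_loc W (val s) = to_loc W a.
Proof.
by rewrite -[LHS]/(loc_mul _ _) loc_mulE; apply: frac_eq => /=; rewrite !mulr1.
Qed.

Lemma frac_unit (A : comPzRingType) (W : set A) (s : denom W) :
  @Defs.frac A W 1 s * to_loc W (val s) = 1.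
Proof. exact: frac_lift. Qed.

Lemma denom_ind (A : comPzRingType) (W : set A) (P : A -> Prop) :
  P 1 -> (forall x y, P x -> P y -> P (x * y)) -> (forall x, W x -> P x) ->
  forall s : denom W, P (val s).
Proof. by move=> P1 PM PW s; move: (asboolW (valP s)) => /(_ P); apply. Qed.

Lemma preimage_ideal (A B : comPzRingType) (f : {rmorphism A -> B}) (I : set B) :
  ideal I -> ideal (f @^-1` I).
Proof.
move=> HI; apply/idealP; split=> [|x y|r x]; rewrite /preimage /= ?rmorph0 ?rmorphD ?rmorphM.
- exact: ideal0. - exact: idealD. - exact: idealMl.
Qed.

Lemma kernel_ideal (A B : comPzRingType) (f : {rmorphism A -> B}) :
  ideal [set x | f x = 0].
Proof.
apply/idealP; split=> /= [|x y Ex Ey|r x Ex]; first exact: rmorph0.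
  by rewrite rmorphD Ex Ey addr0.
by rewrite rmorphM Ex mulr0.
Qed.

Lemma loc_univ (A C : comPzRingType) (W : set A) (g : {rmorphism A -> C}) :
  (forall s, W s -> exists u, u * g s = 1) ->
  exists h : {rmorphism localization W -> C}, forall a, h (to_loc W a) = g a.
Proof.
move=> gW; have gu (s : denom W) : exists u, u * g (val s) = 1.
  move: s; apply: (denom_ind (P := fun x => exists u, u * g x = 1)) => [|x y [u ux] [v vy]|x /gW //].
    by exists 1; rewrite rmorph1 mulr1.
  by exists (u * v); rewrite rmorphM mulrACA ux vy mulr1.
have [inv Hinv] := choice gu.
have cancel (s : denom W) x y : x * g (val s) = y * g (val s) -> x = y.
  move=> E; rewrite -[x]mulr1 -[y]mulr1 -(Hinv s) (mulrC (inv s)) !mulrA.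
  by rewrite E.
pose f (x : localization W) : C := g (repr x).1 * inv (repr x).2.
have fE a s : f (Defs.frac a s) * g (val s) = g a.
  rewrite /f; have [b [t [u [-> Hu]]]] := repr_frac a s.
  apply: (cancel u); apply: (cancel t) => /=.
  move: Hu => /(congr1 g); rewrite rmorphM rmorphB !rmorphM rmorph0 mulrBr => /eqP.
  rewrite subr_eq0 => /eqP Hu.
  transitivity (inv t * g (val t) * (g (val u) * (g b * g (val s)))); first by ring.
  by rewrite Hinv Hu; ring.
have fB : zmod_morphism f.
  elim/frac_ind=> a s; elim/frac_ind=> b t.
  rewrite -[- Defs.frac b t]/(loc_opp _) loc_oppE -[X in f X]/(loc_add _ _) loc_addE.
  apply: (cancel (denM s t)); rewrite fE /= !(rmorphD, rmorphM, rmorphN) /=.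
  by rewrite -(fE a s) -(fE b t); ring.
have fM : monoid_morphism f.
  split.
    by apply: (cancel (den1 W)); rewrite -[1]/(Defs.frac 1 _) fE /= rmorph1 mulr1.
  elim/frac_ind=> a s; elim/frac_ind=> b t.
  rewrite -[X in f X]/(loc_mul _ _) loc_mulE.
  apply: (cancel (denM s t)); rewrite fE /= !rmorphM /=.
  by rewrite -(fE a s) -(fE b t); ring.
have [h Hh] := rmorphism_of fB fM; exists h => a; rewrite Hh.
by apply: (cancel (den1 W)); rewrite fE /= rmorph1 mulr1.
Qed.

Lemma loc_map_to_loc (A R : comPzRingType) (phi : {rmorphism A -> R}) (W : set A) a :
  loc_map phi (to_loc W a) = to_loc (phi @` W) (phi a).
Proof. by rewrite /to_loc loc_mapE; apply: frac_eq => /=; rewrite rmorph1. Qed.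

Lemma quot_univ (A C : comPzRingType) (S : set A) (g : {rmorphism A -> C}) :
  (forall s, S s -> g s = 0) ->
  exists h : {rmorphism quotring S -> C}, forall a, h (qring S a) = g a.
Proof.
move=> gS; pose f (x : quotring S) : C := g (repr x).
have fE a : f (qring S a) = g a.
  apply/eqP; rewrite -subr_eq0 /f -rmorphB; apply/eqP.
  have : ideal_gen S ((repr (qring S a) : A) - a).
    by apply/(@qmodP A A^o)/qmodK.
  by apply: (@ideal_gen_min _ _ [set x | g x = 0]) => //; apply: kernel_ideal.
have fB : zmod_morphism f.
  by move=> x y; rewrite -[x]qringK -[y]qringK -rmorphB !fE rmorphB.
have fM : monoid_morphism f.
  split; first by rewrite -(rmorph1 (qring S)) fE rmorph1.
  by move=> x y; rewrite -[x]qringK -[y]qringK -rmorphM !fE rmorphM.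
by have [h Hh] := rmorphism_of fB fM; exists h => a; rewrite Hh fE.
Qed.

Lemma tens_inl (A B C : comPzRingType) (phi : {rmorphism A -> B})
  (psi : {rmorphism A -> C}) :
  exists h : {rmorphism B -> tensor_ring phi psi},
    forall b, h b = tmul (b : restr phi) (1 : restr psi).
Proof.
pose f (b : B) : tensor_ring phi psi := tmul (b : restr phi) ((1 : C) : restr psi).
have fD b b' : f (b + b') = f b + f b'.
  rewrite -[RHS]/(tens_add _ _); apply/tensP => T g Hg.
  rewrite tens_eval_cat !tens_eval_repr // /tens_eval !big_seq1 /=.
  by case: Hg => gD _ _; apply: gD.
have [||h Hh] := @rmorphism_of _ _ f; last by exists h.
- by move=> x y; apply/eqP; rewrite eq_sym subr_eq -fD subrK.
- split=> // x y; rewrite -[RHS]/(tens_mul _ _) /f /tmul tens_mulE.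
  apply/tensP => T g Hg; rewrite /tens_eval !big_seq1 /=.
  by congr (g _ _); rewrite mulr1.
Qed.

End UniversalProperties.

(** * Regular local rings in terms of generators and chains *)

Section RegularLocal.

Lemma preimage_prime (A B : comPzRingType) (f : {rmorphism A -> B}) (P : set B) :
  prime_ideal P -> prime_ideal (f @^-1` P).
Proof.
case=> PI P1 PM; split; first exact: preimage_ideal.
  by rewrite /preimage /= rmorph1.
by move=> x y; rewrite /preimage /= rmorphM => /PM.
Qed.

(** Expresses regularity by data in [T] itself: numerators of a minimal system of generators of the
    maximal ideal, and the contraction of a chain of primes of the same length. *)
Lemma regular_local_generators (T : comPzRingType) (q : set T) : prime_ideal q ->
  regular_local_ring (localization (~` q)) ->
  exists (ts : seq T) (P : nat -> set T), [/\ forall t, t \in ts -> q t,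
    leQ q q (ideal_gen [set` ts]), prime_chain (size ts) P & P (size ts) `<=` q].
Proof.
move=> Hq [noeL [m [Mm [Muniq [d [[[P' [HP' sP']] _] [[s [ss Es]] _]]]]]]].
have qI := prime_idl Hq.
have dn (u : denom (~` q)) : ~ q (val u).
  move: u; apply: (denom_ind (P := fun x => ~ q x)) => //; first exact: prime_n1 Hq.
  exact: primeM Hq.
have mkd a : ~ q a -> exists u : denom (~` q), val u = a.
  by move=> na; exists (exist _ a (asboolT (fun V _ WV => WV a na))).
have mI : ideal m by case: Mm.
have m1 : ~ m 1 by case: Mm.
have unit x : ~ m x -> exists y, y * x = 1.
  move=> nx; apply: contrapT => nu.
  have id0 : ideal ([set 0] : set (localization (~` q))).
    by apply/idealP; split=> // [x' y -> ->|r x' ->]; rewrite ?addr0 ?mulr0.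
  have [|M MM sM] := @maximal_over _ noeL (iext [set 0] x) (iext_ideal x id0).
    by move=> [a [i [-> E]]]; apply: nu; exists a; rewrite E addr0.
  by apply: nx; rewrite -(Muniq M MM); apply: sM; apply: iext_mem.
have qm a : q a -> m (to_loc _ a).
  move=> qa; apply: contrapT => /unit[y]; elim/frac_ind: y => b t.
  rewrite -[X in X = 1]/(loc_mul _ _) loc_mulE => /fracP[u] /= E.
  apply: (primeM Hq (dn u) (dn t)); rewrite mul1r !mulr1 mulrBr in E.
  move/eqP: E; rewrite subr_eq0 => /eqP <-.
  by apply: (idealMl _ qI); apply: (idealMl _ qI).
have mq a u : m (Defs.frac a u) -> q a.
  move=> ma; apply: contrapT => /mkd[t Et]; apply: m1.
  have <- : Defs.frac (val u) t * Defs.frac a u = 1.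
    rewrite -[LHS]/(loc_mul _ _) loc_mulE; apply: frac_eq => /=.
    by rewrite mul1r mulr1 -Et mulrC.
  exact: idealMl.
have reprE (x : localization (~` q)) : x = Defs.frac (repr x).1 (repr x).2.
  by rewrite -[LHS]reprK /Defs.frac; case: (repr x).
pose ts := [seq (repr x).1 | x <- s].
have sts : size ts = d by rewrite size_map.
exists ts, (fun i => to_loc (~` q) @^-1` P' i); rewrite sts; split.
- move=> _ /mapP[x xs ->]; apply: (mq _ (repr x).2); rewrite -reprE Es.
  exact: sub_ideal_gen.
- move=> a /qm; rewrite Es.
  pose J : set (localization (~` q)) :=
    [set x | exists b t, ideal_gen [set` ts] b /\ x = Defs.frac b t].
  have gI := ideal_gen_ideal [set` ts].
  have HJ : ideal J.
    apply/idealP; split.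
    - by exists 0, (den1 _); split=> //; apply: ideal0.
    - move=> _ _ [b [t [gb ->]]] [c [u [gc ->]]].
      exists (b * val u + c * val t), (denM t u); split; last exact: loc_addE.
      by apply: (idealD gI); apply: (idealMr _ gI).
    - elim/frac_ind=> c u _ [b [t [gb ->]]]; exists (c * b), (denM u t).
      by split; [apply: (idealMl _ gI)|apply: loc_mulE].
  move=> ga; have [b [t [gb /fracP[u /= E]]]] : J (to_loc (~` q) a).
    apply: ideal_gen_min ga => // x xs; exists (repr x).1, (repr x).2.
    by split; [apply: sub_ideal_gen; apply: (map_f (fun x => (repr x).1))|apply: reprE].
  exists (val u * val t); split; first exact: (primeM Hq).
  move: E; rewrite mulr1 mulrBr => /eqP; rewrite subr_eq0 => /eqP E.
  by rewrite -mulrA (mulrC (val t)) E; apply: (idealMl _ gI).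
- split=> [i id|i id]; first by apply: preimage_prime; apply: HP'.
  have [s1 n1] := sP' i id; split; first by move=> x /s1.
  move=> E; apply: n1; apply/seteqP; split=> //; elim/frac_ind=> a t Pa.
  have PI := prime_idl (HP' i.+1 id); have PI' := prime_idl (HP' i (ltnW id)).
  have : (to_loc (~` q) @^-1` P' i) a.
    by rewrite E /preimage /= -(frac_lift a t); apply: (idealMr _ PI).
  rewrite /preimage /= => /(idealMl (Defs.frac 1 t) PI').
  rewrite -(frac_lift a t) mulrCA frac_unit mulr1 //.
- move=> a Pa; apply: contrapT => /mkd[t Et]; apply: (prime_n1 (HP' d (leqnn d))).
  rewrite -(frac_unit t) Et; apply: idealMl => //; exact: prime_idl (HP' d (leqnn d)).
Qed.

Lemma image_prime (R T : comPzRingType) (th : {rmorphism R -> T}) (q : set R) :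
  (forall y, exists x, th x = y) -> prime_ideal q -> (forall x, th x = 0 -> q x) ->
  [/\ prime_ideal (th @` q) & forall x, (th @` q) (th x) -> q x].
Proof.
move=> surj Hq ker; have qI := prime_idl Hq.
have qE x : (th @` q) (th x) -> q x.
  move=> [y qy E]; apply: (idealBr qI (y := y)) => //; apply: ker.
  by rewrite rmorphB E subrr.
split=> //; split.
- apply/idealP; split; first by exists 0; rewrite ?rmorph0 //; apply: ideal0.
  + by move=> _ _ [x qx <-] [y qy <-]; exists (x + y); [apply: idealD|rewrite rmorphD].
  + move=> r _ [x qx <-]; have [r' <-] := surj r.
    by exists (r' * x); [apply: idealMl|rewrite rmorphM].
- by rewrite -(rmorph1 th) => /qE; apply: prime_n1 Hq.
- move=> x y; have [x' <-] := surj x; have [y' <-] := surj y.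
  rewrite -rmorphM => /qE; case: Hq => _ _ H /H[H'|H']; [left|right].
    by exists x'.
  by exists y'.
Qed.

(** The same data pulled back along a surjection, whose kernel joins the generators. *)
Lemma regular_local_transfer (R T : comPzRingType) (th : {rmorphism R -> T}) (q : set R) :
  (forall y, exists x, th x = y) -> prime_ideal q -> (forall x, th x = 0 -> q x) ->
  regular_local_ring (localization (~` (th @` q))) ->
  exists (ts : seq R) (P : nat -> set R), [/\ forall t, t \in ts -> q t,
    leQ q q (iexts [set x | th x = 0] ts), prime_chain (size ts) P,
    [set x | th x = 0] `<=` P 0 & P (size ts) `<=` q].
Proof.
move=> surj Hq ker reg; have [Hq' qE] := image_prime surj Hq ker.
have [ts [P [tsq gts cP Pq]]] := regular_local_generators Hq' reg.
have [g Hg] := choice surj.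
have kerI := kernel_ideal th.
exists (map g ts), (fun i => th @^-1` P i); rewrite size_map; split.
- by move=> _ /mapP[t tst ->]; apply: qE; rewrite Hg; apply: tsq.
- move=> x qx; have [|s [ns gs]] := gts (th x); first by exists x.
  exists (g s); split; first by move=> qg; apply: ns; exists (g s).
  have eI := iexts_ideal (map g ts) kerI.
  have : (ideal_gen [set` ts]) (th (g s * x)) by rewrite rmorphM Hg.
  pose J : set T := [set y | forall x, th x = y -> iexts [set x | th x = 0] (map g ts) x].
  have HJ : ideal J.
    apply/idealP; split.
    - by move=> y Ey; apply: sub_iexts.
    - move=> u v Ju Jv y Ey; rewrite -[y](subrK (g v)); apply: (idealD eI).
        by apply: Ju; rewrite rmorphB Ey Hg addrK.
      by apply: Jv; rewrite Hg.
    - move=> r u Ju y Ey; rewrite -[y](subrK (g r * g u)); apply: (idealD eI).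
        by apply: sub_iexts; rewrite /= rmorphB rmorphM Ey !Hg subrr.
      by apply: (idealMl _ eI); apply: Ju; rewrite Hg.
  move=> gx; apply: (ideal_gen_min HJ _ gx) => // t tst y Ey.
  rewrite -[y](subrK (g t)); apply: (idealD eI).
    by apply: sub_iexts; rewrite /= rmorphB Ey Hg subrr.
  by apply: iexts_mem => //; apply: map_f.
- case: cP => Pp Ps; split=> i id; first by apply: preimage_prime; apply: Pp.
  have [s1 n1] := Ps i id; split; first by move=> x /s1.
  move=> E; apply: n1; apply/seteqP; split=> // y; have [x <-] := surj y.
  by move=> Px; have : (th @^-1` P i) x by rewrite E.
- move=> x Ex; rewrite /preimage /= Ex; apply: ideal0.
  by apply: prime_idl; case: cP => Pp _; apply: Pp.
- by move=> x /Pq /qE.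
Qed.

End RegularLocal.

(** * Consequences of flatness and of regular fibers *)

Section SmoothFibers.
Variables (R : comPzRingType) (hR : smooth_Z R).
Variables (l : nat) (pl : prime l).

Local Notation phi := (@intmul R 1 : {rmorphism int -> R}).

(** Flatness applied to multiplication by [l] on the integers; the balanced map [b] reads off [r]
    from [1 (x) r]. *)
Lemma smooth_torsionfree (r : R) : l%:R * r = 0 -> r = 0.
Proof.
move=> lr; case: hR => _ flatR _.
pose m (x : int^o) : int^o := l%:Z *: x.
have mL : linear m.
  by move=> a x y; rewrite /m scalerDr !scalerA [l%:Z * a]mulrC.
pose u : {linear int^o -> int^o} := HB.pack m (GRing.isLinear.Build int int^o int^o _ m mL).
have injm : injective u.
  move=> x y /= E; apply/(@mulfI _ l%:Z); last exact: E.
  by rewrite eqz_nat -lt0n prime_gt0.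
have H := flatR _ _ u injm.
pose b (x : int^o) (y : restr phi) : R := phi x * (y : R).
have bb : balanced b.
  split=> [x x' y|x y y'|c x y]; rewrite /b.
  - by rewrite rmorphD mulrDl.
  - by rewrite mulrDr.
  - rewrite /GRing.scale /= /restr_scale rmorphM; ring.
have uE x (y : restr phi) : tensor_map u (tmul x y) = tmul (u x) y.
  apply/tensP => T g Hg; rewrite /tens_eval big_map big_seq1 /=.
  pose g' (x : int^o) (y : restr phi) := g (m x) y.
  have Hg' : balanced g'.
    case: Hg => gD gDr gZ; split=> [v w z|v w z|c v w]; rewrite /g'.
    - by rewrite -gD /m scalerDr.
    - exact: gDr.
    - by rewrite -gZ /m !scalerA mulrC.
  have := tens_eval_repr [:: (x, y)] Hg'; rewrite /tens_eval big_seq1 /=.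
  exact.
have E : tmul (1 : int^o) (r : restr phi) = tmul 1 0.
  apply: H; rewrite !uE; apply/tensP => T g [gD gDr gZ].
  rewrite /tens_eval !big_seq1 /= /m !gZ; congr (g _ _).
  by rewrite scaler0 /GRing.scale /= /restr_scale -[RHS]lr.
have := (tensP _ _).1 E _ b bb; rewrite /tens_eval !big_seq1 /= /b.
by rewrite mul1r mulr0.
Qed.

(** Geometric regularity of the fiber over [(l)] is applied to ['F_l], which is the residue field
    there; the resulting tensor product is a quotient of [R] by [th], with kernel [l R]. *)
Lemma smooth_regular (q : set R) : prime_ideal q -> q l%:R ->
  exists (ts : seq R) (P : nat -> set R), [/\ forall t, t \in ts -> q t,
    leQ q q (iexts [set x | exists y, x = l%:R * y] ts), prime_chain (size ts) P,
    P 0 l%:R & P (size ts) `<=` q].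
Proof.
move=> Hq ql; have qI := prime_idl Hq; case: hR => _ _.
pose p : set int := [set n | (l %| `|n|)%N].
have pE n : p n <-> (l%:Z %| n)%Z by rewrite /p /= dvdzE.
have pp : prime_ideal p.
  split.
  - apply/idealP; split; first exact/pE/dvdz0.
    + by move=> x y /pE lx /pE ly; apply/pE/rpredD.
    + by move=> a x /pE lx; apply/pE/dvdz_mull.
  - by rewrite /p /= dvdn1 => /eqP l1; move: pl; rewrite l1.
  - move=> x y; rewrite /p /= abszM Euclid_dvdM // => /orP[]; by [left|right].
move=> /(_ p pp) geo.
have inv (n : int) : ~ p n -> exists c d : int, c * n = 1 + d * l%:R.
  move=> np; have : coprimez n l%:Z.
    rewrite coprimezE /= coprime_sym prime_coprime //.
    by apply/negP => lx; apply: np.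
  by move=> /coprimezP[[c d] /= E]; exists c, (- d); rewrite natz mulNr -E addrK.
have l0F : l%:R = 0 :> 'F_l by rewrite pchar_Fp_0.
have intl (C : comPzRingType) (f : {rmorphism int -> C}) n : l%:R = 0 :> C -> p n -> f n = 0.
  by move=> l0 /pE/dvdzP[d ->]; rewrite rmorphM /= -[l%:Z]natz rmorph_nat l0 mulr0.
have [|j0 Hj0] := @loc_univ int 'F_l (~` p) (@intmul 'F_l 1 : {rmorphism int -> 'F_l}).
  move=> s /= ns; have [c [d E]] := inv s ns; exists c%:~R.
  by rewrite -intrM E rmorphD rmorphM rmorph_nat l0F mulr0 addr0 rmorph1.
have [|j Hj] := @quot_univ _ 'F_l (@to_loc int (~` p) @` p) j0.
  by move=> _ [n pn <-]; rewrite Hj0; apply: (intl _ (@intmul 'F_l 1 : {rmorphism int -> 'F_l})).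
pose K := residue_field p; pose F := fiber phi p.
pose iK : {rmorphism int -> K} := qring _ \o @to_loc int (~` p).
pose iF : {rmorphism R -> F} := qring _ \o @to_loc R (phi @` ~` p).
have jE n : j (iK n) = n%:~R by rewrite /= Hj Hj0.
have jN (c : 'F_l) : j (iK (c : nat)%:Z) = c by rewrite jE; apply: natr_Zp.
have iKF n : fiber_map phi p (iK n) = iF n%:~R.
  rewrite /= quotring_mapE; congr qring; exact: loc_map_to_loc.
have reg := geo 'F_l j; case: reg => [|noeT reg].
  exists [:: 1]; apply/seteqP; split=> // c _.
  have -> : c = (iK (c : nat)%:Z : K) *: (1 : restr j).
    rewrite /GRing.scale /= /restr_scale mulr1.
    exact: (esym (jN c)).
  rewrite -[_ *: _]addr0; apply: (span_submodule _).2; last exact: (span_submodule _).1.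
  by move=> N _; apply; apply: mem_head.
have [inlF HinlF] := tens_inl (fiber_map phi p) j.
pose th : {rmorphism R -> tensor_ring (fiber_map phi p) j} := inlF \o iF.
(* Integers prime to [l] are already invertible modulo [l], so fractions can be replaced by elements
   of [R]. *)
have Fsurj (u : F) : exists a, u = iF a.
  rewrite -[u]qringK; move: (repr u); elim/frac_ind=> a s.
  have [c [b Ec]] : exists c b : R, c * val s = 1 + b * l%:R.
    move: s; apply: (denom_ind (P := fun s => exists c b, c * s = 1 + b * l%:R)).
    - by exists 1, 0; rewrite mul0r mulr1 addr0.
    - move=> x y [c [d E]] [c' [d' E']]; exists (c * c'), (d + d' + d * d' * l%:R).
      by rewrite mulrACA E E'; ring.
    - move=> _ [n np <-]; have [c [d E]] := inv n np; exists c%:~R, d%:~R.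
      by rewrite -intrM E rmorphD rmorphM rmorph_nat rmorph1.
  exists (a * c); apply/(@qmodP _ _).
  have -> : Defs.frac a s - to_loc _ (a * c) =
      Defs.frac 1 s * to_loc _ (- (a * b)) * to_loc _ (l%:R : R).
    rewrite -[LHS]mul1r -(frac_unit s) -!mulrA -rmorphM; congr (_ * _).
    rewrite mulrBr [to_loc _ (val s) * Defs.frac a s]mulrC frac_lift -rmorphM -rmorphB.
    congr to_loc; rewrite mulrCA [X in a - a * X]mulrC Ec; ring.
  apply: (@idealMl _ (ideal_gen _)); first exact: ideal_gen_ideal.
  apply: sub_ideal_gen; exists (to_loc _ l%:Z); first by exists l%:Z => //; rewrite /p /=.
  exact: loc_map_to_loc.
have Kspan (k : K) : exists n (w : K) m, [/\ k * iK m = iK n, w * iK m = 1 & ~ p m].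
  rewrite -[k]qringK; move: (repr k); elim/frac_ind=> n s.
  exists n, (qring _ (Defs.frac 1 s)), (val s).
  rewrite /iK /= -!rmorphM frac_lift frac_unit rmorph1; split=> //.
  move: s; apply: (denom_ind (P := fun m => ~ p m)) => //; first exact: prime_n1 pp.
  exact: primeM pp.
(* A map from the tensor product to [R / l], built from the universal properties, will show that the
   kernel of [th] is not larger than [l R]. *)
pose C := quotring [set (l%:R : R)].
have lC : l%:R = 0 :> C.
  rewrite -(rmorph_nat (qring _)) -(rmorph0 (qring _)); apply/(@qmodP R R^o).
  by rewrite subr0; apply: (@sub_ideal_gen R).
have [|psi1 Hpsi1] := @loc_univ R C (phi @` ~` p) (qring _).
  move=> _ [n np <-]; have [c [d E]] := inv n np; exists c%:~R.
  by rewrite /= rmorph_int -intrM E rmorphD rmorphM rmorph_nat lC mulr0 addr0 rmorph1.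
have [|psi Hpsi] := @quot_univ _ C (@loc_map _ _ phi (~` p) @` (@to_loc int (~` p) @` p)) psi1.
  move=> _ [_ [n pn <-] <-]; rewrite loc_map_to_loc Hpsi1 /= rmorph_int.
  exact: (intl C (@intmul C 1 : {rmorphism int -> C})).
have [chi Hchi] := Fp_rmorphism pl lC.
pose f1 : {rmorphism K -> C} := psi \o fiber_map phi p.
pose g1 : {rmorphism K -> C} := chi \o j.
have fg n : f1 (iK n) = g1 (iK n).
  by rewrite /f1 /g1 [LHS]/= [RHS]/= iKF jE /iF /= Hpsi Hpsi1 !rmorph_int.
have fgE k : f1 k = g1 k.
  have [n [w [m [E Ew _]]]] := Kspan k.
  have Ek : k = w * iK n by rewrite -E mulrCA Ew mulr1.
  have -> : f1 k = f1 w * f1 (iK n) by rewrite Ek rmorphM.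
  have -> : g1 k = g1 w * g1 (iK n) by rewrite Ek rmorphM.
  rewrite fg; congr (_ * _).
  rewrite -[LHS]mulr1 -(rmorph1 g1) -Ew rmorphM -fg mulrCA mulrC -!mulrA.
  by rewrite mulrA -rmorphM Ew rmorph1 mul1r.
pose b (u : restr (fiber_map phi p)) (c : restr j) : C := psi (u : F) * chi (c : 'F_l).
have bb : balanced b.
  split=> [x x' y|x y y'|k x y]; rewrite /b.
  - by rewrite rmorphD mulrDl.
  - by rewrite rmorphD mulrDr.
  - rewrite /GRing.scale /= /restr_scale !rmorphM.
    rewrite -[psi (fiber_map phi p k)]/(f1 k) fgE /g1 /=; ring.
have kerE : [set x | th x = 0] = [set x | exists y, x = l%:R * y].
  apply/seteqP; split=> [x /=|_ [y ->]].
    rewrite HinlF => /(tensP _ [::])/(_ C b bb).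
    rewrite /tens_eval big_seq1 big_nil /b /= rmorph1 mulr1 Hpsi Hpsi1.
    rewrite -(rmorph0 (qring _)) => /(@qmodP R R^o); rewrite subr0.
    exact: ideal_gen1.
  have lF : iF l%:R = 0.
    have -> : iF l%:R = fiber_map phi p (iK l%:Z) by rewrite iKF.
    have -> : iK l%:Z = 0; last by rewrite rmorph0.
    rewrite /iK /= -(rmorph0 (qring _)); apply/(@qmodP _ _); rewrite subr0.
    by apply: (@sub_ideal_gen (localization (~` p))); exists l%:Z => //; rewrite /p /=.
  change (inlF (iF (l%:R * y)) = 0).
  by rewrite rmorphM lF mul0r rmorph0.
have thS y : exists x, th x = y.
  rewrite -[y]tensK; elim: (repr y) => [|[u c] s [x Hx]].
    by exists 0; rewrite rmorph0.
  have [x1 Hx1] : exists x, th x = tmul u c.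
    have [z Ez] := Fsurj (fiber_map phi p (iK (c : nat)%:Z) * (u : F)).
    exists z; change (inlF (iF z) = tmul u c); rewrite HinlF -Ez; apply/tensP => T g [_ _ gZ].
    rewrite /tens_eval !big_seq1 /=; have := gZ (iK (c : nat)%:Z) u 1.
    rewrite /GRing.scale /= /restr_scale => ->; congr (g _ _).
    by rewrite mulr1; apply: jN.
  exists (x1 + x); rewrite rmorphD Hx Hx1 -[LHS]/(tens_add _ _).
  apply/tensP => T g Hg; rewrite tens_eval_cat !tens_eval_repr //.
  by rewrite -tens_eval_cat.
have ker x : th x = 0 -> q x.
  move=> x0; have : [set x | th x = 0] x by [].
  by rewrite kerE => -[y ->]; apply: (idealMr _ qI).
have [qth _] := image_prime thS Hq ker.
have [ts [P [tsq gts cP kP Pq]]] := regular_local_transfer thS Hq ker (reg _ qth).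
rewrite kerE in gts kP; exists ts, P; split=> //.
by apply: kP; exists 1; rewrite mulr1.
Qed.

End SmoothFibers.

(** * Integral polynomials: Taylor expansion and lifts of Frobenius *)

Section MpolyInt.
Variable m : nat.
Local Notation S := {mpoly int[m]}.

Lemma subring_set_int (C : comPzRingType) (D : set C) (z : int) : subring_set D -> D z%:~R.
Proof.
move=> HD; have [D1 DB _] := HD; have D0 : D 0 by rewrite -(subrr 1); apply: DB.
have Dn n : D n%:R.
  by elim: n => // n IH; rewrite -addn1 natrD; apply: subring_setD.
case: z => n; first exact: Dn.
by rewrite NegzE mulrNz -[- _]sub0r; apply: DB => //; apply: Dn.
Qed.

Lemma mpoly_generates : @generates S [seq 'X_i | i <- enum 'I_m].
Proof.
move=> D HD DX; have [D1 _ DM] := HD.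
have Dexp x n : D x -> D (x ^+ n).
  by move=> Dx; elim: n => // n IH; rewrite exprS; apply: DM.
elim/mpolyind => [|c mm p _ _ Dp]; first exact: (subring_set_int 0 HD).
apply: subring_setD => //; rewrite -mul_mpolyC; apply: (DM _ _).
  have -> : c%:MP = c%:~R :> S by rewrite -[c in LHS]intz rmorph_int.
  exact: subring_set_int.
rewrite mpolyXE_id; apply: (big_ind D) => [||i _]; [exact: D1|exact: DM|].
apply: Dexp; apply: DX.
by apply: map_f; rewrite mem_enum.
Qed.

Lemma mpoly_int_noetherian : noetherian S.
Proof. exact: generates_noetherian mpoly_generates. Qed.

Lemma mpoly_hom_ext (C : comPzRingType) (f g : {rmorphism S -> C}) :
  (forall i, f 'X_i = g 'X_i) -> f =1 g.
Proof.
move=> fg; apply: mpoly_generates; last by move=> y ys; have /mapP[i _ ->] := ys.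
split=> [|x y Ex Ey|x y Ex Ey].
- by rewrite !rmorph1. - by rewrite !rmorphB Ex Ey. - by rewrite !rmorphM Ex Ey.
Qed.

Definition mev (C : comNzRingType) (a : 'I_m -> C) : {rmorphism S -> C} :=
  mmap (@intmul C 1 : {rmorphism int -> C}) a.

Lemma mevX (C : comNzRingType) (a : 'I_m -> C) i : mev a 'X_i = a i.
Proof. by rewrite /mev /= mmapX mmap1U. Qed.

(** Products of two increments lie in [K], so the expansion stops at first order; the polynomials
    for which it holds form a subring containing the variables. *)
Lemma mev_taylor (C : comNzRingType) (a a' : 'I_m -> C) (K : set C) : ideal K ->
  (forall i j, K ((a' i - a i) * (a' j - a j))) ->
  forall F, K (mev a' F - mev a F - \sum_i mev a F^`M(i) * (a' i - a i)).
Proof.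
move=> HK Ke; apply: mpoly_generates; last first.
  move=> y ys; have /mapP[j _ ->] := ys; rewrite !mevX (bigD1 j) //= mderivX mnm1E eqxx.
  have -> : (U_(j) - U_(j))%MM = 0%MM by apply/mnmP => i; rewrite mnmBE subnn mnm0E.
  rewrite mpolyX0 scale1r rmorph1 mul1r big1 ?addr0 ?subrr.
    exact: ideal0.
  move=> i ij; rewrite mderivX mnm1E.
  by rewrite eq_sym (negPf ij) scale0r rmorph0 mul0r.
pose d F := \sum_i mev a F^`M(i) * (a' i - a i).
have dd F G : K (d F * d G).
  rewrite /d mulr_suml; apply: ideal_sum => // i _; rewrite mulr_sumr.
  by apply: ideal_sum => // j _; rewrite mulrACA; apply: (idealMl _ HK).
split=> [|F G|F G].
- rewrite !rmorph1 subrr sub0r; apply: (idealN HK); apply: ideal_sum => // i _.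
  by rewrite mderivC rmorph0 mul0r; apply: ideal0.
- rewrite /= -![\sum_i _]/(d _) => KF KG.
  have -> : d (F - G) = d F - d G.
    by rewrite /d -sumrB; apply: eq_bigr => i _; rewrite mderivB rmorphB mulrBl.
  rewrite !rmorphB; have -> : mev a' F - mev a' G - (mev a F - mev a G) - (d F - d G) =
    (mev a' F - mev a F - d F) - (mev a' G - mev a G - d G) by ring.
  exact: idealB.
- rewrite /= -![\sum_i _]/(d _) => KF KG.
  have -> : d (F * G) = d F * mev a G + mev a F * d G.
    rewrite /d mulr_suml mulr_sumr -big_split; apply: eq_bigr => i _ /=.
    by rewrite mderivM rmorphD !rmorphM; ring.
  rewrite !rmorphM; move: KF KG (dd F G).
  set F' := mev a' F; set F0 := mev a F; set G' := mev a' G; set G0 := mev a G.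
  move=> KF KG KFG.
  have -> : F' * G' - F0 * G0 - (d F * G0 + F0 * d G) =
    d F * d G + (F' - F0 - d F) * G' + (F0 + d F) * (G' - G0 - d G) by ring.
  apply: (idealD HK); last exact: (idealMl _ HK).
  by apply: (idealD HK) => //; apply: (idealMr _ HK).
Qed.

Lemma frobenius_hom (A : comPzRingType) (f : {rmorphism S -> A}) (l e : nat)
    (th : {rmorphism S -> S}) : prime l -> l%:R = 0 :> A ->
  (forall i, th 'X_i = 'X_i ^+ (l ^ e)) -> forall F, f (th F) = f F ^+ (l ^ e).
Proof.
move=> pl l0 thX; apply: mpoly_generates; last first.
  by move=> y ys; have /mapP[i _ ->] := ys; rewrite thX rmorphXn.
split=> [|x y Ex Ey|x y Ex Ey] /=.
- by rewrite !rmorph1 expr1n.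
- by rewrite !rmorphB Ex Ey (frobeniusX_add pl l0) (frobeniusX_opp pl l0).
- by rewrite !rmorphM Ex Ey exprMn.
Qed.

Lemma frobenius_congr (K : set S) (l e : nat) (th : {rmorphism S -> S}) : prime l ->
  ideal K -> (forall x, K (l%:R * x)) -> (forall i, th 'X_i = 'X_i ^+ (l ^ e)) ->
  forall F, K (th F - F ^+ (l ^ e)).
Proof.
move=> pl HK Kl thX F; apply/(qring_eq0 _ HK).
have l0 : l%:R = 0 :> quotring K.
  rewrite -(rmorph_nat (qring K)); apply/(qring_eq0 _ HK).
  by rewrite -[l%:R]mulr1.
by rewrite (rmorphB (qring K)) (frobenius_hom (qring K) pl l0 thX) rmorphXn subrr.
Qed.

(* With [y ^ q = y] in the residue field, Taylor expansion at [y ^ q] of an *)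
(* element [s] gives [s = s ^ q + sum_i (d_i s) ^ q * (y_i - y_i ^ q)] modulo *)
(* [l] and [Q ^ 2].                                                           *)
Lemma taylor_trick (Q K : set S) (l e : nat) (s : S) : prime l -> (0 < e)%N ->
  ideal Q -> ideal K -> (forall x, Q (x ^+ (l ^ e) - x)) ->
  (forall x y, Q x -> Q y -> K (x * y)) -> (forall x, K (l%:R * x)) ->
  Q s -> (forall i, Q s^`M(i)) -> K s.
Proof.
move=> pl e0 HQ HK Qq KQ Kl Qs Qds; pose q := (l ^ e)%N.
have q1 : (1 < q)%N by rewrite -(expn0 l) ltn_exp2l // prime_gt1.
have KX x : Q x -> K (x ^+ q).
  move=> Qx; rewrite -(subnKC q1) exprD; apply: (idealMr _ HK).
  by rewrite expr2; apply: KQ.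
pose th := mev (fun i => 'X_i ^+ q : S).
have thE F : K (th F - F ^+ q) by apply: frobenius_congr => // i; apply: mevX.
have idX : mev (fun i => 'X_i : S) =1 id.
  by apply: (mpoly_hom_ext (g := idfun)) => i; rewrite mevX.
have H : K (s - th s - \sum_i th s^`M(i) * ('X_i - 'X_i ^+ q)).
  rewrite -[X in X - th s](idX s); apply: mev_taylor => // i j.
  by apply: KQ; rewrite -opprB; apply: (idealN HQ (Qq _)).
apply: (idealBr HK (y := th s)).
  apply: (idealBr HK H); apply: ideal_sum => // i _; apply: (idealMr _ HK).
  by apply: (idealBr HK (thE _)); apply: KX.
by apply: (idealBr HK (thE _)); apply: KX.
Qed.

End MpolyInt.

Section FreeExtend.
Variables (k : fieldType) (V : vectType k).

Lemma free_extend (X : seq V) (A : V -> Prop) : free X ->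
  exists Y : seq V, [/\ forall y, y \in Y -> A y, free (X ++ Y) &
    forall v, A v -> v \in <<X ++ Y>>%VS].
Proof.
move=> fX.
pose P n := exists Y : seq V, [/\ forall y, y \in Y -> A y, free (X ++ Y) &
  (\dim {:V} - size (X ++ Y))%N = n].
have [|n [[Y [AY fY En]] nmin]] := @nat_min P.
  by exists (\dim {:V} - size (X ++ [::]))%N, [::]; rewrite cats0.
exists Y; split=> // v Av; apply/negPn/negP => nv.
have fv : free (X ++ rcons Y v).
  by rewrite -rcons_cat -cats1 (perm_free (permEl (perm_catC _ _))) /= free_cons nv.
have lt : (size (X ++ Y) < \dim {:V})%N.
  have := dimvS (subvf <<X ++ rcons Y v>>%VS).
  by move/eqP: fv => ->; rewrite !size_cat size_rcons addnS.
have : (n <= \dim {:V} - size (X ++ rcons Y v))%N.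
  apply: nmin; exists (rcons Y v); split=> // y.
  by rewrite mem_rcons inE => /orP[/eqP ->|/AY].
by rewrite -En; move: lt; rewrite !size_cat size_rcons addnS; lia.
Qed.

Lemma seq_lift (T : eqType) (U : Type) (f : U -> T) (A : U -> Prop) (Y : seq T) :
  (forall y, y \in Y -> exists u, A u /\ y = f u) ->
  exists us, (forall i u0, (i < size us)%N -> A (nth u0 us i)) /\ Y = map f us.
Proof.
elim: Y => [|y Y IH] H; first by exists [::].
have [|us [Hus ->]] := IH; first by move=> z zY; apply: H; rewrite inE zY orbT.
have [u [Au ->]] := H y (mem_head _ _); exists (u :: us); split=> //.
by case=> [|i] u0 //= iu; apply: Hus.
Qed.

End FreeExtend.

Lemma leQ_common (A : comPzRingType) (Q N I : set A) : noetherian A -> prime_ideal Q ->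
  ideal I -> ideal N -> leQ Q N I -> exists s, ~ Q s /\ forall y, N y -> I (s * y).
Proof.
move=> noe HQ HI HN NI; have [js Ejs] := noe N HN.
have jsN j : j \in js -> N j by move=> jj; rewrite Ejs; apply: sub_ideal_gen.
suff [s [ns H]] : exists s, ~ Q s /\ forall y, y \in js -> I (s * y).
  exists s; split=> // y; rewrite Ejs => /ideal_gen_seqP[c ->].
  rewrite mulr_sumr; apply: (ideal_sum _ HI) => i _; rewrite mulrCA.
  exact: (idealMl _ HI (H _ (mem_nth 0 (ltn_ord i)))).
elim: {Ejs} js jsN => [|j js IH] jsN; first by exists 1; split=> //; apply: (prime_n1 HQ).
have [|s [ns H]] := IH; first by move=> i ij; apply: jsN; rewrite inE ij orbT.
have [r [nr Hr]] := NI j (jsN j (mem_head _ _)); exists (s * r).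
split=> [|y]; first exact: (primeM HQ).
rewrite inE => /orP[/eqP ->|yj]; first by rewrite -mulrA; apply: (idealMl _ HI).
by rewrite mulrAC; apply: (idealMr _ HI); apply: H.
Qed.

Lemma image_ideal (A B : comPzRingType) (f : {rmorphism A -> B}) (I : set A) :
  (forall b, exists a, f a = b) -> ideal I -> ideal (f @` I).
Proof.
move=> fs HI; apply/idealP; split.
- by exists 0; rewrite ?rmorph0 //; apply: ideal0.
- by move=> _ _ [x Ix <-] [y Iy <-]; exists (x + y); rewrite ?rmorphD //; apply: idealD.
- move=> r _ [x Ix <-]; have [a <-] := fs r.
  by exists (a * x); rewrite ?rmorphM //; apply: idealMl.
Qed.

Lemma preimage_prime_chain (A B : comPzRingType) (f : {rmorphism A -> B}) r P :
  (forall b, exists a, f a = b) -> prime_chain r P -> prime_chain r (fun i => f @^-1` P i).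
Proof.
move=> fs [HP HS]; split=> [i ir|i ir]; first exact: (preimage_prime f (HP i ir)).
have [sub ne] := HS i ir; split=> [x|E]; first exact: sub.
apply: ne; apply/seteqP; split=> // b Pb; have [a Ea] := fs b.
by rewrite -Ea; change ((f @^-1` P i) a); rewrite E /preimage /= Ea.
Qed.

(** * The Jacobian criterion at a closed point *)

Section LocalStructure.
Variables (R : comPzRingType) (hR : smooth_Z R) (m : nat).
Local Notation S := {mpoly int[m]}.
Variables (pi : {rmorphism S -> R}) (pis : forall r, exists f, pi f = r).
Local Notation J := [set g : S | pi g = 0].
Variables (Q : set S) (MQ : maximal_ideal Q) (JQ : J `<=` Q).

Let HQ : prime_ideal Q := maximal_prime MQ.
Let IQ : ideal Q := prime_idl HQ.
Let noeS : noetherian S := @mpoly_int_noetherian m.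
Let HJ : ideal J := kernel_ideal pi.

(** The differentials at the point of the [gs] are a basis of those of [J], and the variables [ys]
    complete it to a basis of the whole space. With [taylor_trick], the elements [l], [gs] and
    [y - y ^ q] generate [Q] locally. Regularity of [R / l] provides a chain of primes at least as
    long as [ys], so [chain_length_le_generators] identifies its bottom prime with [(l, gs)]
    locally. Hence [J] lies in [(l, gs)]; since [R] has no [l]-torsion, [J = l J + (gs)], and
    Nakayama's lemma gives [J = (gs)] locally. The reducedness clause is the primality of that
    bottom ideal. *)
Lemma local_structure : exists (l : nat) (gs ys : seq S) (h : S) (U : 'M[S]_m),
  [/\ prime l /\ Q l%:R, forall g, g \in gs -> J g, size (gs ++ ys) = m /\ ~ Q h,
    U *m (\matrix_(i, j) (nth 0 (gs ++ ys) i)^`M(j)) = h%:M /\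
    (\matrix_(i, j) (nth 0 (gs ++ ys) i)^`M(j)) *m U = h%:M &
    (forall s, J s -> ideal_gen [set` gs] (h * s)) /\
    (exists q, forall x, Q (x ^+ q - x)) /\
    (forall s, iext J l%:R (s ^+ l) -> exists h', ~ Q h' /\ iext J l%:R (h' * s))].
Proof.
have [l [e [pl e0 Ql Qq]]] := maximal_residue (@mpoly_generates m) MQ.
pose q := (l ^ e)%N.
have q1 : (1 < q)%N by rewrite -(expn0 l) ltn_exp2l // prime_gt1.
have [L [kp [kp0 kpfrac]]] := residue_field_of HQ.
have kpq x : kp x ^+ q = kp x.
  by apply/eqP; rewrite -subr_eq0 -rmorphXn -rmorphB; apply/eqP/kp0.
have kps y : exists x, kp x = y.
  have [a [b [b0 E]]] := kpfrac y; exists (a * b ^+ (q - 2)).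
  apply: (mulIf b0); rewrite E rmorphM rmorphXn -mulrA -exprSr.
  have -> : (q - 2).+1 = q.-1 by lia.
  apply: (mulIf b0); rewrite -!mulrA -exprSr prednK ?kpq //; lia.
have l0 : l%:R = 0 :> L by rewrite -(rmorph_nat kp); apply/kp0.
pose d (s : S) : 'rV[L]_m := \row_j kp s^`M(j).
have dD x y : d (x + y) = d x + d y by apply/rowP => j; rewrite !mxE mderivD rmorphD.
have dN x : d (- x) = - d x by apply/rowP => j; rewrite !mxE mderivN rmorphN.
have dM x y : d (x * y) = kp x *: d y + kp y *: d x.
  by apply/rowP => j; rewrite !mxE mderivM rmorphD !rmorphM /= addrC (mulrC (kp y)).
have d0 : d 0 = 0 by apply/rowP => j; rewrite !mxE mderivC rmorph0.
have dsum (I : Type) (r : seq I) F : d (\sum_(i <- r) F i) = \sum_(i <- r) d (F i).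
  by elim: r => [|i r IH]; rewrite ?big_nil // !big_cons dD IH.
have dq x : d (x ^+ q) = 0.
  have dX n : d (x ^+ n.+1) = (kp x ^+ n *+ n.+1) *: d x.
    elim: n => [|n IH]; first by rewrite expr0 scale1r.
    rewrite exprS dM IH scalerA -scalerDl rmorphXn; congr (_ *: _).
    by rewrite (mulrS _ n.+1) mulrnAr -exprS addrC.
  rewrite -(prednK (ltnW q1)) dX prednK ?(ltnW q1) // -mulr_natr.
  by rewrite /q -(prednK e0) expnS natrM l0 mul0r mulr0 scale0r.
have dnat n : d n%:R = 0.
  elim: n => // n IH; rewrite mulrS dD IH addr0.
  have := dM 1 1; rewrite mulr1 rmorph1 scale1r => /eqP.
  by rewrite -subr_eq0 opprD addrA subrr add0r oppr_eq0 => /eqP.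
have dl x : d (l%:R * x) = 0 by rewrite dM rmorph_nat l0 scale0r add0r dnat scaler0.
pose inJ v := exists g, J g /\ v = d g.
have nil_free : free ([::] : seq 'rV[L]_m) by apply: nil_free.
have [X0 [X0A fX0 spX0]] := free_extend inJ nil_free.
rewrite /= in fX0 spX0.
have [gs [gsJ EX0]] := seq_lift X0A.
pose isX v := exists g : S, (exists i, g = 'X_i) /\ v = d g.
have [Y0 [Y0A fXY spY0]] := free_extend isX fX0.
have [ys [ysX EY0]] := seq_lift Y0A.
have dX i : d 'X_i = delta_mx 0 i.
  apply/rowP => j; rewrite !mxE eqxx mderivX mnm1E; case: eqP => [->|ne].
    have -> : (U_(j) - U_(j))%MM = 0%MM by apply/mnmP => i'; rewrite mnmBE subnn mnm0E.
    by rewrite mpolyX0 scale1r rmorph1 eqxx.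
  by rewrite scale0r rmorph0; case: eqP => // /esym.
have span_all (W : {vspace 'rV[L]_m}) : (forall i, d 'X_i \in W) -> W = fullv.
  move=> HW; apply/eqP; rewrite eqEsubv subvf; apply/subvP => v _.
  rewrite (row_sum_delta v); apply: rpred_sum => i _; apply: rpredZ.
  by rewrite -dX.
have spXY : <<X0 ++ Y0>>%VS = fullv by apply: span_all => i; apply: spY0; exists 'X_i; split=> //; exists i.
have szXY : size (X0 ++ Y0) = m.
  by move: fXY; rewrite /free spXY dimvf /dim /= mul1n => /eqP.
pose zs := gs ++ ys.
have dzs : map d zs = X0 ++ Y0 by rewrite map_cat EX0 EY0.
have szzs : size zs = m by rewrite -[RHS]szXY -dzs size_map.
pose Jac : 'M[S]_m := \matrix_(i, j) (nth 0 zs i)^`M(j).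
have gsJ' g : g \in gs -> J g.
  by move=> /(nthP 0)[i ig <-]; apply: gsJ.
have ysX' y : y \in ys -> exists i, y = 'X_i.
  by move=> /(nthP 0)[i ig <-]; apply: ysX.
have Jdet : ~ Q (\det Jac).
  move=> /kp0; rewrite -det_map_mx => /eqP/det0P[u u0 uJ].
  case/negP: u0; apply/eqP/rowP => i; rewrite mxE.
  have szt : size (X0 ++ Y0) == m by apply/eqP.
  have /freeP H : free (Tuple szt) by [].
  apply: (H (fun i => u 0 i)).
  apply: etrans uJ; rewrite mulmx_sum_row; apply: eq_bigr => i' _; congr (_ *: _).
  rewrite /= -dzs (nth_map 0) ?szzs //.
  by apply/rowP => j; rewrite !mxE.
have gen_mem (s : seq S) x : x \in s -> ideal_gen [set` s] x by move=> xs; apply: sub_ideal_gen.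
pose lS := [set x : S | exists y, x = l%:R * y].
have HlS : ideal lS := @multiples_ideal S l%:R.
pose I0 := iexts lS gs.
have HI0 : ideal I0 by apply: iexts_ideal.
(* These lie in [Q], as the residue field satisfies [y ^ q = y], and have the differentials of the
   [ys], as [d] kills [q]-th powers. *)
pose us := [seq y - y ^+ q | y <- ys].
have usQ t : t \in us -> Q t.
  by move=> /mapP[y _ ->]; rewrite -opprB; apply: (idealN IQ); apply: Qq.
(* Modulo a combination of the generators, an element of [Q] has zero differential, and
   [taylor_trick] places it in [Q ^ 2 + (l)]. *)
have QI0 : leQ Q Q (iexts I0 us).
  apply: (nakayama noeS HQ) => // [|s Qs]; first exact: iexts_ideal.
  exists 1; split=> [|K HK IK QK]; first exact: (prime_n1 HQ).
  rewrite mul1r.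
  have Kl x : K (l%:R * x) by apply/IK/sub_iexts/sub_iexts; exists x.
  have Kgs g : g \in gs -> K g by move=> ig; apply/IK/sub_iexts/iexts_mem.
  have Kus g : g \in us -> K g by move=> ig; apply/IK/iexts_mem.
  suff [s' [Ks' Qs' ds']] : exists s', [/\ K s', Q s' & d s' = d s].
    apply: (idealBr HK _ Ks'); apply: (taylor_trick pl e0 IQ HK Qq) => //.
      exact: idealB.
    move=> i; apply/kp0; have := congr1 (fun v : 'rV_m => v 0 i) ds'.
    by rewrite !mxE mderivB rmorphB => ->; rewrite subrr.
  have : d s \in <<X0 ++ Y0>>%VS by rewrite spXY memvf.
  rewrite -dzs -[map d zs]/(val (in_tuple (map d zs))) => /coord_span ->.
  elim/big_ind: _ => [|x y [x' [Kx Qx <-]] [y' [Ky Qy <-]]|i _].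
  - by exists 0; split; [apply: ideal0|apply: ideal0|].
  - by exists (x' + y'); split; [apply: idealD|apply: idealD|rewrite dD].
  have [a <-] := kps (coord (in_tuple (map d zs)) i (d s)).
  have im : (i < size zs)%N by rewrite -(size_map d).
  rewrite (nth_map 0) //; have : nth 0 zs i \in zs by apply: mem_nth.
  move: (nth 0 zs i) => z; rewrite mem_cat => /orP[zg|zy].
    exists (a * z); split; [by apply/(idealMl _ HK)/Kgs|by apply/(idealMl _ IQ)/JQ/gsJ'|].
    by rewrite dM (_ : kp z = 0) ?scale0r ?addr0 //; apply/kp0/JQ/gsJ'.
  have zu : z - z ^+ q \in us by apply: map_f.
  exists (a * (z - z ^+ q)); split; [by apply/(idealMl _ HK)/Kus|by apply/(idealMl _ IQ)/usQ|].
  rewrite dM (_ : kp (z - z ^+ q) = 0) ?scale0r ?addr0; last by apply/kp0/usQ.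
  by rewrite dD dN dq oppr0 addr0.
have [|Hq piQQ] := image_prime pis HQ; first by move=> x; apply: JQ.
have [|ts [P [tsq tsg chP P0l Pq]]] := smooth_regular hR pl Hq.
  by exists l%:R; rewrite ?rmorph_nat.
have chS := preimage_prime_chain pis chP.
(* The differentials of the [gs] and of lifts of the [ts] span everything: ['X_i ^ q - 'X_i] lies in
   [Q], hence locally in [J + (l, ts)], and its differential is that of [- 'X_i]. *)
have sz : (size us <= size ts)%N.
  have [ts' [ts'Q Ets]] := @seq_lift _ _ pi Q ts (fun y yt => match tsq y yt with ex_intro2 u Qu E => ex_intro _ u (conj Qu (esym E)) end).
  pose W := <<X0 ++ map d ts'>>%VS.
  pose K := [set x | kp x = 0 /\ d x \in W].
  have HK : ideal K.
    apply/idealP; split=> [|x y [Kx dx] [Ky dy]|r x [Kx dx]].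
    - by split; rewrite ?rmorph0 ?d0 ?rpred0.
    - by split; rewrite ?rmorphD ?Kx ?Ky ?addr0 // dD rpredD.
    - by split; rewrite ?rmorphM ?Kx ?mulr0 // dM Kx scale0r addr0 rpredZ.
  have JK x : J x -> K x.
    move=> Jx; split; first by apply/kp0/JQ.
    have : d x \in <<X0>>%VS by apply: spX0; exists x.
    by apply: subvP; apply: sub_span => v vX; rewrite mem_cat vX.
  suff WT : W = fullv.
    have := dim_span (X0 ++ map d ts'); rewrite -/W WT dimvf /dim /= mul1n -[X in (X <= _)%N]szXY.
    by rewrite !size_cat !size_map Ets size_map EY0 size_map leq_add2l.
  apply: span_all => i.
  have [s [ns Hs]] : exists s, ~ (pi @` Q) s /\ (pi @` K) (s * pi ('X_i ^+ q - 'X_i)).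
    have [s [ns Hs]] := tsg _ (ex_intro2 _ _ _ (Qq 'X_i) erefl).
    exists s; split=> //; apply: iexts_min Hs; first exact: image_ideal.
      move=> _ [y ->]; have [f <-] := pis y; exists (l%:R * f); last by rewrite rmorphM rmorph_nat.
      by split; rewrite ?rmorphM ?rmorph_nat ?l0 ?mul0r // dl rpred0.
    move=> t tt; have := tt; rewrite Ets => /(nthP 0)[i']; rewrite size_map => i's <-.
    rewrite (nth_map 0) //; exists (nth 0 ts' i') => //; split; first by apply/kp0/ts'Q.
    by apply: memv_span; rewrite mem_cat map_f ?orbT // mem_nth.
  have [sg Esg] := pis s; have [x Kx Ex] := Hs.
  have [_ dKs] : K (sg * ('X_i ^+ q - 'X_i)).
    apply: (idealBr HK _ Kx); apply: JK; rewrite /= rmorphB Ex rmorphM Esg subrr //.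
  move: dKs; rewrite dM (_ : kp ('X_i ^+ q - 'X_i) = 0); last by apply/kp0/Qq.
  rewrite scale0r addr0 dD dq dN add0r scalerN rpredN rpredZeq => /orP[/eqP/kp0 Qsg|//].
  by case: ns; rewrite -Esg; exists sg.
have P0J x : J x -> (pi @^-1` P 0) x.
  by move=> /= ->; apply: (ideal0 (prime_idl (chP.1 0%N isT))).
have P0l' x : (pi @^-1` P 0) (l%:R * x).
  by rewrite /preimage /= rmorphM rmorph_nat; apply: (idealMr _ (prime_idl (chP.1 0%N isT))).
have HP0 : prime_ideal (pi @^-1` P 0) := chS.1 0%N isT.
have [||_ P0I0] := chain_length_le_generators noeS HQ HI0 usQ QI0 chS _ _ sz.
- apply: iexts_min => [|x [y ->]|g /gsJ'/P0J] //; exact: prime_idl.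
- by move=> x /= /Pq; apply: piQQ.
have I0J : I0 `<=` iext J l%:R.
  apply: iexts_min => [|x [y ->]|g /gsJ' Jg]; first exact: iext_ideal.
    by exists y, 0; split; [exact: ideal0 HJ|rewrite addr0 mulrC].
  exact: sub_iext.
have HG := ideal_gen_ideal [set` gs].
have JG : leQ Q J (ideal_gen [set` gs]).
  apply: (nakayama noeS HQ) => // x Jx.
  have [r [nr Ir]] := P0I0 x (P0J x Jx); exists r; split=> // K HK GK QJK.
  have [G [y [KG Jy E]]] : exists G y, [/\ K G, J y & r * x = l%:R * y + G].
    have [G [y [GG E]]] : exists G y, ideal_gen [set` gs] G /\ r * x = l%:R * y + G.
      pose K0 := [set z | exists G y, ideal_gen [set` gs] G /\ z = l%:R * y + G].
      change (K0 (r * x)); apply: iexts_min Ir => [|_ [y ->]|g gg].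
      - apply/idealP; split.
        + by exists 0, 0; split; [exact: ideal0|rewrite mulr0 addr0].
        + move=> _ _ [G [y [GG ->]]] [G' [y' [GG' ->]]]; exists (G + G'), (y + y').
          by split; [exact: (idealD HG)|rewrite mulrDr addrACA].
        + move=> c _ [G [y [GG ->]]]; exists (c * G), (c * y).
          by split; [exact: (idealMl _ HG)|rewrite mulrDr mulrCA].
      - by exists 0, y; split; [exact: ideal0|rewrite addr0].
      - by exists g, 0; split; [exact: gen_mem|rewrite mulr0 add0r].
    exists G, y; split=> //; first exact: GK.
    apply: (smooth_torsionfree hR pl); rewrite -(rmorph_nat pi) -rmorphM.
    have -> : l%:R * y = r * x - G by rewrite E addrK.
    rewrite rmorphB rmorphM Jx mulr0 sub0r.
    have -> : pi G = 0; last by rewrite oppr0.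
    by apply: (ideal_gen_min HJ _ GG) => g; apply: gsJ'.
  by rewrite E; apply: (idealD HK) => //; apply: QJK.
have [h1 [nh1 h1J]] := leQ_common noeS HQ HG HJ JG.
exists l, gs, ys, (h1 * \det Jac), (h1 *: \adj Jac); split=> //.
- by split=> //; apply: (primeM HQ).
- by rewrite -scalemxAl -scalemxAr mul_adj_mx mul_mx_adj scale_scalar_mx.
split=> [s /h1J Gs|]; first by rewrite mulrAC; apply: (idealMr _ HG).
split=> [|s Js]; first by exists q.
have P0s : (pi @^-1` P 0) s.
  apply: (prime_expr HP0 (n := l)); have [a [i [Ji ->]]] := Js.
  by apply: (idealD (prime_idl HP0)); [rewrite mulrC|apply: P0J].
by have [r [nr /I0J Ir]] := P0I0 s P0s; exists r.
Qed.
End LocalStructure.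

(** * Etale coordinates: Taylor expansions and p-bases *)

Section Truncation.
Variables (B : comNzRingType) (N : nat).
Hypothesis N0 : (0 < N)%N.

(** The ring [B[T] / (T ^ N)]; [co i] is the coefficient of [T ^ i]. *)
Lemma truncated_polynomials : exists (C : comNzRingType) (io : {rmorphism B -> C})
  (T : C) (co : nat -> C -> B),
  [/\ T ^+ N = 0, forall c, c = \sum_(i < N) io (co i c) * T ^+ i &
      forall (b : nat -> B) a, (a < N)%N -> co a (\sum_(i < N) io (b i) * T ^+ i) = b a].
Proof.
pose I := [set ('X^N : {poly B})].
have gen p : ideal_gen I p <-> exists y, p = 'X^N * y.
  split=> [/ideal_gen1//|[y ->]]; rewrite mulrC.
  by apply: (idealMl _ (ideal_gen_ideal I)); apply: sub_ideal_gen.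
have eqq (p q : {poly B}) : qring I p = qring I q <-> exists y, p - q = 'X^N * y.
  by rewrite -gen; apply: (@qmodP _ {poly B}^o).
have co_eq (p q : {poly B}) a : (a < N)%N -> qring I p = qring I q -> p`_a = q`_a.
  move=> aN /eqq[y E]; apply/eqP; rewrite -subr_eq0 -coefB E coefXnM aN //.
have n1 : (1 : quotring I) <> 0.
  rewrite -(rmorph1 (qring I)) -(rmorph0 (qring I)) => /(co_eq _ _ 0%N N0).
  by rewrite coef1 coef0 eqxx => /eqP; rewrite oner_eq0.
have [C [f [g [fK gK]]]] := comNzRing_of n1.
pose qf p := f (qring I p).
have [io ioE] : exists io : {rmorphism B -> C}, forall b, io b = qf b%:P.
  have [|| io H] := @rmorphism_of B C (fun b => qf b%:P).
  - by move=> a b; rewrite /qf polyCB !rmorphB.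
  - by split=> [|a b]; rewrite /qf ?polyCM ?rmorphM // polyC1 !rmorph1.
  by exists io => b; rewrite H.
have qfsum (b : nat -> B) : \sum_(i < N) io (b i) * qf 'X ^+ i = qf (\poly_(i < N) b i).
  rewrite poly_def /qf !rmorph_sum; apply: eq_bigr => i _.
  by rewrite ioE /qf -!rmorphXn -!rmorphM mul_polyC.
exists C, io, (qf 'X), (fun a c => (repr (g c) : {poly B})`_a); split.
- rewrite /qf -rmorphXn -rmorphXn /=; have -> : qring I ('X ^+ N) = 0; last exact: rmorph0.
  by rewrite -(rmorph0 (qring I)); apply/eqq; exists 1; rewrite subr0 mulr1.
- move=> c; rewrite (qfsum (fun a => (repr (g c) : {poly B})`_a)) /qf.
  apply: (can_inj gK); rewrite fK; set p : {poly B} := repr (g c).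
  rewrite -[LHS]qringK -/p; apply/eqq; exists (drop_poly N p).
  by rewrite mulrC -[X in X - _](poly_take_drop N) addrAC /take_poly subrr add0r.
- move=> b a aN; rewrite qfsum /qf fK (@co_eq _ (\poly_(i < N) b i)) ?coef_poly ?aN //.
  exact: qringK.
Qed.
End Truncation.

Section Chart.
Variables (m : nat) (B : comNzRingType).
Local Notation S := {mpoly int[m]}.
Variables (th : {rmorphism S -> B}) (h : S) (hi : B) (gs ys : seq S) (U : 'M[S]_m).
Local Notation zs := (gs ++ ys).
Local Notation Jac := (\matrix_(i < m, j < m) (nth 0 zs i)^`M(j)).
Hypotheses (hK : hi * th h = 1) (szm : size zs = m) (UJ : U *m Jac = h%:M)
  (JU : Jac *m U = h%:M) (gs0 : forall g, g \in gs -> th g = 0)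
  (dens : forall b, exists k s, b = hi ^+ k * th s)
  (kers : forall s, th s = 0 -> exists k, ideal_gen [set` gs] (h ^+ k * s)).

Lemma chart_hom_uniq (C : comPzRingType) (f g : {rmorphism B -> C}) :
  (forall i, f (th 'X_i) = g (th 'X_i)) -> f =1 g.
Proof.
move=> fg b; have fgS s : f (th s) = g (th s).
  pose E := [set s | f (th s) = g (th s)].
  change (E s); apply: mpoly_generates => [|y ys']; last first.
    by have /mapP[i _ ->] := ys'; apply: fg.
  split=> [|x y Ex Ey|x y Ex Ey]; rewrite /E /=.
  - by rewrite !rmorph1. - by rewrite !rmorphB Ex Ey. - by rewrite !rmorphM Ex Ey.
have fgh : f hi = g hi.
  rewrite -[f hi]mulr1 -(rmorph1 g) -hK rmorphM -fgS mulrCA -rmorphM hK rmorph1.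
  exact: mulr1.
have [k [s ->]] := dens b; by rewrite !rmorphM !rmorphXn fgh fgS.
Qed.

(** [B] is [S / (gs)] with [h] inverted, so a point with values in [C] extends to [B] as soon as the
    [gs] vanish and [h] is invertible there. *)
Lemma chart_hom (C : comNzRingType) (a : 'I_m -> C) (v : C) :
  (forall g, g \in gs -> mev a g = 0) -> v * mev a h = 1 ->
  exists ta : {rmorphism B -> C}, forall s, ta (th s) = mev a s.
Proof.
move=> ag vh.
have agen s : ideal_gen [set` gs] s -> mev a s = 0.
  by move=> H; apply: (ideal_gen_min (kernel_ideal (mev a)) _ H) => g; apply: ag.
have hX k : hi ^+ k * th h ^+ k = 1 by rewrite -exprMn hK expr1n.
have vX k : v ^+ k * mev a h ^+ k = 1 by rewrite -exprMn vh expr1n.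
have wd k s k' s' : hi ^+ k * th s = hi ^+ k' * th s' -> v ^+ k * mev a s = v ^+ k' * mev a s'.
  move=> E; have /kers[j] : th (h ^+ k' * s - h ^+ k * s') = 0.
    rewrite rmorphB !rmorphM !rmorphXn.
    have -> : th s = th h ^+ k * (hi ^+ k * th s) by rewrite mulrA (mulrC (th h ^+ k)) hX mul1r.
    rewrite E; have -> : th h ^+ k' * (th h ^+ k * (hi ^+ k' * th s')) =
      (hi ^+ k' * th h ^+ k') * (th h ^+ k * th s') by ring.
    by rewrite hX mul1r subrr.
  move/agen; rewrite rmorphM rmorphB !rmorphM !rmorphXn => /(congr1 ( *%R (v ^+ j))).
  rewrite mulrA vX mul1r mulr0 => /eqP; rewrite subr_eq0 => /eqP E'.
  have -> : mev a s = v ^+ k' * (mev a h ^+ k' * mev a s) by rewrite mulrA vX mul1r.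
  by rewrite E' mulrCA (mulrA (v ^+ k)) vX mul1r.
pose kk b := sval (cid (dens b)).
pose ss b := sval (cid (svalP (cid (dens b)))).
have E b : b = hi ^+ kk b * th (ss b) := svalP (cid (svalP (cid (dens b)))).
pose f b := v ^+ kk b * mev a (ss b).
have fE k s : f (hi ^+ k * th s) = v ^+ k * mev a s by apply: wd; rewrite -E.
have [||ta taE] := @rmorphism_of B C f; last first.
- by exists ta => s; rewrite taE -[th s]mul1r -(expr0 hi) fE expr0 mul1r.
- split=> [|b c]; first by have := fE 0%N 1; rewrite !expr0 !rmorph1 !mulr1.
  rewrite [in LHS](E b) [in LHS](E c) mulrACA -exprD -rmorphM fE exprD rmorphM.
  by rewrite mulrACA.
- move=> b c; rewrite {1}(E b) {1}(E c).
  have -> : hi ^+ kk b * th (ss b) - hi ^+ kk c * th (ss c) =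
    hi ^+ (kk b + kk c) * th (h ^+ kk c * ss b - h ^+ kk b * ss c).
    rewrite rmorphB !rmorphM !rmorphXn exprD mulrBr -!mulrA; congr (_ - _).
      by congr (_ * _); rewrite mulrA hX mul1r.
    by rewrite [RHS]mulrCA; congr (_ * _); rewrite mulrA hX mul1r.
  rewrite fE rmorphB !rmorphM !rmorphXn exprD mulrBr -!mulrA; congr (_ - _).
    by rewrite /f; congr (_ * _); rewrite mulrA vX mul1r.
  by rewrite /f mulrCA; congr (_ * _); rewrite mulrA vX mul1r.
Qed.

(** Newton's iteration: the inverse Jacobian [U / h] improves an approximate solution by one power
    of [T], and [T] is nilpotent. This is the infinitesimal lifting property of etale
    coordinates. *)
Lemma newton (C : comNzRingType) (T v0 : C) (N : nat) (a0 : 'I_m -> C) (tgt : 'I_m -> C) :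
  T ^+ N = 0 -> (forall i : 'I_m, exists c, mev a0 (nth 0 zs i) - tgt i = T * c) ->
  v0 * mev a0 h = 1 ->
  exists a v, [/\ forall i, exists c, a i - a0 i = T * c,
    forall i : 'I_m, mev a (nth 0 zs i) = tgt i & v * mev a h = 1].
Proof.
move=> TN E0 v0h.
have mevT a F : (forall i, exists c, a i - a0 i = T * c) ->
    exists c, mev a F - mev a0 F = T * c.
  move=> aa0; have HK : ideal [set c : C | exists d, c = T * d] := multiples_ideal T.
  have := @mev_taylor m C a0 a _ HK _ F; case=> [i j|d Ed].
    by have [c ->] := aa0 i; exists (c * (a j - a0 j)); rewrite mulrA.
  apply: (idealBr HK (y := \sum_i mev a0 F^`M(i) * (a i - a0 i))); first by exists d.
  by apply: (ideal_sum _ HK) => i _; apply: (idealMl _ HK); apply: aa0.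
have inv a : (forall i, exists c, a i - a0 i = T * c) -> exists v, v * mev a h = 1.
  move=> /(mevT a h)[c Ec].
  have -> : mev a h = mev a0 h * (1 - (- v0 * c) * T).
    have -> : mev a h = mev a0 h + T * c by rewrite -Ec addrC subrK.
    have -> : mev a0 h * (1 - (- v0 * c) * T) = mev a0 h + (v0 * mev a0 h) * (T * c) by ring.
    by rewrite v0h mul1r.
  (* A geometric series: the value of [h] changes by a nilpotent amount and stays invertible. *)
  exists (v0 * \sum_(i < N) (- v0 * c * T) ^+ i); rewrite mulrACA v0h mul1r mulrC.
  rewrite -opprB mulNr -subrX1 exprMn TN mulr0 sub0r opprK //.
have step k : exists a, (forall i, exists c, a i - a0 i = T * c) /\
    forall i : 'I_m, exists c, mev a (nth 0 zs i) - tgt i = T ^+ k.+1 * c.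
  elim: k => [|k [a [aa0 Ea]]].
    by exists a0; split=> i; [exists 0; rewrite subrr mulr0|rewrite expr1; apply: E0].
  have [v vh] := inv a aa0.
  pose ep (i : 'I_m) := mev a (nth 0 zs i) - tgt i.
  (* The Newton correction: minus the inverse Jacobian applied to the error. *)
  pose dl j := - v * \sum_l mev a (U j l) * ep l.
  have epT l : exists c, ep l = T ^+ k.+1 * c := Ea l.
  have dlT j : exists c, dl j = T ^+ k.+1 * c.
    have HK : ideal [set c : C | exists d, c = T ^+ k.+1 * d] := multiples_ideal _.
    apply: (idealMl _ HK); apply: (ideal_sum _ HK) => l _; apply: (idealMl _ HK).
    exact: epT.
  exists (fun j => a j + dl j); split=> [i|i].
    have [c Ec] := dlT i; have [d Ed] := aa0 i; exists (T ^+ k * c + d).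
    by rewrite addrAC Ed Ec exprS mulrDr mulrA addrC.
  have HK : ideal [set c : C | exists d, c = T ^+ k.+2 * d] := multiples_ideal _.
  have := @mev_taylor m C a (fun j => a j + dl j) _ HK _ (nth 0 zs i); case=> [j j'|c Ec].
    have [c Ec] := dlT j; have [d Ed] := dlT j'; exists (T ^+ k * (c * d)).
    rewrite !(addrC (a _)) !addrK Ec Ed [in LHS]exprS [in RHS]exprSr exprSr; ring.
  exists c; rewrite -Ec; have -> : \sum_j mev a (nth 0 zs i)^`M(j) * (a j + dl j - a j) = - ep i.
    transitivity (- v * \sum_l mev a ((Jac *m U) i l) * ep l).
      under eq_bigr => j _ do rewrite (addrC (a j)) addrK /dl mulrCA mulr_sumr.
      rewrite -mulr_sumr exchange_big; congr (_ * _); apply: eq_bigr => l _.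
      rewrite mxE rmorph_sum mulr_suml; apply: eq_bigr => j _.
      by rewrite rmorphM !mxE mulrA.
    rewrite JU (bigD1 i) //= big1 ?addr0 => [|l li].
      by rewrite mxE eqxx mulr1n mulrA mulNr vh mulN1r.
    by rewrite mxE eq_sym (negPf li) mulr0n rmorph0 mul0r.
  by rewrite /ep; ring.
have [a [aa0 Ea]] := step N; have [v vh] := inv a aa0; exists a, v; split=> // i.
apply/eqP; rewrite -subr_eq0; have [c ->] := Ea i.
by rewrite exprS TN mulr0 mul0r.
Qed.

Definition chart_coord (i : nat) : B := th (nth 0 ys i).
Local Notation x := chart_coord.

(** Taylor expansion in the [j]-th coordinate, modulo [T ^ N]: the target value of that coordinate
    is moved by [T] and [newton] solves for the point; the [gs] keep the value zero, so the solution
    is a homomorphism on [B]. *)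
Lemma chart_hs (N j : nat) : (0 < N)%N ->
  exists (C : comNzRingType) (io ta : {rmorphism B -> C}) (T : C) (co : nat -> C -> B),
  [/\ T ^+ N = 0, forall c, c = \sum_(i < N) io (co i c) * T ^+ i,
      forall (b : nat -> B) a, (a < N)%N -> co a (\sum_(i < N) io (b i) * T ^+ i) = b a,
      forall b, exists c, ta b = io b + T * c &
      forall i, (i < size ys)%N -> ta (x i) = io (x i) + (i == j)%:R * T].
Proof.
move=> N0; have [C [io [T [co [TN coE coK]]]]] := truncated_polynomials B N0.
pose a0 i := io (th 'X_i).
have a0E : mev a0 =1 io \o th.
  by apply: (mpoly_hom_ext (g := io \o th)) => i; rewrite mevX.
pose tgt (i : 'I_m) : C := io (th (nth 0 zs i)) + (i == size gs + j :> nat)%N%:R * T.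
have [||a [v [aa0 Ea vh]]] := @newton C T (io hi) N a0 tgt TN.
- by move=> i; rewrite a0E /tgt opprD addrA subrr add0r; exists (- (i == size gs + j :> nat)%N%:R);
    rewrite mulrN mulrC.
- by rewrite a0E /= -rmorphM hK rmorph1.
have [|ta taE] := @chart_hom C a v _ vh.
  move=> g gg; have ig : (index g gs < m)%N.
    have := szm; rewrite size_cat; have : (index g gs < size gs)%N by rewrite index_mem.
    lia.
  have := Ea (Ordinal ig); rewrite /tgt /= nth_cat index_mem gg nth_index // => ->.
  rewrite gs0 // rmorph0 add0r; case: eqP => [E|_]; last by rewrite mul0r.
  by move: gg; rewrite -index_mem E ltnNge leq_addr.
exists C, io, ta, T, co; split=> //.
- have HK : ideal [set c : C | exists d, c = T * d] := multiples_ideal T.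
  pose qh b := qring [set c : C | exists d, c = T * d] b.
  have E : forall b, qring [set c : C | exists d, c = T * d] (ta b) =
                     qring [set c : C | exists d, c = T * d] (io b).
    apply: (chart_hom_uniq (f := qring _ \o ta) (g := qring _ \o io)) => i /=.
    apply/(@qmodP C C^o); apply: sub_ideal_gen.
    by rewrite taE mevX; apply: aa0.
  move=> b; have /(@qmodP C C^o) H := E b.
  have [c Ec] := ideal_gen_min HK (fun _ H => H) H.
  by exists c; rewrite -Ec addrC subrK.
- move=> i iy; have im : (size gs + i < m)%N by have := szm; rewrite size_cat; lia.
  rewrite /x taE; have := Ea (Ordinal im); rewrite /tgt /= nth_cat ltnNge leq_addr /= addKn.
  by rewrite eqn_add2l.
Qed.
End Chart.

(** * Monomial bases over the ring of [p]-th powers *)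

Section PowerSpan.
Variables (B : comNzRingType) (D : set B) (p : nat).
Hypotheses (HD : subring_set D) (Dp : forall b, D (b ^+ p)) (p0 : (0 < p)%N).

Lemma subring_set1 : D 1. Proof. by case: HD. Qed.
Lemma subring_setM x y : D x -> D y -> D (x * y). Proof. by case: HD => _ _; apply. Qed.
Lemma subring_set0 : D 0.
Proof. by case: HD => D1 DB _; rewrite -(subrr 1); apply: DB. Qed.
Lemma subring_setX x n : D x -> D (x ^+ n).
Proof.
move=> Dx; elim: n => [|n IH]; first exact: subring_set1.
by rewrite exprS; apply: subring_setM.
Qed.
Lemma subring_set_sum (I : Type) (r : seq I) (P : pred I) (F : I -> B) :
  (forall i, P i -> D (F i)) -> D (\sum_(i <- r | P i) F i).
Proof.
by move=> H; elim/big_ind: _ => //; [exact: subring_set0|move=> x y; apply: subring_setD].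
Qed.
Lemma subring_set_det n (A : 'M[B]_n) : (forall i j, D (A i j)) -> D (\det A).
Proof.
move=> DA; apply: subring_set_sum => s _; apply: subring_setM.
  apply: subring_setX; rewrite -sub0r; case: HD => D1 DB _; apply: DB => //.
  exact: subring_set0.
by elim/big_ind: _ => // [|x y]; [exact: subring_set1|exact: subring_setM].
Qed.

(** The span of [ws] over [D], in impredicative form because [D] is a set rather than a ring
    structure. *)
Definition rspan (ws : seq B) : set B := [set b | forall T : set B, T 0 ->
  (forall x y, T x -> T y -> T (x + y)) -> (forall d w, D d -> w \in ws -> T (d * w)) -> T b].

Lemma rspan0 ws : rspan ws 0. Proof. by move=> T. Qed.
Lemma rspanD ws x y : rspan ws x -> rspan ws y -> rspan ws (x + y).
Proof. by move=> Hx Hy T T0 TD Tw; apply: (TD _ _); [apply: Hx|apply: Hy]. Qed.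
Lemma rspan_mem ws d w : D d -> w \in ws -> rspan ws (d * w).
Proof. by move=> Dd ww T _ _; apply. Qed.
Lemma rspan_mul ws ws' c x : (forall w, w \in ws -> rspan ws' (c * w)) ->
  (forall d y, D d -> rspan ws' y -> rspan ws' (d * y)) -> rspan ws x -> rspan ws' (c * x).
Proof.
move=> H1 H2 Hx; apply: (Hx (fun x => rspan ws' (c * x))) => [|a b|d w Dd ww].
- by rewrite mulr0; apply: rspan0.
- by rewrite mulrDr; apply: rspanD.
- by rewrite mulrCA; apply: H2 => //; apply: H1.
Qed.
Lemma rspanZ ws d y : D d -> rspan ws y -> rspan ws (d * y).
Proof.
move=> Dd Hy; apply: (Hy (fun x => rspan ws (d * x))) => [|a b|d' w Dd' ww].
- by rewrite mulr0; apply: rspan0.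
- by rewrite mulrDr; apply: rspanD.
- by rewrite mulrA; apply: rspan_mem => //; apply: subring_setM.
Qed.

Lemma rspanP ws b : rspan ws b ->
  exists a : nat -> B, (forall i, D (a i)) /\ b = \sum_(i < size ws) a i * ws`_i.
Proof.
move=> H; apply: (H (fun b => exists a : nat -> B, (forall i, D (a i)) /\
  b = \sum_(i < size ws) a i * ws`_i)) => [|x y [a [Da ->]] [a' [Da' ->]]|d w Dd ww].
- exists (fun=> 0); split=> [_|]; first exact: subring_set0.
  by rewrite big1 // => i _; rewrite mul0r.
- exists (fun i => a i + a' i); split=> [i|]; first exact: subring_setD.
  by rewrite -big_split; apply: eq_bigr => i _; rewrite mulrDl.
- exists (fun i => (i == index w ws)%:R * d); split=> [i|].
    by apply: subring_setM => //; case: eqP => _; [exact: subring_set1|exact: subring_set0].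
  have iw : (index w ws < size ws)%N by rewrite index_mem.
  rewrite (bigD1 (Ordinal iw)) //= eqxx mul1r nth_index // big1 ?addr0 // => i ne.
  suff -> : (i == index w ws :> nat) = false by rewrite !mul0r.
  by apply: contraNF ne => /eqP E; apply/eqP/val_inj.
Qed.

(** [B] is finite over [D], which contains all [p]-th powers: monomials in the generators with
    exponents below [p] suffice. *)
Lemma power_span (gs : seq B) : generates gs -> exists ws, forall b, rspan ws b.
Proof.
move=> gens.
suff [ws [w1 H]] : exists ws, 1 \in ws /\ forall g x, g \in gs -> rspan ws x -> rspan ws (g * x).
  exists ws => b; suff E : forall b x, rspan ws x -> rspan ws (b * x).
    by rewrite -[b]mulr1; apply: E; rewrite -[1]mulr1; apply: rspan_mem => //; exact: subring_set1.
  move=> {}b; apply: (gens [set b | forall x, rspan ws x -> rspan ws (b * x)]); last first.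
    by move=> g gg x; apply: H.
  split=> [x|a c Ha Hc x Hx|a c Ha Hc x Hx] /=; rewrite ?mul1r //.
    rewrite mulrBl; apply: rspanD; first exact: Ha.
    rewrite -mulN1r; apply: rspanZ; last exact: Hc.
    by rewrite -sub0r; case: HD => D1 DB _; apply: DB => //; exact: subring_set0.
  by rewrite -mulrA; apply: (Ha _ (Hc _ Hx)).
elim: gs {gens} => [|g gs [ws [w1 IH]]]; first by exists [:: 1]; rewrite mem_head.
pose ws' := [seq w * g ^+ i | w <- ws, i <- iota 0 p].
have mem' w i : w \in ws -> (i < p)%N -> w * g ^+ i \in ws'.
  by move=> ww ip; apply/allpairsP; exists (w, i); rewrite mem_iota.
have emb i x : (i < p)%N -> rspan ws x -> rspan ws' (g ^+ i * x).
  move=> ip; apply: rspan_mul => [w ww|d y]; last exact: rspanZ.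
  by rewrite -[_ * w]mul1r [g ^+ i * w]mulrC; apply: rspan_mem; [exact: subring_set1|exact: mem'].
exists ws'; split; first by rewrite -[1]mulr1 -(expr0 g); apply: mem'.
move=> c x; rewrite inE => /orP[/eqP ->|cg]; apply: rspan_mul => [w|d y]; try exact: rspanZ.
  move=> /allpairsP[[v i] /= [vv]]; rewrite mem_iota /= => ip ->.
  rewrite mulrCA -exprS; case: (ltnP i.+1 p) => ip'.
    by rewrite -[_ * _]mul1r; apply: rspan_mem; [exact: subring_set1|exact: mem'].
  have -> : i.+1 = p by lia.
  by rewrite mulrC; apply: rspan_mem => //; rewrite -[v]mulr1 -(expr0 g); apply: mem'.
move=> /allpairsP[[v i] /= [vv]]; rewrite mem_iota /= => ip ->.
rewrite mulrA mulrC; apply: emb => //; apply: IH => //.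
by rewrite -[v]mul1r; apply: rspan_mem => //; exact: subring_set1.
Qed.

(* Determinant trick: if [t B] lies in [D + (D :&: M) B], then some element of [D] *)
(* outside [M] multiplies [B] into [D].                                              *)
Lemma conductor_outside (gs : seq B) (M : set B) t : generates gs -> prime_ideal M -> D t -> ~ M t ->
  (forall b, exists (a : B) (r : seq (B * B)), [/\ D a, t * b = a + \sum_(z <- r) z.1 * z.2 &
     forall z, z \in r -> D z.1 /\ M z.1]) ->
  exists d, [/\ D d, ~ M d & forall b, D (d * b)].
Proof.
move=> gens HM Dt nMt H; have [ws Hws] := power_span gens.
pose N := size ws.
have IM := prime_idl HM.
have H' b : exists (a : B) (c : nat -> B), [/\ D a, forall i, D (c i) /\ M (c i) &
    t * b = a + \sum_(i < N) c i * ws`_i].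
  have [a [r [Da -> Hr]]] := H b.
  suff [c [Hc ->]] : exists c : nat -> B, (forall i, D (c i) /\ M (c i)) /\
      \sum_(z <- r) z.1 * z.2 = \sum_(i < N) c i * ws`_i by exists a, c.
  elim: r Hr => [|z r IH] Hr.
    exists (fun=> 0); split=> [_|]; first by split; [exact: subring_set0|exact: ideal0].
    by rewrite big_nil big1 // => i _; rewrite mul0r.
  have [|c [Hc E]] := IH; first by move=> z' zr; apply: Hr; rewrite inE zr orbT.
  have [Dz Mz] := Hr z (mem_head _ _); have [e [De Ee]] := rspanP (Hws z.2).
  exists (fun i => z.1 * e i + c i); split=> [i|].
    have [Dc Mc] := Hc i; split; first by apply: subring_setD => //; apply: subring_setM.
    by apply: (idealD IM) => //; apply: (idealMr _ IM).
  rewrite big_cons E {1}Ee mulr_sumr -big_split; apply: eq_bigr => i _ /=.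
  by rewrite mulrDl mulrA.
pose a b := sval (cid (H' b)).
pose c b := sval (cid (svalP (cid (H' b)))).
have acP b : [/\ D (a b), forall i, D (c b i) /\ M (c b i) &
    t * b = a b + \sum_(i < N) c b i * ws`_i] := svalP (cid (svalP (cid (H' b)))).
pose w : 'cV[B]_N := \col_i ws`_i.
(* [A] maps the column of the [ws] to a column over [D], so by the adjugate its determinant
   multiplies every [ws] into [D]; modulo [M] this determinant is [t ^ N]. *)
pose A : 'M[B]_N := t%:M - \matrix_(i, j) c ws`_i j.
have Aw : A *m w = \col_i a ws`_i.
  apply/colP => i; rewrite mulmxBl mul_scalar_mx !mxE.
  have [_ _ ->] := acP ws`_i; apply/eqP; rewrite subr_eq; apply/eqP; congr (_ + _).
  by apply: eq_bigr => j _; rewrite !mxE.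
have DA i j : D (A i j).
  rewrite !mxE; case: HD => D1 DB _; apply: DB; last by have [_ /(_ j)[]] := acP ws`_i.
  by case: eqP => _; rewrite ?mulr1n ?mulr0n //; exact: subring_set0.
have Dadj i j : D (\adj A i j).
  rewrite mxE; apply: subring_setM.
    apply: subring_setX; rewrite -sub0r; case: HD => D1 DB _; apply: DB => //.
    exact: subring_set0.
  by apply: subring_set_det => i' j'; rewrite 2![in D _]mxE; apply: DA.
exists (\det A); split; first exact: subring_set_det.
- have [L [kp [kp0 _]]] := residue_field_of HM.
  move=> /kp0; rewrite -det_map_mx.
  have -> : map_mx kp A = (kp t)%:M.
    apply/matrixP => i j; rewrite !mxE rmorphB rmorphMn.
    by have [_ /(_ j)[_ /kp0 ->] _] := acP ws`_i; rewrite subr0.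
  rewrite det_scalar => /eqP; rewrite expf_eq0 => /andP[_ /eqP/kp0] //.
- move=> b; have [e [De ->]] := rspanP (Hws b); rewrite mulr_sumr.
  apply: subring_set_sum => i _; rewrite mulrCA; apply: subring_setM => //.
  have -> : \det A * ws`_i = (\adj A *m (\col_i a ws`_i)) i 0.
    by rewrite -Aw mulmxA mul_adj_mx mul_scalar_mx !mxE.
  rewrite mxE; apply: subring_set_sum => j _; apply: subring_setM => //.
  by rewrite mxE; have [] := acP ws`_j.
Qed.
End PowerSpan.

Section PowerBasis.
Variables (B : comNzRingType) (x : nat -> B) (n p : nat).
Hypothesis pp : prime p.

Definition pmono (g : {ffun 'I_n -> 'I_p}) : B := \prod_(i < n) x i ^+ g i.

(** When all of [B] has this form, the monomials [pmono] span [B / p] over its [p]-th powers. *)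
Definition pform : set B := [set b | exists (c : {ffun 'I_n -> 'I_p} -> B) b',
  b = \sum_g pmono g * c g ^+ p + p%:R * b'].

Lemma frobenius_add_mod (b c : B) n' : exists d,
  (b + c) ^+ (p ^ n') = b ^+ (p ^ n') + c ^+ (p ^ n') + p%:R * d.
Proof.
have HI := @multiples_ideal B p%:R.
have p0 : p%:R = 0 :> quotring [set z : B | exists y, z = p%:R * y].
  by rewrite -(rmorph_nat (qring _)); apply/(qring_eq0 _ HI); exists 1; rewrite mulr1.
have [d E] : [set z : B | exists y, z = p%:R * y]
    ((b + c) ^+ (p ^ n') - (b ^+ (p ^ n') + c ^+ (p ^ n'))).
  apply/(qring_eq0 _ HI); rewrite rmorphB rmorphD !rmorphXn rmorphD.
  by rewrite (frobeniusX_add pp p0) subrr.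
by exists d; rewrite -E addrCA subrr addr0.
Qed.

Lemma pform_p b : pform (p%:R * b).
Proof.
exists (fun=> 0), b; rewrite big1 ?add0r // => g _.
by rewrite expr0n eqn0Ngt prime_gt0 // mulr0.
Qed.

Lemma pform0 : pform 0. Proof. by rewrite -[0](mulr0 p%:R); apply: pform_p. Qed.

Lemma pformD b b' : pform b -> pform b' -> pform (b + b').
Proof.
move=> [c [d ->]] [c' [d' ->]]; have F g : exists d, (c g + c' g) ^+ p = c g ^+ p + c' g ^+ p + p%:R * d.
  by have := frobenius_add_mod (c g) (c' g) 1; rewrite expn1.
pose f g := sval (cid (F g)); have fE g := svalP (cid (F g)); rewrite -/(f _) in fE.
exists (fun g => c g + c' g), (d + d' - \sum_g pmono g * f g).
under [in RHS]eq_bigr => g _ do rewrite fE !mulrDr mulrCA.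
rewrite !big_split /= -mulr_sumr; ring.
Qed.

Lemma pform_sum (I : Type) (r : seq I) (P : pred I) (F : I -> B) :
  (forall i, P i -> pform (F i)) -> pform (\sum_(i <- r | P i) F i).
Proof. by move=> H; elim/big_ind: _ => //; [exact: pform0|exact: pformD]. Qed.

Lemma pform_term g c : pform (pmono g * c ^+ p).
Proof.
exists (fun g' => (g' == g)%:R * c), 0; rewrite mulr0 addr0 (bigD1 g) //= eqxx mul1r.
rewrite big1 ?addr0 // => g' /negPf ->.
by rewrite mul0r expr0n eqn0Ngt prime_gt0 // mulr0.
Qed.

Lemma pform_mulp b c : pform b -> pform (c ^+ p * b).
Proof.
move=> [d [b' ->]]; rewrite mulrDr mulr_sumr; apply: pformD; last by rewrite mulrCA; apply: pform_p.
by apply: pform_sum => g _; rewrite mulrCA -exprMn; apply: pform_term.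
Qed.

Lemma pform_mulx b i : (i < n)%N -> pform b -> pform (x i * b).
Proof.
move=> ni [d [b' ->]]; rewrite mulrDr mulr_sumr; apply: pformD; last by rewrite mulrCA; apply: pform_p.
apply: pform_sum => g _; pose i' := Ordinal ni.
have E : x i * pmono g = x i ^+ (g i').+1 * \prod_(j < n | j != i') x j ^+ g j.
  by rewrite /pmono (bigD1 i') //= mulrA -exprS.
rewrite mulrA E; case: (ltnP (g i').+1 p) => gp.
  have := pform_term [ffun j => if j == i' then Ordinal gp else g j] (d g).
  rewrite /pmono (bigD1 i') //= ffunE eqxx /=.
  by under eq_bigr => j ne do rewrite ffunE (negPf ne).
have {}gp : (g i').+1 = p by have := ltn_ord (g i'); lia.
rewrite gp -mulrA; apply: pform_mulp.
have := pform_term [ffun j => if j == i' then Ordinal (prime_gt0 pp) else g j] (d g).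
rewrite /pmono (bigD1 i') //= ffunE eqxx /= expr0 mul1r.
by under eq_bigr => j ne do rewrite ffunE (negPf ne).
Qed.

(** The multipliers of [pform] form a subring, to which the determinant trick applies; as [1] has
    the form, it is enough that every element be a multiplier. *)
Definition pring : set B := [set b | forall z, pform z -> pform (b * z)].

Lemma pring_subring : subring_set pring.
Proof.
split=> [z Hz|a b Ha Hb z Hz|a b Ha Hb z Hz]; rewrite ?mul1r //; last first.
  by rewrite -mulrA; apply: (Ha _ (Hb _ Hz)).
rewrite mulrBl; apply: pformD; first exact: Ha.
have nform k y : pform y -> pform (k%:R * y).
  move=> Hy; elim: k => [|k IH]; first by rewrite mul0r; apply: pform0.
  by rewrite mulrS mulrDl mul1r; apply: pformD.
have -> : - (b * z) = p.-1%:R * (b * z) + p%:R * (- (b * z)).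
  by rewrite -[in p%:R](prednK (prime_gt0 pp)) mulrS; ring.
by apply: pformD; [apply/nform/Hb|apply: pform_p].
Qed.

Lemma pring_X b : pring (b ^+ p). Proof. by move=> z; apply: pform_mulp. Qed.
Lemma pring_p b : pring (p%:R * b). Proof. by move=> z _; rewrite -mulrA; apply: pform_p. Qed.
Lemma pring_x i : (i < n)%N -> pring (x i).
Proof. by move=> ni z; apply: pform_mulx. Qed.

Lemma pform1 : pform 1.
Proof.
have := pform_term [ffun=> Ordinal (prime_gt0 pp)] 1; rewrite /pmono expr1n mulr1.
by rewrite big1 // => i _; rewrite ffunE expr0.
Qed.

(* If the [x i - x i ^ q] and [p] generate every maximal ideal over [p] locally, *)
(* the [x i] form a [p]-basis: the ideal of the [a] with [a ^ p B] in [pring] is   *)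
(* contained in no maximal ideal.                                                  *)
Lemma pform_all (gs : seq B) : generates gs ->
  (forall M, maximal_ideal M -> exists l e, [/\ prime l /\ (0 < e)%N, M l%:R,
     forall b, M (b ^+ (l ^ e) - b) &
     leQ M M (iexts [set z | exists y, z = l%:R * y] [seq x i - x i ^+ (l ^ e) | i <- iota 0 n])]) ->
  forall b, pform b.
Proof.
move=> gens HM b; have HR := pring_subring.
suff H : forall b, pring b by rewrite -[b]mulr1; apply: (H b); apply: pform1.
pose c := [set a | forall b, pring (a ^+ p * b)].
have Hc : ideal c.
  apply/idealP; split=> [z|y z Hy Hz d|r y Hy z].
  - rewrite expr0n eqn0Ngt prime_gt0 // mul0r -[0](mulr0 p%:R); exact: pring_p.
  - have [d' E] := frobenius_add_mod y z 1; move: E; rewrite expn1 => ->.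
    rewrite !mulrDl; apply: (subring_setD HR); last by rewrite -mulrA; apply: pring_p.
    by apply: (subring_setD HR); [apply: Hy|apply: Hz].
  - by rewrite exprMn (mulrC (r ^+ p)) -mulrA; apply: Hy.
have [c1|nc1] := EM (c 1); first by move=> a; have := c1 a; rewrite expr1n mul1r.
have [M MM cM] := maximal_over (generates_noetherian gens) Hc nc1.
have HP := maximal_prime MM; have IM := prime_idl HP.
have [l [e [[pl e0] Ml Me Mgen]]] := HM M MM.
have Mp : M p%:R.
  apply: cM => b'; have -> : p%:R ^+ p = p%:R * p%:R ^+ p.-1 :> B.
    by rewrite -exprS prednK ?prime_gt0.
  by rewrite -mulrA; apply: pring_p.
have lp : l = p.
  apply/eqP; apply: contrapT => /negP lp; case: HP => _ M1 _; apply: M1.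
  have : coprime l p by rewrite prime_coprime // dvdn_prime2.
  have [u v E _] := egcdnP p (prime_gt0 pl); rewrite /coprime => /eqP cop.
  have -> : 1 = u%:R * l%:R - v%:R * p%:R :> B.
    by rewrite -!natrM E cop natrD addrAC subrr add0r.
  by apply: (idealB IM); apply: (idealMl _ IM).
move: Ml Me Mgen; rewrite lp => _ Me Mgen {lp}.
have noeB := generates_noetherian gens.
have HI : ideal (iexts [set z | exists y, z = p%:R * y] [seq x i - x i ^+ (p ^ e) | i <- iota 0 n]).
  by apply: iexts_ideal; apply: multiples_ideal.
have [s [ns Hs]] := leQ_common noeB HP HI IM Mgen.
have Dq b' : pring (b' ^+ (p ^ e)).
  by rewrite -(prednK e0) expnSr exprM; apply: pring_X.
pose K := [set z | exists r : seq (B * B), z = \sum_(w <- r) w.1 * w.2 /\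
  forall w, w \in r -> pring w.1 /\ M w.1].
have HK : ideal K.
  apply/idealP; split=> [|y z [r [-> Hr]] [r' [-> Hr']]|c' y [r [-> Hr]]].
  - by exists [::]; rewrite big_nil.
  - exists (r ++ r'); split=> [|w]; first by rewrite big_cat.
    by rewrite mem_cat => /orP[/Hr|/Hr'].
  - exists [seq (w.1, c' * w.2) | w <- r]; split=> [|w /mapP[w' w'r ->]]; last exact: (Hr _ w'r).
    by rewrite big_map mulr_sumr; apply: eq_bigr => w _; rewrite mulrCA.
have KI : iexts [set z | exists y, z = p%:R * y] [seq x i - x i ^+ (p ^ e) | i <- iota 0 n] `<=` K.
  apply: iexts_min => [|z [y ->]|z /mapP[i]] //.
    exists [:: (p%:R, y)]; rewrite big_seq1; split=> // w; rewrite inE => /eqP -> /=.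
    by split=> //; rewrite -[p%:R]mulr1; apply: pring_p.
  rewrite mem_iota => /= ni ->; exists [:: (x i - x i ^+ (p ^ e), 1)].
  rewrite big_seq1 mulr1; split=> // w; rewrite inE => /eqP -> /=; split.
    by case: HR => _ DB _; apply: DB => //; apply: pring_x.
  by rewrite -opprB; apply: (idealN IM).
(* Every element is its own [p ^ e]-th power, which is a multiplier, up to an element of [M]; and
   [s] multiplies [M] into the ideal generated by multipliers in [M]. So [s ^ p] can serve as
   [t]. *)
have [|d [Dd Md Db]] := conductor_outside HR pring_X (prime_gt0 pp) gens HP (pring_X s) (primeX HP ns).
  move=> b'; have [r [E Hr]] : K (- (s ^+ p.-1) * (s * (b' ^+ (p ^ e) - b'))).
    by apply: (idealMl _ HK); apply/KI/Hs.
  exists (s ^+ p * b' ^+ (p ^ e)), r; split=> //; first by apply: (subring_setM HR) => //; apply: pring_X.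
  rewrite -E mulNr mulrA -exprSr prednK ?prime_gt0 //; ring.
case: Md; apply: cM => b'; rewrite -(prednK (prime_gt0 pp)) exprSr -mulrA.
by apply: (subring_setM HR) => //; apply: (subring_setX HR).
Qed.
End PowerBasis.

Section Chart.
Variables (m : nat) (B : comNzRingType).
Local Notation S := {mpoly int[m]}.
Variables (th : {rmorphism S -> B}) (h : S) (hi : B) (gs ys : seq S) (U : 'M[S]_m).
Local Notation zs := (gs ++ ys).
Local Notation Jac := (\matrix_(i < m, j < m) (nth 0 zs i)^`M(j)).
Hypotheses (hK : hi * th h = 1) (szm : size zs = m) (UJ : U *m Jac = h%:M)
  (gs0 : forall g, g \in gs -> th g = 0)
  (dens : forall b, exists k s, b = hi ^+ k * th s).
Local Notation x := (chart_coord th ys).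

Lemma chart_generates : generates (hi :: [seq th 'X_i | i <- enum 'I_m]).
Proof.
move=> D HD DX b; have [k [s ->]] := dens b.
apply: (subring_setM HD); first by apply: (subring_setX HD); apply: DX; rewrite mem_head.
apply: (mpoly_generates (D := th @^-1` D)) => [|y yX].
  case: HD => D1 DB DM; split=> [|a c Da Dc|a c Da Dc]; rewrite /preimage /=.
  - by rewrite rmorph1. - by rewrite rmorphB; apply: DB. - by rewrite rmorphM; apply: DM.
have /mapP[i _ ->] := yX; apply: DX; rewrite inE; apply/orP; right; apply: map_f.
by rewrite mem_enum.
Qed.

Lemma mderiv_exp (s : S) i k : (s ^+ k.+1)^`M(i) = s^`M(i) * s ^+ k *+ k.+1.
Proof.
elim: k => [|k IH]; first by rewrite expr0 mulr1.
rewrite exprS mderivM IH (mulrS _ k.+1); congr (_ + _).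
by rewrite mulrnAr mulrCA -exprS.
Qed.

(** The combination [sum_i lam_i z_i], found from [U], has the same differential at the point as
    [h s]; [taylor_trick] then puts the difference into [M ^ 2 + (l)], and Nakayama's lemma
    concludes. *)
Lemma chart_max (M : set B) : maximal_ideal M -> exists l e, [/\ prime l /\ (0 < e)%N, M l%:R,
     forall b, M (b ^+ (l ^ e) - b) &
     leQ M M (iexts [set z | exists y, z = l%:R * y]
       [seq x i - x i ^+ (l ^ e) | i <- iota 0 (size ys)])].
Proof.
move=> MM; have HP := maximal_prime MM; have IM := prime_idl HP.
have [l [e [pl e0 Ml Mq]]] := maximal_residue chart_generates MM.
exists l, e; split=> //; set q := (l ^ e)%N.
have q0 : (0 < q)%N by rewrite expn_gt0 prime_gt0.
set I := iexts _ _; have HI : ideal I by apply: iexts_ideal; apply: multiples_ideal.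
apply: (nakayama (generates_noetherian chart_generates) HP) => // b Mb.
exists 1; split=> [|K HK IK MK]; first exact: (prime_n1 HP).
rewrite mul1r; have [k [s Eb]] := dens b; rewrite Eb; apply: (idealMl _ HK).
have Ms : M (th s).
  have -> : th s = th h ^+ k * b by rewrite Eb mulrA (mulrC (_ ^+ _)) -exprMn hK expr1n mul1r.
  exact: (idealMl _ IM).
have -> : th s = hi * th (h * s) by rewrite rmorphM mulrA hK mul1r.
apply: (idealMl _ HK).
pose z (i : nat) := if (i < size gs)%N then nth 0 zs i else nth 0 zs i - nth 0 zs i ^+ q.
pose lam (i : 'I_m) := \sum_j s^`M(j) * U j i.
have HQ := preimage_ideal th IM; have HK' := preimage_ideal th HK.
have Kz (i : 'I_m) : K (th (z i)).
  rewrite /z; case: ltnP => ig.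
    rewrite nth_cat ig gs0; first exact: ideal0.
    exact: mem_nth.
  apply: IK; apply: iexts_mem; first exact: multiples_ideal.
  rewrite rmorphB rmorphXn nth_cat ltnNge ig /=; apply/mapP; exists (i - size gs)%N => //.
  by rewrite mem_iota /=; have := ltn_ord i; have := szm; rewrite size_cat; lia.
have Mz (i : 'I_m) : M (th (z i)).
  rewrite /z; case: ltnP => ig.
    rewrite nth_cat ig gs0; first exact: ideal0.
    exact: mem_nth.
  by rewrite rmorphB rmorphXn -opprB; apply: (idealN IM).
have Md (i : 'I_m) j : M (th ((z i)^`M(j) - (nth 0 zs i)^`M(j))).
  rewrite /z; case: ltnP => ig; first by rewrite subrr rmorph0; apply: ideal0.
  rewrite mderivB addrC addKr -(prednK q0) mderiv_exp prednK // rmorphN rmorphMn -mulr_natr.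
  apply: (idealN IM); apply: (idealMl _ IM).
  by rewrite /q -(prednK e0) expnS natrM; apply: (idealMr _ IM).
suff : (th @^-1` K) (h * s - \sum_i lam i * z i).
  move=> H; apply: (idealBr HK (y := th (\sum_i lam i * z i))); first by rewrite -rmorphB.
  rewrite rmorph_sum; apply: (ideal_sum _ HK) => i _; rewrite rmorphM.
  exact: (idealMl _ HK).
have sumM : M (th (\sum_i lam i * z i)).
  by rewrite rmorph_sum; apply: (ideal_sum _ IM) => i _; rewrite rmorphM; apply: (idealMl _ IM).
apply: (taylor_trick pl e0 HQ HK') => [y|y y' Qy Qy'|y||j]; rewrite /preimage /=.
- by rewrite rmorphB rmorphXn; apply: Mq.
- by rewrite rmorphM; apply: MK.
- rewrite rmorphM rmorph_nat; apply: IK; apply: sub_iexts; by exists (th y).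
- by rewrite rmorphB rmorphM; apply: (idealB IM) => //; apply: (idealMl _ IM).
rewrite mderivB mderivM.
have -> : (\sum_i lam i * z i)^`M(j) = \sum_i (lam i * z i)^`M(j).
  exact: (big_morph _ (mderivD j) (mderiv0 _ j)).
have E : \sum_i lam i * (nth 0 zs i)^`M(j) = h * s^`M(j).
  transitivity (\sum_k s^`M(k) * (U *m Jac) k j).
    under eq_bigr => i _ do rewrite mulr_suml.
    rewrite exchange_big; apply: eq_bigr => k' _; rewrite mxE mulr_sumr.
    by apply: eq_bigr => i _; rewrite mxE mulrA.
  rewrite UJ (bigD1 j) //= big1 ?addr0 => [|k' ne]; first by rewrite mxE eqxx mulr1n mulrC.
  by rewrite mxE (negPf ne) mulr0n mulr0.
have -> : h^`M(j) * s + h * s^`M(j) - \sum_i (lam i * z i)^`M(j) =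
  h^`M(j) * s - \sum_i ((lam i)^`M(j) * z i + lam i * ((z i)^`M(j) - (nth 0 zs i)^`M(j))).
  rewrite -E -addrA -sumrB; congr (_ + _); rewrite -sumrN; apply: eq_bigr => i _.
  by rewrite mderivM; ring.
rewrite rmorphB rmorphM; apply: (idealB IM); first exact: (idealMl _ IM).
rewrite rmorph_sum; apply: (ideal_sum _ IM) => i _; rewrite rmorphD !rmorphM; apply: (idealD IM).
  exact: (idealMl _ IM).
by apply: (idealMl _ IM).
Qed.

Lemma chart_pform p : prime p -> forall b, pform x (size ys) p b.
Proof. by move=> pp; apply: (pform_all pp chart_generates); exact: chart_max. Qed.

(** Algebraic independence over the integers; for [r = 0] it says that [P] contains no nonzero
    integer. *)
Definition indep_mod (c : nat -> B) r (P : set B) :=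
  forall a : {mpoly int[r]}, P (mev (fun i : 'I_r => c i) a) -> a = 0.

Lemma muniX r (i : 'I_r) : muni (mwiden ('X_i : {mpoly int[r]})) = ('X_i)%:P.
Proof.
rewrite mwidenX mnmwiden1 muniE msuppX big_seq1 mcoeffX eqxx scale1r.
have -> : [multinom U_(widen_ord (leqnSn r) i)%MM (widen_ord (leqnSn r) j) | j < r] = U_(i)%MM.
  by apply/mnmP => j; rewrite mnmE !mnm1E.
have -> : U_(widen_ord (leqnSn r) i)%MM ord_max = 0%N.
  by rewrite mnm1E; case: eqP => // /(congr1 val) /= E; have := ltn_ord i; rewrite E ltnn.
by rewrite expr0 alg_polyC.
Qed.

Lemma muniX_max r : muni ('X_ord_max : {mpoly int[r.+1]}) = 'X.
Proof.
rewrite muniE msuppX big_seq1 mcoeffX eqxx scale1r mnm1E eqxx expr1.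
have -> : [multinom U_(ord_max)%MM (widen_ord (leqnSn r) j) | j < r] = 0%MM.
  apply/mnmP => j; rewrite mnmE mnm1E mnm0E; case: eqP => // /(congr1 val) /= E.
  by have := ltn_ord j; rewrite -E ltnn.
by rewrite mpolyX0 scale1r.
Qed.

Lemma indep_step c r P : prime_ideal P -> indep_mod c r.+1 P ->
  exists P', [/\ prime_ideal P', P `<=` P', P <> P' & indep_mod c r P'].
Proof.
move=> HP Hc.
pose phi := mev (fun i : 'I_r => c i).
apply: (prime_above chart_generates (phi := phi) (u := c r)) => // q Pq.
pose w := hom_ext (@mwiden r int : {rmorphism _ -> _}) ('X_ord_max : {mpoly int[r.+1]}).
have mevw : mev (fun i : 'I_r.+1 => c i) (w q) = hom_ext phi (c r) q.
  rewrite /w !hom_extE -horner_map -map_poly_comp mevX.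
  congr (_.[_]); apply: eq_map_poly.
  apply: (mpoly_hom_ext (f := mev (fun i : 'I_r.+1 => c i) \o (@mwiden r int : {rmorphism _ -> _}))) => i.
  by rewrite /= mwidenX mnmwiden1 !mevX.
have /(congr1 (@muni r int)) : w q = 0 by apply: Hc; rewrite mevw.
rewrite muni0 /w hom_extE.
have -> : muni (map_poly (@mwiden r int) q).['X_ord_max] =
   (map_poly (@muni r int) (map_poly (@mwiden r int) q)).[muni 'X_ord_max].
  by rewrite horner_map.
rewrite -map_poly_comp muniX_max (@eq_map_poly _ _ _ polyC) => [|s].
  by rewrite -[_.['X]]/(q \Po 'X) comp_polyXr.
exact: (mpoly_hom_ext (f := (@muni r int : {rmorphism _ -> _}) \o (@mwiden r int : {rmorphism _ -> _}))
  (g := polyC) (@muniX r)).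
Qed.

Lemma indep_chain c r P0 : prime_ideal P0 -> indep_mod c r P0 ->
  exists P, [/\ prime_chain r P, P 0%N = P0 & indep_mod c 0 (P r)].
Proof.
elim: r P0 => [|r IH] P0 HP0 Hc; first by exists (fun=> P0).
have [P1 [HP1 sub ne Hc1]] := indep_step HP0 Hc.
have [P [[HP HS] E HI]] := IH P1 HP1 Hc1.
exists (fun i => if i is j.+1 then P j else P0); split=> //; split=> [[|i] // ir|[|i] ir].
- exact: HP. - by rewrite E. - exact: HS.
Qed.

(** A dimension count, with [n = size ys]. Independent elements would give a chain of [n + 1] steps
    ending in a prime without nonzero integers, and a maximal ideal above it, which contains some
    prime number [l], adds a step. But that maximal ideal is locally generated by [l] and the [n]
    elements [x_i - x_i ^ q]. *)
Lemma chart_dependent (c : nat -> B) : exists a : {mpoly int[(size ys).+1]},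
  a != 0 /\ mev (fun i : 'I_(size ys).+1 => c i) a = 0.
Proof.
apply: contrapT => H.
have inj (a : {mpoly int[(size ys).+1]}) :
    mev (fun i : 'I_(size ys).+1 => c i) a = 0 -> a = 0.
  by move=> E; apply: contrapT => a0; apply: H; exists a; split=> //; apply/eqP.
have noeB := generates_noetherian chart_generates.
have id0 : ideal ([set 0] : set B).
  by apply/idealP; split=> // [x y -> ->|r x ->]; rewrite ?addr0 ?mulr0.
pose W := [set b | exists a : {mpoly int[(size ys).+1]}, a <> 0 /\
  b = mev (fun i : 'I_(size ys).+1 => c i) a].
have [||_ -> [a [a0 E]]|P0 [HP0 _ P0W]] := @prime_avoiding B noeB _ W id0.
- exists 1; rewrite rmorph1; split=> //; apply/eqP; exact: oner_neq0.
- move=> _ _ [a [a0 ->]] [a' [a0' ->]]; exists (a * a'); rewrite rmorphM; split=> //.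
  by move/eqP: a0 => a0; move/eqP: a0' => a0'; apply/eqP; rewrite mulf_neq0.
- by apply: a0; apply: inj.
have [|P [chP _ HPr]] := @indep_chain c (size ys).+1 P0 HP0.
  by move=> a Pa; apply: contrapT => a0; apply: (P0W _ Pa); exists a.
have [_ n1 _] := chP.1 _ (leqnn _).
have [M MM PM] := maximal_over noeB (prime_idl (chP.1 _ (leqnn _))) n1.
have HM := maximal_prime MM; have IM := prime_idl HM.
have [l [e [[pl e0] Ml Mq Mgen]]] := chart_max MM.
have PMne : P (size ys).+1 <> M.
  move=> E; have l0 : l%:R = 0 :> {mpoly int[0]} by apply: HPr; rewrite rmorph_nat E.
  have : (l%:R)%:MP = 0 :> {mpoly int[0]} by rewrite rmorph_nat.
  move/eqP; rewrite mpolyC_eq0 Num.Theory.pnatr_eq0 => /eqP lz.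
  by move: pl; rewrite lz.
pose P' i := if i == (size ys).+2 then M else P i.
have chP' : prime_chain (size ys).+2 P'.
  split=> [i ir|i ir]; rewrite /P'.
    by case: eqP => // ne; apply: chP.1; lia.
  rewrite (ltn_eqF ir) eqSS; case: eqP => [->|ne]; first by split.
  by apply: chP.2; lia.
pose us := [seq x i - x i ^+ (l ^ e) | i <- iota 0 (size ys)].
have [||||||||] // := @chain_length_le_generators B noeB M (l%:R :: us) [set 0] (size ys).+2 P'.
- move=> t; rewrite inE => /orP[/eqP -> //|/mapP[i _ ->]].
  by rewrite -opprB; apply: (idealN IM); apply: Mq.
- move=> b /Mgen[s [ns Hs]]; exists s; split=> //; apply: iexts_min Hs.
  + exact: iexts_ideal.
  + move=> z [y ->]; rewrite mulrC; apply: (idealMl _ (iexts_ideal _ id0)).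
    by apply: iexts_mem => //; apply: mem_head.
  + by move=> t ts; apply: iexts_mem => //; rewrite inE ts orbT.
- by move=> z ->; rewrite /P' /=; apply: (ideal0 (prime_idl (chP.1 0%N _))).
- by rewrite /P' eqxx.
- by rewrite /= size_map size_iota.
by rewrite /= size_map size_iota => [[]]; lia.
Qed.
End Chart.

(** * Koszul cochains and local cohomology *)

Section Koszul.
Variables (A : comPzRingType).
Implicit Types (M N : lmodType A) (f g : nat -> A).

(** Koszul cochains in [t] generators, all degrees together: the sum of [2 ^ t] copies of [M], split
    at each step by the absence or presence of the last basis vector. *)
Fixpoint kx M (t : nat) : lmodType A :=
  if t is t'.+1 then (kx M t' * kx M t')%type : lmodType A else M.

Fixpoint kd M f t : kx M t -> kx M t :=
  if t is t'.+1 return kx M t -> kx M t then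
    fun z : kx M t' * kx M t' => (kd f z.1, f t' *: z.1 - kd f z.2)
  else fun=> 0.

(** The chain map from the Koszul complex on [f] to that on [g f] ([kd_tr]): the component of a
    subset is multiplied by the product of its [g i]. *)
Fixpoint ktr M g t : kx M t -> kx M t :=
  if t is t'.+1 return kx M t -> kx M t then
    fun z : kx M t' * kx M t' => (ktr g z.1, g t' *: ktr g z.2)
  else id.

(** Projection to cohomological degree [d - 1]. With this shift, index [0] is the zero projection
    and [d.-1] needs no case distinction. *)
Fixpoint kproj M (d : nat) t : kx M t -> kx M t :=
  if t is t'.+1 return kx M t -> kx M t then
    fun z : kx M t' * kx M t' => (kproj d z.1, kproj d.-1 z.2)
  else fun x => if d == 1 then x else 0.

Fixpoint kin M t (x : M) : kx M t :=
  if t is t'.+1 return kx M t then (kin t' x, 0) else x.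

Lemma pair_eq (U V : Type) (x y : U * V) : x.1 = y.1 -> x.2 = y.2 -> x = y.
Proof. by case: x y => [a b] [c d] /= -> ->. Qed.

Lemma kd_linear M f t : linear (@kd M f t).
Proof.
elim: t => [|t IH] a x y; first by rewrite /= scaler0 addr0.
apply: pair_eq => /=; first exact: IH.
by rewrite IH scalerDr !scalerA mulrC -scalerA scalerBr opprD addrACA.
Qed.
HB.instance Definition _ M f t := GRing.isLinear.Build A (kx M t) (kx M t) _ (@kd M f t) (@kd_linear M f t).

Lemma ktr_linear M g t : linear (@ktr M g t).
Proof.
elim: t => [|t IH] a x y //; apply: pair_eq => /=; first exact: IH.
by rewrite IH scalerDr !scalerA mulrC.
Qed.
HB.instance Definition _ M g t := GRing.isLinear.Build A (kx M t) (kx M t) _ (@ktr M g t) (@ktr_linear M g t).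

Lemma kproj_linear M d t : linear (@kproj M d t).
Proof.
elim: t d => [|t IH] d a x y /=; first by case: eqP; rewrite ?scaler0 ?addr0.
by apply: pair_eq; apply: IH.
Qed.
HB.instance Definition _ M d t := GRing.isLinear.Build A (kx M t) (kx M t) _ (@kproj M d t) (@kproj_linear M d t).

Lemma kin_linear M t : linear (@kin M t).
Proof.
elim: t => [|t IH] a x y //; apply: pair_eq => /=; first exact: IH.
by rewrite scaler0 addr0.
Qed.
HB.instance Definition _ M t := GRing.isLinear.Build A M (kx M t) _ (@kin M t) (@kin_linear M t).

Lemma kdB M f t (x y : kx M t) : kd f (x - y) = kd f x - kd f y.
Proof. exact: linearB. Qed.
Lemma kdZ M f t a (x : kx M t) : kd f (a *: x) = a *: kd f x.
Proof. exact: linearZ. Qed.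
Lemma ktrB M f t (x y : kx M t) : ktr f (x - y) = ktr f x - ktr f y.
Proof. exact: linearB. Qed.
Lemma ktrZ M f t a (x : kx M t) : ktr f (a *: x) = a *: ktr f x.
Proof. exact: linearZ. Qed.

Lemma kdD M f t (x y : kx M t) : kd f (x + y) = kd f x + kd f y.
Proof. exact: linearD. Qed.
Lemma ktrD M f t (x y : kx M t) : ktr f (x + y) = ktr f x + ktr f y.
Proof. exact: linearD. Qed.
Lemma kd0 M f t : kd f (0 : kx M t) = 0. Proof. exact: linear0. Qed.
Lemma ktr0 M f t : ktr f (0 : kx M t) = 0. Proof. exact: linear0. Qed.
Lemma kprojZ M d t a (x : kx M t) : kproj d (a *: x) = a *: kproj d x.
Proof. exact: linearZ. Qed.
Lemma kprojD M d t (x y : kx M t) : kproj d (x + y) = kproj d x + kproj d y.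
Proof. exact: linearD. Qed.
Lemma kinZ M t a (x : M) : kin t (a *: x) = a *: kin t x.
Proof. exact: linearZ. Qed.

Lemma kinB M t (x y : M) : kin t (x - y) = kin t x - kin t y.
Proof. exact: linearB. Qed.

Lemma kdK M f t (x : kx M t) : kd f (kd f x) = 0.
Proof.
elim: t x => [|t IH] x //=; apply: pair_eq => /=; first exact: IH.
by rewrite linearB linearZ /= IH subr0 subrr.
Qed.

Lemma kd_tr M f g t (x : kx M t) : kd (fun i => g i * f i) (ktr g x) = ktr g (kd f x).
Proof.
elim: t x => [|t IH] x //=; apply: pair_eq => /=; first exact: IH.
by rewrite kdZ IH ktrB ktrZ scalerBr !scalerA.
Qed.

Lemma ktrM M f g t (x : kx M t) : ktr f (ktr g x) = ktr (fun i => f i * g i) x.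
Proof.
elim: t x => [|t IH] x //=; apply: pair_eq => /=; first exact: IH.
by rewrite linearZ /= scalerA IH.
Qed.

Lemma ktr1 M f t (x : kx M t) : (forall i, f i = 1) -> ktr f x = x.
Proof.
move=> f1; elim: t x => [|t IH] x //=; apply: pair_eq => /=; first exact: IH.
by rewrite f1 scale1r IH.
Qed.

Lemma kd_ext M f g t (x : kx M t) : (forall i, (i < t)%N -> f i = g i) -> kd f x = kd g x.
Proof.
elim: t x => [|t IH] x //= fg; rewrite fg // !IH // => i it; apply: fg; exact: ltnW.
Qed.

Lemma ktr_ext M f g t (x : kx M t) : (forall i, (i < t)%N -> f i = g i) -> ktr f x = ktr g x.
Proof.
elim: t x => [|t IH] x //= fg; rewrite fg // !IH // => i it; apply: fg; exact: ltnW.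
Qed.

Lemma kproj0 M t (x : kx M t) : kproj 0 x = 0.
Proof. by elim: t x => [|t IH] x //=; apply: pair_eq; apply: IH. Qed.

Lemma kproj_kd M f d t (x : kx M t) : kd f (kproj d x) = kproj d.+1 (kd f x).
Proof.
elim: t d x => [|t IH] d x /=; first by case: eqP.
apply: pair_eq => /=; first exact: IH.
rewrite linearB linearZ /=; congr (_ - _); case: d => [|d]; last exact: IH.
by rewrite !kproj0 linear0.
Qed.

Lemma kproj_tr M g d t (x : kx M t) : ktr g (kproj d x) = kproj d (ktr g x).
Proof.
by elim: t d x => [|t IH] d x //=; rewrite linearZ /= !IH.
Qed.

Lemma kprojK M d t (x : kx M t) : kproj d (kproj d x) = kproj d x.
Proof.
elim: t d x => [|t IH] d x /=; first by case: eqP.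
by rewrite !IH.
Qed.

Lemma kproj_kin M d t (x : M) : kproj d (kin t x) = if d == 1 then kin t x else 0.
Proof.
elim: t d => [|t IH] d //=; rewrite IH linear0; case: eqP => // _; exact: pair_eq.
Qed.

Lemma kin_inj M t (x : M) : kin t x = 0 -> x = 0.
Proof. by elim: t => [|t IH] //= /(congr1 fst)/IH. Qed.

Lemma ktr_kin M g t (x : M) : ktr g (kin t x) = kin t x.
Proof. by elim: t => [|t IH] //=; rewrite IH linear0 scaler0. Qed.

Lemma kproj1 M t (x : kx M t) : exists y, kproj 1 x = kin t y.
Proof.
elim: t x => [|t IH] x /=; first by exists x.
by have [y ->] := IH x.1; exists y; rewrite kproj0.
Qed.

Lemma kd_kin M f t (x : M) : kd f (kin t x) = 0 <-> forall i, (i < t)%N -> f i *: x = 0.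
Proof.
elim: t => [|t IH] //=; rewrite linear0 subr0; split.
  move=> E i; have /IH H := congr1 fst E; rewrite ltnS leq_eqVlt => /orP[/eqP ->|/H //].
  by apply: (@kin_inj M t); rewrite linearZ; exact: (congr1 (@snd (kx M t) (kx M t)) E).
move=> H; apply: pair_eq => /=; first by apply/IH => i it; apply/H/ltnW.
by rewrite -linearZ /= H ?linear0.
Qed.

End Koszul.

Section KoszulMap.
Variables (A A' : comPzRingType) (M : lmodType A) (M' : lmodType A').

Fixpoint kmap (phi : M -> M') t : kx M t -> kx M' t :=
  if t is t'.+1 return kx M t -> kx M' t then
    fun z : kx M t' * kx M t' => (kmap phi z.1, kmap phi z.2)
  else phi.

Lemma kmapD (phi : M -> M') t (x y : kx M t) : {morph phi : a b / a + b} ->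
  kmap phi (x + y) = kmap phi x + kmap phi y.
Proof. by move=> H; elim: t x y => [|t IH] x y /=; [exact: H|rewrite !IH]. Qed.

Lemma kmap0 (phi : M -> M') t : phi 0 = 0 -> kmap phi (0 : kx M t) = 0.
Proof. by move=> H; elim: t => [|t IH] //=; rewrite IH. Qed.

Lemma kmap_kd (phi : M -> M') (f : nat -> A) (f' : nat -> A') t (x : kx M t) :
  zmod_morphism phi -> (forall i a, phi (f i *: a) = f' i *: phi a) ->
  kmap phi (kd f x) = kd f' (kmap phi x).
Proof.
move=> pB pZ; have p0 : phi 0 = 0 by rewrite -(subrr 0) pB subrr.
have kB t' (a b : kx M t') : kmap phi (a - b) = kmap phi a - kmap phi b.
  by elim: t' a b => [|t' IH] a b /=; rewrite ?pB // !IH.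
have kZ t' i (a : kx M t') : kmap phi (f i *: a) = f' i *: kmap phi a.
  by elim: t' a => [|t' IH] a /=; rewrite ?pZ // !IH.
by elim: t x => [|t IH] x //=; rewrite kB kZ !IH.
Qed.

Lemma kmap_tr (phi : M -> M') (f : nat -> A) (f' : nat -> A') t (x : kx M t) :
  (forall i a, phi (f i *: a) = f' i *: phi a) ->
  kmap phi (ktr f x) = ktr f' (kmap phi x).
Proof.
move=> pZ; have kZ t' i (a : kx M t') : kmap phi (f i *: a) = f' i *: kmap phi a.
  by elim: t' a => [|t' IH] a /=; rewrite ?pZ // !IH.
by elim: t x => [|t IH] x //=; rewrite kZ !IH.
Qed.

Lemma kmap_proj (phi : M -> M') d t (x : kx M t) : phi 0 = 0 ->
  kmap phi (kproj d x) = kproj d (kmap phi x).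
Proof.
by move=> p0; elim: t d x => [|t IH] d x /=; [case: eqP|rewrite !IH].
Qed.

Lemma kmap_kin (phi : M -> M') t (x : M) : phi 0 = 0 -> kmap phi (kin t x) = kin t (phi x).
Proof. by move=> p0; elim: t => [|t IH] //=; rewrite IH kmap0. Qed.

Lemma kmap_inj (phi : M -> M') t (x y : kx M t) : injective phi ->
  kmap phi x = kmap phi y -> x = y.
Proof.
by move=> pI; elim: t x y => [|t IH] x y /=; [exact: pI|case=> /IH E1 /IH E2; apply: pair_eq].
Qed.

Lemma kmap_ext (phi psi : M -> M') t (x : kx M t) : phi =1 psi -> kmap phi x = kmap psi x.
Proof. by move=> E; elim: t x => [|t IH] x /=; rewrite ?E // !IH. Qed.

End KoszulMap.

Section Components.
Variables (A : comPzRingType) (M : lmodType A).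

Fixpoint kall (P : M -> Prop) t : kx M t -> Prop :=
  if t is t'.+1 return kx M t -> Prop then
    fun z : kx M t' * kx M t' => kall P z.1 /\ kall P z.2
  else P.

Lemma kallT (P : M -> Prop) t (x : kx M t) : (forall a, P a) -> kall P x.
Proof. by move=> H; elim: t x => [|t IH] x //=. Qed.

Lemma kall_imp (P P' : M -> Prop) t (x : kx M t) : (forall a, P a -> P' a) ->
  kall P x -> kall P' x.
Proof. by move=> H; elim: t x => [|t IH] x /=; [exact: H|case=> ? ?; split; apply: IH]. Qed.

Lemma kall_lift (A' : comPzRingType) (M' : lmodType A') (phi : M' -> M) t (x : kx M t) :
  kall (fun a => exists b, phi b = a) x -> exists y : kx M' t, kmap phi y = x.
Proof.
elim: t x => [|t IH] x //= [/IH[y1 E1] /IH[y2 E2]]; exists (y1, y2).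
by rewrite /= E1 E2; exact: pair_eq.
Qed.

Lemma kall_eq0 (A' : comPzRingType) (M' : lmodType A') (phi : M -> M') t (x : kx M t) :
  kmap phi x = 0 <-> kall (fun a => phi a = 0) x.
Proof.
elim: t x => [|t IH] x //=; rewrite -!IH; split=> [E|[E1 E2]]; last exact: pair_eq.
by split; [exact: (congr1 (@fst (kx M' t) (kx M' t)) E)|exact: (congr1 (@snd (kx M' t) (kx M' t)) E)].
Qed.

Lemma kmap_comp (A1 A2 : comPzRingType) (M1 : lmodType A1) (M2 : lmodType A2)
  (phi : M1 -> M2) (psi : M -> M1) t (x : kx M t) :
  kmap phi (kmap psi x) = kmap (phi \o psi) x.
Proof. by elim: t x => [|t IH] x //=; rewrite !IH. Qed.

End Components.

Section Eventually.
Variables (A : comPzRingType) (M : lmodType A) (f : nat -> A) (t : nat).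

(** A cochain of level [m] belongs to the Koszul complex on the [m]-th powers, and [ktr (lev s)]
    carries it to level [m + s]. *)
Definition lev (m : nat) (i : nat) : A := f i ^+ m.

Lemma lev_tr s m (x : kx M t) : kd (lev (m + s)) (ktr (lev s) x) = ktr (lev s) (kd (lev m) x).
Proof.
by rewrite -kd_tr; apply: kd_ext => i _; rewrite /lev addnC exprD.
Qed.

Lemma ktr_lev s s' (x : kx M t) : ktr (lev s) (ktr (lev s') x) = ktr (lev (s' + s)) x.
Proof. by rewrite ktrM; apply: ktr_ext => i _; rewrite /lev addnC exprD. Qed.

Lemma ktr_lev0 (x : kx M t) : ktr (lev 0) x = x.
Proof. by apply: ktr1. Qed.

Variable K : nat -> kx M t -> Prop.
Hypotheses (K0 : forall m, K m 0) (KD : forall m x y, K m x -> K m y -> K m (x + y))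
  (Ktr : forall m s x, K m x -> K (m + s)%N (ktr (lev s) x)).

(* [x], of level [m], becomes an element of [K] plus a coboundary at a higher level. *)
Definition ev m (x : kx M t) := exists s w z, K (m + s)%N z /\
  ktr (lev s) x = kd (lev (m + s)) w + z.

Lemma ev_up m s' x : ev m x -> ev (m + s') (ktr (lev s') x).
Proof.
move=> [s [w [z [Kz E]]]]; exists s, (ktr (lev s') w), (ktr (lev s') z).
rewrite (addnAC m s') ; split; first exact: Ktr.
by rewrite ktr_lev addnC -ktr_lev E linearD lev_tr.
Qed.

Lemma ev_down m s' x : ev (m + s') (ktr (lev s') x) -> ev m x.
Proof.
move=> [s [w [z [Kz E]]]]; exists (s' + s)%N, w, z; rewrite addnA; split=> //.
by rewrite -ktr_lev.
Qed.

Lemma ev_K m x : K m x -> ev m x.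
Proof. by move=> Kx; exists 0%N, 0, x; rewrite addn0 linear0 add0r ktr_lev0. Qed.

Lemma evD m x y : ev m x -> ev m y -> ev m (x + y).
Proof.
move=> [s [w [z [Kz E]]]] [s' [w' [z' [Kz' E']]]].
exists (s + s')%N, (ktr (lev s') w + ktr (lev s) w'), (ktr (lev s') z + ktr (lev s) z').
split; first by apply: KD; rewrite ?addnA; [|rewrite addnAC]; apply: Ktr.
rewrite !linearD /= -[ktr _ x]ktr_lev E (addnC s s') -ktr_lev E' !linearD.
by rewrite (addnC s' s) addnA lev_tr (addnAC m s s') lev_tr addrACA.
Qed.

Lemma ev_sum (I : Type) (r : seq I) (P : pred I) m (F : I -> kx M t) :
  (forall i, P i -> ev m (F i)) -> ev m (\sum_(i <- r | P i) F i).
Proof.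
move=> H; elim/big_ind: _ => //; first by apply: ev_K.
by move=> x y; apply: evD.
Qed.

Lemma evZ m a x : (forall m' y, K m' y -> K m' (a *: y)) -> ev m x -> ev m (a *: x).
Proof.
move=> Ka [s [w [z [Kz E]]]]; exists s, (a *: w), (a *: z); split; first exact: Ka.
by rewrite !linearZ /= E scalerDr.
Qed.

End Eventually.

Lemma linear_of (R : comPzRingType) (M N : lmodType R) (u : M -> N) : linear u ->
  exists h : {linear M -> N}, h =1 u.
Proof.
move=> ul; pose L := GRing.isLinear.Build R M N _ u ul.
by pose H : {linear M -> N} := HB.pack u L; exists H.
Qed.

Lemma qmod_univ (R : comPzRingType) (M N : lmodType R) (D : set M) (u : {linear M -> N}) :
  (forall s, D s -> u s = 0) ->
  exists h : {linear quotmod D -> N}, forall x, h (qmod D x) = u x.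
Proof.
move=> H; have wd x y : qmod D x = qmod D y -> u x = u y.
  move/qmodP => Dxy; apply/eqP; rewrite -subr_eq0 -linearB; apply/eqP.
  apply: (Dxy [set z | u z = 0]); last by move=> s; apply: H.
  by split=> [|r a b ua ub] /=; rewrite ?linear0 // linearP ua ub scaler0 addr0.
pose h (x : quotmod D) : N := u (repr x).
have hE x : h (qmod D x) = u x by apply: wd; apply: qmodK.
have hl : linear h.
  move=> a x y; rewrite -[x]qmodK -[y]qmodK -[a *: _]/(qscale _ _) qscaleE -qmodD !hE.
  exact: linearP.
by have [H' E] := linear_of hl; exists H' => x; rewrite E.
Qed.

Lemma qmod_eq0 (R : comPzRingType) (M : lmodType R) (D : set M) x : qmod D x = 0 <-> Defs.span D x.
Proof.
have q0 : qmod D 0 = 0.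
  have /eqP := qmodD D 0 0; rewrite addr0 -subr_eq0 opprD addrA subrr sub0r oppr_eq0.
  by move/eqP.
by rewrite -q0 qmodP subr0.
Qed.

(** * Injective modules, and the comparison of Koszul with local cohomology *)

Section Injective.
Variables (R : comPzRingType) (noeR : noetherian R).

(** Injective modules are divisible in the limit. The annihilators [c s] of [g ^ s y] stabilize;
    then multiplication by [g ^ (m + s)] embeds [R / c s] into [R / c 0], and the map sending [1] to
    [g ^ s y] extends along it. The clause on annihilators lets [w] inherit Koszul relations from
    [y]. *)
Lemma inj_div (E : lmodType R) (y : E) (g : R) (m : nat) : injective_module E ->
  exists s w, (forall r, r *: y = 0 -> r *: w = 0) /\ g ^+ (m + s) *: w = g ^+ s *: y.
Proof.
move=> injE; pose c s := [set r : R | (r * g ^+ s) *: y = 0].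
have Hc s : ideal (c s).
  apply/idealP; split=> [|a b|r a]; rewrite /c /=.
  - by rewrite mul0r scale0r.
  - by move=> Ha Hb; rewrite mulrDl scalerDl Ha Hb addr0.
  - by move=> Ha; rewrite -mulrA -scalerA Ha scaler0.
have [s Hs] : exists s, forall n, (s <= n)%N -> c n = c s.
  apply: (noeth_acc noeR Hc) => n r; rewrite /c /= => Hr.
  by rewrite exprS mulrCA -scalerA Hr scaler0.
exists s.
have [h0 h0E] : exists h : {linear R^o -> quotmod (c 0%N : set R^o)},
    forall r, h r = qmod (c 0%N : set R^o) (r * g ^+ (m + s) : R^o).
  pose h0 (r : R^o) : quotmod (c 0%N : set R^o) := qmod _ (r * g ^+ (m + s) : R^o).
  have hl : linear h0.
    move=> a x z; rewrite /h0 -[a *: qmod _ _]/(qscale _ _) qscaleE -qmodD.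
    by congr qmod; rewrite /GRing.scale /= mulrDl mulrA.
  by have [H' E'] := linear_of hl; exists H' => r; rewrite E'.
have memc (D : set R) (x : R) : ideal D -> ideal_gen D x -> D x.
  by move=> HD; apply: ideal_gen_min.
have [|h hE] := @qmod_univ R R^o _ (c s : set R^o) h0.
  move=> r cr; rewrite h0E; apply/qmod_eq0; apply: Defs.sub_span.
  by rewrite /c /= expr0 mulr1; have : c s r by []; rewrite -(Hs (m + s)%N (leq_addl _ _)).
have hinj : injective h.
  move=> a b; rewrite -[a]qmodK -[b]qmodK !hE => E'; apply/qmodP; apply: Defs.sub_span.
  have : h0 (repr a - repr b) = 0 by rewrite linearB E' subrr.
  rewrite h0E => /qmod_eq0/(memc _ _ (Hc 0%N)).
  rewrite /c /= expr0 mulr1 => H; have : c (m + s)%N (repr a - repr b) by [].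
  by rewrite Hs ?leq_addl.
have [u uE] : exists u : {linear R^o -> E}, forall r, u r = (r * g ^+ s) *: y.
  pose u (r : R^o) := ((r : R) * g ^+ s) *: y.
  have ul : linear u by move=> a x z; rewrite /u -[a *: x]/(a * x) mulrDl scalerDl -mulrA scalerA.
  by have [H' E'] := linear_of ul; exists H' => r; rewrite E'.
have [|u' u'E] := @qmod_univ R R^o _ (c s : set R^o) u; first by move=> r; rewrite uE.
have [v vE] := injE _ _ h u' hinj.
exists (v (qmod _ (1 : R^o))); split=> [r ry|].
  rewrite -linearZ /= -[r *: qmod _ _]/(qscale _ _) qscaleE.
  have -> : qmod (c 0%N : set R^o) (r *: (1 : R^o)) = 0.
    apply/qmod_eq0; apply: Defs.sub_span.
    by rewrite /c /= /GRing.scale /= expr0 !mulr1.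
  exact: linear0.
have := vE (qmod _ (1 : R^o)); rewrite hE h0E u'E uE !mul1r => <-.
rewrite -linearZ /= -[_ *: qmod _ _]/(qscale _ _) qscaleE.
by congr (v (qmod _ _)); rewrite /GRing.scale /= mulr1.
Qed.

Variables (f : nat -> R).

(** Acyclicity in the limit, where [kin t e0] is the part of degree zero. By induction on [t] the
    first component is a coboundary up to degree zero, and so is the second after a correction; its
    remainder [y0] is divided by a power of the last generator with [inj_div]. *)
Lemma inj_acyclic (E : lmodType R) t m (x : kx E t) : injective_module E ->
  kd (lev f m) x = 0 -> exists s w e0, ktr (lev f s) x = kd (lev f (m + s)) w + kin t e0.
Proof.
move=> injE; elim: t m x => [|t IH] m x; first by exists 0%N, 0, x; rewrite /= add0r.
move=> E0; pose x1 : kx E t := x.1; pose y : kx E t := x.2.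
have Ex1 : kd (lev f m) x1 = 0 := congr1 (@fst (kx E t) (kx E t)) E0.
have Ey : lev f m t *: x1 = kd (lev f m) y.
  by apply/eqP; rewrite -subr_eq0; apply/eqP; exact: (congr1 (@snd (kx E t) (kx E t)) E0).
have [s [w [e0 Ex]]] := IH _ _ Ex1.
have fD a b : lev f (a + b) t = lev f a t * lev f b t by rewrite /lev exprD.
pose y' : kx E t := lev f s t *: ktr (lev f s) y - lev f (m + s) t *: w.
have Ey' : lev f (m + s) t *: kin t e0 = kd (lev f (m + s)) y'.
  rewrite kdB !kdZ lev_tr -Ey ktrZ scalerA -fD (addnC s) -scalerBr Ex.
  by rewrite [kd _ w + _]addrC addrK.
have kdy0 : kd (lev f (m + s)) y' = 0.
  have := congr1 (@kproj R E 1 t) Ey'.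
  by rewrite -kproj_kd kproj0 kd0 kprojZ kproj_kin /= -Ey'.
have [s' [w' [y0 Ey0]]] := IH _ _ kdy0.
set m' := (m + s + s')%N in Ey0 *.
pose y1 := lev f s' t *: y0.
have [s2 [w0 [w0K w0E]]] := inj_div y1 (f t) m' injE.
have y0K : kd (lev f m') (kin t y0) = 0.
  have -> : kin t y0 = ktr (lev f s') y' - kd (lev f m') w' by rewrite Ey0 [kd _ w' + _]addrC addrK.
  by rewrite kdB lev_tr kdy0 ktr0 kdK subr0.
have w0K' : kd (lev f (m' + s2)) (kin t w0) = 0.
  apply/kd_kin => i it; have /kd_kin/(_ i it) H := y0K.
  rewrite /lev exprD mulrC -scalerA w0K ?scaler0 // /y1 scalerA mulrC -scalerA H.
  exact: scaler0.
exists (s + (s' + s2))%N, (ktr (lev f (s' + s2)) w + kin t w0,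
  - (lev f (s' + s2) t *: ktr (lev f s2) w')), e0.
have Em : (m + (s + (s' + s2)) = m' + s2)%N by rewrite /m' !addnA.
apply: pair_eq; rewrite [LHS]/= [RHS]/= ?addr0.
  rewrite -ktr_lev -/x1 Ex ktrD ktr_kin kdD; congr (_ + _).
  by rewrite [in X in _ + X]Em w0K' addr0 addnA lev_tr.
have E1 : lev f s t *: ktr (lev f s) y = y' + lev f (m + s) t *: w by rewrite subrK.
have E2 : lev f (s + s') t *: ktr (lev f (s + s')) y =
    lev f s' t *: kd (lev f m') w' + kin t y1 + lev f m' t *: ktr (lev f s') w.
  rewrite (addnC s) fD -scalerA (addnC s') -ktr_lev -ktrZ E1 ktrD ktrZ scalerDr Ey0 scalerDr.
  by rewrite -kinZ scalerA -fD (addnC s').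
rewrite addnA fD (mulrC (lev f _ t)) -scalerA -ktr_lev -ktrZ E2 !ktrD !ktrZ ktr_kin ktr_lev.
have -> : (m + (s + s' + s2) = m' + s2)%N by rewrite /m' !addnA.
have -> : lev f s2 t *: (lev f s' t *: ktr (lev f s2) (kd (lev f m') w') + kin t y1 +
    lev f m' t *: ktr (lev f (s' + s2)) w) =
  lev f (m' + s2) t *: (ktr (lev f (s' + s2)) w + kin t w0) +
    lev f (s' + s2) t *: ktr (lev f s2) (kd (lev f m') w').
  have w0E' : lev f (m' + s2) t *: w0 = lev f s2 t *: y1 := w0E.
  rewrite [in RHS]scalerDr -(kinZ t _ w0) w0E' kinZ !scalerDr !scalerA -!fD.
  by rewrite kinZ (addnC s2 s') (addnC s2 m') [LHS]addrC [X in _ + X]addrC addrA.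
by rewrite scalerDr -scaleNr kdZ lev_tr scaleNr opprK.
Qed.
End Injective.

Section Comparison.
Variables (R : comPzRingType) (noeR : noetherian R) (f : nat -> R) (t : nat).
Variables (I : injective_resolution R^o) (k : nat) (a : set R).
Hypothesis (ha : a = ideal_gen [set x | exists i, (i < t)%N /\ x = f i]).

(** A pigeonhole on exponents, as an induction in which [K] is replaced by its colon ideal with
    respect to [f i]. *)
Lemma ideal_pow_sub (K : set R) (e : nat -> nat) n : ideal K ->
  (forall i, (i < t)%N -> K (f i ^+ e i)) -> (\sum_(i < t) e i < n)%N -> ideal_pow a n `<=` K.
Proof.
elim: n K e => // n IH K e HK Ke; rewrite ltnS => sn; apply: ideal_gen_min => // _ [x [y [ax Iy ->]]].
have Hc : ideal [set x | K (x * y)].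
  apply/idealP; split=> [|u v Hu Hv|r u Hu] /=; rewrite ?mul0r ?mulrDl; first exact: ideal0.
    exact: idealD.
  by rewrite -mulrA; apply: idealMl.
move: ax; rewrite ha => ax; apply: (ideal_gen_min Hc _ ax) => _ [i [it ->]] /=.
case Ei: (e i) => [|ei].
  by have := Ke i it; rewrite Ei expr0 => K1; apply: ideal1.
have Hfc : ideal [set x | K (f i * x)].
  apply/idealP; split=> [|u v Hu Hv|r u Hu] /=; rewrite ?mulr0 ?mulrDr; first exact: ideal0.
    exact: idealD.
  by rewrite mulrCA; apply: idealMl.
apply: (IH _ (fun j => if j == i then ei else e j) Hfc) => [j jt||] //.
  rewrite /=; case: eqP => [->|_]; first by rewrite -exprS -Ei; apply: Ke.
  by apply: idealMl => //; apply: Ke.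
rewrite (bigD1 (Ordinal it)) //= eqxx.
move: sn; rewrite [X in (X <= _)%N](bigD1 (Ordinal it)) //= Ei addSn => sn.
rewrite (leq_trans _ sn) // ltnS leq_add2l; apply: leq_sum => j /negPf ne.
by rewrite -[(j == i :> nat)]/(j == Ordinal it) ne.
Qed.

Lemma torsion_levP (M : lmodType R) (z : M) : @torsion R a M z <->
  exists m, forall i, (i < t)%N -> f i ^+ m *: z = 0.
Proof.
split=> [[n Hn]|[m Hm]].
  exists n => i it; apply: Hn; apply: ideal_powX; rewrite ha; first exact: ideal_gen_ideal.
  by apply: Defs.sub_span; exists i.
have HK : ideal [set r | r *: z = 0].
  apply/idealP; split=> [|x y|r x] /=; rewrite ?scale0r // => Hx; last by rewrite -scalerA Hx scaler0.
  by move=> Hy; rewrite scalerDl Hx Hy addr0.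
exists (\sum_(i < t) m).+1; apply: (ideal_pow_sub HK) (ltnSn _) => i it; exact: Hm.
Qed.

Lemma Gamma_val (M : lmodType R) (z : Gamma a M) : @torsion R a M (val z).
Proof.
have /span_predP := valP z; apply; last by [].
split=> [|r x y /torsion_levP[m Hm] /torsion_levP[m' Hm']].
  by exists 0%N => r _; rewrite scaler0.
apply/torsion_levP; exists (m + m')%N => i it.
rewrite exprD scalerDr scalerA -[X in _ + X]scalerA Hm' // scaler0 addr0 mulrC.
by rewrite [f i ^+ m * _]mulrC -!scalerA Hm // !scaler0.
Qed.

Definition zc j (x : kx (I j) t) := kmap (cdiff I j) x = 0.

(** The connecting map of [0 -> Z^j -> I^j -> Z^(j+1) -> 0] in the limit of Koszul cohomology, with
    the vanishing of all multiples followed. It is injective because [I^j] is acyclic in positive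
    degree, which is the meaning of [1 < d]. *)
Lemma zigzag_step j m d (x : kx (I j.+1) t) : zc x -> (1 < d)%N -> kproj d x = x ->
  kd (lev f m) x = 0 -> exists x' : kx (I j) t, [/\ zc x', kproj d.+1 x' = x',
    kd (lev f m) x' = 0 & forall r,
   (exists s w, zc w /\ ktr (lev f s) (r *: x) = kd (lev f (m + s)) w) <->
   (exists s w, zc w /\ ktr (lev f s) (r *: x') = kd (lev f (m + s)) w)].
Proof.
move=> zx d1 dx cx.
have linB j' : zmod_morphism (cdiff I j') by move=> u v; apply: linearB.
have linZ j' g i u : cdiff I j' (lev f g i *: u) = lev f g i *: cdiff I j' u by apply: linearZ.
have dkd j' m' (u : kx (I j') t) := kmap_kd (f := lev f m') (f' := lev f m') u (linB j') (linZ j' m').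
have dtr j' m' (u : kx (I j') t) := kmap_tr (f := lev f m') (f' := lev f m') u (linZ j' m').
have dZ j' r (u : kx (I j') t) : kmap (cdiff I j') (r *: u) = r *: kmap (cdiff I j') u.
  elim: t u {zx dx cx dkd dtr x} => [|t' IH] u /=; [exact: linearZ|by rewrite !IH].
have dB j' (u v : kx (I j') t) : kmap (cdiff I j') (u - v) = kmap (cdiff I j') u - kmap (cdiff I j') v.
  elim: t u v {zx dx cx dkd dtr dZ x} => [|t' IH] u v /=; [exact: linearB|by rewrite !IH].
have dd (u : kx (I j) t) : zc (kmap (cdiff I j) u).
  by rewrite /zc kmap_comp; apply/kall_eq0/kallT => v /=; apply: cdiffK.
have lift j' (u : kx (I j'.+1) t) : zc u -> exists v, kmap (cdiff I j') v = u.
  move=> /kall_eq0 zu; apply: kall_lift; apply: kall_imp zu => v Ev.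
  have : cocycles I j'.+1 v by []. by rewrite res_exactS => -[w _ <-]; exists w.
have [x0 Ex0] := lift _ _ zx; pose x1 := kproj d x0.
have Ex1 : kmap (cdiff I j) x1 = x by rewrite kmap_proj ?linear0 // Ex0.
exists (kd (lev f m) x1); split; rewrite ?kdK //.
- by rewrite /zc dkd Ex1.
- by rewrite -kproj_kd /x1 kprojK.
move=> r; split=> [[s [w [zw E]]]|[s [w [zw E]]]].
  have [w1 Ew1] := lift _ _ zw.
  exists s, (ktr (lev f s) (r *: x1) - kd (lev f (m + s)) w1); split.
    by rewrite /zc dB dtr dkd dZ Ex1 Ew1 E subrr.
  by rewrite kdB kdK subr0 lev_tr kdZ.
pose y := ktr (lev f s) (r *: x1) - w.
have Ey : kd (lev f (m + s)) y = 0 by rewrite kdB lev_tr kdZ E subrr.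
have [s' [v [e0 Ev]]] := inj_acyclic noeR (@res_injective _ _ I j) Ey.
exists (s + s')%N, (kproj d.-1 (kmap (cdiff I j) v)); split.
  by rewrite /zc kmap_proj ?linear0 // dd linear0.
rewrite kproj_kd prednK; last exact: ltnW.
have E2 : kmap (cdiff I j) (ktr (lev f s') y) = ktr (lev f (s + s')) (r *: x).
  by rewrite dtr dB zw subr0 dtr dZ Ex1 ktr_lev.
have E3 : kproj d (ktr (lev f (s + s')) (r *: x)) = ktr (lev f (s + s')) (r *: x).
  by rewrite -kproj_tr kprojZ dx.
rewrite -E3 -E2 Ev kmapD => [|u v']; last exact: linearD.
rewrite kmap_kin ?linear0 // dkd kprojD kproj_kin gtn_eqF // addr0.
by rewrite addnA.
Qed.
End Comparison.

Section Cohomology.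
Variables (R : comPzRingType) (C : complex R) (k : nat).

Lemma span_id (M : lmodType R) (D : set M) x : submodule D -> Defs.span D x -> D x.
Proof. by move=> HD; apply. Qed.

Lemma cocycles_submodule : submodule (cocycles C k).
Proof.
by split=> [|r x y Hx Hy]; rewrite /cocycles /= ?linear0 // linearP Hx Hy scaler0 addr0.
Qed.

Lemma coboundaries_submodule : submodule (coboundaries C k).
Proof.
rewrite /coboundaries; case: k => [|n]; split=> //.
- by move=> r x y -> ->; rewrite /= scaler0 addr0.
- by exists 0; rewrite ?linear0.
- by move=> r _ _ [u _ <-] [v _ <-]; exists (r *: u + v); rewrite ?linearP.
Qed.

Lemma cohomology_eq0 (w : submod (cocycles C k)) r :
  r *: qmod [set z : submod (cocycles C k) | coboundaries C k (val z)] w = 0 <->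
  coboundaries C k (r *: val w).
Proof.
have EZ : val (r *: w) = r *: val w by exact: linearZ.
rewrite -[r *: _]/(qscale _ _) qscaleE qmod_eq0; split=> [H|H].
  have /H : submodule [set z : submod (cocycles C k) | coboundaries C k (val z)].
    have [H0 HD] := coboundaries_submodule; split=> [|a x y Hx Hy]; last first.
      have EP : val (a *: x + y) = a *: val x + val y by exact: linearP.
      by change (coboundaries C k (val (a *: x + y))); rewrite EP; apply: HD.
    have E0 : val (0 : submod (cocycles C k)) = 0 by exact: raddf0.
    by change (coboundaries C k (val (0 : submod (cocycles C k)))); rewrite E0.
  by move=> /(_ (fun _ H => H)) H'; rewrite -EZ; apply: H'.
by apply: Defs.sub_span; change (coboundaries C k (val (r *: w))); rewrite EZ.
Qed.

Lemma cohomology_repr (z : cohomology C k) : exists c, cocycles C k c /\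
  forall r, r *: z = 0 <-> coboundaries C k (r *: c).
Proof.
exists (val (repr z : submod (cocycles C k))); split.
  by have /span_predP/(span_id cocycles_submodule) := valP (repr z : submod (cocycles C k)).
by move=> r; rewrite -cohomology_eq0 -[in X in X <-> _](qmodK z).
Qed.

Lemma cohomology_class c : cocycles C k c ->
  exists z : cohomology C k, forall r, r *: z = 0 <-> coboundaries C k (r *: c).
Proof.
move=> Hc; have cs : c \in span_pred (cocycles C k).
  by apply/span_predP; apply: Defs.sub_span.
by exists (qmod _ (exist _ c cs : submod (cocycles C k))) => r; rewrite cohomology_eq0.
Qed.

End Cohomology.

Section Representatives.
Variables (R : comPzRingType) (noeR : noetherian R) (f : nat -> R) (t : nat).
Variables (I : injective_resolution R^o) (a : set R).
Hypothesis (ha : a = ideal_gen [set x | exists i, (i < t)%N /\ x = f i]).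

Definition evc m (x : kx R^o t) := exists s w, ktr (lev f s) x = kd (lev f (m + s)) w.

Lemma zigzag j m d (x : kx (I j) t) : zc x -> (0 < d)%N -> (j == 0%N) || (1 < d)%N ->
  kproj d x = x ->
  kd (lev f m) x = 0 -> exists x' : kx R^o t, [/\ kproj (d + j) x' = x',
    kd (lev f m) x' = 0 & forall r,
   (exists s w, zc w /\ ktr (lev f s) (r *: x) = kd (lev f (m + s)) w) <-> evc m (r *: x')].
Proof.
elim: j d x => [|j IH] d x zx d0 dj dx cx; last first.
  have [//|x1 [zx1 dx1 cx1 E1]] := zigzag_step noeR zx _ dx cx.
  have dj' : (j == 0%N) || (1 < d.+1)%N by rewrite ltnS d0 orbT.
  have [x' [dx' cx' E']] := IH d.+1 x1 zx1 isT dj' dx1 cx1.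
  by exists x'; rewrite addnS -addSn; split=> // r; rewrite E1 E'.
have augB : zmod_morphism (res_aug I) by move=> u v; apply: linearB.
have augZ g i u : res_aug I (lev f g i *: u) = lev f g i *: res_aug I u by apply: linearZ.
have akd m' (u : kx R^o t) := kmap_kd (f := lev f m') (f' := lev f m') u augB (augZ m').
have atr m' (u : kx R^o t) := kmap_tr (f := lev f m') (f' := lev f m') u (augZ m').
have aZ r (u : kx R^o t) : kmap (res_aug I) (r *: u) = r *: kmap (res_aug I) u.
  elim: t u {zx dx cx akd atr x} => [|t' IH] u /=; [exact: linearZ|by rewrite !IH].
have ainj (u v : kx R^o t) := kmap_inj (x := u) (y := v) (@res_aug_inj _ _ I).
have lift (u : kx (I 0%N) t) : zc u -> exists v, kmap (res_aug I) v = u.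
  move=> /kall_eq0 zu; apply: kall_lift; apply: kall_imp zu => v Ev.
  have : cocycles I 0%N v by []. by rewrite res_exact0 => -[w _ <-]; exists w.
have [x' Ex'] := lift _ zx; exists x'; rewrite addn0; split.
- by apply: ainj; rewrite kmap_proj ?linear0 // Ex'.
- by apply: ainj; rewrite akd Ex' cx kmap0 ?linear0.
move=> r; split=> [[s [w [zw E]]]|[s [w E]]].
  have [w1 Ew1] := lift _ zw; exists s, w1.
  by apply: ainj; rewrite atr aZ Ex' akd Ew1.
exists s, (kmap (res_aug I) w); split; last by rewrite -Ex' -aZ -atr E akd.
rewrite /zc kmap_comp; apply/kall_eq0/kallT => v /=.
have : cocycles I 0%N (res_aug I v) by rewrite res_exact0; exists v.
by [].
Qed.

(** The dictionary between local cohomology and Koszul cochains of large level: the chosen [x] has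
    the annihilator of [z]. A torsion cocycle is killed by some [f_i ^ m], which makes it a Koszul
    cocycle of degree zero, and [zigzag] transports it to [R]. *)
Lemma local_cohomology_repr k (z : local_cohomology a I k) : exists m (x : kx R^o t),
  [/\ kproj k.+1 x = x, kd (lev f m) x = 0 & forall r, r *: z = 0 <-> evc m (r *: x)].
Proof.
have [c [cc Hc]] := cohomology_repr z.
have dc : cdiff I k (val c) = 0 by have := congr1 val (cc : _ = 0).
have [m Hm] := (torsion_levP ha (val c)).1 (Gamma_val ha c).
have km : kd (lev f m) (kin t (val c)) = 0 by apply/kd_kin => i it; apply: Hm.
have GammaP (j : nat) (y : I j) m' : kd (lev f m') (kin t y) = 0 ->
    exists y' : Gamma a (I j), val y' = y.
  move=> /kd_kin H; have Hy : torsion a y by apply/(torsion_levP ha); exists m'.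
  have ys : y \in span_pred (@torsion R a (I j)) by apply/span_predP; apply: Defs.sub_span.
  by exists (exist _ y ys).
have valZ (j : nat) r (y : Gamma a (I j)) : val (r *: y) = r *: val y by apply: linearZ.
case: k z c cc Hc dc Hm km => [|k] z c cc Hc dc Hm km.
  have [|||||x' [dx' cx' E']] // := @zigzag 0 m 1 (kin t (val c)).
  - by rewrite /zc kmap_kin ?linear0 // dc linear0.
  - by rewrite kproj_kin.
  exists m, x'; split=> // r; rewrite -E' Hc; split=> [/(congr1 val) E|[s [w [zw E]]]].
    exists 0%N, 0; split; first by rewrite /zc kmap0 ?linear0.
    by rewrite -kinZ -valZ E kd0 /= linear0 ktr0.
  apply: val_inj; rewrite valZ; apply: (@kin_inj _ _ t).
  have := congr1 (@kproj R _ 1 t) E.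
  by rewrite -kproj_kd kproj0 kd0 -kproj_tr kprojZ kproj_kin /= -kinZ ktr_kin.
(* In positive degree the first connecting step is done by hand: the Koszul coboundary of a
   primitive [y0] of [c] is a cocycle of degree one with coefficients in [Z^k]. *)
have [y0 _ Ey0] : coboundaries I k.+1 (val c) by rewrite -res_exactS.
have Ek : kmap (cdiff I k) (kd (lev f m) (kin t y0)) = 0.
  rewrite (kmap_kd (f' := lev f m)) => [|u v|i u]; [|exact: linearB|exact: linearZ].
  by rewrite kmap_kin ?linear0 // Ey0.
have [|||||x' [dx' cx' E']] // := @zigzag k m 2 (kd (lev f m) (kin t y0)).
- by rewrite orbT.
- by rewrite -kproj_kd kproj_kin.
- exact: kdK.
exists m, x'; split=> // r; rewrite -E' Hc; split=> [[y _ Ey]|[s [w [zw E]]]].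
  have [m1 Hm1] := (torsion_levP ha (val y)).1 (Gamma_val ha y).
  exists m1, (kin t (r *: y0 - val y)); split.
    have Ey' : cdiff I k (val y) = r *: val c by rewrite -valZ -Ey.
    by rewrite /zc kmap_kin ?linear0 // linearB Ey' linearZ Ey0 subrr linear0.
  rewrite ktrZ -lev_tr ktr_kin kinB kdB kinZ kdZ.
  have -> : kd (lev f (m + m1)) (kin t (val y)) = 0.
    by apply/kd_kin => i it; rewrite /lev exprD -scalerA Hm1 ?scaler0.
  by rewrite subr0.
have [u Eu] := kproj1 w.
have : kd (lev f (m + s)) (kin t (r *: y0 - u)) = 0.
  rewrite kinB kdB -Eu kproj_kd -E -kproj_tr kprojZ -kproj_kd kproj_kin /=.
  by rewrite ktrZ -lev_tr ktr_kin kinZ kdZ subrr.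
case/GammaP => y Ey; exists y => //; apply: val_inj; rewrite valZ /= Ey linearB linearZ /= Ey0.
suff -> : cdiff I k u = 0 by rewrite subr0.
apply: (@kin_inj _ _ t); rewrite -(kmap_kin t u) ?linear0 // -Eu kmap_proj ?linear0 // zw.
exact: linear0.
Qed.
End Representatives.

(** * The Koszul complex of the statement *)

Section ListKoszul.
Variable R : comPzRingType.

(** Embeds each degree into the total complex, with image cut out by [kproj k.+1] ([toK_surj]). *)
Fixpoint toK (fs : seq R) : forall k, koszul fs k -> kx R^o (size fs) :=
  match fs return forall k, koszul fs k -> kx R^o (size fs) with
  | [::] => fun k => match k return koszul [::] k -> R^o with 0 => fun x => x | _ => fun=> 0 end
  | f :: fs' => fun k =>
      match k return koszul (f :: fs') k -> kx R^o (size fs').+1 with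
      | 0 => fun x : koszul fs' 0%N => (toK x, 0)
      | k'.+1 => fun z : koszul fs' k'.+1 * koszul fs' k' => (toK z.1, toK z.2)
      end
  end.

(* [koszul] adds the first generator last, [kx] the one of largest index. *)
Definition kgens (fs : seq R) (i : nat) := nth 0 (rev fs) i.

Lemma toK_linear fs k : linear (@toK fs k).
Proof.
elim: fs k => [|f fs IH] [|k] a x y //=; first by rewrite scaler0 addr0.
  by apply: pair_eq; rewrite /= ?scaler0 ?addr0 ?IH.
by apply: pair_eq; apply: IH.
Qed.
HB.instance Definition _ fs k := GRing.isLinear.Build R (koszul fs k) (kx R^o (size fs)) _
  (@toK fs k) (@toK_linear fs k).

Lemma toK_inj fs k (x : koszul fs k) : toK x = 0 -> x = 0.
Proof.
elim: fs k x => [|f fs IH] [|k] x //=.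
- by move=> _; apply/rowP => -[].
- by move=> /(congr1 (@fst (kx R^o (size fs)) (kx R^o (size fs)))) /IH.
- move=> E; apply: pair_eq; apply: IH.
    exact: (congr1 (@fst (kx R^o (size fs)) (kx R^o (size fs))) E).
  exact: (congr1 (@snd (kx R^o (size fs)) (kx R^o (size fs))) E).
Qed.

Lemma toK_surj fs k (y : kx R^o (size fs)) : kproj k.+1 y = y -> exists x : koszul fs k, toK x = y.
Proof.
elim: fs k y => [|f fs IH] [|k] y.
- by exists y.
- by move=> /= <-; exists 0.
- move=> E; have [x Ex] := IH 0%N y.1 (congr1 (@fst (kx R^o (size fs)) (kx R^o (size fs))) E).
  exists x; apply: pair_eq => //=.
  by rewrite -[y.2](congr1 (@snd (kx R^o (size fs)) (kx R^o (size fs))) E) /= kproj0.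
- move=> E; have [x1 Ex1] := IH k.+1 y.1 (congr1 (@fst (kx R^o (size fs)) (kx R^o (size fs))) E).
  have [x2 Ex2] := IH k y.2 (congr1 (@snd (kx R^o (size fs)) (kx R^o (size fs))) E).
  by exists (x1, x2); apply: pair_eq.
Qed.

Lemma kgens_cons f fs i : (i < size fs)%N -> kgens (f :: fs) i = kgens fs i.
Proof. by move=> il; rewrite /kgens rev_cons nth_rcons size_rev il. Qed.

Lemma kgens_last f fs : kgens (f :: fs) (size fs) = f.
Proof. by rewrite /kgens rev_cons nth_rcons size_rev ltnn eqxx. Qed.

Lemma toK_diff fs k (x : koszul fs k) : toK (cdiff (koszul fs) k x) = kd (kgens fs) (toK x).
Proof.
elim: fs k x => [|f fs IH] k x; first by case: k x => [|k] x.
have ext (y : kx R^o (size fs)) : kd (kgens (f :: fs)) y = kd (kgens fs) y.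
  by apply: kd_ext => i; apply: kgens_cons.
have tZ k' (y : koszul fs k') : toK (f *: y) = f *: toK y by apply: linearZ.
case: k x => [|k] x; apply: pair_eq; rewrite /= ?ext ?kgens_last ?IH //.
  by rewrite kd0 subr0 tZ.
have tB k' (y y' : koszul fs k') : toK (y - y') = toK y - toK y' by apply: linearB.
by rewrite tB tZ IH.
Qed.

Lemma koszul_nzd fs k (r : R) (x : kx R^o (size fs)) :
  nonzerodivisor (cohomology (koszul fs) k) r ->
  kproj k.+1 x = x -> kd (kgens fs) x = 0 -> (exists w, r *: x = kd (kgens fs) w) ->
  exists v, x = kd (kgens fs) v.
Proof.
move=> rz dx cx [w Ew]; have [c Ec] := toK_surj dx.
have cc : cocycles (koszul fs) k c by apply: toK_inj; rewrite toK_diff Ec.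
have [z Hz] := cohomology_class cc.
suff /Hz : 1 *: z = 0.
  rewrite scale1r -Ec; case: k {rz dx cc z Hz} c Ec => [|k] c Ec.
    by move=> ->; exists 0; rewrite kd0 linear0.
  by case=> v _ <-; exists (toK v); rewrite toK_diff.
rewrite scale1r; apply: rz; rewrite scaler0; apply/Hz.
have Ew' : r *: x = kd (kgens fs) (kproj k w) by rewrite kproj_kd -Ew kprojZ dx.
have tZ k' (y : koszul fs k') : toK (r *: y) = r *: toK y by apply: linearZ.
case: k w Ew' {Ew} c {Hz z} cc Ec {dx cx} => [|k] w Ew' c cc Ec.
  by apply: toK_inj; rewrite tZ Ec Ew' kproj0 kd0.
have [v Ev] := toK_surj (kprojK k.+1 w); exists v => //.
by apply/eqP; rewrite -subr_eq0; apply/eqP/toK_inj; rewrite linearB /= toK_diff Ev -Ew' tZ Ec subrr.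
Qed.

End ListKoszul.

(** * Bounded torsion of Koszul cohomology *)

Section AscendingChains.
Variables (R : comPzRingType) (noeR : noetherian R).

Definition acc (M : lmodType R) := forall C : nat -> set M, (forall n, submodule (C n)) ->
  (forall n, C n `<=` C n.+1) -> exists N, forall n, (N <= n)%N -> C n `<=` C N.

Lemma chain_mono (T : Type) (C : nat -> set T) n m : (forall n, C n `<=` C n.+1) ->
  (n <= m)%N -> C n `<=` C m.
Proof.
move=> H; elim: m => [|m IH]; first by rewrite leqn0 => /eqP ->.
by rewrite leq_eqVlt => /orP[/eqP -> //|/IH E] x /E/H.
Qed.

Lemma acc_ring : acc R^o.
Proof.
move=> C HC CS; have [N HN] := noeth_acc noeR (HC : forall n, ideal (C n : set R)) CS.
by exists N => n Nn; rewrite HN.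
Qed.

Lemma acc_pair (M N : lmodType R) : acc M -> acc N -> acc (M * N)%type.
Proof.
move=> aM aN C HC CS.
have [||n1 H1] := aM (fun n => [set x | exists y, C n (x, y)]).
- move=> n; have [C0 CD] := HC n; split=> [|r x x' [y Hy] [y' Hy']]; first by exists 0.
  by exists (r *: y + y'); apply: (CD r _ _ Hy Hy').
- by move=> n x [y /CS]; exists y.
have [||n2 H2] := aN (fun n => [set y | C n (0, y)]).
- move=> n; have [C0 CD] := HC n; split=> [//|r x x' Hx Hx'] /=.
  by have := CD r _ _ Hx Hx'; congr (C n _); apply: pair_eq; rewrite //= scaler0 addr0.
- by move=> n y /CS.
exists (maxn n1 n2) => n; rewrite geq_max => /andP[nn1 nn2] [x y] Cxy.
have [y' Hy'] : exists y', C n1 (x, y') by apply: (H1 n nn1); exists y.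
have Hd : C n2 (0, y - y').
  apply: (H2 n nn2) => /=; have [C0 CD] := HC n.
  have := CD (-1) _ _ (chain_mono CS nn1 Hy') Cxy; congr (C n _).
  by apply: pair_eq; rewrite /= scaleN1r addrC ?subrr.
have [C0 CD] := HC (maxn n1 n2).
have := CD 1 _ _ (chain_mono CS (leq_maxl _ _) Hy') (chain_mono CS (leq_maxr n1 n2) Hd).
by congr (C _ _); apply: pair_eq; rewrite /= scale1r ?addr0 // addrC subrK.
Qed.

Lemma acc_kx t : acc (kx R^o t).
Proof. by elim: t => [|t IH]; [exact: acc_ring|exact: acc_pair]. Qed.

(** The cochains that become coboundaries after multiplication by [n!] form an increasing chain of
    submodules, constant from some [N] on. For a prime [p > N], both [p x] and [N! x] are then
    coboundaries, and [p] is prime to [N!]. *)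
Lemma bounded_torsion (f : nat -> R) t : exists N, forall p (x w : kx R^o t), prime p ->
  (N < p)%N -> p%:R *: x = kd f w -> exists v, x = kd f v.
Proof.
pose C n := [set x : kx R^o t | exists v, n`!%:R *: x = kd f v].
have [||N HN] := @acc_kx t C.
- move=> n; split=> [|r x y [v Ev] [u Eu]]; first by exists 0; rewrite scaler0 kd0.
  by exists (r *: v + u); rewrite kdD kdZ -Ev -Eu scalerDr !scalerA mulrC.
- by move=> n x [v Ev]; exists (n.+1%:R *: v); rewrite factS natrM -scalerA Ev kdZ.
exists N => p x w pp Np E.
have [v Ev] : C N x.
  apply: (HN p (ltnW Np)); exists ((p.-1)`!%:R *: w).
  have Ep : p`! = ((p.-1)`! * p)%N.
    by rewrite -[in LHS](prednK (prime_gt0 pp)) factS prednK ?prime_gt0 // mulnC.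
  by rewrite kdZ -E scalerA -natrM Ep.
have cop : coprime p N`!.
  rewrite prime_coprime //; elim: N Np {HN v Ev} => [|N IH] Np; first by rewrite dvdn1 neq_ltn prime_gt1 ?orbT.
  by rewrite factS Euclid_dvdM // negb_or IH ?(ltnW Np) // andbT gtnNdvd.
have [u u' Eu _] := egcdnP N`! (prime_gt0 pp).
exists (u%:R *: w - u'%:R *: v); rewrite kdB !kdZ -E -Ev !scalerA -!natrM Eu.
move: cop; rewrite /coprime => /eqP ->.
by rewrite natrD scalerDl scale1r addrAC subrr add0r.
Qed.
End AscendingChains.

(** * Classes modulo a prime number *)

Section Congruence.
Variables (A : comPzRingType) (p : nat).

Definition kcong t (z z' : kx A^o t) := exists u, z = z' + p%:R *: u.

Lemma kcong_refl t (z : kx A^o t) : kcong z z.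
Proof. by exists 0; rewrite scaler0 addr0. Qed.
Lemma kcong_sym t (z z' : kx A^o t) : kcong z z' -> kcong z' z.
Proof. by move=> [u ->]; exists (- u); rewrite scalerN addrK. Qed.
Lemma kcong_trans t (z1 z2 z3 : kx A^o t) : kcong z1 z2 -> kcong z2 z3 -> kcong z1 z3.
Proof. by move=> [u ->] [v ->]; exists (v + u); rewrite scalerDr addrA. Qed.
Lemma kcongD t (z1 z1' z2 z2' : kx A^o t) : kcong z1 z1' -> kcong z2 z2' -> kcong (z1 + z2) (z1' + z2').
Proof. by move=> [u ->] [v ->]; exists (u + v); rewrite scalerDr addrACA. Qed.
Lemma kcong_sum (I : Type) (r : seq I) (P : pred I) t (F G : I -> kx A^o t) :
  (forall i, P i -> kcong (F i) (G i)) ->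
  kcong (\sum_(i <- r | P i) F i) (\sum_(i <- r | P i) G i).
Proof.
by move=> H; elim/big_ind2: _ => //; [exact: kcong_refl|move=> *; exact: kcongD].
Qed.
Lemma kcongZ t (a a' : A) (z z' : kx A^o t) : (exists b, a = a' + p%:R * b) -> kcong z z' ->
  kcong (a *: z) (a' *: z').
Proof.
move=> [b ->] [u ->]; exists (a' *: u + b *: (z' + p%:R *: u)).
rewrite scalerDl !scalerDr !scalerA -!addrA; congr (_ + _).
by rewrite (mulrC p%:R a') (mulrC _ b).
Qed.
Lemma kcongZl t (a : A) (z z' : kx A^o t) : kcong z z' -> kcong (a *: z) (a *: z').
Proof. by apply: kcongZ; exists 0; rewrite mulr0 addr0. Qed.

Lemma kcong_pair t (z z' : kx A^o t.+1) : kcong z.1 z'.1 -> kcong z.2 z'.2 -> kcong z z'.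
Proof. by move=> [u Eu] [v Ev]; exists (u, v); apply: pair_eq. Qed.

Lemma kcong_tr t (g g' : nat -> A) (z z' : kx A^o t) :
  (forall i, exists b, g i = g' i + p%:R * b) -> kcong z z' -> kcong (ktr g z) (ktr g' z').
Proof.
move=> Hg; elim: t z z' => [|t IH] z z' // [u Eu]; apply: kcong_pair => /=.
  by apply: IH; exists u.1; rewrite Eu.
by apply: kcongZ => //; apply: IH; exists u.2; rewrite Eu.
Qed.

Lemma kcong_kd t (g : nat -> A) (z z' : kx A^o t) : kcong z z' -> kcong (kd g z) (kd g z').
Proof. by move=> [u ->]; exists (kd g u); rewrite kdD kdZ. Qed.

Lemma kcong_map (A' : comPzRingType) t (g g' : A' -> A) (v : kx A'^o t) :
  (forall b, exists c, g b = g' b + p%:R * c) -> kcong (kmap (M := A'^o) (M' := A^o) g v) (kmap (M := A'^o) (M' := A^o) g' v).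
Proof.
by move=> H; elim: t v => [|t IH] v /=; [exact: H|apply: kcong_pair; exact: IH].
Qed.

Lemma kcong_kall t (z : kx A^o t) : kcong z 0 <-> kall (M := A^o) (fun a : A => exists b, a = p%:R * b) z.
Proof.
elim: t z => [|t IH] z; first by split=> -[b ->]; exists b; rewrite add0r.
rewrite /= -!IH; split=> [[u ->]|[H1 H2]]; last exact: (kcong_pair (z' := (0 : kx A^o t.+1))).
by split; [exists u.1|exists u.2].
Qed.

End Congruence.

Section Operators.
Variables (B : comPzRingType) (f : nat -> B) (t p : nat).
Local Notation X := (kx B^o t).

Definition liftable m (z : X) := exists u v, kd (lev f m) u = 0 /\ z = u + p%:R *: v.

Lemma liftable0 m : liftable m 0.
Proof. by exists 0, 0; rewrite kd0 scaler0 addr0. Qed.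
Lemma liftableD m x y : liftable m x -> liftable m y -> liftable m (x + y).
Proof.
move=> [u [v [E ->]]] [u' [v' [E' ->]]]; exists (u + u'), (v + v').
by rewrite kdD E E' addr0 scalerDr addrACA.
Qed.
Lemma liftable_tr m s x : liftable m x -> liftable (m + s)%N (ktr (lev f s) x).
Proof.
move=> [u [v [E ->]]]; exists (ktr (lev f s) u), (ktr (lev f s) v).
by rewrite lev_tr E ktr0 ktrD ktrZ.
Qed.
Lemma liftableZ m a x : liftable m x -> liftable m (a *: x).
Proof.
move=> [u [v [E ->]]]; exists (a *: u), (a *: v).
by rewrite kdZ E scaler0 scalerDr !scalerA mulrC.
Qed.
Lemma liftable_p m v : liftable m (p%:R *: v).
Proof. by exists 0, v; rewrite kd0 add0r. Qed.

(* The image of the cohomology of [B] in that of [B / p]. *)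
Definition InIm := ev f liftable.

Lemma InImD m x y : InIm m x -> InIm m y -> InIm m (x + y).
Proof. exact: (evD liftableD liftable_tr). Qed.
Lemma InImZ m a x : InIm m x -> InIm m (a *: x).
Proof. by apply: evZ => m' y; apply: liftableZ. Qed.
Lemma InIm_sum (I : Type) (r : seq I) (P : pred I) m (F : I -> X) :
  (forall i, P i -> InIm m (F i)) -> InIm m (\sum_(i <- r | P i) F i).
Proof. exact: (ev_sum liftable0 liftableD liftable_tr). Qed.
Lemma InIm_up m s x : InIm m x -> InIm (m + s) (ktr (lev f s) x).
Proof. exact: (ev_up liftable_tr). Qed.
Lemma InIm_down m s x : InIm (m + s) (ktr (lev f s) x) -> InIm m x.
Proof. exact: ev_down. Qed.
Lemma InIm_cong m x y : kcong p x y -> InIm m y -> InIm m x.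
Proof. by move=> [u ->] Hy; apply: InImD => //; apply: ev_K; apply: liftable_p. Qed.

Variables (C : comPzRingType) (io ta : {rmorphism B -> C}) (e : nat -> C) (L : C -> B) (N : nat).
Hypotheses (eE : forall i, e i * ta (f i) = io (f i) ^+ N)
  (LB : zmod_morphism L) (LZ : forall b c, L (io b * c) = b * L c).

(** Formally [y / f ^ m] is sent to [L (ta y / ta f ^ m)]. As [e i] stands for [f_i ^ N / ta f_i],
    the new denominator is [f ^ (N m)], and the level is multiplied by [N]. *)
Definition opD m (y : X) : X :=
  kmap (M := C^o) (M' := B^o) L (ktr (lev e m) (kmap (M := B^o) (M' := C^o) ta y)).

Lemma L0 : L 0 = 0. Proof. by rewrite -(subrr 0) LB subrr. Qed.
Lemma LD : {morph L : a b / a + b}.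
Proof. by move=> a b; rewrite -[b in LHS]opprK LB -[- b]sub0r LB L0 sub0r opprK. Qed.

Lemma opDD m y y' : opD m (y + y') = opD m y + opD m y'.
Proof.
rewrite /opD !kmapD ?ktrD ?kmapD //; first exact: LD.
exact: rmorphD.
Qed.

Lemma opD0 m : opD m 0 = 0.
Proof. by rewrite /opD kmap0 ?rmorph0 // ktr0 kmap0 // L0. Qed.

Lemma opDp m k y : opD m (k%:R *: y) = k%:R *: opD m y.
Proof.
elim: k => [|k IH]; first by rewrite !scale0r opD0.
by rewrite !mulrS !scalerDl !scale1r opDD IH.
Qed.

Lemma opD_sum m (I : Type) (r : seq I) (P : pred I) (F : I -> X) :
  opD m (\sum_(i <- r | P i) F i) = \sum_(i <- r | P i) opD m (F i).
Proof. exact: (big_morph _ (opDD m) (opD0 m)). Qed.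

Lemma opD_kd m w : opD m (kd (lev f m) w) = kd (lev f (N * m)) (opD m w).
Proof.
rewrite /opD (kmap_kd (f' := lev (ta \o f) m)); last first.
- by move=> i a; rewrite /lev [_ *: a]/(_ * a) rmorphM rmorphXn.
- by move=> a b; rewrite rmorphB.
rewrite -kd_tr (kd_ext (g := io \o lev f (N * m))); last first.
  by move=> i _; rewrite /lev /= -exprMn eE rmorphXn /= exprM.
rewrite (kmap_kd (f' := lev f (N * m))) // => i a.
exact: LZ.
Qed.

Lemma opD_tr m s y : opD (m + s) (ktr (lev f s) y) = ktr (lev f (N * s)) (opD m y).
Proof.
rewrite /opD (kmap_tr (f' := lev (ta \o f) s)); last first.
  by move=> i a; rewrite /lev [_ *: a]/(_ * a) rmorphM rmorphXn.
rewrite ktrM (ktr_ext (g := fun i => io (lev f (N * s) i) * lev e m i)); last first.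
  move=> i _; rewrite /lev /= exprD -mulrA -exprMn eE mulrC; congr (_ * _).
  by rewrite rmorphXn /= exprM.
rewrite -ktrM (kmap_tr (f' := lev f (N * s))) // => i a.
exact: LZ.
Qed.

Lemma opD_InIm m y : InIm m y -> InIm (N * m) (opD m y).
Proof.
move=> [s [w [z [[u [v [cu ->]]] E]]]].
exists (N * s)%N, (opD (m + s) w), (opD (m + s) (u + p%:R *: v)); split.
  exists (opD (m + s) u), (opD (m + s) v); split; last by rewrite opDD opDp.
  by rewrite -mulnDr -opD_kd cu opD0.
by rewrite -opD_tr E opDD opD_kd mulnDr.
Qed.

Lemma opD_cong m y y' : kcong p y y' -> kcong p (opD m y) (opD m y').
Proof. by move=> [u ->]; exists (opD m u); rewrite opDD opDp. Qed.

(** Modulo [p] the homomorphism [ta] fixes [N]-th powers, so the operator is linear over them and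
    acts on the coefficient [c] alone. *)
Lemma opD_power m (c : B) (v : X) :
  (forall b, exists d, ta b ^+ N = io b ^+ N + p%:R * d) ->
  (forall i, exists d, e i ^+ N = io (f i) ^+ (N * N.-1) + p%:R * d) ->
  kcong p (opD (N * m) (kmap (M := B^o) (M' := B^o) (fun b => c * b ^+ N) v))
    (ktr (lev f (N * m * N.-1)) (kmap (M := B^o) (M' := B^o) (fun b => L (ta c) * b ^+ N) v)).
Proof.
move=> Hta He.
have powcong k (a b : C) : (exists d, a = b + p%:R * d) -> exists d, a ^+ k = b ^+ k + p%:R * d.
  move=> [d ->]; elim: k => [|k [d' IH]]; first by exists 0; rewrite mulr0 addr0.
  by exists (b * d' + d * b ^+ k + d * p%:R * d'); rewrite !exprS IH; ring.
pose z1 := ktr (lev e (N * m)) (kmap (M := B^o) (M' := C^o) (fun b => ta c * ta b ^+ N) v).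
pose z2 := ktr (fun i => io (lev f (N * m * N.-1) i)) (kmap (M := B^o) (M' := C^o) (fun b => io (b ^+ N) * ta c) v).
have [u Eu] : kcong p z1 z2.
  apply: kcong_tr => [i|].
    have [d E] := powcong m _ _ (He i); exists d.
    by rewrite /lev exprM E rmorphXn -exprM mulnAC.
  apply: kcong_map => b; have [d ->] := Hta b; exists (ta c * d).
  by rewrite rmorphXn; ring.
have -> : opD (N * m) (kmap (M := B^o) (M' := B^o) (fun b => c * b ^+ N) v) =
    kmap (M := C^o) (M' := B^o) L z1.
  rewrite /opD kmap_comp; congr (kmap _ (ktr _ _)); apply: kmap_ext => b /=.
  by rewrite rmorphM rmorphXn.
have pC k (w : kx C^o t) : kmap (M := C^o) (M' := B^o) L (k%:R *: w) = k%:R *: kmap (M := C^o) (M' := B^o) L w.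
  elim: k => [|k IH]; first by rewrite !scale0r kmap0 // L0.
  by rewrite !mulrS !scalerDl !scale1r kmapD ?IH //; exact: LD.
exists (kmap (M := C^o) (M' := B^o) L u).
rewrite Eu kmapD ?pC; last exact: LD.
congr (_ + _); rewrite (kmap_tr (f' := lev f (N * m * N.-1))) => [|i a]; last exact: LZ.
rewrite kmap_comp; congr (ktr _ _); apply: kmap_ext => b /=.
by rewrite LZ mulrC.
Qed.

End Operators.

(** * Separation of exponents by differential operators *)

Section HasseSchmidt.
Variables (B : comNzRingType) (f : nat -> B) (t p : nat) (x : nat -> B) (n : nat).
Hypotheses (pp : prime p)
  (hs : forall N j, (0 < N)%N ->
    exists (C : comNzRingType) (io ta : {rmorphism B -> C}) (T : C) (co : nat -> C -> B),
    [/\ T ^+ N = 0, forall c, c = \sum_(i < N) io (co i c) * T ^+ i,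
        forall (b : nat -> B) a, (a < N)%N -> co a (\sum_(i < N) io (b i) * T ^+ i) = b a,
        forall b, exists c, ta b = io b + T * c &
        forall i, (i < n)%N -> ta (x i) = io (x i) + (i == j)%:R * T]).
Local Notation X := (kx B^o t).

Lemma horner_map_wide (A C : comNzRingType) (phi : {rmorphism A -> C}) (q : {poly A}) z k :
  (size q <= k)%N -> (map_poly phi q).[z] = \sum_(a < k) phi q`_a * z ^+ a.
Proof.
move=> sq; rewrite (@horner_coef_wide _ k); last by rewrite (leq_trans _ sq) // size_poly.
by apply: eq_bigr => a _; rewrite coef_map.
Qed.

(** The operator that reads the coefficient of [(x_j ^ (p ^ e)) ^ b], treating the other coordinates
    and, modulo [p], all [p ^ (e + 1)]-st powers as constants. *)
Lemma coord_op e j b : (b < p)%N -> (j < n)%N ->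
  exists (C : comNzRingType) (io ta : {rmorphism B -> C}) (ee : nat -> C) (L : C -> B),
  [/\ (forall i, ee i * ta (f i) = io (f i) ^+ (p ^ e.+1)) /\ zmod_morphism L,
      forall b c, L (io b * c) = b * L c,
      (forall b, exists d, ta b ^+ (p ^ e.+1) = io b ^+ (p ^ e.+1) + p%:R * d) /\
      (forall i, exists d, ee i ^+ (p ^ e.+1) = io (f i) ^+ (p ^ e.+1 * (p ^ e.+1).-1) + p%:R * d),
      forall i, (i < n)%N -> i <> j -> ta (x i) = io (x i) &
      forall k, (k < p)%N -> exists d, L (ta ((x j ^+ (p ^ e)) ^+ k)) = (k == b)%:R + p%:R * d].
Proof.
move=> bp jn; set N := (p ^ e.+1)%N.
have N0 : (0 < N)%N by rewrite expn_gt0 prime_gt0.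
have [C [io [ta [T [co [TN coE coK taT tax]]]]]] := hs j N0.
have coB a c c' : (a < N)%N -> co a (c - c') = co a c - co a c'.
  move=> aN; rewrite {1}(coE c) {1}(coE c') -sumrB.
  rewrite -(coK (fun i => co i c - co i c') a aN); congr (co a _); apply: eq_bigr => i _.
  by rewrite rmorphB mulrBl.
have coZ a c b' : (a < N)%N -> co a (io b' * c) = b' * co a c.
  move=> aN; rewrite {1}(coE c) -(coK (fun i => b' * co i c) a aN); congr (co a _).
  by rewrite mulr_sumr; apply: eq_bigr => i _; rewrite rmorphM mulrA.
have coT a k b' : (a < N)%N -> (k < N)%N -> co a (io b' * T ^+ k) = (a == k)%:R * b'.
  move=> aN kN; rewrite -(coK (fun i => (i == k)%:R * b') a aN); congr (co a _).
  rewrite (bigD1 (Ordinal kN)) //= eqxx mul1r big1 ?addr0 // => i ne.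
  suff -> : (i == k :> nat) = false by rewrite mul0r rmorph0 mul0r.
  by apply: contraNF ne => /eqP E; apply/eqP/val_inj.
have Na (a : 'I_p) : (p ^ e * a < N)%N by rewrite /N expnSr ltn_pmul2l // expn_gt0 prime_gt0.
pose X0 := x j ^+ (p ^ e).
(* Replacing the increment [T ^ (p ^ e)] by ['X - X0] turns the expansion of
   [(X0 + T ^ (p ^ e)) ^ k] back into ['X^k], whose coefficient at [b] is wanted. *)
pose w (a : nat) := (('X - X0%:P) ^+ a)`_b.
pose L c := \sum_(a < p) w a * co (p ^ e * a)%N c.
have LB : zmod_morphism L.
  by move=> c c'; rewrite /L -sumrB; apply: eq_bigr => a _; rewrite coB // mulrBr.
have LZ b' c : L (io b' * c) = b' * L c.
  by rewrite /L mulr_sumr; apply: eq_bigr => a _; rewrite coZ // mulrCA.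
have Lp c d : L (c + p%:R * d) = L c + p%:R * L d.
  have -> : c + p%:R * d = c - io (- p%:R) * d by rewrite rmorphN rmorph_nat; ring.
  by rewrite LB LZ mulNr opprK.
have powmod (c d : C) k : exists d', (c + T * d) ^+ (p ^ k) = c ^+ (p ^ k) + T ^+ (p ^ k) * d ^+ (p ^ k) + p%:R * d'.
  by have [d' ->] := frobenius_add_mod pp c (T * d) k; exists d'; rewrite exprMn.
pose phi i := sval (cid (taT (f i))).
have phiE i : ta (f i) = io (f i) + T * phi i := svalP (cid (taT (f i))).
(* The quotient of [f ^ N - (- T phi) ^ N] by [f + T phi], where [T ^ N = 0]. *)
pose ee i := \sum_(a < N) io (f i) ^+ (N.-1 - a) * (- (T * phi i)) ^+ a.
exists C, io, ta, ee, L; split=> //.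
- split=> // i; rewrite phiE -[T * phi i in X in _ * X]opprK mulrC.
  by rewrite -subrXX exprNn exprMn TN mul0r mulr0 subr0.
- split=> [b'|i].
    by have [c ->] := taT b'; have [d ->] := powmod (io b') c e.+1; exists d; rewrite TN mul0r addr0.
  have [c Ec] : exists c, ee i = io (f i) ^+ N.-1 + T * c.
    rewrite /ee -(prednK N0) big_ord_recl /= subn0 expr0 mulr1.
    exists (\sum_(a < N.-1) io (f i) ^+ (N.-1 - bump 0 a) * (- phi i * (- (T * phi i)) ^+ a)).
    rewrite mulr_sumr; congr (_ + _); apply: eq_bigr => a _.
    rewrite /bump /= add1n exprS; ring.
  by rewrite Ec; have [d ->] := powmod (io (f i) ^+ N.-1) c e.+1; exists d; rewrite TN mul0r addr0 -exprM mulnC.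
- by move=> i ni ij; rewrite tax //; have /eqP/negPf -> := ij; rewrite mul0r addr0.
move=> k kp; pose T' := T ^+ (p ^ e).
have [d Ed] : exists d, ta (X0 ^+ k) = (io X0 + T') ^+ k + p%:R * d.
  have [d1 E1] := powmod (io (x j)) 1 e.
  rewrite /X0 !rmorphXn tax // eqxx mul1r -{1}[T]mulr1 E1 expr1n mulr1 -/T'.
  elim: k {kp} => [|k [d' IH]]; first by exists 0; rewrite mulr0 addr0.
  by exists ((io (x j) ^+ (p ^ e) + T') * d' + d1 * (io (x j) ^+ (p ^ e) + T') ^+ k + p%:R * d1 * d'); rewrite !exprS IH; ring.
exists (L d); rewrite Ed Lp; congr (_ + _).
pose q := ('X - (- X0)%:P) ^+ k : {poly B}.
have sq : (size q <= p)%N by rewrite size_exp_XsubC.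
have -> : (io X0 + T') ^+ k = \sum_(a < p) io q`_a * T ^+ (p ^ e * a).
  transitivity (map_poly io q).[T'].
    by rewrite /q (rmorphXn (map_poly io)) /= map_polyXsubC horner_exp hornerXsubC rmorphN opprK addrC.
  rewrite (horner_map_wide io T' sq); apply: eq_bigr => a _.
  by rewrite /T' -exprM.
have LD : {morph L : c c' / c + c'}.
  by move=> c c'; rewrite -{1}[c']opprK LB -[- c']mulN1r -(rmorphN1 io) LZ mulN1r opprK.
have L00 : L 0 = 0 by rewrite -(subrr 0) LB subrr.
rewrite (big_morph L LD L00).
have LT (a : 'I_p) : L (io q`_a * T ^+ (p ^ e * a)) = q`_a * w a.
  rewrite LZ /L (bigD1 a) //= -{1}[T ^+ _]mul1r -(rmorph1 io) coT // eqxx mulr1 big1 => [|a' ne].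
    by rewrite mulr1 addr0.
  rewrite -[T ^+ _]mul1r -(rmorph1 io) coT // eqn_pmul2l ?expn_gt0 ?prime_gt0 //.
  suff -> : (a' == a :> nat) = false by rewrite mul0r mulr0.
  by apply: contraNF ne => /eqP E; apply/eqP/val_inj.
under eq_bigr => a _ do rewrite LT.
have Eq : q \Po ('X - X0%:P) = 'X^k.
  by rewrite /q (rmorphXn (comp_poly ('X - X0%:P))) /= comp_polyB comp_polyX comp_polyC polyCN opprK subrK.
rewrite -[RHS](_ : ('X^k : {poly B})`_b = _); last by rewrite coefXn eq_sym.
rewrite -Eq /comp_poly (horner_map_wide polyC _ sq) coef_sum; apply: eq_bigr => a _.
by rewrite coefCM.
Qed.

(** Two properties will be substituted: lying in the image [InIm], and vanishing modulo [p] at level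
    zero. *)
Variable P : nat -> X -> Prop.
Hypotheses
  (PD : forall (C : comNzRingType) (io ta : {rmorphism B -> C}) (ee : nat -> C) (L : C -> B) N m y,
     (forall i, ee i * ta (f i) = io (f i) ^+ N) -> zmod_morphism L ->
     (forall b c, L (io b * c) = b * L c) -> (0 < N)%N -> P m y -> P (N * m)%N (opD ta ee L m y))
  (Pcong : forall m y y', kcong p y y' -> P m y' -> P m y)
  (Pdown : forall m k y, P (m + m * k)%N (ktr (lev f (m * k)) y) -> P m y).

Definition kpow (c : B) (N : nat) (v : X) : X := kmap (M := B^o) (M' := B^o) (fun b => c * b ^+ N) v.

Lemma kpow_scale c N v : kpow c N v = c *: kpow 1 N v.
Proof.
rewrite /kpow; elim: t v => [|t' IH] v /=; first by rewrite mul1r.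
by rewrite !IH.
Qed.

(* One coordinate at a time, a differential operator picks out the terms with a given *)
(* exponent.                                                                           *)
Lemma extract e m (v : {ffun 'I_n -> 'I_p} -> X) g0 :
  P (p ^ e.+1 * m)%N (\sum_g kpow (pmono x g ^+ (p ^ e)) (p ^ e.+1) (v g)) ->
  P (p ^ e.+1 * m)%N (kpow 1 (p ^ e.+1) (v g0)).
Proof.
set N := (p ^ e.+1)%N => H.
have N0 : (0 < N)%N by rewrite expn_gt0 prime_gt0.
pose mu k (g : {ffun 'I_n -> 'I_p}) := \prod_(i < n | (k <= i)%N) (x i ^+ (p ^ e)) ^+ g i.
pose S k (g : {ffun 'I_n -> 'I_p}) := [forall i : 'I_n, (i < k)%N ==> (g i == g0 i)].
suff C k : (k <= n)%N -> P (N * m)%N (\sum_(g | S k g) kpow (mu k g) N (v g)).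
  have := C n (leqnn n); rewrite (big_pred1 g0) => [|g].
    by rewrite /mu big_pred0 // => i; rewrite leqNgt ltn_ord.
  rewrite /S /=; apply/forallP/eqP => [E|-> i]; last by rewrite eqxx implybT.
  by apply/ffunP => i; have := E i; rewrite ltn_ord => /eqP.
elim: k => [_|k IH kn].
  rewrite (eq_bigl predT) => [|g]; last by apply/forallP => i; rewrite ltn0.
  move: H; congr P; apply: eq_bigr => g _; congr kpow.
  by rewrite /mu /pmono -prodrXl; apply: eq_big => // i _; rewrite -!exprM mulnC.
have [C [io [ta [ee [L [[eE LB] LZ [Hta He] tax Lk]]]]]] := coord_op e (ltn_ord (g0 (Ordinal kn))) kn.
have := PD eE LB LZ N0 (IH (ltnW kn)); rewrite opD_sum // => H1.
(* The operator has brought the level from [N m] to [N (N m)]; the surplus is a transition map. *)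
apply: (@Pdown _ N.-1).
have -> : (N * m + N * m * N.-1 = N * (N * m))%N by rewrite -mulnS prednK // mulnC.
apply: (Pcong _ H1).
pose mon g := \prod_(i < n | (k.+1 <= i)%N) (x i ^+ (p ^ e)) ^+ g i.
have muE (g : {ffun 'I_n -> 'I_p}) : mu k g = mu k.+1 g * (x k ^+ (p ^ e)) ^+ g (Ordinal kn).
  rewrite /mu (bigD1 (Ordinal kn)) //= mulrC; congr (_ * _); apply: eq_bigl => i.
  by rewrite [RHS]ltn_neqAle eq_sym andbC.
have tamu (g : {ffun 'I_n -> 'I_p}) : ta (mu k.+1 g) = io (mu k.+1 g).
  rewrite /mu !rmorph_prod; apply: eq_bigr => i ki; rewrite !rmorphXn tax //.
  by move=> E; move: ki; rewrite E ltnn.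
apply: kcong_sym; rewrite linear_sum /=.
have -> : \sum_(g | S k.+1 g) ktr (lev f (N * m * N.-1)) (kpow (mu k.+1 g) N (v g)) =
   \sum_(g | S k g) (g (Ordinal kn) == g0 (Ordinal kn))%:R *: ktr (lev f (N * m * N.-1)) (kpow (mu k.+1 g) N (v g)).
  rewrite [RHS]big_mkcond [LHS]big_mkcond; apply: eq_bigr => g _.
  have -> : S k.+1 g = S k g && (g (Ordinal kn) == g0 (Ordinal kn)).
    apply/forallP/andP => [E|[/forallP E1 /eqP E2] i].
      split; last by have := E (Ordinal kn); rewrite ltnSn.
      by apply/forallP => i; apply/implyP => ik; have := E i; rewrite ltnS (ltnW ik).
    rewrite ltnS leq_eqVlt; apply/implyP => /orP[/eqP ik|ik]; last by have := E1 i; rewrite ik.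
    by have -> : i = Ordinal kn by [apply: val_inj]; rewrite E2.
  by case: (S k g); case: eqP => _ //=; rewrite ?scale1r ?scale0r.
apply: kcong_sum => g _.
have Hd := @opD_power B f t p C io ta ee L N LB LZ m (mu k g) (v g) Hta He.
apply: (kcong_trans Hd).
rewrite kpow_scale ktrZ scalerA.
have -> : kmap (M := B^o) (M' := B^o) (fun b => L (ta (mu k g)) * b ^+ N) (v g) = kpow (L (ta (mu k g))) N (v g) by [].
rewrite [kpow (L _) _ _]kpow_scale ktrZ; apply: kcongZ; last exact: kcong_refl.
rewrite muE rmorphM tamu LZ.
have [d ->] := Lk (g (Ordinal kn)) (ltn_ord _); exists (mu k.+1 g * d).
have -> : (g (Ordinal kn) == g0 (Ordinal kn) :> nat) = (g (Ordinal kn) == g0 (Ordinal kn)) by [].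
ring.
Qed.

End HasseSchmidt.

Section ComponentMaps.
Variables (A : comPzRingType).

Lemma kall_map (M M' : lmodType A) (P : M' -> Prop) (phi : M -> M') t (v : kx M t) :
  kall P (kmap phi v) <-> kall (P \o phi) v.
Proof. by elim: t v => [|t IH] v //=; rewrite !IH. Qed.

Lemma kcong_map_arg p t (g : A -> A) (v w : kx A^o t) :
  (forall b d, exists d', g (b + p%:R * d) = g b + p%:R * d') -> kcong p v w ->
  kcong p (kmap (M := A^o) (M' := A^o) g v) (kmap (M := A^o) (M' := A^o) g w).
Proof.
move=> H; elim: t v w => [|t IH] v w [u ->]; first exact: H.
by apply: kcong_pair; apply: IH; [exists u.1|exists u.2].
Qed.

Lemma kcong_mapD p t (g : A -> A) (v w : kx A^o t) :
  (forall b b', exists d, g (b + b') = g b + g b' + p%:R * d) ->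
  kcong p (kmap (M := A^o) (M' := A^o) g (v + w))
    (kmap (M := A^o) (M' := A^o) g v + kmap (M := A^o) (M' := A^o) g w).
Proof.
move=> H; elim: t v w => [|t IH] v w; first exact: H.
by apply: kcong_pair; apply: IH.
Qed.

Lemma fst_sum (U V : zmodType) (I : Type) (r : seq I) (P : pred I) (F : I -> U * V) :
  (\sum_(i <- r | P i) F i).1 = \sum_(i <- r | P i) (F i).1.
Proof. exact: (big_morph fst). Qed.
Lemma snd_sum (U V : zmodType) (I : Type) (r : seq I) (P : pred I) (F : I -> U * V) :
  (\sum_(i <- r | P i) F i).2 = \sum_(i <- r | P i) (F i).2.
Proof. exact: (big_morph snd). Qed.
End ComponentMaps.

(** * Roots with respect to a [p]-basis *)

Section Roots.
Variables (B : comNzRingType) (f : nat -> B) (p : nat) (x : nat -> B) (n : nat).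
Hypotheses (pp : prime p)
  (hs : forall N j, (0 < N)%N ->
    exists (C : comNzRingType) (io ta : {rmorphism B -> C}) (T : C) (co : nat -> C -> B),
    [/\ T ^+ N = 0, forall c, c = \sum_(i < N) io (co i c) * T ^+ i,
        forall (b : nat -> B) a, (a < N)%N -> co a (\sum_(i < N) io (b i) * T ^+ i) = b a,
        forall b, exists c, ta b = io b + T * c &
        forall i, (i < n)%N -> ta (x i) = io (x i) + (i == j)%:R * T])
  (pf : forall b, pform x n p b)
  (red : forall b b' : B, b ^+ p = p%:R * b' -> exists b'', b = p%:R * b'').
Local Notation X t := (kx B^o t).
Local Notation G := {ffun 'I_n -> 'I_p}.
Local Notation "v =p w" := (kcong p v w) (at level 70).

Let p0 : (0 < p)%N := prime_gt0 pp.

Lemma kpow_cong t c N (v w : X t) : v =p w -> kpow c N v =p kpow c N w.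
Proof.
apply: kcong_map_arg => b d; elim: N => [|N [d' IH]]; first by exists 0; rewrite mulr0 addr0.
exists (c * b ^+ N * d + d' * (b + p%:R * d)); rewrite !exprS.
have -> : c * ((b + p%:R * d) * (b + p%:R * d) ^+ N) = (c * (b + p%:R * d) ^+ N) * (b + p%:R * d) by ring.
rewrite IH; ring.
Qed.

Lemma kpowD t c e (v w : X t) : kpow c (p ^ e) (v + w) =p kpow c (p ^ e) v + kpow c (p ^ e) w.
Proof.
apply: kcong_mapD => b b'; have [d ->] := frobenius_add_mod pp b b' e.
by exists (c * d); rewrite !mulrDr mulrCA.
Qed.

Lemma kpow0 t c e : kpow c (p ^ e) (0 : X t) = 0.
Proof. by rewrite /kpow kmap0 // expr0n expn_eq0 eqn0Ngt p0 mulr0. Qed.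

Lemma kpowN t c e (v : X t) : kpow c (p ^ e) (- v) =p - kpow c (p ^ e) v.
Proof.
have /kcong_sym[u] := kpowD c e v (- v); rewrite subrr kpow0 => E.
exists u; apply: (addrI (kpow c (p ^ e) v)).
by rewrite addrA subrr E.
Qed.

Lemma kpow_sum t c e (I : Type) (r : seq I) (P : pred I) (F : I -> X t) :
  kpow c (p ^ e) (\sum_(i <- r | P i) F i) =p \sum_(i <- r | P i) kpow c (p ^ e) (F i).
Proof.
elim/big_rec2: _ => [|i u w _ H]; first by rewrite kpow0; apply: kcong_refl.
apply: kcong_trans (kpowD _ _ _ _) _; apply: kcongD H; exact: kcong_refl.
Qed.

Lemma kpow_kpow t c N N' (v : X t) : kpow 1 N (kpow c N' v) = kpow (c ^+ N) (N' * N) v.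
Proof.
by rewrite /kpow kmap_comp; apply: kmap_ext => b /=; rewrite mul1r exprMn exprM.
Qed.

Lemma kpow1 t (v : X t) : kpow 1 1 v = v.
Proof.
by rewrite /kpow; elim: t v => [|t IH] v /=; [rewrite mul1r|rewrite !IH; apply: pair_eq].
Qed.

Lemma kpow_tr t N s (v : X t) : kpow 1 N (ktr (lev f s) v) = ktr (lev f (N * s)) (kpow 1 N v).
Proof.
apply: kmap_tr => i a.
change (1 * (f i ^+ s * (a : B)) ^+ N = f i ^+ (N * s) * (1 * (a : B) ^+ N)).
by rewrite !mul1r exprMn -exprM mulnC.
Qed.

Lemma kpow_Zl t c N (v : X t) : kpow 1 N (c *: v) = (c ^+ N) *: kpow 1 N v.
Proof.
rewrite -kpow_scale /kpow; elim: t v => [|t IH] v /=; last by rewrite !IH.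
by rewrite [c *: v]/(c * v) exprMn mul1r.
Qed.

Lemma kpow_kd t e m (v : X t) :
  kpow 1 (p ^ e) (kd (lev f m) v) =p kd (lev f (p ^ e * m)) (kpow 1 (p ^ e) v).
Proof.
elim: t v => [|t IH] v.
  by rewrite /= /kpow /= expr0n expn_eq0 eqn0Ngt p0 mulr0; apply: kcong_refl.
apply: kcong_pair; first exact: IH.
apply: (kcong_trans (z2 := kpow 1 (p ^ e) (lev f m t *: v.1) + kpow 1 (p ^ e) (- kd (lev f m) v.2))).
  exact: kpowD.
apply: kcongD.
  by rewrite kpow_Zl /lev -exprM mulnC; apply: kcong_refl.
apply: kcong_trans (kpowN _ _ _) _.
by have [u ->] := IH v.2; exists (- u); rewrite opprD scalerN.
Qed.

Lemma extract_InIm t e m (v : G -> X t) g0 :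
  InIm f p (p ^ e.+1 * m)%N (\sum_g kpow (pmono x g ^+ (p ^ e)) (p ^ e.+1) (v g)) ->
  InIm f p (p ^ e.+1 * m)%N (kpow 1 (p ^ e.+1) (v g0)).
Proof.
apply: (extract (P := @InIm B f t p) pp hs) => [C io ta ee L N m' y eE LB LZ _|m' y y'|m' k y].
- exact: opD_InIm.
- exact: InIm_cong.
- exact: InIm_down.
Qed.

(** Uniqueness of [p]-basis expansions: [extract], used at level zero where transition maps are
    trivial, isolates each [v g ^ p], and [B / p] is reduced. *)
Lemma root_uniq0 t (v : G -> X t) : \sum_g kpow (pmono x g) p (v g) =p 0 ->
  forall g, v g =p 0.
Proof.
move=> H g0.
have : kpow 1 (p ^ 1) (v g0) =p 0.
  apply: (@extract B f t p x n pp hs (fun m (y : X t) => m = 0%N -> y =p 0) _ _ _ 0 0 v g0); last first.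
  - by rewrite muln0.
  - move=> _; apply: kcong_trans H; apply: kcong_sum => g _.
    by rewrite expn0 expr1 expn1; apply: kcong_refl.
  - move=> m k y H0 m0; move: (H0); rewrite m0 mul0n ktr_lev0; exact.
  - by move=> m y y' E H0 /H0; apply: kcong_trans.
  - move=> C io ta ee L N m y eE LB LZ N0 H0 /eqP; rewrite muln_eq0 eqn0Ngt N0 /= => /eqP /H0 H1.
    have Hc : opD ta ee L m y =p opD ta ee L m 0 by apply: opD_cong.
    by rewrite opD0 in Hc.
rewrite expn1 => /kcong_kall/kall_map H1; apply/kcong_kall; apply: kall_imp H1 => b [b' /=].
by rewrite mul1r; apply: red.
Qed.

Lemma root_uniq t (v w : G -> X t) :
  \sum_g kpow (pmono x g) p (v g) =p \sum_g kpow (pmono x g) p (w g) -> forall g, v g =p w g.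
Proof.
move=> H g; suff [u Eu] : v g - w g =p 0 by exists u; rewrite -[LHS](subrK (w g)) Eu add0r addrC.
apply: (root_uniq0 (v := fun g => v g - w g)).
have : \sum_g kpow (pmono x g) p (v g) =p
    \sum_g kpow (pmono x g) p (v g - w g) + \sum_g kpow (pmono x g) p (w g).
  rewrite -big_split; apply: kcong_sum => g' _.
  by have := kpowD (pmono x g') 1 (v g' - w g') (w g'); rewrite expn1 subrK.
move=> /kcong_sym/kcong_trans/(_ H)[u Eu]; exists u.
by apply: (addIr (\sum_g kpow (pmono x g) p (w g))); rewrite Eu add0r addrC.
Qed.

(** A chosen root of the component of [b] along [pmono x g], determined modulo [p]. The value at [0]
    is imposed so that taking roots respects the grading of cochains. *)
Definition rt (g : G) (b : B) : B := if b == 0 then 0 else sval (cid (pf b)) g.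

Lemma rt0 g : rt g 0 = 0. Proof. by rewrite /rt eqxx. Qed.

Lemma rtE b : exists b', b = \sum_g pmono x g * rt g b ^+ p + p%:R * b'.
Proof.
rewrite /rt; case: eqP => [->|_]; last exact: (svalP (cid (pf b))).
exists 0; rewrite mulr0 addr0 big1 // => g _.
by rewrite expr0n eqn0Ngt p0 mulr0.
Qed.

Definition krt t (g : G) (v : X t) : X t := kmap (M := B^o) (M' := B^o) (rt g) v.

Lemma krtE t (v : X t) : v =p \sum_g kpow (pmono x g) p (krt g v).
Proof.
elim: t v => [|t IH] v; first by have [b' E] := rtE v; exists b'.
by apply: kcong_pair; rewrite ?fst_sum ?snd_sum; apply: IH.
Qed.

Lemma krt_uniq t (v : X t) (w : G -> X t) : v =p \sum_g kpow (pmono x g) p (w g) ->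
  forall g, krt g v =p w g.
Proof.
move=> H; apply: root_uniq; apply: kcong_trans H; apply: kcong_sym; exact: krtE.
Qed.

Lemma krt_cong t (v w : X t) g : v =p w -> krt g v =p krt g w.
Proof. by move=> H; apply: (krt_uniq (w := fun g => krt g w)); apply: (kcong_trans H (krtE w)). Qed.

Lemma krtZ t a (v : X t) g : krt g (a ^+ p *: v) =p a *: krt g v.
Proof.
apply: (krt_uniq (w := fun g => a *: krt g v)).
apply: kcong_trans (kcongZl (a ^+ p) (krtE v)) _.
rewrite scaler_sumr; apply: kcong_sum => g' _.
rewrite kpow_scale [Y in kcong p _ Y]kpow_scale kpow_Zl !scalerA mulrC; exact: kcong_refl.
Qed.

(** Modulo [p], Frobenius carries the differential of level [m] to that of level [p m] ([kpow_kd]),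
    so the roots of the coboundary of [v] are the coboundaries of its roots. *)
Lemma krt_cocycle t m (v : X t) g : kd (lev f (p * m)) v =p 0 -> kd (lev f m) (krt g v) =p 0.
Proof.
move=> H; apply: (root_uniq0 (v := fun g => kd (lev f m) (krt g v))).
apply: kcong_trans H; apply: kcong_sym.
apply: kcong_trans (kcong_kd _ (krtE v)) _.
rewrite linear_sum; apply: kcong_sum => g' _ /=.
rewrite kpow_scale [Y in kcong p _ Y]kpow_scale kdZ; apply: kcongZl; apply: kcong_sym.
by have := kpow_kd 1 m (krt g' v); rewrite expn1.
Qed.

(** Taking roots trades a division of the level by [p] for a step in [e], by [St_root]. *)
Definition St t e m (v : X t) := InIm f p (p ^ e * m) (kpow 1 (p ^ e) v).

Lemma St0 t m (v : X t) : St 0 m v <-> InIm f p m v.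
Proof. by rewrite /St expn0 mul1n kpow1. Qed.

Lemma St_cong t e m (v w : X t) : v =p w -> St e m w -> St e m v.
Proof. by move=> H; apply: InIm_cong; apply: kpow_cong. Qed.

Lemma St_push t e m s (v : X t) : St e m v <-> St e (m + s) (ktr (lev f s) v).
Proof.
rewrite /St kpow_tr mulnDr; split; [exact: InIm_up|exact: InIm_down].
Qed.

(** The [p ^ e]-th power of [v] is the sum of the [pmono x g ^ (p ^ e)] times the [p ^ (e + 1)]-st
    powers of its roots. [extract_InIm] separates the summands; conversely the image is stable under
    scaling and sums. *)
Lemma St_root t e m (v : X t) : St e (p * m) v <-> forall g, St e.+1 m (krt g v).
Proof.
have E : kpow 1 (p ^ e) v =p \sum_g kpow (pmono x g ^+ (p ^ e)) (p ^ e.+1) (krt g v).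
  apply: kcong_trans (kpow_cong _ _ (krtE v)) _.
  apply: kcong_trans (kpow_sum _ _ _ _ _) _; apply: kcong_sum => g _.
  by rewrite kpow_kpow expnS; apply: kcong_refl.
have Em : (p ^ e * (p * m) = p ^ e.+1 * m)%N by rewrite mulnA -expnSr.
rewrite /St Em; split=> [H g|H].
  apply: (extract_InIm (v := fun g => krt g v)); apply: InIm_cong H; exact: kcong_sym.
apply: (InIm_cong E); apply: InIm_sum => g _; rewrite kpow_scale.
by apply: InImZ; apply: H.
Qed.

(** [m / p] rounded up, so that iteration from a positive level ends at [1]. *)
Definition lv m := ((m + p.-1) %/ p)%N.
Definition pstep t (g : G) m (v : X t) := krt g (ktr (lev f (p * lv m - m)) v).

Lemma lv_ge m : (m <= p * lv m)%N.
Proof.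
rewrite /lv; have := divn_eq (m + p.-1) p; have := ltn_pmod (m + p.-1) p0.
by rewrite mulnC; move: p0; lia.
Qed.

Lemma lv1 : lv 1 = 1%N. Proof. by rewrite /lv add1n prednK // divnn p0. Qed.

Lemma lv_lt m : (1 < m)%N -> (0 < lv m < m)%N.
Proof.
move=> m1; have p1 := prime_gt1 pp; rewrite /lv divn_gt0 // ltn_divLR //.
by apply/andP; split; nia.
Qed.

Lemma St_step t e m (v : X t) : St e m v <-> forall g, St e.+1 (lv m) (pstep g m v).
Proof. by rewrite -St_root (St_push _ _ (p * lv m - m)) subnKC ?lv_ge. Qed.

Fixpoint pst t m (s : seq G) (v : X t) : X t :=
  if s is g :: s' then pst (lv m) s' (pstep g m v) else v.

Lemma pst_cat t m s s' (v : X t) :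
  pst m (s ++ s') v = pst (iter (size s) lv m) s' (pst m s v).
Proof. by elim: s m v => [|g s IH] m v //=; rewrite IH -iterSr. Qed.

Lemma St_iter t e m k (v : X t) :
  St e m v <-> forall s, size s = k -> St (e + k) (iter k lv m) (pst m s v).
Proof.
elim: k e m v => [|k IH] e m v.
  by rewrite addn0; split=> [H [] //|H]; apply: (H [::]).
rewrite St_step; split=> [H [|g s] //= [sk]|H g].
  by rewrite -iterS iterSr -addSnnS; move/IH: (H g); apply.
apply/IH => s sk; have := H (g :: s); rewrite /= sk -iterS iterSr -addSnnS; exact.
Qed.

Lemma pst_cong t m s (v w : X t) : v =p w -> pst m s v =p pst m s w.
Proof.
elim: s m v w => [|g s IH] m v w //= H; apply: IH; apply: krt_cong.
by apply: kcong_tr => // i; exists 0; rewrite mulr0 addr0.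
Qed.

Lemma pst_cocycle t m s (v : X t) : kd (lev f m) v =p 0 ->
  kd (lev f (iter (size s) lv m)) (pst m s v) =p 0.
Proof.
elim: s m v => [|g s IH] m v //= H; rewrite -iterS iterSr; apply: IH; apply: krt_cocycle.
rewrite -{1}(subnKC (lv_ge m)) lev_tr -[Y in kcong p _ Y](ktr0 B^o (lev f (p * lv m - m)) t).
by apply: kcong_tr => // i; exists 0; rewrite mulr0 addr0.
Qed.

Lemma pst_proj t m s d (v : X t) : kproj d v = v -> kproj d (pst m s v) = pst m s v.
Proof.
elim: s m v => [|g s IH] m v //= H; apply: IH.
by rewrite /pstep /krt -kmap_proj ?rt0 // -kproj_tr H.
Qed.

Lemma pstZ t m s a (v : X t) : pst m s (a ^+ (p ^ size s) *: v) =p a *: pst m s v.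
Proof.
elim: s m a v => [|g s IH] m a v /=; first by rewrite expn0 expr1; apply: kcong_refl.
apply: kcong_trans (IH _ _ _); apply: pst_cong.
by rewrite /pstep ktrZ expnSr exprM; apply: krtZ.
Qed.

End Roots.

(** * Degrees of iterated roots *)

Section Gauge.
Variables (B : comNzRingType) (f : nat -> B) (t p : nat) (x : nat -> B) (n : nat).
Variables (M : nat) (y : 'I_M -> B).
Hypotheses (pp : prime p)
  (hs : forall N j, (0 < N)%N ->
    exists (C : comNzRingType) (io ta : {rmorphism B -> C}) (T : C) (co : nat -> C -> B),
    [/\ T ^+ N = 0, forall c, c = \sum_(i < N) io (co i c) * T ^+ i,
        forall (b : nat -> B) a, (a < N)%N -> co a (\sum_(i < N) io (b i) * T ^+ i) = b a,
        forall b, exists c, ta b = io b + T * c &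
        forall i, (i < n)%N -> ta (x i) = io (x i) + (i == j)%:R * T])
  (pf : forall b, pform x n p b)
  (red : forall b b' : B, b ^+ p = p%:R * b' -> exists b'', b = p%:R * b'')
  (ysurj : forall b, exists F, mev y F = b).
Local Notation X := (kx B^o t).
Local Notation G := {ffun 'I_n -> 'I_p}.
Local Notation "v =p w" := (kcong p v w) (at level 70).
Local Notation pst := (pst f pf).

Let p0 : (0 < p)%N := prime_gt0 pp.

(* [b] is modulo [p] an integral combination of monomials of degree at most [d]. *)
Definition Bm d (b : B) := forall T : set B, T 0 -> (forall a b, T a -> T b -> T (a - b)) ->
  (forall m, (mdeg m <= d)%N -> T (mmap1 y m)) -> (forall c, T (p%:R * c)) -> T b.

Lemma Bm0 d : Bm d 0. Proof. by move=> T. Qed.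
Lemma BmB d a b : Bm d a -> Bm d b -> Bm d (a - b).
Proof. by move=> Ha Hb T T0 TB Tm Tp; apply: (TB _ _ (Ha T T0 TB Tm Tp) (Hb T T0 TB Tm Tp)). Qed.
Lemma BmD d a b : Bm d a -> Bm d b -> Bm d (a + b).
Proof. by move=> Ha Hb; rewrite -[b]opprK -[- b]sub0r; apply: BmB => //; apply: BmB => //; exact: Bm0. Qed.
Lemma Bm_mon d m : (mdeg m <= d)%N -> Bm d (mmap1 y m).
Proof. by move=> md T _ _ Tm _; apply: Tm. Qed.
Lemma Bm_p d c : Bm d (p%:R * c). Proof. by move=> T. Qed.
Lemma Bm_le d d' b : (d <= d')%N -> Bm d b -> Bm d' b.
Proof.
move=> dd' Hb; apply: (Hb (Bm d')); [exact: Bm0|exact: BmB|move=> m md|exact: Bm_p].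
by apply: Bm_mon; apply: leq_trans dd'.
Qed.

Lemma mmap1_add m m' : mmap1 y (m + m')%MM = mmap1 y m * mmap1 y m'.
Proof. by rewrite /mmap1 -big_split; apply: eq_bigr => i _; rewrite mnmDE exprD. Qed.

Lemma BmM d d' a b : Bm d a -> Bm d' b -> Bm (d + d') (a * b).
Proof.
move=> Ha Hb; apply: (Ha (fun a => Bm (d + d') (a * b))).
- by rewrite mul0r; exact: Bm0.
- by move=> a1 a2 H1 H2; rewrite mulrBl; apply: BmB.
- move=> m md; apply: (Hb (fun b => Bm (d + d') (mmap1 y m * b))).
  + by rewrite mulr0; exact: Bm0.
  + by move=> a1 a2 H1 H2; rewrite mulrBr; apply: BmB.
  + by move=> m' md'; rewrite -mmap1_add; apply: Bm_mon; rewrite mdegD leq_add.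
  + by move=> c; rewrite mulrCA; apply: Bm_p.
- by move=> c; rewrite -mulrA; apply: Bm_p.
Qed.

Lemma BmX d a s : Bm d a -> Bm (d * s) (a ^+ s).
Proof.
move=> Ha; elim: s => [|s IH]; last by rewrite exprS mulnS; apply: BmM.
rewrite expr0 muln0; have := @Bm_mon 0 0%MM; rewrite mdeg0 mmap11; exact.
Qed.

Lemma Bm_ex b : exists d, Bm d b.
Proof.
have [F <-] := ysurj b; elim/mpolyind: F => [|c m F _ _ [d IH]].
  by exists 0%N; rewrite rmorph0; exact: Bm0.
exists (maxn (mdeg m) d); rewrite rmorphD; apply: BmD; last by apply: Bm_le IH; exact: leq_maxr.
rewrite /mev /= mmapZ mmapX.
have Hn k : Bm (maxn (mdeg m) d) (k%:R * mmap1 y m).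
  elim: k => [|k IHk]; first by rewrite mul0r; exact: Bm0.
  by rewrite mulrS mulrDl mul1r; apply: BmD => //; apply: Bm_mon; exact: leq_maxl.
case: c => k; first exact: (Hn k).
rewrite NegzE rmorphN mulNr -[- _]sub0r; apply: BmB; [exact: Bm0|exact: (Hn k.+1)].
Qed.

(** Writing the exponents of a monomial as [p nu + r] takes [y ^ nu], of degree at most [d / p], out
    of the root; the finitely many remainders [y ^ r] contribute a bounded degree. Additivity of
    roots modulo [p] extends this to combinations. *)
Lemma rt_gauge : exists C, forall d b, Bm d b -> forall g, Bm (d %/ p + C) (rt pf g b).
Proof.
pose yr (r : {ffun 'I_M -> 'I_p}) := \prod_i y i ^+ r i.
pose cc r g := sval (cid (Bm_ex (rt pf g (yr r)))).
have ccP r g : Bm (cc r g) (rt pf g (yr r)) := svalP (cid (Bm_ex (rt pf g (yr r)))).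
exists (\sum_r \sum_g cc r g)%N => d b Hb; set C := (\sum_r _)%N.
have ccC r g : (cc r g <= C)%N.
  by rewrite /C (bigD1 r) //= (bigD1 g) //= -!addnA leq_addr.
suff [c [Hc [b' E]]] : exists c : G -> B, (forall g, Bm (d %/ p + C) (c g)) /\
    exists b', b = \sum_g pmono x g * c g ^+ p + p%:R * b'.
  move=> g; have [|u] := @krt_uniq B f p x n pp hs pf red 0 b c _ g; first by exists b'.
  by rewrite /krt /= => ->; apply: BmD => //; apply: Bm_p.
apply: (Hb (fun b => exists c : G -> B, (forall g, Bm (d %/ p + C) (c g)) /\
    exists b', b = \sum_g pmono x g * c g ^+ p + p%:R * b')).
- exists (fun=> 0); split=> [g|]; first exact: Bm0.
  exists 0; rewrite big1 ?mulr0 ?addr0 // => g _.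
  by rewrite expr0n eqn0Ngt p0 mulr0.
- move=> a1 a2 [c1 [H1 [b1 ->]]] [c2 [H2 [b2 ->]]].
  exists (fun g => c1 g - c2 g); split=> [g|]; first exact: BmB.
  have F g : exists e, c1 g ^+ p = (c1 g - c2 g) ^+ p + c2 g ^+ p + p%:R * e.
    by have := frobenius_add_mod pp (c1 g - c2 g) (c2 g) 1; rewrite expn1 subrK.
  pose e g := sval (cid (F g)); have eE g := svalP (cid (F g)); rewrite -/(e _) in eE.
  exists (\sum_g pmono x g * e g + b1 - b2).
  under eq_bigr => g _ do rewrite eE !mulrDr [X in _ + X]mulrCA.
  rewrite !big_split /= -mulr_sumr; ring.
- move=> m md; pose nu := [multinom (m i %/ p)%N | i < M].
  pose r : {ffun 'I_M -> 'I_p} := [ffun i => Ordinal (ltn_pmod (m i) p0)].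
  have Em : mmap1 y m = mmap1 y nu ^+ p * yr r.
    rewrite /mmap1 /yr -prodrXl -big_split; apply: eq_bigr => i _ /=.
    by rewrite mnmE ffunE /= -exprM -exprD -divn_eq.
  exists (fun g => mmap1 y nu * rt pf g (yr r)); split=> [g|].
    apply: BmM; last exact: (Bm_le (ccC r g)).
    apply: Bm_mon; rewrite leq_divRL //; apply: leq_trans md; rewrite !mdegE big_distrl /=.
    by apply: leq_sum => i _; rewrite mnmE leq_trunc_div.
  have [b' Eb] := rtE pp pf (yr r); exists (mmap1 y nu ^+ p * b').
  rewrite Em {1}Eb mulrDr mulr_sumr mulrCA; congr (_ + _).
  by apply: eq_bigr => g _; rewrite exprMn mulrCA.
- move=> c; exists (fun=> 0); split=> [g|]; first exact: Bm0.
  exists c; rewrite big1 ?add0r // => g _.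
  by rewrite expr0n eqn0Ngt p0 mulr0.
Qed.

Lemma Bm_finite D : exists s : seq B, forall b, Bm D b -> exists2 w, w \in s & exists d, b = w + p%:R * d.
Proof.
pose bm := 'X_{1..M < D.+1}.
pose ev (c : {ffun bm -> 'I_p}) := \sum_(m : bm) (c m)%:R * mmap1 y m.
exists [seq ev c | c <- enum {ffun bm -> 'I_p}] => b Hb.
suff [c [d E]] : exists c d, b = ev c + p%:R * d.
  by exists (ev c); [apply: map_f; rewrite mem_enum|exists d].
apply: (Hb (fun b => exists c d, b = ev c + p%:R * d)) => [|a1 a2 [c1 [d1 ->]] [c2 [d2 ->]]|m md|c].
- exists [ffun=> Ordinal p0], 0; rewrite mulr0 addr0 /ev big1 // => m _.
  by rewrite ffunE mul0r.
(* A nonnegative representative modulo [p] of the difference of the coefficients. *)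
- pose k (m : bm) := (c1 m + (p - c2 m))%N.
  exists [ffun m => Ordinal (ltn_pmod (k m) p0)].
  exists (\sum_m ((k m %/ p)%:R - 1) * mmap1 y m + d1 - d2).
  have -> : ev c1 = \sum_m ((c2 m)%:R + (k m %% p)%:R + p%:R * ((k m %/ p)%:R - 1)) * mmap1 y m.
    apply: eq_bigr => m _; congr (_ * _).
    have E : (k m)%:R = (k m %/ p)%:R * p%:R + (k m %% p)%:R :> B.
      by rewrite -natrM -natrD -divn_eq.
    have E2 : (k m)%:R = (c1 m)%:R + p%:R - (c2 m)%:R :> B.
      by rewrite /k natrD natrB ?addrA // ltnW.
    have -> : (c1 m)%:R = (k m)%:R - p%:R + (c2 m)%:R :> B by rewrite E2; ring.
    by rewrite E; ring.
  rewrite /ev; under eq_bigr => m _ do rewrite !mulrDl.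
  under [in RHS]eq_bigr => m _ do rewrite ffunE /=.
  rewrite !big_split /=; under [X in _ + _ + X]eq_bigr => m _ do rewrite -mulrA.
  rewrite -mulr_sumr; ring.
- have mD : (mdeg m < D.+1)%N by [].
  exists [ffun m' : bm => if m' == BMultinom mD then Ordinal (prime_gt1 pp) else Ordinal p0], 0.
  rewrite mulr0 addr0 /ev (bigD1 (BMultinom mD)) //= ffunE eqxx mul1r big1 ?addr0 // => m' ne.
  by rewrite ffunE (negPf ne) mul0r.
- exists [ffun=> Ordinal p0], c; rewrite /ev big1 ?add0r // => m _.
  by rewrite ffunE mul0r.
Qed.

Lemma kx_finite D t' : exists Vs : seq (kx B^o t'), forall v : kx B^o t',
  kall (M := B^o) (Bm D) v -> exists2 w, w \in Vs & v =p w.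
Proof.
elim: t' => [|t' [Vs IH]]; first exact: Bm_finite.
exists [seq ((v, w) : kx B^o t'.+1) | v <- Vs, w <- Vs] => v [/IH[w1 V1 E1] /IH[w2 V2 E2]].
exists (w1, w2); last exact: kcong_pair.
by apply/allpairsP; exists (w1, w2).
Qed.

Variable df : nat -> nat.
Hypothesis dfP : forall i, Bm (df i) (f i).

Definition cdeg t' := (\sum_(i < t') df i)%N.

Lemma gauge_tr t' d s (v : kx B^o t') : kall (M := B^o) (Bm d) v ->
  kall (M := B^o) (Bm (d + s * cdeg t')) (ktr (lev f s) v).
Proof.
elim: t' v => [|t' IH] v; first by rewrite /cdeg big_ord0 muln0 addn0.
have Ec : cdeg t'.+1 = (cdeg t' + df t')%N by rewrite /cdeg big_ord_recr.
move=> [H1 H2]; split.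
  apply: kall_imp (IH _ H1) => b; apply: Bm_le; rewrite Ec; nia.
have := IH _ H2; rewrite /= -[lev f s t' *: _]/(lev f s t' *: _).
have Hf : Bm (s * df t') (f t' ^+ s) by rewrite mulnC; apply: BmX.
have scal t2 (w : kx B^o t2) e : kall (M := B^o) (Bm e) w -> kall (M := B^o) (Bm (e + s * df t')) (f t' ^+ s *: w).
  elim: t2 w => [|t2 IH2] w /=; first by move=> Hw; rewrite addnC; apply: BmM.
  by move=> [A1 A2]; split; apply: IH2.
by move=> /scal; rewrite Ec mulnDr addnA.
Qed.

Variable C : nat.
Hypothesis rtC : forall d b, Bm d b -> forall g, Bm (d %/ p + C) (rt pf g b).

Lemma gauge_pstep m d (v : X) g : kall (M := B^o) (Bm d) v ->
  kall (M := B^o) (Bm ((d + (p * lv p m - m) * cdeg t) %/ p + C)) (pstep f pf g m v).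
Proof.
move=> H; apply/kall_map; apply: kall_imp (gauge_tr (p * lv p m - m) H) => b Hb.
exact: rtC.
Qed.

(** The degree at which roots of level one settle: above it each root lowers the degree bound by at
    least one, and below it the bound persists ([gauge_one]). *)
Definition gauge0 := (cdeg t + 2 * C)%N.

Lemma gauge_level m d : exists k d1, iter k (lv p) m.+1 = 1%N /\ forall v : X, kall (M := B^o) (Bm d) v ->
  forall s, size s = k -> kall (M := B^o) (Bm d1) (pst m.+1 s v).
Proof.
have [N] := ubnP m; elim: N m d => // N IH m d mN.
case: (posnP m) => [->|m0]; first by exists 0%N, d; split=> // v Hv [].
have /andP[l0 lm] : (0 < lv p m.+1 < m.+1)%N by apply: lv_lt.
have [|k [d1 [Ek Hk]]] := IH (lv p m.+1).-1 ((d + (p * lv p m.+1 - m.+1) * cdeg t) %/ p + C)%N.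
  by move: l0 lm mN; lia.
exists k.+1, d1; rewrite iterSr; move: Ek Hk; rewrite prednK // => Ek Hk; split=> // v Hv [|g s] //= [sk].
by apply: Hk => //; apply: gauge_pstep.
Qed.

Lemma gauge_one d (v : X) s : kall (M := B^o) (Bm d) v -> (d - gauge0 <= size s)%N ->
  kall (M := B^o) (Bm gauge0) (pst 1 s v).
Proof.
elim: s d v => [|g s IH] d v Hv ds; first by apply: kall_imp Hv => b; apply: Bm_le; move: ds => /=; lia.
have := gauge_pstep 1 g Hv; rewrite (lv1 pp) muln1 => Hg.
rewrite /=; rewrite lv1 //; apply: (IH (maxn gauge0 d.-1)); last by move: ds => /=; lia.
apply: kall_imp Hg => b; apply: Bm_le.
have p1 := prime_gt1 pp.
have := leq_trunc_div (d + (p - 1) * cdeg t) p; set q := (_ %/ p)%N => Hq.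
rewrite leq_max /gauge0; case: (leqP (q + C) (cdeg t + 2 * C)) => //= lt.
have E1 : (q * p = q + (p - 1) * q)%N by nia.
have E2 : ((p - 1) * (cdeg t + C.+1) <= (p - 1) * q)%N by rewrite leq_mul2l; apply/orP; right; lia.
have E3 : (C.+1 <= (p - 1) * C.+1)%N by rewrite leq_pmull //; lia.
by rewrite mulnDr in E2; lia.
Qed.

Lemma gauge_eventually m d : (0 < m)%N -> exists k0, forall v : X, kall (M := B^o) (Bm d) v ->
  forall s, (k0 <= size s)%N ->
  iter (size s) (lv p) m = 1%N /\ kall (M := B^o) (Bm gauge0) (pst m s v).
Proof.
case: m => // m _; have [k [d1 [Ek Hk]]] := gauge_level m d.
exists (k + d1)%N => v Hv s sk.
have it1 j : iter j (lv p) 1 = 1%N by elim: j => //= j ->; apply: lv1.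
have sz : size (take k s) = k by rewrite size_take_min; lia.
split; first by have -> : size s = (size s - k + k)%N by [lia]; rewrite iterD Ek.
rewrite -(cat_take_drop k s) pst_cat sz Ek; apply: (gauge_one (d := d1)).
  exact: Hk.
by rewrite size_drop; lia.
Qed.

Lemma kall_Bm t' (v : kx B^o t') : exists d, kall (M := B^o) (Bm d) v.
Proof.
elim: t' v => [|t' IH] v; first exact: Bm_ex.
have [d1 H1] := IH v.1; have [d2 H2] := IH v.2; exists (maxn d1 d2); split.
  by apply: kall_imp H1 => b; apply: Bm_le; apply: leq_maxl.
by apply: kall_imp H2 => b; apply: Bm_le; apply: leq_maxr.
Qed.

Lemma finite_decreasing (T : eqType) (s : seq T) (P : nat -> T -> Prop) :
  (forall k w, P k.+1 w -> P k w) -> exists r, forall k w, (r <= k)%N -> w \in s -> P r w -> P k w.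
Proof.
move=> Pd; have Pm k k' w : (k <= k')%N -> P k' w -> P k w.
  elim: k' => [|k' IH]; first by rewrite leqn0 => /eqP ->.
  by rewrite leq_eqVlt => /orP[/eqP -> //|/IH E /Pd/E].
elim: s => [|a s [r Hr]]; first by exists 0%N.
have [[k0 nP]|allP] := EM (exists k0, ~ P k0 a).
  exists (maxn r k0) => k w; rewrite geq_max => /andP[rk k0k].
  rewrite inE => /orP[/eqP -> /(Pm _ _ _ (leq_maxr r k0))//|ws Pw].
  by apply: Hr => //; apply: Pm Pw; apply: leq_maxl.
exists r => k w rk; rewrite inE => /orP[/eqP -> _|]; last exact: Hr.
by apply: contrapT => nP; apply: allP; exists k.
Qed.

(* Iterated roots of level-one cocycles eventually stay in a fixed finite set, in which the *)
(* sets of [k]-fold roots decrease.                                                         *)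
Lemma all_lift d : (forall v : X, kproj d v = v -> kd (lev f 1) v =p 0 -> InIm f p 1 v) ->
  forall m (v : X), (0 < m)%N -> kproj d v = v -> kd (lev f m) v =p 0 -> InIm f p m v.
Proof.
move=> H1 m v m0 dv cv.
have [Vs HVs] := kx_finite gauge0 t.
have it1 j : iter j (lv p) 1 = 1%N by elim: j => //= j ->; apply: lv1.
pose ok (u : X) := [/\ kproj d u = u, kd (lev f 1) u =p 0 & kall (M := B^o) (Bm gauge0) u].
(* Such a [w] satisfies [St k 1], because the level-one cocycle [u] lifts by hypothesis. *)
pose P k w := exists u s, [/\ ok u, size s = k & w =p pst 1 s u].
have okstep u g : ok u -> ok (pstep f pf g 1 u).
  move=> [du cu gu]; split.
  - exact: (@pst_proj B f p x n pf t 1 [:: g] d u du).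
  - by have := @pst_cocycle B f p x n pp hs pf red t 1 [:: g] u cu; rewrite it1.
  - have := @gauge_one gauge0 u [:: g] gu; apply; lia.
have [|r Hr] := @finite_decreasing _ Vs P.
  move=> k w [u [[|g s] [ou sk Ew]]] //; exists (pstep f pf g 1 u), s; split.
  - exact: okstep. - by case: sk. - by move: Ew; rewrite /= lv1.
have stP k w : P k w -> St f p k 1 w.
  move=> [u [s [[du cu _] sk Ew]]]; apply: (St_cong Ew).
  have /(St0 f p 1 u) : InIm f p 1 u by apply: H1.
  by move=> /(@St_iter B f p x n pp hs pf t 0 1 k u)/(_ s sk); rewrite it1.
have [dg Hg] := kall_Bm v; have [k0 Hk0] := gauge_eventually dg m0.
(* The first [k0] roots reach level one and bounded degree, and [r] more reach the stable set. Its
   members are [k]-fold roots for every [k >= r], in particular for [k0 + r], the number that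
   matches the Frobenius power. *)
apply/(St0 f p m v)/(@St_iter B f p x n pp hs pf t 0 m (k0 + r) v) => s sz.
have szt : size (take k0 s) = k0 by rewrite size_take_min; lia.
have [i1 g1] := Hk0 v Hg (take k0 s) (eq_leq (esym szt)).
have [i2 g2] : iter (size s) (lv p) m = 1%N /\ kall (M := B^o) (Bm gauge0) (pst m s v).
  by apply: (Hk0 v Hg s); lia.
have [w wV Ew] := HVs _ g2; rewrite -sz i2; apply: (St_cong Ew); rewrite sz; apply: stP.
apply: (Hr _ w _ wV); first by apply: leq_addl.
exists (pst m (take k0 s) v), (drop k0 s); split; last 2 first.
- by rewrite size_drop; lia.
- by apply: kcong_trans (kcong_sym Ew) _; rewrite -{1}(cat_take_drop k0 s) pst_cat i1; apply: kcong_refl.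
split=> //; first exact: pst_proj.
by have := pst_cocycle pp hs pf red (take k0 s) cv; rewrite i1.
Qed.

Lemma St_ideal k (w : X) : ideal [set r | St f p k 1 (r *: w)].
Proof.
have S1 r : kpow 1 (p ^ k) (r *: w) = (r ^+ (p ^ k)) *: kpow 1 (p ^ k) w by rewrite kpow_Zl.
apply/idealP; split=> [|a b|r a]; rewrite /= /St ?S1.
- rewrite expr0n expn_eq0 eqn0Ngt p0 scale0r; apply: ev_K; exact: liftable0.
- move=> Ha Hb; have [d ->] := frobenius_add_mod pp a b k.
  rewrite !scalerDl; apply: InImD; first exact: InImD.
  by rewrite -scalerA; apply: ev_K; apply: liftable_p.
- by move=> Ha; rewrite exprMn -scalerA; apply: InImZ.
Qed.

(** [r] is in [Q] exactly when [r ^ (p ^ k)] is, that is, when [r] times every [k]-fold root of [v]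
    satisfies [St k 1]. So [Q] is a finite intersection of ideals ([St_ideal]) and, being prime, is
    one of them; for large [k] the roots are congruent to members of a fixed finite set. *)
Lemma prime_annihilators : exists Vs : seq X, forall m (v : X) (Q : set B), (0 < m)%N -> prime_ideal Q ->
  (forall r, Q r <-> InIm f p m (r *: v)) ->
  exists k0, forall k, (k0 <= k)%N -> exists2 w, w \in Vs & Q = [set r | St f p k 1 (r *: w)].
Proof.
have [Vs HVs] := kx_finite gauge0 t; exists Vs => m v Q m0 HQ QE.
have [dg Hg] := kall_Bm v; have [k0 Hk0] := gauge_eventually dg m0.
exists k0 => k kk.
have QJ r : Q r <-> forall s : k.-tuple G, St f p k 1 (r *: pst m s v).
  have -> : Q r <-> Q (r ^+ (p ^ k)).
    split=> [Qr|]; last exact: prime_expr.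
    rewrite -(prednK (_ : 0 < p ^ k)%N) ?expn_gt0 ?p0 // exprS.
    by apply: (idealMr _ (prime_idl HQ)).
  rewrite QE -(St0 f p) (@St_iter B f p x n pp hs pf t 0 m k); split=> H s.
    have sk := size_tuple s; have Hs := H s sk; have [|i1 _] := Hk0 v Hg s; first by rewrite sk.
    rewrite sk in i1; rewrite i1 in Hs; apply: (St_cong _ Hs).
    by have := pstZ f pp hs pf red m s r v; rewrite sk; apply: kcong_sym.
  move=> sk; have skb : size s == k by apply/eqP.
  have [|i1 _] := Hk0 v Hg s; first by rewrite sk.
  rewrite -sk i1; apply: (St_cong (pstZ f pp hs pf red m s r v)); rewrite sk.
  exact: (H (Tuple skb)).
apply: contrapT => nV.
have wP (s : k.-tuple G) : exists2 w, w \in Vs & pst m s v =p w.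
  by apply: HVs; have [|] := Hk0 v Hg s; rewrite ?size_tuple.
have rP (s : k.-tuple G) : exists r, St f p k 1 (r *: pst m s v) /\ ~ Q r.
  apply: contrapT => nr; have [w wV Ew] := wP s; apply: nV; exists w => //.
  apply/seteqP; split=> r /=.
    by move=> /QJ/(_ s); apply: St_cong; apply/kcongZl/kcong_sym.
  move=> Hr; apply: contrapT => nQ; apply: nr; exists r; split=> //.
  by apply: St_cong Hr; apply: kcongZl.
pose r s := sval (cid (rP s)); have rsP s : St f p k 1 (r s *: pst m s v) /\ ~ Q (r s) := svalP (cid (rP s)).
have nQ : ~ Q (\prod_s r s).
  elim/big_ind: _ => [|a b|s _]; [exact: (prime_n1 HQ)|exact: (primeM HQ)|exact: (rsP s).2].
apply: nQ; apply/QJ => s; rewrite (bigD1 s) //=.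
exact: (idealMr _ (St_ideal k (pst m s v)) (rsP s).1).
Qed.
End Gauge.

(** * Differential operators in characteristic zero *)

Section Derivations.
Variables (B : comNzRingType) (n : nat) (del : 'I_n -> B -> B) (x : 'I_n -> B).
Hypotheses (delD : forall i, {morph del i : a b / a + b})
  (delM : forall i a b, del i (a * b) = del i a * b + a * del i b)
  (delx : forall i j, del i (x j) = (i == j)%:R).

Lemma del1 i : del i 1 = 0.
Proof.
have /eqP := delM i 1 1; rewrite mulr1 !mul1r -subr_eq0 mulr1 opprD addrA subrr sub0r oppr_eq0.
by move/eqP.
Qed.
Lemma delB i a b : del i (a - b) = del i a - del i b.
Proof. by apply: (addIr (del i b)); rewrite -delD !subrK. Qed.

Lemma del_mev i F : del i (mev x F) = mev x F^`M(i).
Proof.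
apply: (mpoly_generates (D := [set F | del i (mev x F) = mev x F^`M(i)])) => [|y ys].
  split=> [|a b Ha Hb|a b Ha Hb].
  - by rewrite /mkset -mpolyC1 mderivC mpolyC1 !rmorph1 del1 rmorph0.
  - by rewrite /mkset rmorphB delB Ha Hb mderivB rmorphB.
  - by rewrite /mkset rmorphM delM Ha Hb mderivM rmorphD !rmorphM.
have /mapP[j _ ->] := ys; rewrite /mkset mevX delx mderivX mnm1E eq_sym; case: eqP => [->|_].
  have -> : (U_(i) - U_(i))%MM = 0%MM by apply/mnmP => i'; rewrite mnmBE subnn mnm0E.
  by rewrite !mulr1n mpolyX0 scale1r rmorph1.
by rewrite !mulr0n scale0r rmorph0.
Qed.

Variables (Q : set B) (HQ : prime_ideal Q) (Q0 : forall k, (0 < k)%N -> ~ Q k%:R).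

Lemma mderiv_msize (F : {mpoly int[n]}) i : F^`M(i) != 0 -> (msize F^`M(i) < msize F)%N.
Proof.
move=> F0; rewrite -mlead_deg //; have := mlead_supp F0.
rewrite mcoeff_msupp mcoeff_deriv => H.
have : (mlead F^`M(i) + U_(i))%MM \in msupp F.
  by rewrite mcoeff_msupp; apply: contraNneq H => ->; rewrite mul0rn.
by move/msize_mdeg_lt; rewrite mdegD mdeg1 addn1.
Qed.

Lemma mderiv_neq0 (F : {mpoly int[n]}) : (forall i, F^`M(i) = 0) -> exists c, F = c%:MP.
Proof.
move=> F0; exists F@_0; apply/mpolyP => m; rewrite mcoeffC; case: (eqVneq 0%MM m) => [<-|m0].
  by rewrite mulr1.
rewrite mulr0; have [i mi] : exists i, (0 < m i)%N.
  apply: contrapT => H; case/eqP: m0; apply/mnmP => i; rewrite mnm0E.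
  by case E: (m i) => [//|j]; case: H; exists i; rewrite E.
have := congr1 (mcoeff (m - U_(i))%MM) (F0 i); rewrite mcoeff_deriv mcoeff0.
have -> : (m - U_(i) + U_(i))%MM = m.
  by apply/mnmP => j; rewrite mnmDE mnmBE mnm1E; case: eqP => [<-|_]; lia.
by move/eqP; rewrite Num.Theory.mulrn_eq0 /= => /eqP.
Qed.

(** Directions transversal to the zero set of [Q]: along [Hc], the Jacobian matrix of suitable
    elements of [Q] is a nonzero scalar modulo [Q]. *)
Definition frame (Hc : {set 'I_n}) := exists (g : 'I_n -> B) (d : B), [/\ ~ Q d,
  forall j, j \in Hc -> Q (g j) &
  forall i j, i \in Hc -> j \in Hc -> Q (del i (g j) - d * (i == j)%:R)].

(** For a frame of largest size, the coordinates outside [Hc] are algebraically independent modulo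
    [Q]: a nonzero relation of least size would have a derivative outside [Q], and its direction
    could be added to the frame. *)
Lemma frame_max : exists Hc, frame Hc /\
  forall F : {mpoly int[n]}, (forall i, i \in Hc -> F^`M(i) = 0) -> Q (mev x F) -> F = 0.
Proof.
have IQ := prime_idl HQ.
have f0 : frame finset.set0.
  by exists (fun=> 0), 1; split=> [|j|i j]; rewrite ?inE //; apply: (prime_n1 HQ).
have [Hc [fHc Hmax]] : exists Hc, frame Hc /\ forall Hc', frame Hc' -> (#|Hc'| <= #|Hc|)%N.
  have [Hc /asboolP fHc Hm] := @arg_maxnP _ finset.set0 (fun H => `[< frame H >]) (fun H => #|H|) (introT (asboolP _) f0).
  by exists Hc; split=> // Hc' /asboolP/Hm.
exists Hc; split=> // F; have [N] := ubnP (msize F); elim: N F => // N IH F FN dF QF.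
have [H0|/existsNP[a /eqP Fa0]] := EM (forall a, F^`M(a) = 0).
  have [c Ec] := mderiv_neq0 H0; move: QF; rewrite Ec /mev /= mmapC.
  case: c {Ec} => [[|k]|k] // Qk.
    by case: (@Q0 k.+1).
  have {}Qk : Q (- k.+1%:R) := Qk.
  by case: (@Q0 k.+1) => //; have := idealN IQ Qk; rewrite opprK.
have aHc : a \notin Hc by apply: contraNN Fa0 => /dF ->.
have nQa : ~ Q (mev x F^`M(a)).
  move=> Qa; apply: (negP Fa0); apply/eqP; apply: IH => //.
    by move: (mderiv_msize Fa0) FN; lia.
  by move=> i /dF Fi; rewrite mderiv_comm Fi mderiv0.
have [g [d [nd Qg Qd]]] := fHc.
pose G := mev x F; pose e := mev x F^`M(a).
have GE i : i \in Hc -> del i G = 0 by move=> /dF Fi; rewrite /G del_mev Fi rmorph0.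
have Ge : del a G = e by rewrite /G del_mev.
suff : frame (a |: Hc) by move/Hmax; rewrite cardsU1 aHc; lia.
(* The old elements are corrected by multiples of [G] to have derivative zero along [a] modulo [Q],
   [d G] serves the new direction, and the common scalar becomes [e d]. *)
exists (fun j => if j == a then d * G else e * g j - del a (g j) * G), (e * d); split.
- exact: (primeM HQ).
- move=> j; rewrite !inE; case: eqP => [_ _|_ /= jH]; first exact: (idealMl _ IQ).
  by apply: (idealB IQ); apply: (idealMl _ IQ) => //; apply: Qg.
move=> i j; rewrite !inE => /orP[/eqP ->|iH] /orP[/eqP ->|jH].
- rewrite !eqxx mulr1 delM Ge.
  have -> : del a d * G + d * e - e * d = del a d * G by ring.
  exact: (idealMl _ IQ).
- have ja : (j == a) = false by apply: contraNF aHc => /eqP <-.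
  rewrite ja eq_sym ja mulr0 subr0 delB !delM Ge.
  have -> : del a e * g j + e * del a (g j) - (del a (del a (g j)) * G + del a (g j) * e) =
    del a e * g j - del a (del a (g j)) * G by ring.
  by apply: (idealB IQ); apply: (idealMl _ IQ) => //; apply: Qg.
- have ia : (i == a) = false by apply: contraNF aHc => /eqP <-.
  rewrite eqxx ia mulr0 subr0 delM GE // mulr0 addr0; exact: (idealMl _ IQ).
- have ja : (j == a) = false by apply: contraNF aHc => /eqP <-.
  rewrite ja delB !delM GE // mulr0 addr0.
  have -> : del i e * g j + e * del i (g j) - del i (del a (g j)) * G - e * d * (i == j)%:R =
    del i e * g j - del i (del a (g j)) * G + e * (del i (g j) - d * (i == j)%:R) by ring.
  apply: (idealD IQ); last by apply: (idealMl _ IQ); apply: Qd.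
  by apply: (idealB IQ); apply: (idealMl _ IQ) => //; apply: Qg.
Qed.

End Derivations.

Lemma mcoeff0_mulX (R : nzRingType) (n : nat) (sg : {mpoly R[n]}) i : (sg * 'X_i)@_0%MM = 0.
Proof.
rewrite mcoeffM big1 // => -[m1 m2] /= /eqP; move: (bmnm m1) (bmnm m2) => u v E; have : v = 0%MM.
  apply/eqP; rewrite -mdeg_eq0; have := congr1 mdeg E; rewrite mdegD mdeg0.
  by move/esym/eqP; rewrite addn_eq0 => /andP[].
by move=> ->; rewrite mcoeffX mnm1_eq0 mulr0.
Qed.

(** * Symbols of differential operators and linear independence *)

Section Orders.
Variables (B : comNzRingType) (n : nat) (del : 'I_n -> B -> B) (x : 'I_n -> B).
Variables (H : lmodType B) (dl : 'I_n -> H -> H).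
Hypotheses (dlD : forall i, {morph dl i : a b / a + b})
  (dlZ : forall i b h, dl i (b *: h) = del i b *: h + b *: dl i h).

Section Ord.
Variable Hc : {set 'I_n}.

Definition bracket (g : B) (P : H -> H) (h : H) := P (g *: h) - g *: P h.
(** The effect of [bracket g] on symbols, whose variables stand for the derivations along [Hc]. *)
Definition symb (g : B) (s : {mpoly B[n]}) : {mpoly B[n]} := \sum_(k in Hc) del k g *: s^`M(k).

(* Differential operators of order at most [s] with a given symbol. *)
Fixpoint Ord s (P : H -> H) (sg : {mpoly B[n]}) : Prop :=
  if s is s'.+1 then forall g, Ord s' (bracket g P) (symb g sg)
  else forall h, P h = sg@_0%MM *: h.

Lemma Ord_ext s P P' sg : P =1 P' -> Ord s P sg -> Ord s P' sg.
Proof.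
elim: s P P' sg => [|s IH] P P' sg E HP /=; first by move=> h; rewrite -E.
by move=> g; apply: IH (HP g) => h; rewrite /bracket !E.
Qed.

Lemma symb0 g : symb g 0 = 0.
Proof. by rewrite /symb big1 // => k _; rewrite mderiv0 scaler0. Qed.
Lemma symbD g s s' : symb g (s + s') = symb g s + symb g s'.
Proof. by rewrite /symb -big_split; apply: eq_bigr => k _ /=; rewrite mderivD scalerDr. Qed.
Lemma symbZ g a s : symb g (a *: s) = a *: symb g s.
Proof.
by rewrite /symb scaler_sumr; apply: eq_bigr => k _; rewrite mderivZ !scalerA mulrC.
Qed.

Lemma OrdD s P P' sg sg' : Ord s P sg -> Ord s P' sg' -> Ord s (fun h => P h + P' h) (sg + sg').
Proof.
elim: s P P' sg sg' => [|s IH] P P' sg sg' HP HP' /=.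
  by move=> h; rewrite HP HP' mcoeffD scalerDl.
move=> g; rewrite symbD; apply: Ord_ext (IH _ _ _ _ (HP g) (HP' g)) => h.
by rewrite /bracket scalerDr opprD addrACA.
Qed.

Lemma OrdZ s a P sg : Ord s P sg -> Ord s (fun h => a *: P h) (a *: sg).
Proof.
elim: s P sg => [|s IH] P sg HP /=; first by move=> h; rewrite HP mcoeffZ scalerA.
move=> g; rewrite symbZ; apply: Ord_ext (IH _ _ (HP g)) => h.
by rewrite /bracket scalerBr !scalerA mulrC.
Qed.

Lemma Ord_zero s : Ord s (fun=> 0) 0.
Proof.
elim: s => [|s IH] /=; first by move=> h; rewrite mcoeff0 scale0r.
by move=> g; rewrite symb0; apply: Ord_ext IH => h; rewrite /bracket scaler0 subrr.
Qed.

Lemma Ord_raise s P sg : Ord s P sg -> Ord s.+1 P 0.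
Proof.
elim: s P sg => [|s IH] P sg HP g; rewrite symb0.
  move=> h; rewrite /bracket !HP mcoeff0 scale0r !scalerA mulrC subrr //.
exact: IH (HP g).
Qed.

Lemma Ord_le s s' P sg : (s < s')%N -> Ord s P sg -> Ord s' P 0.
Proof.
elim: s' => // s' IH; rewrite ltnS leq_eqVlt => /orP[/eqP -> /Ord_raise//|ss' HP].
exact: Ord_raise (IH ss' HP).
Qed.

Lemma Ord_dl s i P sg : i \in Hc -> Ord s P sg -> Ord s.+1 (fun h => dl i (P h)) (sg * 'X_i).
Proof.
move=> iH; have dl0 h : dl i (- h) = - dl i h.
  apply: (addrI (dl i h)); rewrite -dlD !subrr.
  by apply: (addrI (dl i 0)); rewrite -dlD !addr0.
have symbX g sg' : symb g (sg' * 'X_i) = symb g sg' * 'X_i + del i g *: sg'.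
  rewrite /symb (bigD1 i) //= [in RHS](bigD1 i) //= mulrDl -addrA.
  rewrite mderivM scalerDr scalerAl -!addrA; congr (_ + _).
  rewrite mderivX mnm1E eqxx.
  have -> : (U_(i) - U_(i))%MM = 0%MM by apply/mnmP => i'; rewrite mnmBE subnn mnm0E.
  rewrite mpolyX0 scale1r mulr1 addrC; congr (_ + _).
  rewrite mulr_suml; apply: eq_bigr => k /andP[_ ki].
  by rewrite mderivM mderivX mnm1E eq_sym (negPf ki) scale0r mulr0 addr0 scalerAl.
elim: s P sg => [|s IH] P sg HP g; rewrite symbX.
  move=> h; rewrite /bracket !HP mcoeffD mcoeffZ.
  have -> : (symb g sg * 'X_i)@_0%MM = 0.
    by rewrite mcoeff0_mulX.
  rewrite add0r scalerA mulrC -scalerA dlZ scalerA addrK //.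
have H1 := IH _ _ (HP g); have H2 := OrdZ (del i g) HP.
apply: Ord_ext (OrdD H1 H2) => h.
by rewrite /bracket dlD dl0 dlZ opprD addrA [LHS]addrAC subrK.
Qed.

Variables (Q : set B) (HQ : prime_ideal Q) (Q0 : forall k, (0 < k)%N -> ~ Q k%:R).
Variables (z : H) (Qz : forall r, Q r <-> r *: z = 0).
Variables (g : 'I_n -> B) (d : B).
Hypotheses (nd : ~ Q d) (Qg : forall j, j \in Hc -> Q (g j))
  (Qd : forall i j, i \in Hc -> j \in Hc -> Q (del i (g j) - d * (i == j)%:R)).

(** As [g j] kills [z], the commutator with [g j] kills [z] too; it has order one less, and its
    symbol is [d] times the derivative along [j], modulo [Q]. After [s] steps a multiple of [z] is
    left; neither [d] nor a positive integer is in the prime [Q]. *)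
Lemma Ord_symbol s P sg b : Ord s P sg -> P 0 = 0 -> P z = 0 -> mdeg b = s ->
  (forall i, i \notin Hc -> b i = 0%N) -> Q sg@_b.
Proof.
have IQ := prime_idl HQ.
elim: s P sg b => [|s IH] P sg b HP P0 Pz bs bH.
  by move/eqP: bs; rewrite mdeg_eq0 => /eqP ->; apply/Qz; rewrite -HP.
have [j bj] : exists j, (0 < b j)%N.
  apply: contrapT => nj; have : mdeg b = 0%N; last by rewrite bs.
  rewrite mdegE big1 // => i _; case E: (b i) => [//|k].
  by case: nj; exists i; rewrite E.
have jH : j \in Hc by apply: contraTT bj => /bH ->.
pose b' := (b - U_(j))%MM.
have Eb : (b' + U_(j))%MM = b.
  by apply/mnmP => i; rewrite mnmDE mnmBE mnm1E; case: eqP => [<-|_]; lia.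
have b's : mdeg b' = s.
  by have := congr1 mdeg Eb; rewrite mdegD mdeg1 bs addn1 => -[].
have b'H i : i \notin Hc -> b' i = 0%N by move=> iH; rewrite mnmBE bH.
have /Qz gz : Q (g j) by apply: Qg.
have : Q (symb (g j) sg)@_b'.
  apply: (IH _ _ b' (HP (g j))) => //.
  - by rewrite /bracket !scaler0 P0 scaler0 subrr.
  - by rewrite /bracket gz P0 Pz scaler0 subrr.
rewrite /symb raddf_sum /= (bigD1 j) //= mcoeffZ mcoeff_deriv Eb => Hs.
have Qrest : Q (\sum_(i in Hc | i != j) (del i (g j) *: sg^`M(i))@_b').
  apply: (ideal_sum _ IQ) => i /andP[iH ij]; rewrite mcoeffZ; apply: (idealMr _ IQ).
  by have := Qd iH jH; rewrite (negPf ij) mulr0 subr0.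
have {Hs} : Q (del j (g j) * (sg@_b *+ (b' j).+1)).
  by have := idealB IQ Hs Qrest; rewrite addrK.
have -> : del j (g j) * (sg@_b *+ (b' j).+1) =
   (del j (g j) - d * (j == j)%:R) * (sg@_b *+ (b' j).+1) + d * ((b' j).+1%:R * sg@_b).
  by rewrite eqxx mulr1 mulr_natl mulrBl subrK.
move=> Hs; have : Q (d * ((b' j).+1%:R * sg@_b)).
  have := idealB IQ Hs (idealMr (sg@_b *+ (b' j).+1) IQ (Qd jH jH)).
  by rewrite [X in X - _]addrC addrK.
case: HQ => _ _ HQM; case/HQM => // /HQM[] // Qb.
by case: (@Q0 (b' j).+1).
Qed.

Fixpoint word (w : seq 'I_n) (h : H) : H := if w is i :: w' then dl i (word w' h) else h.

Lemma wordD w : {morph word w : a b / a + b}.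
Proof. by elim: w => //= i w IH a b; rewrite IH dlD. Qed.

Lemma word0 w : word w 0 = 0.
Proof. by apply: (addrI (word w 0)); rewrite -wordD !addr0. Qed.

Lemma word_kill a u w : (forall i a b, del i (a * b) = del i a * b + a * del i b) ->
  a *: u = 0 -> a ^+ (size w).+1 *: word w u = 0.
Proof.
move=> delM au; elim: w => [|i w IH] /=; first by rewrite expr1.
have Ea e : a * del i (a ^+ e.+1) = e.+1%:R * del i a * a ^+ e.+1.
  elim: e => [|e IHe]; first by rewrite expr1 mul1r mulrC.
  by rewrite exprS delM mulrDr IHe -natr1 exprS; ring.
have := congr1 (dl i) IH; rewrite dlZ.
have -> : dl i 0 = 0 := word0 [:: i].
move=> E; have := congr1 (fun h => a *: h) E; rewrite scalerDr scaler0 !scalerA -exprS => <-.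
by rewrite Ea -[X in X + _]scalerA IH scaler0 add0r.
Qed.

Definition wmon (w : seq 'I_n) : 'X_{1.. n} := \big[+%MM/0%MM]_(i <- w) U_(i)%MM.

Lemma Ord_word w : all (mem Hc) w -> Ord (size w) (word w) 'X_[wmon w].
Proof.
rewrite /wmon; elim: w => [|i w IH] /=.
  by move=> _ h; rewrite big_nil mcoeffX eqxx scale1r.
move=> /andP[iH /IH /(Ord_dl iH)]; rewrite big_cons mulrC -mpolyXD //.
Qed.

(** The exponents [ga] are shared out: along [Hc] they prescribe derivations ([won], [xon]),
    elsewhere powers of the coordinates ([xoff]). *)
Definition won k (ga : {ffun 'I_n -> 'I_k.+1}) : seq 'I_n :=
  flatten [seq nseq (ga j) j | j <- enum Hc].
Definition xoff k (ga : {ffun 'I_n -> 'I_k.+1}) : 'X_{1.. n} :=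
  [multinom if j \in Hc then 0%N else ga j | j < n].
Definition xon k (ga : {ffun 'I_n -> 'I_k.+1}) : 'X_{1.. n} :=
  [multinom if j \in Hc then ga j : nat else 0%N | j < n].
Definition ew k (ga : {ffun 'I_n -> 'I_k.+1}) (h : H) : H :=
  mev x 'X_[xoff ga] *: word (won ga) h.

Lemma wmonE w i : wmon w i = count_mem i w.
Proof.
rewrite /wmon; elim: w => [|j w IH]; first by rewrite big_nil mnm0E.
by rewrite big_cons mnmDE IH mnm1E.
Qed.

Lemma mdeg_wmon w : mdeg (wmon w) = size w.
Proof.
rewrite /wmon; elim: w => [|j w IH]; first by rewrite big_nil mdeg0.
by rewrite big_cons mdegD mdeg1 IH.
Qed.

Lemma won_xon k (ga : {ffun 'I_n -> 'I_k.+1}) : wmon (won ga) = xon ga.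
Proof.
apply/mnmP => i; rewrite wmonE mnmE count_flatten -map_comp sumnE big_map big_enum /=.
under eq_bigr do rewrite count_nseq.
case: ifP => iH.
  rewrite (bigD1 i) //= eqxx mul1n big1 ?addn0 // => j /andP[_ /negPf]; rewrite eq_sym => ji.
  by rewrite ji.
by apply: big1 => j jH; rewrite /= (_ : (j == i) = false) //; apply: contraTF jH => /eqP ->; rewrite iH.
Qed.

Lemma all_won k (ga : {ffun 'I_n -> 'I_k.+1}) : all (mem Hc) (won ga).
Proof.
apply/allP => j /flattenP[s /mapP[i]]; rewrite mem_enum => iH -> /nseqP[-> _] //.
Qed.

Lemma size_won k (ga : {ffun 'I_n -> 'I_k.+1}) : (size (won ga) <= n * k)%N.
Proof.
rewrite -mdeg_wmon won_xon mdegE; apply: (@leq_trans (\sum_(i < n) k)%N).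
  by apply: leq_sum => i _; rewrite mnmE; case: ifP => // _; rewrite -ltnS.
by rewrite sum_nat_const card_ord.
Qed.

Lemma mdeg_xoff k (ga : {ffun 'I_n -> 'I_k.+1}) : (mdeg (xoff ga) <= n * k)%N.
Proof.
rewrite mdegE; apply: (@leq_trans (\sum_(i < n) k)%N).
  by apply: leq_sum => i _; rewrite mnmE; case: ifP => // _; rewrite -ltnS.
by rewrite sum_nat_const card_ord.
Qed.

Lemma Ord_sum s (I : Type) (r : seq I) (P : I -> H -> H) sg :
  (forall i, Ord s (P i) (sg i)) -> Ord s (fun h => \sum_(i <- r) P i h) (\sum_(i <- r) sg i).
Proof.
move=> HP; elim: r => [|i r IH].
  by rewrite big_nil; apply: Ord_ext (Ord_zero s) => h; rewrite big_nil.
by rewrite big_cons; apply: Ord_ext (OrdD (HP i) IH) => h; rewrite big_cons.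
Qed.

(** Descending induction on the number of derivations. In the top order, [Ord_symbol] puts each
    coefficient of the symbol into [Q]; it is an integral polynomial in the coordinates outside
    [Hc], which are independent modulo [Q], so it is zero. *)
Lemma indep_one k (c : {ffun 'I_n -> 'I_k.+1} -> int) a :
  (forall F : {mpoly int[n]}, (forall i, i \in Hc -> F^`M(i) = 0) -> Q (mev x F) -> F = 0) ->
  ~ Q a -> a *: (\sum_ga ew ga z *~ c ga) = 0 -> forall ga, c ga = 0.
Proof.
move=> HF na rel.
suff : forall s, (forall ga, (s <= size (won ga))%N -> c ga = 0) -> forall ga, c ga = 0.
  by move/(_ (n * k).+1); apply => ga H1; have := size_won ga; lia.
elim=> [|s IH] Hs; first by move=> ga; apply: Hs.
apply: IH => ga0; rewrite leq_eqVlt => /orP[/eqP Es|]; last exact: Hs.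
pose sg := \sum_ga (c ga)%:~R *: (mev x 'X_[xoff ga] *:
  if size (won ga) == s then 'X_[xon ga] else 0) : {mpoly B[n]}.
have Osg : Ord s (fun h => \sum_ga ew ga h *~ c ga) sg.
  apply: Ord_sum => ga; have [sl|sl|E] := ltngtP (size (won ga)) s.
  - apply: Ord_ext (OrdZ _ (OrdZ _ (Ord_le sl (Ord_word (all_won ga))))) => h.
    by rewrite scaler_int.
  - rewrite (Hs _ sl) scale0r; apply: Ord_ext (Ord_zero s) => h; by rewrite mulr0z.
  - rewrite -won_xon -E; apply: Ord_ext (OrdZ _ (OrdZ _ (Ord_word (all_won ga)))) => h.
    by rewrite scaler_int.
have ew0 ga : ew ga 0 = 0 by rewrite /ew word0 scaler0.
have IQ := prime_idl HQ.
have : Q (a *: sg)@_(xon ga0).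
  apply: (Ord_symbol (OrdZ a Osg)) => //.
  - by rewrite big1 ?scaler0 // => ga _; rewrite ew0 mul0rz.
  - by rewrite -won_xon mdeg_wmon.
  - by move=> i iH; rewrite mnmE (negPf iH).
rewrite mcoeffZ; case: HQ => _ _ HQM; case/HQM => // Qsg.
pose F : {mpoly int[n]} := \sum_(ga | xon ga == xon ga0) c ga *: 'X_[xoff ga].
have : F = 0.
  apply: HF => [i iH|].
    rewrite /F raddf_sum big1 // => ga _ /=.
    by rewrite mderivZ mderivX mnmE iH scale0r scaler0.
  suff -> : mev x F = sg@_(xon ga0) by [].
  rewrite /F /sg !raddf_sum /= [LHS]big_mkcond /=; apply: eq_bigr => ga _.
  rewrite !mcoeffZ; case: eqP => Eg.
    have -> : size (won ga) == s by rewrite -mdeg_wmon won_xon Eg -won_xon mdeg_wmon Es.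
    by rewrite Eg mcoeffX eqxx mulr1 -mul_mpolyC rmorphM; congr (_ * _); rewrite /mev /= mmapC.
  by case: ifP; rewrite ?mcoeffX ?mcoeff0 ?(negPf (introN eqP Eg)) ?mulr0.
move/(congr1 (mcoeff (xoff ga0))); rewrite mcoeff0 /F raddf_sum (bigD1 ga0) //=.
rewrite mcoeffZ mcoeffX eqxx mulr1 big1 ?addr0 // => ga /andP[/eqP Eon neq].
rewrite mcoeffZ mcoeffX; case: eqP => [Eoff|_]; last by rewrite mulr0.
case/eqP: neq; apply/ffunP => j; apply: val_inj.
have /= := congr1 (fun m : 'X_{1.. n} => m j) Eon; have /= := congr1 (fun m : 'X_{1.. n} => m j) Eoff.
by rewrite !mnmE; case: ifP.
Qed.

End Ord.

(** Among the primes occurring in a relation take [Q l0] minimal, found by maximizing the number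
    [up] of given primes over it. Every other one that occurs has an element outside [Q l0], a power
    of which kills its terms ([word_kill]); multiplication by these leaves a relation for [l0]
    alone. *)
Lemma joint_independent (I : finType) (Q : I -> set B) (z : I -> H) :
  (forall i : 'I_n, {morph del i : a b / a + b}) ->
  (forall i a b, del i (a * b) = del i a * b + a * del i b) ->
  (forall i j, del i (x j) = (i == j)%:R) ->
  (forall l, prime_ideal (Q l)) -> (forall l k, (0 < k)%N -> ~ Q l k%:R) ->
  (forall l r, Q l r <-> r *: z l = 0) -> injective Q ->
  exists Hc : I -> {set 'I_n}, forall k (c : I -> {ffun 'I_n -> 'I_k.+1} -> int),
  \sum_l \sum_ga ew (Hc l) ga (z l) *~ c l ga = 0 -> forall l ga, c l ga = 0.
Proof.
move=> delD delM delx HQ Q0 Qz Qinj.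
have [Hc HHc] := choice (fun l => frame_max delD delM delx (HQ l) (Q0 l)).
exists Hc => k c rel; apply: contrapT => nc.
have [l1 c1] : exists l, exists ga, c l ga != 0.
  apply: contrapT => H1; apply: nc => l ga; apply/eqP/negPn/negP => H2.
  by apply: H1; exists l, ga.
pose up l := #|[set l' | `[< Q l `<=` Q l' >]]%SET|.
have [l0 c0 lmax] : exists2 l0, (exists ga, c l0 ga != 0) &
   forall l, (exists ga, c l ga != 0) -> (up l <= up l0)%N.
  have [l0 /asboolP H1 H2] := @arg_maxnP _ l1 (fun l => `[< exists ga, c l ga != 0 >]) up
    (introT (asboolP _) c1).
  by exists l0 => // l Hl; apply: H2; apply/asboolP.
have /choice[a Ha] : forall l, exists a, ~ Q l0 a /\ (l != l0 -> a *: z l = 0 \/ forall ga, c l ga = 0).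
  move=> l; have [->|ll] := eqVneq l l0; first by exists 1; split=> //; apply: (prime_n1 (HQ l0)).
  have [cl|cl] := EM (exists ga, c l ga != 0); last first.
    exists 1; split; first exact: (prime_n1 (HQ l0)).
    move=> _; right=> ga; apply/eqP/negPn/negP => H2; apply: cl; by exists ga.
  have [sub|/existsNP[a /not_implyP[Qa nQa]]] := EM (Q l `<=` Q l0); last first.
    by exists a; split=> // _; left; apply/Qz.
  have := lmax l cl; suff : (up l0 < up l)%N by lia.
  apply: proper_card; apply/properP; split.
    apply/fintype.subsetP => l'; by rewrite !inE => H1 r Qr; apply: H1; apply: sub.
  exists l; rewrite inE; first exact/asboolP.
  apply/asboolP => sub2; case/eqP: ll; apply: Qinj; apply/seteqP; by split.
pose A := \prod_(l | l != l0) a l ^+ (n * k).+1.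
have nA : ~ Q l0 A.
  rewrite /A; elim/big_ind: _ => [|u v|l _]; first exact: (prime_n1 (HQ l0)).
    exact: (primeM (HQ l0)).
  elim: (n * k).+1 => [|e IHe]; first by rewrite expr0; apply: (prime_n1 (HQ l0)).
  by rewrite exprS; apply: (primeM (HQ l0)) => //; case: (Ha l).
have [[g [d [nd Qg Qd]]] HF] := HHc l0.
have : A *: (\sum_ga ew (Hc l0) ga (z l0) *~ c l0 ga) = 0.
  have := congr1 (fun h => A *: h) rel; rewrite scaler0 (bigD1 l0) //= scalerDr.
  rewrite [X in _ + X](_ : _ = 0) ?addr0 // scaler_sumr big1 // => l ll.
  have [_ /(_ ll)[az|cl]] := Ha l; last first.
    by rewrite big1 ?scaler0 // => ga _; rewrite cl mulr0z.
  rewrite scaler_sumr big1 // => ga _.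
  have [e Ee] : exists e, (n * k).+1 = (e + (size (won (Hc l) ga)).+1)%N.
    by exists (n * k - size (won (Hc l) ga))%N; have := size_won (Hc l) ga; lia.
  rewrite -scaler_int scalerA mulrC -scalerA /A (bigD1 l) //= Ee exprD /ew.
  set m := mev _ _; set pr := bigop _ _ _; set w := word _ _.
  have -> : (a l ^+ e * a l ^+ (size (won (Hc l) ga)).+1 * pr) *: (m *: w) =
      (m * a l ^+ e * pr) *: (a l ^+ (size (won (Hc l) ga)).+1 *: w).
    by rewrite !scalerA; congr (_ *: _); ring.
  by rewrite (word_kill _ delM az) !scaler0.
move/(indep_one (HQ l0) (Q0 l0) (Qz l0) nd Qg Qd HF nA) => c00.
by case: c0 => ga; rewrite c00 eqxx.
Qed.

End Orders.

(** * Growth *)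

Section RationalSpan.
Variable V : zmodType.
Implicit Types (L : seq V) (v : V).

Definition zspan L v := forall D : set V, D 0 -> (forall a b, D a -> D b -> D (a - b)) ->
  (forall l, l \in L -> D l) -> D v.

Lemma zspan0 L : zspan L 0. Proof. by move=> D. Qed.
Lemma zspanB L a b : zspan L a -> zspan L b -> zspan L (a - b).
Proof. by move=> Ha Hb D D0 DB DL; apply: (DB); [apply: Ha|apply: Hb]. Qed.
Lemma zspan_mem L l : l \in L -> zspan L l.
Proof. by move=> lL D _ _; apply. Qed.
Lemma zspanD L a b : zspan L a -> zspan L b -> zspan L (a + b).
Proof. by move=> Ha Hb; rewrite -[b]opprK -[- b]sub0r; do !apply: zspanB => //; apply: zspan0. Qed.
Lemma zspanMn L a k : zspan L a -> zspan L (a *+ k).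
Proof. by move=> Ha; elim: k => [|k IH]; [exact: zspan0|rewrite mulrS; apply: zspanD]. Qed.
Lemma zspanMz L a c : zspan L a -> zspan L (a *~ c).
Proof.
move=> Ha; case: c => k; first exact: zspanMn.
by rewrite NegzE mulrNz -sub0r; apply: zspanB; [exact: zspan0|exact: zspanMn].
Qed.

Lemma zspan_coef L v : zspan L v -> exists c : nat -> int, v = \sum_(i < size L) L`_i *~ c i.
Proof.
move=> /(_ [set v | exists c : nat -> int, v = \sum_(i < size L) L`_i *~ c i]); apply.
- by exists (fun=> 0); rewrite big1 // => i _; rewrite mulr0z.
- move=> _ _ [c ->] [c' ->]; exists (fun i => c i - c' i); rewrite -sumrB.
  by apply: eq_bigr => i _; rewrite mulrzBr.
move=> l lL; exists (fun i => (i == index l L)%:R).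
have iL : (index l L < size L)%N by rewrite index_mem.
rewrite (bigD1 (Ordinal iL)) //= eqxx mulr1z nth_index // big1 ?addr0 // => i ni.
have -> : (i == index l L :> nat) = false by apply: contraNF ni => /eqP E; apply/eqP/val_inj.
by rewrite mulr0z.
Qed.

Definition qspan L v := exists N : int, N != 0 /\ zspan L (v *~ N).

Lemma qspan_mem L l : l \in L -> qspan L l.
Proof. by move=> lL; exists 1; split=> //; rewrite mulr1z; apply: zspan_mem. Qed.
Lemma qspan0 L : qspan L 0.
Proof. by exists 1; split=> //; rewrite mulr1z; apply: zspan0. Qed.
Lemma qspanB L a b : qspan L a -> qspan L b -> qspan L (a - b).
Proof.
move=> [N [N0 Ha]] [M [M0 Hb]]; exists (N * M); split; first by rewrite mulf_neq0.
rewrite mulrzBl; apply: zspanB; first by rewrite mulrzA; apply: zspanMz.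
by rewrite mulrC mulrzA; apply: zspanMz.
Qed.
Lemma qspanN L a : qspan L a -> qspan L (- a).
Proof. by move=> Ha; rewrite -sub0r; apply: qspanB => //; apply: qspan0. Qed.
Lemma qspanD L a b : qspan L a -> qspan L b -> qspan L (a + b).
Proof. by move=> Ha /qspanN Hb; rewrite -[b]opprK; apply: qspanB. Qed.
Lemma qspan_sum L (I : eqType) (r : seq I) (P : pred I) (F : I -> V) :
  (forall i, i \in r -> P i -> qspan L (F i)) -> qspan L (\sum_(i <- r | P i) F i).
Proof.
move=> H; rewrite big_seq_cond; elim/big_ind: _ => [|a b|i /andP[ir Pi]]; first exact: qspan0.
  exact: qspanD.
exact: H.
Qed.
Lemma qspanMz L a c : qspan L a -> qspan L (a *~ c).
Proof. by move=> [N [N0 Ha]]; exists N; split=> //; rewrite mulrzAC; apply: zspanMz. Qed.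
Lemma qspan_div L a c : c != 0 -> qspan L (a *~ c) -> qspan L a.
Proof.
by move=> c0 [N [N0 Ha]]; exists (c * N); split; [rewrite mulf_neq0|rewrite mulrzA].
Qed.

(** A rational relation exists by rank; its denominators are then cleared. *)
Lemma qspan_relation L K (u : 'I_K -> V) : (forall i, qspan L (u i)) -> (size L < K)%N ->
  exists c : 'I_K -> int, (exists i, c i != 0) /\ \sum_i u i *~ c i = 0.
Proof.
move=> Hu LK; have /choice[N HN] : forall i, exists N, N != 0 /\
    exists c : nat -> int, u i *~ N = \sum_(j < size L) L`_j *~ c j.
  by move=> i; have [N [N0 /zspan_coef Hc]] := Hu i; exists N.
have /choice[C HC] := fun i => (HN i).2.
pose A : 'M[rat]_(K, size L) := \matrix_(i, j) (C i j)%:~R.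
have : kermx A != 0.
  by rewrite kermx_eq0 /row_free neq_ltn (leq_ltn_trans (rank_leq_col A) LK).
case/rowV0Pn => w /sub_kermxP wA w0.
pose D := \prod_j denq (w 0 j).
have /choice[W HW] : forall i, exists W : int, W%:~R = D%:~R * w 0 i.
  move=> i; rewrite /D (bigD1 i) //=; set e := bigop _ _ _; exists (e * numq (w 0 i)).
  by rewrite !intrM numqE; ring.
have D0 : D%:~R != 0 :> rat.
  by rewrite intr_eq0; apply/prodf_neq0 => j _; apply: denq_neq0.
exists (fun i => N i * W i); split.
  have [i wi] : exists i, w 0 i != 0 by apply/rV0Pn.
  exists i; rewrite mulf_neq0 //; first by case: (HN i).
  by rewrite -(intr_eq0 rat) HW mulf_neq0.
under eq_bigr => i _ do rewrite mulrzA HC mulrz_suml.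
rewrite exchange_big big1 // => j _ /=.
under eq_bigr => i _ do rewrite -mulrzA.
rewrite -mulrz_sumr; suff -> : \sum_i C i j * W i = 0 by rewrite mulr0z.
apply: (@intr_inj rat); rewrite rmorph_sum rmorph0 /=.
have := congr1 (fun M : 'rV_(size L) => M 0 j) wA; rewrite !mxE => E.
rewrite -[RHS](mulr0 D%:~R) -[X in _ = _ * X]E mulr_sumr; apply: eq_bigr => i _.
by rewrite !mxE rmorphM /= HW; ring.
Qed.

End RationalSpan.

Section StandardMonomials.
Variables (B : comNzRingType) (M n : nat) (y : 'I_M -> B).
Hypothesis dep : forall c : 'I_n.+1 -> B, exists a : {mpoly int[n.+1]}, a != 0 /\ mev c a = 0.

Definition push (e : {ffun 'I_n.+1 -> 'I_M}) (m : 'X_{1.. n.+1}) : 'X_{1.. M} :=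
  [multinom (\sum_(i | e i == j) m i)%N | j < M].

Lemma mev_monomial (C : comNzRingType) r (c : 'I_r -> C) (m : 'X_{1.. r}) :
  mev c 'X_[m] = \prod_i c i ^+ m i.
Proof. by rewrite /mev /= mmapX. Qed.

Lemma mevZ (C : comNzRingType) r (c : 'I_r -> C) k F : mev c (k *: F) = mev c F *~ k.
Proof. by rewrite -mul_mpolyC rmorphM /mev /= mmapC /= mulrzl. Qed.

Lemma mev_push e m : mev y 'X_[push e m] = mev (fun i => y (e i)) 'X_[m].
Proof.
rewrite !mev_monomial [RHS](partition_big e xpredT) //=; apply: eq_bigr => j _.
by rewrite mnmE -prodrXr; apply: eq_bigr => i /eqP ->.
Qed.

Lemma push_inj (e : {ffun _ -> _}) : injective e -> injective (push e).
Proof.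
move=> einj m m' E; apply/mnmP => i; have := congr1 (fun m : 'X_{1.. M} => m (e i)) E.
by rewrite !mnmE !(big_pred1 i) // => j; rewrite /= (inj_eq einj).
Qed.

(** For each choice of [n + 1] generators, a monomial in these alone that reduces rationally to
    smaller ones. For [e] not injective, [m] is a dummy. *)
Lemma leading_relation (e : {ffun 'I_n.+1 -> 'I_M}) : exists m : 'X_{1.. M}, injective e ->
  (exists a : {mpoly int[M]}, [/\ a != 0, mev y a = 0 & mlead a = m]) /\
  forall j, (0 < m j)%N -> exists i, e i = j.
Proof.
have [einj|ne] := EM (injective e); last by exists 0%MM.
have [a [a0 Ha]] := dep (fun i => y (e i)).
pose a' : {mpoly int[M]} := \sum_(m <- msupp a) a@_m *: 'X_[push e m].
have Ha' : mev y a' = 0.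
  rewrite -Ha [a in RHS]mpolyE !rmorph_sum; apply: eq_bigr => m _.
  by rewrite !mevZ mev_push.
have ca m : m \in msupp a -> a'@_(push e m) = a@_m.
  move=> ma; rewrite /a' raddf_sum (bigD1_seq m) //= ?msupp_uniq //.
  rewrite mcoeffZ mcoeffX eqxx mulr1 big1 ?addr0 // => m' mm'.
  by rewrite mcoeffZ mcoeffX (inj_eq (push_inj einj)) (negPf mm') mulr0.
have a'0 : a' != 0.
  have ml := mlead_supp a0; apply: contraTneq ml => E.
  by rewrite mcoeff_msupp -(ca _ (mlead_supp a0)) E mcoeff0 eqxx.
exists (mlead a') => _; split; first by exists a'.
move=> j; have : exists2 m, m \in msupp a & mlead a' = push e m.
  apply: contrapT => H; have := mlead_supp a'0; rewrite mcoeff_msupp /a' raddf_sum /=.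
  rewrite big_seq big1 ?eqxx // => m ma; rewrite mcoeffZ mcoeffX; case: eqP => [E|]; last by rewrite mulr0.
  by case: H; exists m.
move=> [m _ ->]; rewrite mnmE => H; apply: contrapT => H'; move: H; rewrite big1 // => i /eqP E.
by case: H'; exists i.
Qed.

Section Reduction.
Variable lead : {ffun 'I_n.+1 -> 'I_M} -> 'X_{1.. M}.
Hypothesis Hlead : forall e : {ffun 'I_n.+1 -> 'I_M}, injective e ->
  (exists a : {mpoly int[M]}, [/\ a != 0, mev y a = 0 & mlead a = lead e]) /\
  forall j, (0 < lead e j)%N -> exists i, e i = j.

Definition stdm (m : 'X_{1.. M}) := [forall e : {ffun 'I_n.+1 -> 'I_M}, injectiveb e ==> ~~ (lead e <= m)%MM].
Definition stds d : seq B := [seq mev y 'X_[bmnm m] | m : 'X_{1.. M < d.+1} in [pred m | stdm (bmnm m)]].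

(** Induction on the monomial order, which refines the degree; leading coefficients are invertible
    rationally. *)
Lemma std_reduction d m : (mdeg m <= d)%N -> qspan (stds d) (mev y 'X_[m]).
Proof.
elim/(well_founded_ind (@ltom_wf M)): m => m IH md.
have [sm|] := boolP (stdm m).
  apply: qspan_mem; have mb : (mdeg m < d.+1)%N by [].
  by apply/fintype.imageP; exists (BMultinom mb).
rewrite negb_forall => /existsP[e]; rewrite negb_imply negbK => /andP[/injectiveP einj lm].
have [[a [a0 Ha la]] _] := Hlead einj.
pose m' := (m - lead e)%MM; have Em : (m' + lead e)%MM = m by rewrite submK.
apply: (qspan_div (c := a@_(lead e))); first by rewrite -la mleadc_eq0.
have : mev y (\sum_(u <- msupp a) a@_u *: 'X_[u] * 'X_[m']) = 0.
  by rewrite -mulr_suml -mpolyE rmorphM Ha mul0r.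
have lsupp : lead e \in msupp a by rewrite -la mlead_supp.
rewrite rmorph_sum (bigD1_seq (lead e)) ?msupp_uniq //.
rewrite -scalerAl -mpolyXD mevZ addmC Em => /eqP.
rewrite addr_eq0 => /eqP ->; apply: qspanN; apply: qspan_sum => u ua ul.
rewrite -scalerAl -mpolyXD mevZ; apply: qspanMz.
have lt : ((u + m')%MM < m)%O.
  by rewrite -Em [(u + _)%MM]addmC ltmc_add2r Order.POrderTheory.lt_neqAle ul -la msupp_le_mlead.
apply: (IH _ lt); apply: leq_trans md.
exact: lemc_mdeg (Order.POrderTheory.ltW lt).
Qed.

(** A standard monomial has at most [n] exponents above [C0]: given [n + 1], the corresponding
    [lead e], whose exponents are at most [C0], would divide it. It is coded by the set of its large
    exponents, its small exponents, and [n] numbers up to [d]. *)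
Lemma size_stds d : (size (stds d) <= 2 ^ M * (\max_e mdeg (lead e)).+1 ^ M * d.+1 ^ n)%N.
Proof.
set C0 := \max_e mdeg (lead e); rewrite size_map -cardE.
pose big (m : 'X_{1.. M}) := [set i | (C0 < m i)%N]%SET.
pose code (m : 'X_{1.. M < d.+1}) : {set 'I_M} * {ffun 'I_M -> 'I_C0.+1} * {ffun 'I_n -> 'I_d.+1} :=
  (big m, [ffun i => inord (m i)], [ffun j : 'I_n => inord (nth 0%N [seq bmnm m i | i <- enum (big m)] j)]).
have bign m : stdm m -> (#|big m| <= n)%N.
  move=> /forallP sm; rewrite leqNgt; apply/negP => bn.
  have s n' : (n' < #|big m|)%N -> (n' < size (enum (big m)))%N by rewrite -cardE.
  have [i0 _] : exists i0, i0 \in big m by apply/card_gt0P; lia.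
  pose e : {ffun 'I_n.+1 -> 'I_M} := [ffun i : 'I_n.+1 => nth i0 (enum (big m)) i].
  have einj : injective e.
    move=> i j; rewrite !ffunE => /eqP; rewrite nth_uniq ?enum_uniq //; first by move/eqP/val_inj.
      by apply: s; apply: leq_trans bn.
    by apply: s; apply: leq_trans bn.
  have := sm e; rewrite (introT (injectiveP _) einj) /= => /negP; apply.
  apply/mnm_lepP => j; have [-> //|lj] := posnP (lead e j).
  have [i Ei] := (Hlead einj).2 j lj.
  have : j \in big m by rewrite -Ei ffunE -mem_enum mem_nth // s // (leq_trans _ bn).
  rewrite inE; apply: leq_trans; rewrite ltnW // ltnS.
  apply: leq_trans (leq_bigmax e); rewrite mdegE (bigD1 j) //= leq_addr //.
apply: (@leq_trans #|{: {set 'I_M} * {ffun 'I_M -> 'I_C0.+1} * {ffun 'I_n -> 'I_d.+1}}|); last first.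
  rewrite !card_prod -[#|{: {set 'I_M}}|]cardsT -powersetT card_powerset cardsT.
  by rewrite !card_ffun !card_ord.
apply: (@leq_card_in _ _ code) => m m' sm sm' [E1 E2 E3]; apply/val_inj/mnmP => i.
have mle (u : 'X_{1.. M < d.+1}) j : (u j < d.+1)%N.
  by apply: leq_ltn_trans (bmdeg u); rewrite mdegE (bigD1 j) //= leq_addr.
have [ib|ib] := boolP (i \in big m).
  have ib' : i \in big m' by rewrite -E1.
  have iM : (index i (enum (big m)) < #|big m|)%N by rewrite cardE index_mem mem_enum.
  have iN : (index i (enum (big m)) < n)%N by apply: leq_trans (bign _ sm).
  have := congr1 (fun g : {ffun 'I_n -> 'I_d.+1} => g (Ordinal iN) : nat) E3; rewrite !ffunE /=.
  rewrite -E1 !(nth_map i) -?cardE // !nth_index ?mem_enum // !inordK //.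
have := congr1 (fun g : {ffun 'I_M -> 'I_C0.+1} => g i : nat) E2; rewrite !ffunE.
have ib' : i \notin big m' by rewrite -E1.
by move: ib ib'; rewrite !inE -!leqNgt => ib ib'; rewrite !inordK.
Qed.

End Reduction.

Lemma growth : exists C, forall d, exists L : seq B, (size L <= C * d.+1 ^ n)%N /\
  forall F : {mpoly int[M]}, (msize F <= d.+1)%N -> qspan L (mev y F).
Proof.
have [lead Hlead] := choice leading_relation.
exists (2 ^ M * (\max_e mdeg (lead e)).+1 ^ M)%N => d; exists (stds lead d); split.
  exact: size_stds.
move=> F Fd; rewrite [F]mpolyE rmorph_sum; apply: qspan_sum => m mF _.
rewrite mevZ; apply: qspanMz; apply: std_reduction => //.
by have := msize_mdeg_lt mF; lia.
Qed.

End StandardMonomials.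

Lemma growth_kx (B : comNzRingType) (L : seq B) t : exists L' : seq (kx B^o t),
  size L' = (size L * 2 ^ t)%N /\ forall v : kx B^o t, kall (qspan L : B^o -> Prop) v -> qspan L' v.
Proof.
elim: t => [|t [L1 [s1 H1]]]; first by exists L; rewrite muln1.
exists ([seq (x, 0) | x <- L1] ++ [seq (0, x) | x <- L1] : seq (kx B^o t * kx B^o t)); split.
  by rewrite size_cat !size_map s1 expnS; lia.
move=> [u v] [/H1 Hu /H1 Hv].
suff tr (g : kx B^o t -> kx B^o t.+1) (gB : {morph g : a b / a - b}) Lg w :
    (forall l, l \in L1 -> g l \in Lg) -> qspan L1 w -> qspan Lg (g w).
  rewrite (_ : (u, v) = ((u, 0) : kx B^o t.+1) + (0, v)); last by apply: pair_eq; rewrite /= ?addr0 ?add0r.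
  apply: qspanD.
    apply: (tr (fun a => (a, 0))) Hu => [a b|l l1]; first by apply: pair_eq; rewrite //= subr0.
    by rewrite mem_cat map_f.
  apply: (tr (fun a => (0, a))) Hv => [a b|l l1]; first by apply: pair_eq; rewrite //= subr0.
  by rewrite mem_cat map_f ?orbT.
move=> Hg [N [N0 Hw]]; exists N; split=> //.
have g0 : g 0 = 0 by rewrite -[X in g X](subrr 0) gB subrr.
have gN a : g (- a) = - g a by rewrite -[X in g X]sub0r gB g0 sub0r.
have gD a b : g (a + b) = g a + g b by rewrite -[X in a + X]opprK gB gN opprK.
have gn a k : g (a *+ k) = g a *+ k by elim: k => [|k IH]; rewrite ?mulr0n // !mulrS gD IH.
have -> : g w *~ N = g (w *~ N).
  by case: N {N0 Hw} => k; rewrite ?NegzE ?mulrNz ?gN -!pmulrn gn.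
apply: (Hw [set v | zspan Lg (g v)]) => [|a b Ha Hb|l l1]; rewrite /mkset.
- by rewrite g0; apply: zspan0.
- by rewrite gB; apply: zspanB.
- exact: zspan_mem (Hg _ l1).
Qed.

(** * Derivations of local cohomology *)

Section Evc.
Variables (B : comPzRingType) (f : nat -> B) (t : nat).
Local Notation X := (kx B^o t).
Local Notation evc := (evc f).

Lemma evcE m (x : X) : evc m x <-> ev f (fun _ z => z = 0) m x.
Proof.
split=> [[s [w E]]|[s [w [z [-> E]]]]]; last by exists s, w; rewrite E addr0.
by exists s, w, 0; rewrite addr0.
Qed.
Lemma evc0 m : evc m (0 : X).
Proof. by exists 0%N, 0; rewrite kd0 ktr0. Qed.
Lemma evcD m (x y : X) : evc m x -> evc m y -> evc m (x + y).
Proof.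
move=> /evcE Hx /evcE Hy; apply/evcE; apply: evD => // [_ u v -> ->|k s u ->]; first by rewrite addr0.
exact: ktr0.
Qed.
Lemma evcZ m a (x : X) : evc m x -> evc m (a *: x).
Proof. by move=> /evcE Hx; apply/evcE; apply: evZ => // _ u ->; rewrite scaler0. Qed.
Lemma evcN m (x : X) : evc m x -> evc m (- x).
Proof. by rewrite -scaleN1r; apply: evcZ. Qed.
Lemma evc_up m s (x : X) : evc m x -> evc (m + s) (ktr (lev f s) x).
Proof. by move=> /evcE Hx; apply/evcE; apply: ev_up => // k s' u ->; apply: ktr0. Qed.
Lemma evc_down m s (x : X) : evc (m + s) (ktr (lev f s) x) -> evc m x.
Proof. by move=> /evcE Hx; apply/evcE; apply: (ev_down Hx) => // k s' u ->; apply: ktr0. Qed.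
End Evc.

Section KoszulDerivation.
Variables (B : comNzRingType) (f : nat -> B) (D : B -> B).
Hypotheses (DD : {morph D : a b / a + b}) (DM : forall a b, D (a * b) = D a * b + a * D b).

(** The quotient rule [D (z / f ^ m) = (f D z - m D f z) / f ^ (m + 1)], applied to one generator
    after another; the level rises by one. *)
Fixpoint dk (m t : nat) : kx B^o t -> kx B^o t :=
  if t is t'.+1 return kx B^o t -> kx B^o t then
    fun z : kx B^o t' * kx B^o t' =>
      (dk m z.1, f t' *: dk m z.2 - (m%:R * D (f t')) *: ktr (lev f 1) z.2)
  else D.

Lemma dkD m t : {morph @dk m t : a b / a + b}.
Proof.
elim: t => [|t IH] a b; first exact: DD.
apply: pair_eq => /=; first exact: IH.
by rewrite IH ktrD !scalerDr opprD addrACA.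
Qed.

Lemma dk0 m t : @dk m t 0 = 0.
Proof. by apply: (addrI (dk m 0)); rewrite -dkD !addr0. Qed.
Lemma dkN m t x : @dk m t (- x) = - dk m x.
Proof. by apply: (addrI (dk m x)); rewrite -dkD !subrr dk0. Qed.
Lemma dkB m t a b : @dk m t (a - b) = dk m a - dk m b.
Proof. by rewrite dkD dkN. Qed.

Lemma dkZ m t a (x : kx B^o t) : dk m (a *: x) = a *: dk m x + D a *: ktr (lev f 1) x.
Proof.
elim: t x => [|t IH] x; first by rewrite /= /GRing.scale /= DM addrC.
apply: pair_eq; first exact: IH.
change (f t *: dk m (a *: x.2) - (m%:R * D (f t)) *: ktr (lev f 1) (a *: x.2) =
  a *: (f t *: dk m x.2 - (m%:R * D (f t)) *: ktr (lev f 1) x.2) +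
  D a *: (lev f 1 t *: ktr (lev f 1) x.2)).
rewrite IH ktrZ /lev expr1 scalerDr scalerBr !scalerA [LHS]addrAC.
by rewrite [a * f t]mulrC [a * _]mulrC [D a * _]mulrC.
Qed.

Lemma DX a s : a * D (a ^+ s) = s%:R * D a * a ^+ s.
Proof.
elim: s => [|s IH].
  have D1 : D 1 = 0 by apply: (addrI (D 1)); rewrite addr0 -{3}[1]mulr1 DM mulr1 mul1r.
  by rewrite expr0 D1 mulr0 !mul0r.
by rewrite exprS DM mulrDr IH -natr1; ring.
Qed.

Lemma dk_kd m t (x : kx B^o t) : dk m (kd (lev f m) x) = kd (lev f m.+1) (dk m x).
Proof.
elim: t x => [|t IH] x; first exact: (@dk0 m 0).
apply: pair_eq; first exact: IH.
change (f t *: dk m (lev f m t *: x.1 - kd (lev f m) x.2) -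
    (m%:R * D (f t)) *: ktr (lev f 1) (lev f m t *: x.1 - kd (lev f m) x.2) =
  lev f m.+1 t *: dk m x.1 -
    kd (lev f m.+1) (f t *: dk m x.2 - (m%:R * D (f t)) *: ktr (lev f 1) x.2)).
rewrite dkB dkZ IH ktrB ktrZ kdB !kdZ.
have -> : kd (lev f m.+1) (ktr (lev f 1) x.2) = ktr (lev f 1) (kd (lev f m) x.2).
  by rewrite -addn1 lev_tr.
rewrite scalerBr scalerDr !scalerA [X in _ - X = _]scalerBr scalerA.
rewrite /lev DX exprS.
have alg (V : zmodType) (a b c d : V) : a + b - c - (b - d) = a - (c - d).
  by rewrite !opprB [d - b]addrC [d - c]addrC !addrA [a + b - c - b]addrAC addrK.
exact: alg.
Qed.

Lemma dk_tr m s t (x : kx B^o t) : dk (m + s) (ktr (lev f s) x) = ktr (lev f s) (dk m x).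
Proof.
elim: t x => [|t IH] x //; apply: pair_eq; first exact: IH.
change (f t *: dk (m + s) (lev f s t *: ktr (lev f s) x.2) -
    ((m + s)%:R * D (f t)) *: ktr (lev f 1) (lev f s t *: ktr (lev f s) x.2) =
  lev f s t *: ktr (lev f s) (f t *: dk m x.2 - (m%:R * D (f t)) *: ktr (lev f 1) x.2)).
rewrite dkZ IH ktrZ ktrB !ktrZ !ktr_lev [(s + 1)%N]addnC scalerDr scalerBr !scalerA.
rewrite /lev DX -addrA -scalerBl -scaleNr; congr (_ *: _ + _ *: _); first exact: mulrC.
by rewrite natrD; ring.
Qed.

Lemma evc_dk m t (x : kx B^o t) : evc f m x -> evc f m.+1 (dk m x).
Proof.
by move=> [s [w E]]; exists s, (dk (m + s) w); rewrite -dk_tr E dk_kd addSn.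
Qed.

End KoszulDerivation.

Section Degree.
Variables (B : comNzRingType) (M : nat) (y : 'I_M -> B).
Hypothesis ysurj : forall b, exists F, mev y F = b.
(* Modulo [0], [Bm] is a plain bound on degrees. *)
Local Notation Dg := (Bm 0 y).
Local Notation kdeg d := (kall (Dg d : B^o -> Prop)).

Lemma Dg_ex b : exists d, Dg d b.
Proof.
exact: Bm_ex.
Qed.

Lemma Dg_uniform (I : finType) (b : I -> B) : exists c, forall i, Dg c (b i).
Proof.
have /choice[c Hc] := fun i => Dg_ex (b i).
by exists (\max_i c i) => i; apply: Bm_le (Hc i); apply: (leq_bigmax (F := c)).
Qed.

Lemma Dg_qspan (L : seq B) d : (forall F : {mpoly int[M]}, (msize F <= d.+1)%N -> qspan L (mev y F)) ->
  forall b, Dg d b -> qspan L b.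
Proof.
move=> HL b; apply=> [|a c||c]; [exact: qspan0|exact: qspanB| |].
  by move=> m md; have := HL 'X_[m]; rewrite msizeX /mev /= mmapX; apply.
by rewrite mul0r; apply: qspan0.
Qed.

Section Der.
Variable D : B -> B.
Hypotheses (DD : {morph D : a b / a + b}) (DM : forall a b, D (a * b) = D a * b + a * D b).
Variable c : nat.
Hypothesis Dy : forall j, Dg c (D (y j)).

Lemma Dg_der d b : Dg d b -> Dg (d + c) (D b).
Proof.
have D0 : D 0 = 0 by apply: (addrI (D 0)); rewrite -DD !addr0.
have D1 : D 1 = 0 by apply: (addrI (D 1)); rewrite addr0 -{3}[1]mulr1 DM mulr1 mul1r.
have DN a : D (- a) = - D a by apply: (addrI (D a)); rewrite -DD !subrr.
move=> /(_ (fun b => Dg (d + c) (D b))); apply=> [|a a'|m md|a].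
- by rewrite D0; apply: Bm0.
- by rewrite DD DN; apply: BmB.
- elim: d m md => [|d IH] m md.
    have -> : m = 0%MM by apply/eqP; rewrite -mdeg_eq0 -leqn0.
    by rewrite mmap11 D1; apply: Bm0.
  have [/eqP|m0] := posnP (mdeg m).
    by rewrite mdeg_eq0 => /eqP ->; rewrite mmap11 D1; apply: Bm0.
  have [j mj] : exists j, (0 < m j)%N.
    apply: contrapT => nj; move: m0; rewrite mdegE big1 // => i _; case E: (m i) => [//|k].
    by case: nj; exists i; rewrite E.
  have Em : m = (m - U_(j) + U_(j))%MM.
    by apply/mnmP => i; rewrite mnmDE mnmBE mnm1E; case: eqP => [<-|_]; lia.
  have m'd : (mdeg (m - U_(j))%MM <= d)%N.
    by have := congr1 mdeg Em; rewrite mdegD mdeg1; lia.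
  rewrite Em mmap1_add mmap1U DM; apply: BmD.
    rewrite addSn -addn1; apply: BmM; first exact: IH.
    by rewrite -[y j]mmap1U; apply: Bm_mon; rewrite mdeg1.
  by apply: (@Bm_le _ _ _ _ (d + c)); [lia|]; apply: BmM => //; apply: Bm_mon.
- by rewrite mul0r D0; apply: Bm0.
Qed.

End Der.

Lemma kdeg_le d d' t (x : kx B^o t) : (d <= d')%N -> kdeg d x -> kdeg d' x.
Proof. by move=> dd'; apply: kall_imp => b; apply: Bm_le. Qed.

Lemma kdegB d t (x x' : kx B^o t) : kdeg d x -> kdeg d x' -> kdeg d (x - x').
Proof. by elim: t x x' => [|t IH] x x' /=; [exact: BmB|move=> [? ?] [? ?]; split; apply: IH]. Qed.

Lemma kdegZ e d t a (x : kx B^o t) : Dg e a -> kdeg d x -> kdeg (e + d) (a *: x).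
Proof. by move=> Ha; elim: t x => [|t IH] x /=; [exact: BmM|move=> [? ?]; split; apply: IH]. Qed.

Lemma kdeg_ex t (x : kx B^o t) : exists d, kdeg d x.
Proof.
elim: t x => [|t IH] x /=; first exact: Dg_ex.
have [d1 H1] := IH x.1; have [d2 H2] := IH x.2; exists (maxn d1 d2).
by split; [apply: kdeg_le H1|apply: kdeg_le H2]; rewrite ?leq_maxl ?leq_maxr.
Qed.

Variables (f : nat -> B).

Lemma kdeg_tr c s d t (x : kx B^o t) : (forall i, (i < t)%N -> Dg c (f i)) ->
  kdeg d x -> kdeg (d + t * c * s) (ktr (lev f s) x).
Proof.
elim: t x => [|t IH] x fc /=; first by rewrite !mul0n addn0.
move=> [H1 H2]; have fc' i : (i < t)%N -> Dg c (f i) by move=> it; apply: fc; lia.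
split; first by apply: kdeg_le (IH _ fc' H1); rewrite leq_add2l leq_mul2r leq_mul2r leqnSn !orbT.
have -> : (d + t.+1 * c * s = c * s + (d + t * c * s))%N by lia.
by apply: kdegZ; [apply: BmX; apply: fc|apply: IH].
Qed.

Lemma kdeg_dk (D : B -> B) c m d t (x : kx B^o t) :
  {morph D : a b / a + b} -> (forall a b, D (a * b) = D a * b + a * D b) ->
  (forall j, Dg c (D (y j))) ->
  (forall i, (i < t)%N -> Dg c (f i) /\ Dg c (D (f i))) ->
  kdeg d x -> kdeg (d + t.+1 * c) (dk f D m x).
Proof.
move=> DD DM Dy; elim: t x => [|t IH] x fc; first by rewrite mul1n; apply: Dg_der.
have fc' i : (i < t)%N -> Dg c (f i) /\ Dg c (D (f i)) by move=> it; apply: fc; lia.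
move=> [H1 H2]; split => /=.
  by apply: kdeg_le (IH _ fc' H1); rewrite leq_add2l leq_mul2r leqnSn orbT.
have [ft Dft] := fc t (leqnn _).
apply: kdegB.
  by have := kdegZ ft (IH _ fc' H2); apply: kdeg_le; lia.
have H3 := kdeg_tr 1%N (fun i it => (fc' i it).1) H2.
have := kdegZ Dft H3; move/(kdegZ (a := m%:R) (e := 0)) => H4.
rewrite -scalerA; apply: kdeg_le (H4 _); first lia.
elim: {H4 IH} m => [|m IHm]; first exact: Bm0.
rewrite -natr1; apply: BmD => //.
by have := @Bm_mon _ 0 _ y 0 0%MM; rewrite mdeg0 mmap11; exact.
Qed.

End Degree.

Section Colimit.
Variables (B : comNzRingType) (f : nat -> B) (t : nat).
Local Notation X := (kx B^o t).
Local Notation evc := (evc f).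
Local Notation tr1 := (ktr (lev f 1)).

(* The colimit of the levels, as germs at infinity of sequences compatible up to coboundaries. *)
Definition sequences : lmodType B := (nat -> X)%type.
Definition coherent : set sequences :=
  [set u | exists N, forall k, (N <= k)%N -> evc k.+1 (u k.+1 - tr1 (u k))].
Definition vanishing (u : nat -> X) := exists N, forall k, (N <= k)%N -> evc k (u k).
Definition germ : lmodType B := quotmod [set w : submod coherent | vanishing (val w)].

Lemma coherent_submodule : submodule coherent.
Proof.
split=> [|a u v [N Hu] [N' Hv]].
  by exists 0%N => k _ /=; rewrite ktr0 subrr; apply: evc0.
exists (maxn N N') => k kN.
have -> : (a *: u + v) k.+1 - tr1 ((a *: u + v) k) =
    a *: (u k.+1 - tr1 (u k)) + (v k.+1 - tr1 (v k)).
  rewrite -[(a *: u + v) k.+1]/(a *: u k.+1 + v k.+1) -[(a *: u + v) k]/(a *: u k + v k).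
  by rewrite ktrD ktrZ scalerBr opprD addrACA.
apply: evcD; last by apply: Hv; apply: leq_trans kN; apply: leq_maxr.
by apply: evcZ; apply: Hu; apply: leq_trans kN; apply: leq_maxl.
Qed.

Lemma vanishing_submodule : submodule [set w : submod coherent | vanishing (val w)].
Proof.
split=> [|a u v [N Hu] [N' Hv]]; first by exists 0%N => k _; apply: evc0.
exists (maxn N N') => k kN.
have E : val (a *: u + v) = a *: val u + val v by exact: linearP.
rewrite E; apply: evcD; last by apply: Hv; apply: leq_trans kN; apply: leq_maxr.
by apply: evcZ; apply: Hu; apply: leq_trans kN; apply: leq_maxl.
Qed.

Lemma coh_in u : coherent u -> u \in span_pred coherent.
Proof. by move=> cu; apply/span_predP; apply: Defs.sub_span. Qed.

(** Incoherent sequences are sent to [0] to make [mk] total. *)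
Definition mk u : germ := if pselect (coherent u) is left cu then
  qmod _ (exist _ u (coh_in cu) : submod coherent) else 0.

Lemma mkE u (cu : u \in span_pred coherent) : mk u = qmod _ (exist _ u cu : submod coherent).
Proof.
rewrite /mk; case: pselect => [cu'|[]].
  by congr (qmod _ _); apply: val_inj.
by apply: (span_id coherent_submodule); apply/span_predP.
Qed.

Lemma mk_surj h : exists u, coherent u /\ mk u = h.
Proof.
rewrite -[h]qmodK; case: (repr h) => u cu; exists u; split; last exact: mkE.
by apply: (span_id coherent_submodule); apply/span_predP.
Qed.

Lemma mk_eq0 u : coherent u -> mk u = 0 <-> vanishing u.
Proof.
move=> /coh_in cu; rewrite (mkE cu) qmod_eq0.
by split=> [/(span_id vanishing_submodule)|V] //; apply: Defs.sub_span.
Qed.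

Lemma mkP a u v : coherent u -> coherent v -> mk (a *: u + v) = a *: mk u + mk v.
Proof.
move=> cu cv; have cuv := coherent_submodule.2 a _ _ cu cv.
rewrite (mkE (coh_in cu)) (mkE (coh_in cv)) (mkE (coh_in cuv)).
rewrite -[_ *: qmod _ _]/(qscale _ _) qscaleE -qmodD; congr (qmod _ _).
exact: val_inj.
Qed.

Lemma mkD u v : coherent u -> coherent v -> mk (u + v) = mk u + mk v.
Proof. by move=> cu cv; rewrite -[u in LHS]scale1r mkP // scale1r. Qed.

Lemma mk_eq u v : coherent u -> coherent v -> vanishing (u - v) -> mk u = mk v.
Proof.
move=> cu cv V; have cuv : coherent (u - v).
  by rewrite addrC -scaleN1r; apply: coherent_submodule.2.
by move/(mk_eq0 cuv): V => E; rewrite -[u](subrK v) mkD // E add0r.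
Qed.

Section Shift.
Variable D : B -> B.
Hypotheses (DD : {morph D : a b / a + b}) (DM : forall a b, D (a * b) = D a * b + a * D b).

(** Indices move by one with the level; the value at index [0] does not affect the germ. *)
Definition shift (u : nat -> X) : nat -> X := fun k => if k is k'.+1 then dk f D k' (u k') else 0.

Lemma shift_coherent u : coherent u -> coherent (shift u).
Proof.
move=> [N Hu]; exists N.+1 => -[//|k] kN /=.
by rewrite -(dk_tr f DM) addn1 -(dkB f DD); apply: (evc_dk DD DM); apply: Hu.
Qed.

Definition dgerm (h : germ) : germ := mk (shift (sval (cid (mk_surj h)))).

Lemma dgermE u : coherent u -> dgerm (mk u) = mk (shift u).
Proof.
move=> cu; rewrite /dgerm; case: cid => v [cv E] /=.
apply: mk_eq; [exact: shift_coherent|exact: shift_coherent|].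
have [N HN] : vanishing (v - u).
  apply/mk_eq0; first by rewrite addrC -scaleN1r; apply: coherent_submodule.2.
  by rewrite addrC -scaleN1r mkP // E scaleN1r addNr.
exists N.+1 => -[//|k] kN; rewrite -[(_ - _) _]/(shift v k.+1 - shift u k.+1) /=.
by rewrite -(dkB f DD); apply: (evc_dk DD DM); apply: HN.
Qed.

Lemma dgermD : {morph dgerm : a b / a + b}.
Proof.
move=> a b; have [u [cu <-]] := mk_surj a; have [v [cv <-]] := mk_surj b.
have cuv : coherent (u + v) by rewrite -[u]scale1r; apply: coherent_submodule.2.
rewrite -mkD // !dgermE // -mkD; do 1?exact: shift_coherent.
congr mk; apply/funext => -[|k]; last exact: (dkD f DD).
by rewrite -[RHS]/((0 : X) + 0) addr0.
Qed.

Lemma dgermZ a h : dgerm (a *: h) = D a *: h + a *: dgerm h.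
Proof.
have [u [cu <-]] := mk_surj h.
have mkZ b v : coherent v -> mk (b *: v) = b *: mk v.
  move=> cv; have c0 := coherent_submodule.1.
  have z0 : mk 0 = 0 by apply/mk_eq0 => //; exists 0%N => k _; apply: evc0.
  by rewrite -[b *: v]addr0 mkP // z0 addr0.
have cZ b v : coherent v -> coherent (b *: v).
  by move=> cv; rewrite -[b *: v]addr0; apply: coherent_submodule.2 => //; apply: coherent_submodule.1.
rewrite -mkZ // !dgermE //; last exact: cZ.
rewrite -mkZ; last exact: shift_coherent.
rewrite -mkP //; last by apply: cZ; apply: shift_coherent.
have cs := shift_coherent (cZ a _ cu).
apply: mk_eq => //.
  by apply: coherent_submodule.2 => //; apply: cZ; apply: shift_coherent.
have [N HN] := cu; exists N.+1 => -[//|k] kN.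
rewrite -[(_ - _) _]/(dk f D k (a *: u k) - (D a *: u k.+1 + a *: dk f D k (u k))).
rewrite (dkZ _ DM) [_ + a *: _]addrC opprD addrACA subrr add0r -opprB -scalerBr.
by apply: evcN; apply: evcZ; apply: HN.
Qed.

End Shift.

Definition cls m (z : X) : germ := mk (fun k => if (m <= k)%N then ktr (lev f (k - m)) z else 0).

Lemma cls_coherent m (z : X) : coherent (fun k => if (m <= k)%N then ktr (lev f (k - m)) z else 0).
Proof.
exists m => k mk; rewrite mk (leqW mk) ktr_lev.
by rewrite (_ : (k - m + 1)%N = (k.+1 - m)%N) ?subrr; [exact: evc0|lia].
Qed.

Lemma clsP m a (z z' : X) : cls m (a *: z + z') = a *: cls m z + cls m z'.
Proof.
rewrite -mkP; try exact: cls_coherent.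
congr mk; apply/funext => k; rewrite -[RHS]/(a *: (if (m <= k)%N then _ else _) + (if (m <= k)%N then _ else _)).
by case: ifP => _; rewrite ?ktrD ?ktrZ // scaler0 addr0.
Qed.

Lemma cls_eq0 m (z : X) : cls m z = 0 <-> evc m z.
Proof.
rewrite mk_eq0; last exact: cls_coherent; split=> [[N HN]|Hz].
  have := HN (N + m)%N (leq_addr _ _); rewrite leq_addl addnK [(N + m)%N]addnC.
  exact: evc_down.
by exists m => k mk; rewrite mk -{1}(subnKC mk); apply: evc_up.
Qed.

Lemma cls_up m s (z : X) : cls (m + s) (ktr (lev f s) z) = cls m z.
Proof.
apply: mk_eq; try exact: cls_coherent.
exists (m + s)%N => k mk; rewrite -[(_ - _) _]/((if (m + s <= k)%N then _ else _) - (if (m <= k)%N then _ else _)).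
rewrite mk (_ : (m <= k)%N); last lia.
by rewrite ktr_lev (_ : (s + (k - (m + s)) = k - m)%N) ?subrr; [exact: evc0|lia].
Qed.

Lemma cls0 m : cls m 0 = 0.
Proof. by apply/cls_eq0; apply: evc0. Qed.
Lemma clsD m (z z' : X) : cls m (z + z') = cls m z + cls m z'.
Proof. by rewrite -[z in LHS]scale1r clsP scale1r. Qed.
Lemma clsZ m a (z : X) : cls m (a *: z) = a *: cls m z.
Proof. by rewrite -[a *: z]addr0 clsP cls0 addr0. Qed.

Lemma dgerm_cls D m (z : X) : {morph D : a b / a + b} -> (forall a b, D (a * b) = D a * b + a * D b) ->
  dgerm D (cls m z) = cls m.+1 (dk f D m z).
Proof.
move=> DD DM; rewrite (dgermE DD DM); last exact: cls_coherent.
congr mk; apply/funext => -[|k] //=; rewrite ltnS subSS; case: ifP => mk; last exact: dk0.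
by rewrite -(dk_tr f DM) subnKC.
Qed.

End Colimit.

Section FewAnnihilators.
Variables (B : comNzRingType) (f : nat -> B) (t M n : nat) (y : 'I_M -> B) (x : 'I_n -> B).
Variable del : 'I_n -> B -> B.
Hypotheses (ysurj : forall b, exists F, mev y F = b)
  (delD : forall i, {morph del i : a b / a + b})
  (delM : forall i a b, del i (a * b) = del i a * b + a * del i b)
  (delx : forall i j, del i (x j) = (i == j)%:R)
  (dep : forall c : 'I_n.+1 -> B, exists a : {mpoly int[n.+1]}, a != 0 /\ mev c a = 0).
Local Notation X := (kx B^o t).
Local Notation Dg := (Bm 0 y).
Local Notation kdeg d := (kall (Dg d : B^o -> Prop)).
Local Notation dl := (fun i => dgerm (f := f) (t := t) (del i)).

Fixpoint wk m (w : seq 'I_n) (z : X) : X :=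
  if w is i :: w' then dk f (del i) (m + size w') (wk m w' z) else z.

Lemma cls_wk m w z : cls f (m + size w) (wk m w z) = word dl w (cls f m z).
Proof.
elim: w => [|i w IH] /=; first by rewrite addn0.
by rewrite -IH dgerm_cls // addnS.
Qed.

(** Rank against growth: [N] distinct primes give [N (k + 1) ^ n] cochains of one level, independent
    over the integers and of degree at most [D k + k], inside a space of rational rank at most
    [C ((D + 1) (k + 1)) ^ n 2 ^ t]. *)
Lemma few_annihilators : exists N, forall (Q : 'I_N -> set B) (m : 'I_N -> nat) (z : 'I_N -> X),
  (forall l, prime_ideal (Q l)) -> (forall l k, (0 < k)%N -> ~ Q l k%:R) ->
  (forall l r, Q l r <-> evc f (m l) (r *: z l)) -> ~ injective Q.
Proof.
have [c1 H1] := Dg_uniform ysurj (fun ij : 'I_n * 'I_M => del ij.1 (y ij.2)).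
have [c2 H2] := Dg_uniform ysurj (fun i : 'I_t => f i).
have [c3 H3] := Dg_uniform ysurj (fun ij : 'I_n * 'I_t => del ij.1 (f ij.2)).
have [c4 H4] := Dg_uniform ysurj x.
pose c := (c1 + c2 + c3 + c4)%N.
have [C HC] := growth y dep.
(* The slope of the degree in [k]: at most [n k] each of coordinates, derivations and transition
   steps, which cost [c], [(t + 1) c] and [t c]. *)
pose D := (n * (c + t.+1 * c + t * c))%N.
exists (C * D.+1 ^ n * 2 ^ t).+1 => Q m z HQ Q0 Qz Qinj.
set N := (_).+1 in Q m z HQ Q0 Qz Qinj *.
have Hdk i m' d (v : X) : kdeg d v -> kdeg (d + t.+1 * c) (dk f (del i) m' v).
  apply: kdeg_dk => //.
    by move=> j; apply: (@Bm_le _ _ _ _ c1); [rewrite /c; lia|apply: (H1 (i, j))].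
  move=> j jt; split.
    by apply: (@Bm_le _ _ _ _ c2); [rewrite /c; lia|apply: (H2 (Ordinal jt))].
  by apply: (@Bm_le _ _ _ _ c3); [rewrite /c; lia|apply: (H3 (i, Ordinal jt))].
have Htr s d (v : X) : kdeg d v -> kdeg (d + t * c * s) (ktr (lev f s) v).
  apply: kdeg_tr => j jt; apply: (@Bm_le _ _ _ _ c2); [rewrite /c; lia|apply: (H2 (Ordinal jt))].
have Hx (u : 'X_{1.. n}) : Dg (c * mdeg u) (mev x 'X_[u]).
  rewrite mev_monomial mdegE.
  elim/big_rec2: _ => [|i b d _ Hb].
    by rewrite muln0; have := @Bm_mon _ 0 _ y 0 0%MM; rewrite mdeg0 mmap11; apply.
  rewrite mulnDr; apply: BmM => //; apply: BmX.
  by apply: (@Bm_le _ _ _ _ c4); [rewrite /c; lia|apply: H4].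
have Hwk m' d w (v : X) : kdeg d v -> kdeg (d + t.+1 * c * size w) (wk m' w v).
  move=> Hv; elim: w => [|i w IH] /=; first by rewrite muln0 addn0.
  by rewrite mulnS [(_ + _ * size w)%N]addnC addnA; apply: Hdk.
pose m0 := (\max_l m l)%N; have mm0 l : (m l <= m0)%N by apply: (leq_bigmax (F := m)).
pose z0 l := ktr (lev f (m0 - m l)) (z l).
have Ez l : cls f m0 (z0 l) = cls f (m l) (z l).
  by rewrite -{1}(subnKC (mm0 l)) /z0 cls_up.
have /choice[E0 HE0] := fun l => kdeg_ex ysurj (z0 l).
(* [k] bounds the degrees of the given cochains and serves as the bound for exponents as well. *)
pose k := (\max_l E0 l)%N.
have HE l : kdeg k (z0 l) by apply: kdeg_le (HE0 l); apply: (leq_bigmax (F := E0)).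
have [Hc Hind] := @joint_independent B n del x (germ f t) dl
  (fun i => dgermD (@delD i) (@delM i)) (fun i => dgermZ (@delD i) (@delM i)) _ Q
  (fun l => cls f (m l) (z l)) delD delM delx HQ Q0
  (fun l r => iff_trans (Qz l r) (iff_trans (iff_sym (cls_eq0 f (m l) (r *: z l)))
     (eq_ind_r (fun h => h = 0 <-> _) (iff_refl _) (clsZ f (m l) r (z l))))) Qinj.
pose T := ('I_N * {ffun 'I_n -> 'I_k.+1})%type.
pose w (q : T) := won (Hc q.1) q.2.
pose u (q : T) : X := mev x 'X_[xoff (Hc q.1) q.2] *:
  ktr (lev f (n * k - size (w q))) (wk m0 (w q) (z0 q.1)).
have wn q : (size (w q) <= n * k)%N by apply: size_won.
have Hu q : kdeg (D * k + k) (u q).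
  apply: (@kdeg_le _ _ y (c * mdeg (xoff (Hc q.1) q.2) +
     (k + t.+1 * c * size (w q) + t * c * (n * k - size (w q))))).
    have := mdeg_xoff (Hc q.1) q.2; have := wn q; set a := mdeg _; set b := size _ => Hb Ha.
    have h1 : (c * a <= c * (n * k))%N by rewrite leq_mul2l Ha orbT.
    have h2 : (t.+1 * c * b <= t.+1 * c * (n * k))%N by rewrite leq_mul2l Hb orbT.
    have h3 : (t * c * (n * k - b) <= t * c * (n * k))%N by rewrite leq_mul2l leq_subr orbT.
    have -> : (D * k = c * (n * k) + t.+1 * c * (n * k) + t * c * (n * k))%N by rewrite /D; ring.
    by move: h1 h2 h3; lia.
  by apply: kdegZ => //; apply: Htr; apply: Hwk.
have Eu q : cls f (m0 + n * k) (u q) = ew x dl (Hc q.1) q.2 (cls f (m q.1) (z q.1)).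
  rewrite /u clsZ /ew; congr (_ *: _).
  rewrite -{1}(subnKC (wn q)) addnA cls_up cls_wk Ez //.
have [L [sL HL]] := HC (D * k + k)%N.
have [L' [sL' HL']] := growth_kx L t.
have LT : (size L' < #|{: T}|)%N.
  rewrite sL' card_prod card_ffun !card_ord.
  apply: (@leq_ltn_trans (C * (D.+1 * k.+1) ^ n * 2 ^ t)).
    rewrite leq_mul2r (leq_trans sL) ?orbT // leq_mul2l; apply/orP; right.
    have [->|n0] := posnP n; first by [].
    by rewrite leq_exp2r //; lia.
  rewrite expnMn mulSn; set b := (k.+1 ^ n)%N; set a := (D.+1 ^ n)%N.
  have -> : (C * (a * b) * 2 ^ t = C * a * 2 ^ t * b)%N by ring.
  by rewrite -[X in (X < _)%N]add0n ltn_add2r expn_gt0.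
have [|c' [[i ci] rel]] := qspan_relation (u := fun i => u (enum_val i)) _ LT.
  by move=> i; apply: HL'; apply: kall_imp (Hu (enum_val i)) => b; apply: Dg_qspan.
have : forall l ga, c' (enum_rank ((l, ga) : T)) = 0.
  apply: Hind; rewrite pair_bigA /=.
  have := congr1 (cls f (m0 + n * k)) rel; rewrite cls0.
  have clsMz (v : X) e : cls f (m0 + n * k) (v *~ e) = cls f (m0 + n * k) v *~ e.
    by rewrite -!scaler_int clsZ.
  have cls_sum (J : finType) (F : J -> X) : cls f (m0 + n * k) (\sum_j F j) = \sum_j cls f (m0 + n * k) (F j).
    by apply: (big_morph _ (@clsD _ _ _ _) (cls0 _ _ _)).
  rewrite cls_sum => E; rewrite (reindex (fun i : 'I_#|{: T}| => enum_val i)) /=; last first.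
    by exists enum_rank => q _; rewrite ?enum_valK ?enum_rankK.
  rewrite -[RHS]E; apply: eq_bigr => j _; rewrite clsMz Eu.
  by rewrite -[X in enum_rank X]/(_, _) -surjective_pairing enum_valK.
move/(_ (enum_val i).1 (enum_val i).2); rewrite -surjective_pairing enum_valK => c0.
by rewrite c0 eqxx in ci.
Qed.

End FewAnnihilators.

(** * Charts of smooth algebras *)

Section Charts.

Definition hasse (B : comNzRingType) (x : nat -> B) n := forall N j, (0 < N)%N ->
  exists (C : comNzRingType) (io ta : {rmorphism B -> C}) (T : C) (co : nat -> C -> B),
    [/\ T ^+ N = 0, forall c, c = \sum_(i < N) io (co i c) * T ^+ i,
        forall (b : nat -> B) a, (a < N)%N -> co a (\sum_(i < N) io (b i) * T ^+ i) = b a,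
        forall b, exists c, ta b = io b + T * c &
        forall i, (i < n)%N -> ta (x i) = io (x i) + (i == j)%:R * T].

(** [B] is the localization of [R] at [g], characterized rather than constructed. *)
Definition chart (R : comPzRingType) (g : R) (B : comNzRingType) (rho : {rmorphism R -> B}) (hi : B) :=
  [/\ hi * rho g = 1, forall b, exists k r, b = hi ^+ k * rho r &
      forall r, rho r = 0 -> exists k, g ^+ k * r = 0].

Definition analytic (B : comNzRingType) (x : nat -> B) n M (y : 'I_M -> B) :=
  [/\ hasse x n, forall p, prime p -> forall b, pform x n p b,
      forall p, prime p -> forall b b' : B, b ^+ p = p%:R * b' -> exists b'', b = p%:R * b'',
      forall b, exists F, mev y F = b &
      forall c : 'I_n.+1 -> B, exists a : {mpoly int[n.+1]}, a != 0 /\ mev c a = 0].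

Definition good (R : comPzRingType) (g : R) :=
  exists (B : comNzRingType) (rho : {rmorphism R -> B}) (hi : B), chart g rho hi /\
  exists n (x : nat -> B) M (y : 'I_M -> B), analytic x n y.

(** The Taylor map with [N = 2] has values in dual numbers; its coefficient of [T] is the
    derivation. *)
Lemma hasse_derivations (B : comNzRingType) (x : nat -> B) n : hasse x n ->
  exists del : 'I_n -> B -> B, [/\ forall i, {morph del i : a b / a + b},
    forall i a b, del i (a * b) = del i a * b + a * del i b &
    forall i j : 'I_n, del i (x j) = (i == j)%:R].
Proof.
move=> hs.
suff /choice[del Hd] : forall i : 'I_n, exists D : B -> B, [/\ {morph D : a b / a + b},
    forall a b, D (a * b) = D a * b + a * D b & forall j : 'I_n, D (x j) = (i == j)%:R].
  by exists del; split=> i; case: (Hd i).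
move=> i; have [C [io [ta [T [co [T2 Tc coE Hta tax]]]]]] := hs 2 i isT.
have coq u v : co 1%N (io u + io v * T) = v.
  have := coE (fun k => if k is 0 then u else v) 1%N isT.
  by rewrite !big_ord_recl big_ord0 /= expr0 mulr1 addr0 expr1.
have taE b : ta b = io b + io (co 1%N (ta b)) * T.
  have [c Ec] := Hta b; rewrite [in RHS]Ec; have := Tc c.
  rewrite !big_ord_recl big_ord0 /= expr0 mulr1 addr0 expr1 => E.
  have E' : T * c = io (co 0%N c) * T.
    by rewrite {1}E mulrDr mulrCA -expr2 T2 mulr0 addr0 mulrC.
  by rewrite Ec E' coq.
exists (fun b => co 1%N (ta b)); split=> [a b|a b|j].
- rewrite rmorphD (taE a) (taE b) !coq.
  have -> : io a + io (co 1%N (ta a)) * T + (io b + io (co 1%N (ta b)) * T) =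
    io (a + b) + io (co 1%N (ta a) + co 1%N (ta b)) * T by rewrite !rmorphD; ring.
  exact: coq.
- rewrite rmorphM (taE a) (taE b) !coq.
  have -> : (io a + io (co 1%N (ta a)) * T) * (io b + io (co 1%N (ta b)) * T) =
    io (a * b) + io (co 1%N (ta a) * b + a * co 1%N (ta b)) * T +
    io (co 1%N (ta a)) * io (co 1%N (ta b)) * T ^+ 2 by rewrite rmorphD !rmorphM; ring.
  by rewrite T2 mulr0 addr0 coq.
- rewrite (tax j (ltn_ord j)) -(rmorph_nat io) coq.
  by rewrite eq_sym.
Qed.

Variables (R : comPzRingType) (hR : smooth_Z R).
Variables (m : nat) (pi : {rmorphism {mpoly int[m]} -> R}).
Hypothesis pis : forall r, exists F, pi F = r.
Local Notation S := {mpoly int[m]}.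
Local Notation J := [set g | pi g = 0].

Lemma smooth_noetherian : noetherian R.
Proof. exact: noetherian_surj pis (@mpoly_int_noetherian m). Qed.

(** The [s] with [s r] divisible by [p] form an ideal, which no maximal ideal contains by the last
    clause of [local_structure]. *)
Lemma smooth_reduced p (r r' : R) : prime p -> r ^+ p = p%:R * r' -> exists r'', r = p%:R * r''.
Proof.
move=> pp E; pose I := [set s : R | exists u, s * r = p%:R * u].
have HI : ideal I.
  apply/idealP; split=> [|a b [u Eu] [v Ev]|a b [u Eu]]; first by exists 0; rewrite mul0r mulr0.
    by exists (u + v); rewrite mulrDl Eu Ev mulrDr.
  by exists (a * u); rewrite -mulrA Eu mulrCA.
have [[u]|nI] := EM (I 1); first by rewrite mul1r => ->; exists u.
have [Q MQ IQ] := maximal_over smooth_noetherian HI nI; have HQ := maximal_prime MQ.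
pose Q' := pi @^-1` Q.
have MQ' : maximal_ideal Q'.
  split; first exact: preimage_ideal (prime_idl HQ).
    by rewrite /Q' /preimage /= rmorph1; apply: prime_n1.
  move=> K HK sub nK; apply/seteqP; split=> [a Ka|]; last exact: sub.
  apply: contrapT => nQa; have [b Hb] := maximal_inv MQ nQa; have [c Ec] := pis b.
  apply: nK; have Kc : K (c * a - 1) by apply: sub; rewrite /Q' /preimage /= rmorphB rmorphM Ec rmorph1.
  by have := idealB HK (idealMl c HK Ka) Kc; rewrite opprB addrCA subrr addr0.
have JQ : J `<=` Q' by move=> a; rewrite /Q' /preimage /= => ->; apply: ideal0 (prime_idl HQ).
have [l [gs [ys [h [U [[pl Ql] _ _ _ [_ [_ red]]]]]]]] := local_structure hR pis MQ' JQ.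
have Qp : Q p%:R by apply: IQ; exists r.
have lp : l = p.
  apply/eqP; apply: contrapT => /negP lp; apply: (prime_n1 HQ).
  have cop : coprime l p by rewrite prime_coprime // dvdn_prime2.
  have IdQ := prime_idl HQ; rewrite /Q' /preimage /= rmorph_nat in Ql.
  have [u v Euv _] := egcdnP p (prime_gt0 pl); move: Euv; rewrite (eqP cop) => Euv.
  have := congr1 (fun k => k%:R : R) Euv; rewrite natrD !natrM => Euv'.
  have -> : 1 = u%:R * l%:R - v%:R * p%:R :> R by rewrite Euv' addrC addKr.
  by apply: (idealB IdQ); apply: (idealMl _ IdQ).
subst l; have [s Es] := pis r; have [s' Es'] := pis r'.
have [|h' [nh [a [i [Ji Ei]]]]] := red s.
  exists s', (s ^+ p - s' * p%:R); split; last by rewrite addrC subrK.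
  by rewrite /mkset rmorphB rmorphM rmorphXn rmorph_nat Es Es' E mulrC subrr.
case: nh; apply: IQ; exists (pi a); have := congr1 pi Ei.
by rewrite rmorphM rmorphD rmorphM rmorph_nat Es Ji addr0 [p%:R * _]mulrC.
Qed.

Lemma good_outside (Q : set S) : maximal_ideal Q -> J `<=` Q -> exists2 h, ~ Q h & good (pi h).
Proof.
move=> MQ JQ; have HQ := maximal_prime MQ; have IQ := prime_idl HQ.
have [l [gs [ys [h [U [_ gsJ [szm nQh] [UJ JU] [hJ _]]]]]]] := local_structure hR pis MQ JQ.
exists h => //; pose W := [set pi h].
(* If the localization were zero, a power of [h] would lie in [J], hence [h] in [Q]. *)
have [sub|] := EM ((1 : localization W) <> 0); last first.
  move/contrapT; rewrite -[1]/(@Defs.frac R W 1 (den1 W)) -[0]/(@Defs.frac R W 0 (den1 W)).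
  move/fracP => [u]; rewrite /= !mul0r !mulr1 subr0 mulr1.
  suff : forall u : denom W, exists k, val u = pi (h ^+ k).
    move=> /(_ u)[k ->] Ek; case: nQh; apply: (prime_expr HQ (n := k)); exact: JQ.
  apply: (denom_ind (P := fun x => exists k, x = pi (h ^+ k))).
  - by exists 0%N; rewrite expr0 rmorph1.
  - by move=> _ _ [a ->] [b ->]; exists (a + b)%N; rewrite exprD rmorphM.
  - by move=> _ ->; exists 1%N; rewrite expr1.
have [B [F [G [FG GF]]]] := comNzRing_of sub.
pose rho : {rmorphism R -> B} := F \o to_loc W.
have WP : forall u : denom W, exists k, val u = pi h ^+ k.
  apply: (denom_ind (P := fun x => exists k, x = pi h ^+ k)).
  - by exists 0%N; rewrite expr0.
  - by move=> _ _ [a ->] [b ->]; exists (a + b)%N; rewrite exprD.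
  - by move=> _ ->; exists 1%N; rewrite expr1.
have Wh : submonoid_gen W (pi h) by move=> V [_ _] sub'; apply: sub'.
pose hi : B := F (@Defs.frac R W 1 (exist _ (pi h) (asboolT Wh))).
have hK : hi * rho (pi h) = 1.
  by rewrite /hi /rho /= -rmorphM (frac_unit (exist _ (pi h) (asboolT Wh))) rmorph1.
have hKn k : hi ^+ k * rho (pi h) ^+ k = 1 by rewrite -exprMn hK expr1n.
have dens b : exists k r, b = hi ^+ k * rho r.
  rewrite -[b]GF; move: (G b); apply: frac_ind => a u.
  have [k Ek] := WP u; exists k, a.
  have := congr1 F (@frac_lift R W a u); rewrite Ek rmorphM !rmorphXn /= => E.
  rewrite /rho /= -E mulrCA -[F _ ^+ k]/(rho (pi h) ^+ k) hKn mulr1 //.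
have kers r : rho r = 0 -> exists k, pi h ^+ k * r = 0.
  rewrite /rho /= => E; have : to_loc W r = 0 by rewrite -[LHS]FG E rmorph0.
  rewrite -[0]/(@Defs.frac R W 0 (den1 W)) => /fracP[u]; rewrite /= mul0r mulr1 subr0.
  by have [k ->] := WP u; exists k.
exists B, rho, hi; split; first by split.
pose th : {rmorphism S -> B} := rho \o pi.
have hK' : hi * th h = 1 by [].
have gs0 g : g \in gs -> th g = 0 by move=> /gsJ E; rewrite /th /= E rmorph0.
have densS b : exists k s, b = hi ^+ k * th s.
  by have [k [r ->]] := dens b; have [s <-] := pis r; exists k, s.
have kersS s : th s = 0 -> exists k, ideal_gen [set` gs] (h ^+ k * s).
  move=> /kers[k Ek]; exists k.+1; rewrite exprS -mulrA; apply: hJ.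
  by rewrite /mkset rmorphM rmorphXn.
exists (size ys), (chart_coord th ys).
have gen := chart_generates densS.
exists (size (hi :: [seq th 'X_i | i <- enum 'I_m])), (fun i => nth 0 (hi :: [seq th 'X_i | i <- enum 'I_m]) i).
split.
- by move=> N j; apply: (chart_hs hK' szm JU gs0 densS kersS).
- by move=> p pp; apply: (chart_pform hK' szm UJ gs0 densS pp).
- move=> p pp b b'; have [k [r ->]] := dens b; have [k' [r' ->]] := dens b' => E.
  have [e Ee] : exists e, pi h ^+ e * (pi h ^+ k' * r ^+ p - p%:R * (pi h ^+ (k * p) * r')) = 0.
    apply: kers; rewrite rmorphB !rmorphM rmorph_nat !rmorphXn.
    have := congr1 (fun c => rho (pi h) ^+ k' * rho (pi h) ^+ (k * p) * c) E.
    rewrite exprMn -exprM => E'; apply/eqP; rewrite subr_eq0; apply/eqP.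
    transitivity (rho (pi h) ^+ k' * rho (pi h) ^+ (k * p) * (hi ^+ (k * p) * rho r ^+ p)).
      by rewrite -[LHS]mul1r -(hKn (k * p)%N); ring.
    rewrite E'; transitivity (p%:R * (rho (pi h) ^+ (k * p) * rho r') * (hi ^+ k' * rho (pi h) ^+ k')); last first.
      by rewrite hKn mulr1.
    by ring.
  have [|r'' Er] := @smooth_reduced p (pi h ^+ (e + k') * r)
      (pi h ^+ ((e + k') * p.-1) * (pi h ^+ e * (pi h ^+ (k * p) * r'))) pp.
    have Ep : p = p.-1.+1 by rewrite prednK // prime_gt0.
    rewrite exprMn -exprM {1}Ep mulnS [(_ + _ * p.-1)%N]addnC !exprD -!mulrA.
    have -> : pi h ^+ e * (pi h ^+ k' * r ^+ p) = p%:R * (pi h ^+ e * (pi h ^+ (k * p) * r')).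
      by apply/eqP; rewrite -subr_eq0 -[X in _ == X]Ee; apply/eqP; ring.
    by ring.
  exists (hi ^+ (k + (e + k')) * rho r''); rewrite mulrCA -(rmorph_nat rho) -rmorphM -Er.
  by rewrite rmorphM rmorphXn exprD -[LHS]mulr1 -(hKn (e + k')%N); ring.
- move=> b; apply: (gen [set b | exists F, mev (fun i : 'I_(size _) => nth 0 (hi :: [seq th 'X_i | i <- enum 'I_m]) i) F = b]).
    split=> [|a c [F1 <-] [F2 <-]|a c [F1 <-] [F2 <-]].
    + by exists 1; rewrite rmorph1.
    + by exists (F1 - F2); rewrite rmorphB.
    + by exists (F1 * F2); rewrite rmorphM.
  move=> y /(nthP 0)[i iy <-]; exists 'X_(Ordinal iy); exact: mevX.
- move=> c; have [a [a0 Ha]] := chart_dependent hK' szm UJ gs0 densS (fun i => c (inord i)).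
  exists a; split=> //; rewrite -[RHS]Ha; congr (mev _ _); apply/funext => i.
  by rewrite inord_val.
Qed.

(** Quasi-compactness: by [good_outside] no maximal ideal contains all good elements, so finitely
    many of them generate the unit ideal. *)
Lemma good_cover : exists gs : seq R, (forall g, g \in gs -> good g) /\
  forall Q, prime_ideal Q -> exists2 g, g \in gs & ~ Q g.
Proof.
pose I := [set x | exists gs : seq R, (forall g, g \in gs -> good g) /\ ideal_gen [set` gs] x].
have gsub (s s' : seq R) x : {subset s <= s'} -> ideal_gen [set` s] x -> ideal_gen [set` s'] x.
  move=> ss; apply: (ideal_gen_min (ideal_gen_ideal _)) => y ys; apply: sub_ideal_gen; exact: ss.
have HI : ideal I.
  apply/idealP; split=> [|x x' [s [Hs sx]] [s' [Hs' sx']]|r x [s [Hs sx]]].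
  - by exists [::]; split=> //; apply: (ideal0 (ideal_gen_ideal _)).
  - exists (s ++ s'); split; first by move=> g; rewrite mem_cat => /orP[/Hs|/Hs'].
    by apply: (idealD (ideal_gen_ideal _)); [apply: gsub sx|apply: gsub sx'] => g gs;
      rewrite mem_cat gs ?orbT.
  - by exists s; split=> //; apply: (idealMl _ (ideal_gen_ideal _)).
suff [gs [Hgs gs1]] : I 1.
  exists gs; split=> // Q HQ; apply: contrapT => H; apply: (prime_n1 HQ).
  apply: (ideal_gen_min (prime_idl HQ)) gs1 => g gs'; apply: contrapT => nQ.
  by apply: H; exists g.
apply: contrapT => nI; have [Q MQ IQ] := maximal_over smooth_noetherian HI nI; have HQ := maximal_prime MQ.
have MQ' : maximal_ideal (pi @^-1` Q).
  split; first exact: preimage_ideal (prime_idl HQ).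
    by rewrite /preimage /= rmorph1; apply: prime_n1.
  move=> K HK sub nK; apply/seteqP; split=> [a Ka|]; last exact: sub.
  apply: contrapT => nQa; have [b Hb] := maximal_inv MQ nQa; have [c Ec] := pis b.
  apply: nK; have Kc : K (c * a - 1) by apply: sub; rewrite /preimage /= rmorphB rmorphM Ec rmorph1.
  by have := idealB HK (idealMl c HK Ka) Kc; rewrite opprB addrCA subrr addr0.
have [|h nh gh] := good_outside MQ'.
  by move=> a; rewrite /preimage /= => ->; apply: ideal0 (prime_idl HQ).
case: nh; apply: IQ; exists [:: pi h]; split; first by move=> g; rewrite inE => /eqP ->.
by apply: sub_ideal_gen; rewrite /= inE.
Qed.

End Charts.

Section ChartTransfer.
Variables (R : comPzRingType) (g : R) (B : comNzRingType) (rho : {rmorphism R -> B}) (hi : B).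
Hypothesis Hch : chart g rho hi.
Variables (f : nat -> R) (t : nat).
Local Notation f' := (fun i => rho (f i)).
Local Notation K := (kmap (M := R^o) (M' := B^o) rho).

Let hK : hi * rho g = 1. Proof. by case: Hch. Qed.
Let dens b : exists k r, b = hi ^+ k * rho r. Proof. by case: Hch. Qed.
Let kers r : rho r = 0 -> exists k, g ^+ k * r = 0. Proof. by case: Hch => _ _; apply. Qed.
Let hKn k : hi ^+ k * rho g ^+ k = 1. Proof. by rewrite -exprMn hK expr1n. Qed.

Lemma K_kd m u (x : kx R^o u) : K (kd (lev f m) x) = kd (lev f' m) (K x).
Proof.
apply: kmap_kd => [a b|i a]; first exact: rmorphB.
by rewrite /lev /GRing.scale /= rmorphM rmorphXn.
Qed.

Lemma K_tr m u (x : kx R^o u) : K (ktr (lev f m) x) = ktr (lev f' m) (K x).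
Proof. by apply: kmap_tr => i a; rewrite /lev /GRing.scale /= rmorphM rmorphXn. Qed.

Lemma KZ u r (x : kx R^o u) : K (r *: x) = rho r *: K x.
Proof.
by elim: u x => [|u IH] x; [exact: (rmorphM rho)|apply: pair_eq; apply: IH].
Qed.

Lemma KB u (x y : kx R^o u) : K (x - y) = K x - K y.
Proof.
by elim: u x y => [|u IH] x y; [exact: (rmorphB rho)|apply: pair_eq; apply: IH].
Qed.

Lemma KD u (x y : kx R^o u) : K (x + y) = K x + K y.
Proof. by apply: kmapD => a b; apply: rmorphD. Qed.

Lemma K_proj d u (x : kx R^o u) : K (kproj d x) = kproj d (K x).
Proof. by apply: kmap_proj; apply: (rmorph0 rho). Qed.

Lemma hi_scale (k : nat) u (x : kx R^o u) : hi ^+ k *: K (g ^+ k *: x) = K x.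
Proof. by rewrite KZ scalerA rmorphXn hKn scale1r. Qed.

Lemma K_dens u (w : kx B^o u) : exists k x, w = hi ^+ k *: K x.
Proof.
elim: u w => [|u IH] w; first by have [k [r ->]] := dens w; exists k, r.
have [k [x Ex]] := IH w.1; have [l [y Ey]] := IH w.2.
exists (k + l)%N, (g ^+ l *: x, g ^+ k *: y); apply: pair_eq.
  by rewrite Ex exprD -scalerA; congr (_ *: _); rewrite -[LHS](hi_scale l).
by rewrite Ey exprD mulrC -scalerA; congr (_ *: _); rewrite -[LHS](hi_scale k).
Qed.

Lemma K_kers u (x : kx R^o u) : K x = 0 -> exists k, g ^+ k *: x = 0.
Proof.
elim: u x => [|u IH] x; first exact: kers.
move=> E; have [k Ek] := IH x.1 (congr1 fst E); have [l El] := IH x.2 (congr1 snd E).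
exists (k + l)%N; apply: pair_eq.
  by rewrite exprD mulrC -[RHS](scaler0 _ (g ^+ l)) -Ek scalerA.
by rewrite exprD -[RHS](scaler0 _ (g ^+ k)) -El scalerA.
Qed.

Lemma K_evc m (x : kx R^o t) : evc f' m (K x) <-> exists k, evc f m (g ^+ k *: x).
Proof.
split=> [[s [w E]]|[k [s [w E]]]]; last first.
  exists s, (hi ^+ k *: K w).
  by rewrite kdZ -K_kd -E K_tr -ktrZ -[in LHS](hi_scale k).
have [k [y Ey]] := K_dens w.
have [e Ee] : exists e, g ^+ e *: (g ^+ k *: ktr (lev f s) x - kd (lev f (m + s)) y) = 0.
  apply: K_kers; rewrite KB KZ K_tr E Ey kdZ -K_kd scalerA rmorphXn mulrC hKn scale1r subrr //.
exists (e + k)%N, s, (g ^+ e *: y); rewrite kdZ exprD -scalerA ktrZ ktrZ.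
by apply/eqP; rewrite -subr_eq0 -scalerBr Ee.
Qed.

Lemma chart_torsionfree p : (forall r : R, p%:R * r = 0 -> r = 0) -> forall b : B, p%:R * b = 0 -> b = 0.
Proof.
move=> tf b E; have [k [r Eb]] := dens b.
have [e Ee] : exists e, g ^+ e * (p%:R * r) = 0.
  apply: kers; rewrite rmorphM rmorph_nat.
  have -> : p%:R * rho r = rho g ^+ k * (p%:R * b).
    by rewrite Eb -[LHS]mulr1 -(hKn k); ring.
  by rewrite E mulr0.
have Er : g ^+ e * r = 0 by apply: tf; rewrite mulrCA.
by rewrite Eb -[rho r]mul1r -(hKn e) -mulrA -rmorphXn -rmorphM Er rmorph0 !mulr0.
Qed.

Lemma chart_lift p d :
  (forall y : kx R^o t, kproj d y = y -> kcong p (kd (lev f 1) y) 0 -> liftable f p 1 y) ->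
  forall v : kx B^o t, kproj d v = v -> kcong p (kd (lev f' 1) v) 0 -> InIm f' p 1 v.
Proof.
move=> H v dv [z Ez]; have [a [y0 Ev]] := K_dens v; pose y := kproj d y0.
have {dv}Ev : v = hi ^+ a *: K y by rewrite -dv Ev kprojZ -K_proj.
have [b [z0 Ez0]] := K_dens z.
have [e Ee] : exists e, g ^+ e *: (g ^+ b *: kd (lev f 1) y - p%:R *: (g ^+ a *: z0)) = 0.
  apply: K_kers; rewrite KB !KZ K_kd !rmorphXn rmorph_nat.
  have -> : kd (lev f' 1) (K y) = rho g ^+ a *: (p%:R *: z).
    by rewrite -[p%:R *: z]add0r -Ez Ev kdZ scalerA mulrC hKn scale1r.
  rewrite Ez0 !scalerA; apply/eqP; rewrite subr_eq0; apply/eqP; congr (_ *: _).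
  by rewrite -[RHS]mulr1 -(hKn b); ring.
have [u [w [cu Eu]]] : liftable f p 1 (g ^+ (e + b) *: y).
  apply: H; first by rewrite kprojZ kprojK.
  exists (g ^+ e *: (g ^+ a *: z0)); rewrite add0r kdZ exprD -scalerA.
  by rewrite [p%:R *: _]scalerA mulrC -[in RHS]scalerA; apply/eqP; rewrite -subr_eq0 -scalerBr Ee.
apply: ev_K; exists (hi ^+ (a + (e + b)) *: K u), (hi ^+ (a + (e + b)) *: K w); split.
  by rewrite kdZ -K_kd cu; have := KZ 0 (0 : kx R^o t); rewrite scale0r rmorph0 scale0r => ->; rewrite scaler0.
rewrite scalerA [p%:R * _]mulrC -scalerA -scalerDr -(rmorph_nat rho) -KZ -KD -Eu.
by rewrite exprD -scalerA hi_scale.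
Qed.

End ChartTransfer.

Lemma torsionfree_kx (R : comPzRingType) p t : (forall r : R, p%:R * r = 0 -> r = 0) ->
  forall x : kx R^o t, p%:R *: x = 0 -> x = 0.
Proof.
move=> tf; elim: t => [|t IH] x; first exact: tf.
by move=> E; apply: pair_eq; apply: IH; [exact: (congr1 fst E)|exact: (congr1 snd E)].
Qed.

(* A class killed by [p] is the image of the connecting map of multiplication by [p]; its
   multiples vanish exactly when the corresponding classes modulo [p] lift. *)
Lemma evc_InIm (B : comPzRingType) (f : nat -> B) t p m s (x w : kx B^o t) :
  (forall b : B, p%:R * b = 0 -> b = 0) ->
  ktr (lev f s) (p%:R *: x) = kd (lev f (m + s)) w ->
  forall b, evc f m (b *: x) <-> InIm f p (m + s) (b *: w).
Proof.
move=> tf E b; have Eb : ktr (lev f s) (p%:R *: (b *: x)) = kd (lev f (m + s)) (b *: w).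
  by rewrite kdZ -E -ktrZ !scalerA mulrC.
split=> [[s' [u Eu]]|[s2 [w2 [z2 [[u [v [cu Ez]]] E2]]]]].
  apply: (@InIm_down _ _ _ _ _ s'); apply: ev_K.
  exists (ktr (lev f s') (b *: w) - p%:R *: ktr (lev f s) u), (ktr (lev f s) u).
  split; last by rewrite subrK.
  rewrite kdB lev_tr -Eb kdZ addnAC lev_tr -Eu !ktrZ !ktr_lev [(s' + s)%N]addnC.
  by rewrite !scalerA subrr.
exists (s + s2)%N, v; rewrite addnA; apply/eqP; rewrite -subr_eq0; apply/eqP.
apply: (torsionfree_kx tf); rewrite scalerBr -ktr_lev -!ktrZ Eb -lev_tr E2 kdD kdK add0r.
by rewrite Ez kdD cu add0r kdZ subrr.
Qed.

(** * Reduction of [p]-torsion to level one *)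

Section Criterion.
Variables (R : comPzRingType) (hR : smooth_Z R) (f : nat -> R) (t : nat).

Lemma smooth_presentation : exists m (pi : {rmorphism {mpoly int[m]} -> R}), forall r, exists F, pi F = r.
Proof. by case: hR => -[m [pi [_ pis _]]] _ _; exists m, pi. Qed.

(** The core of the first assertion. If the class of [x] were nonzero, its annihilator would lie in
    a maximal ideal, which misses some chart element [g]. On that chart [all_lift] makes the class
    modulo [p] of [w] lift, so a power of [g] annihilates [x], a contradiction. *)
Lemma nzd_criterion p k : prime p ->
  (forall x : kx R^o t, kproj k.+1 x = x -> kd (lev f 1) x = 0 ->
     (exists w, p%:R *: x = kd (lev f 1) w) -> exists v, x = kd (lev f 1) v) ->
  forall m (x : kx R^o t), kproj k.+1 x = x -> evc f m (p%:R *: x) -> evc f m x.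
Proof.
move=> pp H m x dx [s0 [w0 E0]].
have tf (r : R) := smooth_torsionfree hR pp (r := r).
have [mm [pi pis]] := smooth_presentation.
(* One extra transition makes the level [m + s] positive, as [all_lift] requires; [kproj k] keeps
   the part of [w0] that bounds the component of degree [k]. *)
pose s := s0.+1; pose w := kproj k (ktr (lev f 1) w0).
have E : ktr (lev f s) (p%:R *: x) = kd (lev f (m + s)) w.
  rewrite /w kproj_kd /s -addn1 addnA lev_tr -E0 ktr_lev addn1 -kproj_tr kprojZ dx //.
(* If [kd y = p z], then [z] is a cocycle and [p z] a coboundary; by hypothesis [z = kd v], and
   [y - p v] is the lift. *)
have Hlift (y : kx R^o t) : kproj k y = y -> kcong p (kd (lev f 1) y) 0 -> liftable f p 1 y.
  move=> dy [z]; rewrite add0r => Ez.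
  have z0 : kd (lev f 1) z = 0.
    by apply: (torsionfree_kx tf); rewrite -kdZ -Ez kdK.
  have dz : kproj k.+1 z = z.
    apply/eqP; rewrite -subr_eq0; apply/eqP; apply: (torsionfree_kx tf).
    by rewrite scalerBr -kprojZ -Ez -kproj_kd dy subrr.
  have [|v Ev] := H z dz z0; first by exists y.
  by exists (y - p%:R *: v), v; rewrite kdB kdZ Ez -Ev subrr subrK.
apply: contrapT => nx.
pose I := [set r : R | evc f m (r *: x)].
have HI : ideal I.
  apply/idealP; split=> [|a b Ha Hb|a b Hb]; rewrite /I /mkset.
  - by rewrite scale0r; apply: evc0.
  - by rewrite scalerDl; apply: evcD.
  - by rewrite -scalerA; apply: evcZ.
have nI : ~ I 1 by rewrite /I /mkset scale1r.
have [Q MQ IQ] := maximal_over (smooth_noetherian pis) HI nI; have HQ := maximal_prime MQ.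
have [gs [Hgs cov]] := good_cover hR pis; have [g ggs nQg] := cov Q HQ.
have [B [rho [hi [Hch [n [xx [M [y [hs pf red ysurj dep]]]]]]]]] := Hgs g ggs.
pose f' i := rho (f i); pose pf' := pf p pp.
have /choice[df dfP] := fun i => Bm_ex p ysurj (f' i).
have [C rtC] := rt_gauge f' pp hs pf' (red p pp) ysurj.
have HB := chart_lift Hch (f := f) Hlift.
have tfB := chart_torsionfree Hch tf.
pose K (u : kx R^o t) : kx B^o t := kmap (M := R^o) (M' := B^o) rho u.
have EB : ktr (lev f' s) (p%:R *: K x) = kd (lev f' (m + s)) (K w).
  by rewrite /K -(K_kd rho) -E (K_tr rho) KZ rmorph_nat.
have : InIm f' p (m + s) (K w).
  apply: (all_lift pp hs (pf := pf') (red p pp) ysurj dfP rtC HB); first by rewrite /s; lia.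
    by rewrite /K -K_proj /w kprojK.
  by exists (ktr (lev f' s) (K x)); rewrite add0r -EB ktrZ.
rewrite -[K w]scale1r; move/(evc_InIm tfB EB 1); rewrite scale1r => /(K_evc Hch)[e He].
by case: nQg; apply: (prime_expr HQ (n := e)); apply: IQ.
Qed.

End Criterion.

(** * Associated primes *)

Lemma finite_of_repetition (T : choiceType) (A : set T) N :
  (forall q : 'I_N -> T, (forall i, A (q i)) -> ~ injective q) -> finite_set A.
Proof.
move=> H; apply: contrapT => /(infinite_set_fset N)[D DA sD].
have [N0|N0] := posnP N; first by subst N; case: (H (fun i => match notF (ltn_ord i) with end)) => [[]|[]].
have [x0 x0D] : exists x0, x0 \in D.
  by case: (fset_0Vmem D) => [E|[x xD]]; [move: sD; rewrite E cardfs0; lia|exists x].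
case: (H (fun i => nth x0 (enum_fset D) i)) => [i|i j /eqP].
  by apply: DA; rewrite /= mem_nth // (leq_trans _ sD).
by rewrite nth_uniq ?fset_uniq ?(leq_trans (ltn_ord _) sD) // => /eqP/val_inj.
Qed.

Section AssociatedPrimes.
Variables (R : comPzRingType) (hR : smooth_Z R) (f : nat -> R) (t : nat).

Definition annihilates (P : set R) m (x : kx R^o t) := forall r, P r <-> evc f m (r *: x).

(** On the chart the annihilator is the extension of [P]: a power of [g] can be cancelled, as [g] is
    outside [P]. *)
Lemma chart_annihilator g (B : comNzRingType) (rho : {rmorphism R -> B}) hi P m x :
  chart g rho hi -> prime_ideal P -> ~ P g -> annihilates P m x ->
  let Q := [set b | evc (fun i => rho (f i)) m (b *: kmap (M := R^o) (M' := B^o) rho x)] in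
  prime_ideal Q /\ forall r, Q (rho r) <-> P r.
Proof.
move=> Hch HP nPg HPx Q; have [hK dens kers] := Hch.
have QP r : Q (rho r) <-> P r.
  rewrite /Q /mkset -KZ; split=> [/(K_evc Hch)[k]|Pr].
    rewrite scalerA => /HPx; have [_ _ HPM] := HP; case/HPM => // Pk.
    by case: nPg; apply: (prime_expr HP (n := k)).
  by apply/(K_evc Hch); exists 0%N; rewrite expr0 scale1r; apply/HPx.
have IQ : ideal Q.
  apply/idealP; split=> [|a b Ha Hb|a b Hb]; rewrite /Q /mkset.
  - by rewrite scale0r; apply: evc0.
  - by rewrite scalerDl; apply: evcD.
  - by rewrite -scalerA; apply: evcZ.
split=> //; split=> //.
  by rewrite -(rmorph1 rho) => /QP; apply: prime_n1.
move=> b c; have [k [r ->]] := dens b; have [l [s ->]] := dens c => Qbc.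
have : Q (rho (r * s)).
  have -> : rho (r * s) = rho g ^+ (k + l) * (hi ^+ k * rho r * (hi ^+ l * rho s)).
    rewrite rmorphM -[LHS]mul1r -[X in X * _](expr1n _ (k + l)) -hK exprMn !exprD; ring.
  exact: idealMl.
move/QP; case: HP => _ _ HPM; case/HPM => /QP H; [left|right]; exact: idealMl.
Qed.

Lemma finite_annihilators0 g : good g ->
  finite_set [set P | [/\ prime_ideal P, ~ P g, forall k, (0 < k)%N -> ~ P k%:R &
    exists m x, annihilates P m x]].
Proof.
move=> [B [rho [hi [Hch [n [xx [M [y [hs pf red ysurj dep]]]]]]]]].
have [del [delD delM delx]] := hasse_derivations hs.
have [N HN] := few_annihilators (fun i => rho (f i)) t ysurj delD delM delx dep.
apply: (finite_of_repetition (N := N)) => q Hq.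
have /choice[m /choice[x Hx]] : forall i, exists m, exists x, annihilates (q i) m x.
  by move=> i; case: (Hq i).
pose Q i := [set b | evc (fun i => rho (f i)) (m i) (b *: kmap (M := R^o) (M' := B^o) rho (x i))].
have HQ i : prime_ideal (Q i) /\ forall r, Q i (rho r) <-> q i r.
  by have [Hp ng _ _] := Hq i; apply: (chart_annihilator Hch Hp ng (Hx i)).
move=> qinj; apply: (HN Q m (fun i => kmap (M := R^o) (M' := B^o) rho (x i))).
- by move=> i; case: (HQ i).
- by move=> i k k0; rewrite -(rmorph_nat rho) => /(HQ i).2; have [_ _ H _] := Hq i; apply: H.
- by [].
- move=> i j E; apply: qinj; apply/seteqP; split=> r.
    by move/(HQ i).2; rewrite E => /(HQ j).2.
  by move/(HQ j).2; rewrite -E => /(HQ i).2.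
Qed.

Lemma finite_annihilators_p p g : prime p -> good g ->
  finite_set [set P | [/\ prime_ideal P, ~ P g, P p%:R & exists m x, annihilates P m x]].
Proof.
move=> pp [B [rho [hi [Hch [n [xx [M [y [hs pf red ysurj dep]]]]]]]]].
pose f' i := rho (f i); pose pf' := pf p pp.
have /choice[df dfP] := fun i => Bm_ex p ysurj (f' i).
have [C rtC] := rt_gauge f' pp hs pf' (red p pp) ysurj.
have [Vs HVs] := prime_annihilators t pp hs (pf := pf') (red p pp) ysurj dfP rtC.
have tfB := chart_torsionfree Hch (fun r => smooth_torsionfree hR pp (r := r)).
apply: (finite_of_repetition (N := (size Vs).+1)) => q Hq qinj.
have /choice[Q HQ] : forall i, exists Q : set B, (forall r, Q (rho r) <-> q i r) /\
    exists k0, forall k, (k0 <= k)%N -> exists2 w, w \in Vs & Q = [set r | St f' p k 1 (r *: w)].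
  move=> i; have [Hp ng Pp [m [x Hx]]] := Hq i.
  have [HQ QP] := chart_annihilator Hch Hp ng Hx.
  exists [set b | evc f' m (b *: kmap (M := R^o) (M' := B^o) rho x)]; split=> //.
  have [s [w E]] : evc f' m (p%:R *: kmap (M := R^o) (M' := B^o) rho x).
    by rewrite -(rmorph_nat rho); apply/QP.
  have E1 : ktr (lev f' s.+1) (p%:R *: kmap (M := R^o) (M' := B^o) rho x) =
      kd (lev f' (m + s.+1)) (ktr (lev f' 1) w).
    by rewrite -addn1 addnA lev_tr -E ktr_lev.
  apply: (HVs (m + s.+1)%N (ktr (lev f' 1) w)) => //; first by lia.
  exact: (evc_InIm tfB E1).
have /choice[k0 Hk0] := fun i => (HQ i).2.
(* For this common [k], each prime is determined by its element of [Vs]. *)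
pose k := (\max_i k0 i)%N.
have /choice[w Hw] : forall i, exists w, w \in Vs /\ Q i = [set r | St f' p k 1 (r *: w)].
  by move=> i; have [|w wV Ew] := Hk0 i k; [apply: (leq_bigmax (F := k0))|exists w].
have winj : injective w.
  move=> i j Eij; have EQ : Q i = Q j by rewrite (Hw i).2 (Hw j).2 Eij.
  apply: qinj; apply/seteqP; split=> r.
    by move/(HQ i).1; rewrite EQ => /(HQ j).1.
  by move/(HQ j).1; rewrite -EQ => /(HQ i).1.
have wu : uniq [seq w i | i <- enum 'I_(size Vs).+1] by rewrite map_inj_uniq ?enum_uniq.
have := @uniq_leq_size _ _ Vs wu; rewrite size_map size_enum_ord ltnn => H.
by apply: notF; apply: H => _ /mapP[i _ ->]; case: (Hw i).
Qed.

End AssociatedPrimes.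

Theorem theorem3p1 (R : comPzRingType) (hR : smooth_Z R)
    (t : nat) (f : t.-tuple R) (a : set R) (ha : a = ideal_gen [set` f])
    (k : nat) (I : injective_resolution R^o) :
  [/\ forall p : nat, prime p ->
        nonzerodivisor (cohomology (koszul f) k) (p%:R : R) ->
        nonzerodivisor (local_cohomology a I k) (p%:R : R),
      finite_set [set p : nat |
        prime p /\ ~ nonzerodivisor (local_cohomology a I k) (p%:R : R)]
    & finite_set (associated_primes (local_cohomology a I k))].
Proof.
have [mm [pi pis]] := smooth_presentation hR; have noeR := smooth_noetherian pis.
pose F := kgens f; pose n := size f.
have ha' : a = ideal_gen [set x | exists i, (i < n)%N /\ x = F i].
  rewrite ha; congr ideal_gen; apply/seteqP; split=> x /=.
    rewrite -mem_rev => /(nthP 0)[i]; rewrite size_rev => iN <-; by exists i.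
  by move=> [i [iN ->]]; rewrite -mem_rev /F /kgens mem_nth // size_rev.
have repr := local_cohomology_repr noeR ha' (I := I) (k := k).
have crit p : prime p -> (forall x : kx R^o n, kproj k.+1 x = x -> kd F x = 0 ->
     (exists w, p%:R *: x = kd F w) -> exists v, x = kd F v) ->
    nonzerodivisor (local_cohomology a I k) (p%:R : R).
  move=> pp H u v E; apply/eqP; rewrite -subr_eq0; apply/eqP.
  have [m [x [dx _ Hx]]] := repr (u - v).
  rewrite -[u - v]scale1r; apply/Hx; rewrite scale1r.
  apply: (nzd_criterion hR pp H dx); apply/Hx.
  by rewrite scalerBr; apply/eqP; rewrite subr_eq0; apply/eqP.
(* Beyond [N] the condition of [crit] on Koszul cochains holds for every prime number. *)
have [N HN] := bounded_torsion noeR F n.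
have big p : prime p -> (N < p)%N -> nonzerodivisor (local_cohomology a I k) (p%:R : R).
  by move=> pp Np; apply: crit => // x _ _ [w E]; apply: (HN p x w).
split.
- by move=> p pp nz; apply: crit => // x; apply: koszul_nzd.
- apply: (sub_finite_set _ (finite_II N.+1)) => p /= [pp nz]; rewrite ltnS leqNgt.
  by apply/negP => Np; apply: nz; apply: big.
have [gs [Hgs cov]] := good_cover hR pis.
pose A0 g := [set P : set R | [/\ prime_ideal P, ~ P g, forall k, (0 < k)%N -> ~ P k%:R &
    exists m x, annihilates F (t := n) P m x]].
pose Ap g p := [set P : set R | prime p /\ [/\ prime_ideal P, ~ P g, P p%:R &
    exists m x, annihilates F (t := n) P m x]].
apply: (sub_finite_set (B := \bigcup_(g in [set` gs]) (A0 g `|` \bigcup_(p in `I_N.+1) Ap g p))).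
  move=> P [HP [z EP]]; have [g ggs nPg] := cov P HP; exists g => //.
  have [m [x [_ _ Hx]]] := repr z.
  have Hax : annihilates F (t := n) P m x by move=> r; rewrite -Hx EP.
  (* A prime [P] containing a positive integer contains a prime number, which is a zerodivisor on
     the module and so at most [N]. *)
  have [[j [j0 Pj]]|nP] := EM (exists j, (0 < j)%N /\ P j%:R); last first.
    by left; split=> //; [move=> j j0 Pj; apply: nP; exists j|exists m, x].
  have [p [pp Pp]] : exists p, prime p /\ P p%:R.
    elim/ltn_ind: j j0 Pj => j IH j0 Pj; have [j1|j1] := leqP j 1.
      have E : j = 1%N by lia.
      by case: (prime_n1 HP); rewrite E in Pj.
    have pj := pdiv_prime j1; have dj := pdiv_dvd j.
    move: Pj; rewrite -(divnK dj) natrM; case: HP => _ _ HPM; case/HPM; last by exists (pdiv j).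
    apply: IH; last by rewrite divn_gt0 ?prime_gt0 // dvdn_leq.
    by rewrite ltn_Pdiv // prime_gt1.
  right; exists p; last by split=> //; split=> //; exists m, x.
  rewrite /= ltnS leqNgt; apply/negP => Np; have := big p pp Np.
  move=> /(_ z 0); rewrite scaler0 => z0; apply: (prime_n1 HP); rewrite EP /= z0 ?scaler0 //.
  by move: Pp; rewrite EP.
apply: bigcup_finite => // g ggs; rewrite finite_setU; split.
  exact: finite_annihilators0 (Hgs g ggs).
apply: bigcup_finite; first exact: finite_II.
move=> p _; have [pp|npp] := EM (prime p).
  by apply: (sub_finite_set _ (finite_annihilators_p hR F n pp (Hgs g ggs))) => P [].
by apply: (sub_finite_set _ (finite_set0 (set R))) => P [].
Qed.
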